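(* Let $\Omega\subset\mathbb R^2$ be a bounded Lipschitz domain that is simply connected with connected boundary, and let $f\in H^{-2}(\Omega)$. The mixed formulation of the triharmonic equation: find $(\boldsymbol\sigma,u)\in\boldsymbol H^{-2}(\operatorname{div}^3,\Omega)\times H_0^2(\Omega)$ such that $$(\boldsymbol\sigma,\boldsymbol\tau)+\langle\operatorname{div}\mathbf{div}\mathbf{div}\boldsymbol\tau,u\rangle=0\quad\forall\,\boldsymbol\tau\in\boldsymbol H^{-2}(\operatorname{div}^3,\Omega),$$ $$\langle\operatorname{div}\mathbf{div}\mathbf{div}\boldsymbol\sigma,v\rangle=\langle f,v\rangle\quad\forall\,v\in H_0^2(\Omega),$$ is equivalent to the decoupled problem: find $w\in H_0^2(\Omega)$, $\boldsymbol\phi\in\boldsymbol H^1(\Omega;\mathbb S)$ and $u\in H_0^2(\Omega)$ such that $$(\Delta w,\Delta v)=\langle f,v\rangle\quad\forall\,v\in H_0^2(\Omega),$$ $$(\operatorname{sym}\mathbf{curl}\boldsymbol\phi,\operatorname{sym}\mathbf{curl}\boldsymbol\psi)=-(\boldsymbol\Xi\nabla w,\operatorname{sym}\mathbf{curl}\boldsymbol\psi)\quad\forall\,\boldsymbol\psi\in\boldsymbol H^1(\Omega;\mathbb S),$$ $$(\Delta u,\Delta\chi)=-(\boldsymbol\sigma,\boldsymbol\Xi\nabla\chi)\quad\forall\,\chi\in H_0^2(\Omega),$$ where $\boldsymbol\sigma=\operatorname{sym}\mathbf{curl}\boldsymbol\phi+\boldsymbol\Xi\nabla w$.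
   Context: $(\cdot,\cdot)$ is the $L^2$ inner product and $\langle\cdot,\cdot\rangle$ the duality pairing. $\mathbb S$ is the space of symmetric $2\times2$ matrices; $\mathbb S(3)$ is the space of third-order tensors $(\tau_{ijk})_{i,j,k\in\{1,2\}}$ invariant under all permutations of the indices; for a third-order tensor, $(\operatorname{sym}\boldsymbol\tau)_{j_1j_2j_3}=\frac16\sum_{\sigma\in\mathfrak S_3}\tau_{j_{\sigma(1)}j_{\sigma(2)}j_{\sigma(3)}}$, where $\mathfrak S_3$ is the set of permutations of $(1,2,3)$. $\operatorname{curl}v=(\partial_2v,-\partial_1v)^{\intercal}$; for a matrix field $\boldsymbol\phi$, $(\mathbf{curl}\boldsymbol\phi)_{ij\cdot}=\operatorname{curl}\phi_{ij}$. $\operatorname{div}\mathbf{div}\mathbf{div}\boldsymbol\tau=\sum_{i,j,k}\partial_i\partial_j\partial_k\tau_{ijk}$. $\boldsymbol H^{-2}(\operatorname{div}^3,\Omega)=\{\boldsymbol\tau\in\boldsymbol L^2(\Omega;\mathbb S(3)):\operatorname{div}\mathbf{div}\mathbf{div}\boldsymbol\tau\in H^{-2}(\Omega)\}$. For $\boldsymbol\psi=(\psi_1,\psi_2)^{\intercal}$, $\boldsymbol\Xi\boldsymbol\psi=(\tau_{ijk})$ with $\tau_{111}=\psi_1$, $\tau_{222}=\psi_2$, $\tau_{112}=\tau_{121}=\tau_{211}=\frac13\psi_2$, $\tau_{122}=\tau_{212}=\tau_{221}=\frac13\psi_1$. ''Equivalent'' means that $(\boldsymbol\sigma,u)$ solves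 the mixed formulation if and only if $\boldsymbol\sigma=\operatorname{sym}\mathbf{curl}\boldsymbol\phi+\boldsymbol\Xi\nabla w$ for some $w,\boldsymbol\phi$ such that $(w,\boldsymbol\phi,u)$ solves the decoupled problem. *)

(* Defs.v *)
From HB Require Import structures.
From mathcomp Require Import all_boot all_order all_algebra all_fingroup.
From mathcomp Require Import all_classical all_reals all_analysis.

Set Implicit Arguments.
Unset Strict Implicit.
Unset Printing Implicit Defensive.

Import Order.TTheory GRing.Theory Num.Theory numFieldNormedType.Exports.

Local Open Scope classical_set_scope.
Local Open Scope ring_scope.

(* Conventions: the plane is R * R; coordinate directions and tensor indices
   range over 'I_2, so that 0 and 1 stand for the indices 1 and 2.  Elements of
   L^2, H^1, H^2_0 are represented by functions on the plane of which only the
   values on Omega matter, up to almost everywhere equality.  Vector, matrix and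
   third-order tensor fields are families of scalar fields. *)

Section Domains.
Context {R : realType}.
Implicit Types Omega : set (R * R).

Definition boundary Omega : set (R * R) := closure Omega `\` interior Omega.

(* Near each boundary point, after a rotation (y1, y2) of the coordinates,
   Omega is the set of points strictly above a Lipschitz graph. *)
Definition lipschitz_boundary Omega : Prop :=
  forall p, boundary Omega p ->
  exists (c s : R) (g : R -> R) (r : R),
    [/\ c ^+ 2 + s ^+ 2 = 1, lipschitz g, 0 < r &
        forall x, ball p r x ->
          (Omega x <-> g (c * x.1 + s * x.2) < - s * x.1 + c * x.2)].

Definition bounded_lipschitz_domain Omega : Prop :=
  [/\ Omega !=set0, open Omega, connected Omega, bounded_set Omega &
      lipschitz_boundary Omega].

(* Every loop is null-homotopic relative to its base point; path-connectedness
   is not repeated, as it follows from being open and connected. *)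
Definition simply_connected Omega : Prop :=
  forall gamma : R -> R * R,
    {within `[0, 1], continuous gamma} ->
    (forall t, t \in `[0, 1] -> Omega (gamma t)) ->
    gamma 0 = gamma 1 ->
    exists H : R * R -> R * R,
      [/\ {within `[0, 1]%classic `*` `[0, 1]%classic, continuous H},
          forall s t, s \in `[0, 1] -> t \in `[0, 1] -> Omega (H (s, t)),
          forall t, t \in `[0, 1] -> H (0, t) = gamma t,
          forall t, t \in `[0, 1] -> H (1, t) = gamma 0 &
          forall s, s \in `[0, 1] -> H (s, 0) = gamma 0 /\ H (s, 1) = gamma 0].

End Domains.

Section Distributions.
Context {R : realType}.
Implicit Types (Omega : set (R * R)) (g h phi : R * R -> R).
Implicit Types (T : (R * R -> R) -> R).

Definition leb2 :
    {measure set (measurableTypeR R * measurableTypeR R) -> \bar R} :=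
  ((@lebesgue_measure R) \x (@lebesgue_measure R))%E.

Definition dir (i : 'I_2) : R * R := if i == 0 then (1, 0) else (0, 1).

Definition pder (i : 'I_2) g : R * R -> R := fun x => 'D_(dir i) g x.

Definition smooth g : Prop :=
  forall (s : seq 'I_2),
    continuous (foldr pder g s) /\
    forall (i : 'I_2) (x : R * R), derivable (foldr pder g s) x (dir i).

Definition test_function Omega phi : Prop :=
  smooth phi /\
  exists K : set (R * R),
    [/\ compact K, K `<=` Omega & forall x, ~ K x -> phi x = 0].

(* A distribution on Omega is a functional of which only the values on
   test functions matter. *)
Definition dist_eq Omega T1 T2 : Prop :=
  forall phi, test_function Omega phi -> T1 phi = T2 phi.

Definition dist_of Omega g : (R * R -> R) -> R :=
  fun phi => \int[leb2]_(x in Omega) (g x * phi x).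

Definition dist_der (i : 'I_2) T : (R * R -> R) -> R :=
  fun phi => - T (pder i phi).

End Distributions.

Section Sobolev.
Context {R : realType}.
Variable Omega : set (R * R).
Implicit Types (g h v w : R * R -> R).

Definition L2 g : Prop := g \_ Omega \in Lfun (@leb2 R) 2%:E.

Definition dot g h : R := \int[leb2]_(x in Omega) (g x * h x).

Definition is_weak_der (i : 'I_2) g h : Prop :=
  L2 h /\ dist_eq Omega (dist_der i (dist_of Omega g)) (dist_of Omega h).

(* Weak partial derivative: a representative of the (a.e. unique) weak
   derivative in L^2, whenever there is one. *)
Definition weak_der (i : 'I_2) g : R * R -> R :=
  get [set h | is_weak_der i g h].

Definition H1 g : Prop :=
  L2 g /\ forall i : 'I_2, exists h, is_weak_der i g h.

Definition H2 g : Prop := H1 g /\ forall i : 'I_2, H1 (weak_der i g).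

Definition H2norm g : R :=
  Num.sqrt (dot g g
    + \sum_(i : 'I_2) dot (weak_der i g) (weak_der i g)
    + \sum_(i : 'I_2) \sum_(j : 'I_2)
        dot (weak_der j (weak_der i g)) (weak_der j (weak_der i g))).

(* closure of the test functions in H^2 *)
Definition H20 v : Prop :=
  H2 v /\ forall e : R, 0 < e ->
    exists phi, test_function Omega phi /\ H2norm (fun x => v x - phi x) < e.

(* Continuous dual of H^2_0.  Boundedness makes the values depend only on the
   a.e. class of the argument. *)
Definition Hm2 (F : (R * R -> R) -> R) : Prop :=
  (forall (a : R) v w, H20 v -> H20 w ->
     F (fun x => a * v x + w x) = a * F v + F w) /\
  exists C : R, forall v, H20 v -> `|F v| <= C * H2norm v.

Definition in_Hm2 (T : (R * R -> R) -> R) : Prop :=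
  exists F, Hm2 F /\ dist_eq Omega T F.

(* <T, v> for a distribution T in H^{-2} and v in H^2_0: the value at v of the
   element of H^{-2} extending T, which is unique on H^2_0 by density. *)
Definition pairing (T : (R * R -> R) -> R) v : R :=
  (get [set F | Hm2 F /\ dist_eq Omega T F]) v.

Definition laplacian g : R * R -> R :=
  fun x => \sum_(i : 'I_2) weak_der i (weak_der i g) x.

Definition grad g : 'I_2 -> R * R -> R := fun i => weak_der i g.

Definition curl g : 'I_2 -> R * R -> R :=
  fun k x => if k == 0 then weak_der 1 g x else - weak_der 0 g x.

End Sobolev.

Section Tensors.
Context {R : realType}.
Variable Omega : set (R * R).

Definition vec_field := 'I_2 -> R * R -> R.
Definition mat_field := 'I_2 -> 'I_2 -> R * R -> R.
Definition tens_field := 'I_2 -> 'I_2 -> 'I_2 -> R * R -> R.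

Implicit Types (psi : vec_field) (phi : mat_field) (tau sigma : tens_field).

(* (j_1, j_2, j_3) |-> tau_{j_{s(1)} j_{s(2)} j_{s(3)}} *)
Definition permute_indices (s : 'S_3) tau : tens_field :=
  fun j1 j2 j3 =>
    let j := tnth [tuple j1; j2; j3] in
    tau (j (s (0 : 'I_3))) (j (s (1 : 'I_3))) (j (s (2 : 'I_3))).

Definition sym tau : tens_field :=
  fun j1 j2 j3 x => 6^-1 * \sum_(s : 'S_3) permute_indices s tau j1 j2 j3 x.

Definition Curl phi : tens_field := fun i j k => curl Omega (phi i j) k.

Definition symCurl phi : tens_field := sym (Curl phi).

(* The case distinction is on the number of indices equal to 2, which is
   i + j + k since the indices 1 and 2 are encoded by 0 and 1. *)
Definition Xi psi : tens_field :=
  fun i j k x =>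
    match (i + j + k)%N with
    | 0 => psi 0 x
    | 1 => 3^-1 * psi 1 x
    | 2 => 3^-1 * psi 0 x
    | _ => psi 1 x
    end.

Definition dot3 sigma tau : R :=
  \sum_(i : 'I_2) \sum_(j : 'I_2) \sum_(k : 'I_2)
    dot Omega (sigma i j k) (tau i j k).

Definition divdivdiv tau : (R * R -> R) -> R :=
  fun v => \sum_(i : 'I_2) \sum_(j : 'I_2) \sum_(k : 'I_2)
    dist_der i (dist_der j (dist_der k (dist_of Omega (tau i j k)))) v.

(* equality of tensor fields in L^2 *)
Definition tens_ae_eq sigma tau : Prop :=
  forall i j k : 'I_2, sigma i j k = tau i j k %[ae leb2 in Omega].

(* L^2(Omega; S(3)) *)
Definition L2S3 tau : Prop :=
  (forall i j k : 'I_2, L2 Omega (tau i j k)) /\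
  forall s : 'S_3, tens_ae_eq (permute_indices s tau) tau.

(* H^1(Omega; S) *)
Definition H1S phi : Prop :=
  (forall i j : 'I_2, H1 Omega (phi i j)) /\
  forall i j : 'I_2, phi i j = phi j i %[ae leb2 in Omega].

(* H^{-2}(div^3, Omega) *)
Definition Hdiv3 tau : Prop := L2S3 tau /\ in_Hm2 Omega (divdivdiv tau).

Definition tens_add sigma tau : tens_field :=
  fun i j k x => sigma i j k x + tau i j k x.

Definition sigma_of (w : R * R -> R) phi : tens_field :=
  tens_add (symCurl phi) (Xi (grad Omega w)).

Definition mixed_solution (f : (R * R -> R) -> R) sigma (u : R * R -> R) :
    Prop :=
  [/\ Hdiv3 sigma, H20 Omega u,
      forall tau, Hdiv3 tau ->
        dot3 sigma tau + pairing Omega (divdivdiv tau) u = 0 &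
      forall v, H20 Omega v -> pairing Omega (divdivdiv sigma) v = f v].

Definition decoupled_solution (f : (R * R -> R) -> R) (w : R * R -> R) phi
    (u : R * R -> R) : Prop :=
  [/\ H20 Omega w /\ H1S phi /\ H20 Omega u,
      forall v, H20 Omega v ->
        dot Omega (laplacian Omega w) (laplacian Omega v) = f v,
      forall psi : mat_field, H1S psi ->
        dot3 (symCurl phi) (symCurl psi)
        = - dot3 (Xi (grad Omega w)) (symCurl psi) &
      forall chi, H20 Omega chi ->
        dot Omega (laplacian Omega u) (laplacian Omega chi)
        = - dot3 (sigma_of w phi) (Xi (grad Omega chi))].

End Tensors.

Arguments tens_field : clear implicits.
Arguments mat_field : clear implicits.
Arguments vec_field : clear implicits.

(* Main.v *)
From HB Require Import structures.
Require Import Defs.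
From mathcomp Require Import all_boot all_order all_algebra all_fingroup.
From mathcomp Require Import all_classical all_reals all_analysis.
From mathcomp Require Import measurable_realfun lebesgue_integral ring lra.

Set Implicit Arguments.
Unset Strict Implicit.
Unset Printing Implicit Defensive.

Import Order.TTheory GRing.Theory Num.Theory numFieldNormedType.Exports.

Local Open Scope classical_set_scope.
Local Open Scope ring_scope.

(** The equivalence rests on a decomposition of the test space: every symmetric tensor field [tau] with
    [divdivdiv tau] in [H^-2] is [sym curl psi + Xi (grad chi)] with [psi] in [H^1] and [chi] in [H^2_0]
    ([tensor_decomposition]). Once it is known, testing the first mixed equation with the two kinds of fields
    gives the last two decoupled equations and conversely, while the second mixed equation is the first
    decoupled one ([mixed_decoupled], [decoupled_mixed]).

    The decomposition combines three facts. The divdivdiv of [Xi (grad chi)] is the bilaplacian of [chi]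
    ([divdivdiv_Xi]) and that of [sym curl psi] is zero ([divdivdiv_curl]), by integration by parts. The
    bilaplacian is an isomorphism from [H^2_0] to [H^-2] ([biharmonic_Hm2]), so that [chi] can be chosen to
    make the divdivdiv of [tau - Xi (grad chi)] vanish. And the complex is exact: a square integrable
    symmetric field with vanishing divdivdiv is some [sym curl psi] ([tensor_exact]).

    Exactness is where the domain matters. Let [d_0], [d_1] be the partial derivatives, let [t1, .., t4] be
    the entries [tau 0 0 0], [tau 0 0 1], [tau 0 1 1], [tau 1 1 1], and look for
    [psi = [[a, c], [c, b]]]. The equations are

      [d_1 a = t1], [- d_0 b = t4], [2 d_1 c = d_0 a + 3 t2], [2 d_0 c = d_1 b - 3 t3].

    The missing derivatives [p = d_0 a] and [q = d_1 b] must have Hessians that are given combinations of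
    second derivatives of the entries, and [divdivdiv tau = 0] is exactly what makes these Hessians
    compatible. So everything reduces to finding a square integrable function with a given compatible Hessian
    [A], whose entries are sums of second derivatives of square integrable functions ([hessian_solvable]);
    closed forms with square integrable coefficients are integrated by the same result ([weak_potential]).

    To solve the Hessian equation, subtract from [A] the Hessian of [lap z], where [z] in [H^2_0] solves
    [lap (lap z) = A 0 0 + A 1 1]. What remains is compatible and trace-free, hence all its entries are
    harmonic distributions. They are smooth by Weyl's lemma ([rep_regular]), and two integrations on the
    simply connected domain ([global_potential]) produce a function [h] with that Hessian. It remains to see
    that [h] is square integrable up to the boundary. At distance [delta] from it, the interior estimate
    [rep_bound] bounds the square of the second derivatives of [h] by [delta^-6] times the integral over a
    square of size [delta] of a fixed integrable function; hence [delta^4 * |D^2 h|^2] is integrable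
    ([growth_intg]), and a Hardy inequality of second order, in a direction transversal to the Lipschitz
    boundary, bounds the integral of [h^2] ([hardy_core], [hardy_L2]). *)

(** * Integration on the plane *)

Section PlaneMeasure.
Context {R : realType}.
Local Notation P := (R * R)%type.
Local Notation MP := (measurableTypeR R * measurableTypeR R)%type.
Local Notation mu := (@leb2 R).
Implicit Types (f g : P -> R) (A : set P).

Definition mset2 A := @measurable _ MP A.
Definition mfun2 f := @measurable_fun _ _ MP (measurableTypeR R) setT f.
Definition intg f := mu.-integrable setT (EFin \o f).
Definition Int f : R := \int[mu]_x f x.

Lemma ball2E (p : P) (r : R) x :
  ball p r x <-> `|p.1 - x.1| < r /\ `|p.2 - x.2| < r.
Proof. by split => -[]. Qed.

(** Open sets are countable unions of rectangles with rational data. *)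
Lemma open_mset A : open A -> mset2 A.
Proof.
move=> oA.
pose B (q : rat * rat * nat) : set P :=
  (ball (ratr q.1.1 : R) q.2.+1%:R^-1 `*` ball (ratr q.1.2 : R) q.2.+1%:R^-1).
pose F q := if `[< B q `<=` A >] then B q else set0.
have mB q : mset2 (B q).
  by apply: measurableX; apply: open_measurable; exact: ball_open.
have -> : A = \bigcup_q F q.
  apply/seteqP; split => [x Ax|x [q _]]; last first.
    by rewrite /F; case: asboolP => // BA /BA.
  have /nbhs_ballP[e /= e0 xe] : nbhs x A by apply: open_nbhs_nbhs.
  have [n n1] : exists n : nat, n.+1%:R^-1 < e / 2.
    have e20 : 0 < e / 2 by rewrite divr_gt0.
    exists (Num.truncn (e / 2)^-1).
    rewrite -[ltRHS]invrK ltf_pV2 ?posrE ?invr_gt0//.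
    exact: truncnS_gt.
  have n0 : (0 : R) < n.+1%:R^-1 by rewrite invr_gt0.
  have rat_near (y : R) : exists q : rat, `|y - ratr q| < n.+1%:R^-1.
    have [|q] := @rat_in_itvoo R (y - n.+1%:R^-1) (y + n.+1%:R^-1).
      by rewrite ltrD2l gtrN.
    rewrite in_itv/= => /andP[q1 q2]; exists q.
    by rewrite ltr_distlC q1 q2.
  have [q1 hq1] := rat_near x.1; have [q2 hq2] := rat_near x.2.
  exists (q1, q2, n) => //; rewrite /F; case: asboolP => [_|]; last first.
    case=> y [] /= y1 y2; move: hq1 hq2 y1 y2 n1; rewrite /ball/=.
    set d := n.+1%:R^-1 => hq1 hq2 y1 y2 n1; apply: xe; split => /=.
      apply: le_lt_trans (ler_distD (ratr q1) _ _) _.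
      rewrite /ball_ in y1; lra.
    apply: le_lt_trans (ler_distD (ratr q2) _ _) _.
    rewrite /ball_ in y2; lra.
  by split => /=; rewrite /ball/= distrC.
apply: countable_bigcupT_measurable => [|q]; first exact: countableP.
by rewrite /F; case: asboolP => _; [exact: mB | exact: measurable0].
Qed.

Lemma mfun_restrict A f : mset2 A ->
  @measurable_fun _ _ MP (measurableTypeR R) A f -> mfun2 (f \_ A).
Proof. by move=> mA mf; apply/(measurable_restrictT f mA). Qed.

Lemma mfun_open A f : open A -> (forall x, A x -> {for x, continuous f}) ->
  mfun2 (f \_ A).
Proof.
move=> oA cf; apply: mfun_restrict; first exact: open_mset.
apply: (measurability _ (RGenOpens.measurableE R)).
move=> _ [_ [a [b ->] <-]]; apply: open_mset.
rewrite openE => x [Ax fx]; have := cf _ Ax.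
have /= on : nbhs (f x) `]a, b[%classic.
  by apply: open_nbhs_nbhs; split => //; exact: interval_open.
move=> /(_ _ on) h; apply: filterI; last exact: h.
by apply: open_nbhs_nbhs.
Qed.

Lemma continuous_mfun f : continuous f -> mfun2 f.
Proof.
move=> cf; rewrite -(patch_setT (fun=> 0) f); apply: mfun_open => // [|x _].
  exact: openT.
exact: cf.
Qed.

Lemma mfun_comp f (g : P -> P) : mfun2 f ->
  @measurable_fun _ _ MP MP setT g -> mfun2 (f \o g).
Proof. by move=> mf mg; exact: measurableT_comp. Qed.

Definition ae2 (Q : P -> Prop) : Prop := \forall x \ae mu, Q x.

Lemma ae2S (Q Q' : P -> Prop) : (forall x, Q x -> Q' x) -> ae2 Q -> ae2 Q'.
Proof. exact: (@filterS MP _ (ae_filter_ringOfSetsType mu)). Qed.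

Lemma ae2I (Q Q' : P -> Prop) : ae2 Q -> ae2 Q' -> ae2 (fun x => Q x /\ Q' x).
Proof. exact: (@filterI MP _ (ae_filter_ringOfSetsType mu)). Qed.

Lemma ae2T (Q : P -> Prop) : (forall x, Q x) -> ae2 Q.
Proof. by move=> hQ; apply: (@ae2S setT) => //; exact: (@filterT MP _ (ae_filter_ringOfSetsType mu)). Qed.

Lemma measurable_shift (v : P) : @measurable_fun _ _ MP MP setT (fun x => x + v).
Proof.
have -> : (fun x => x + v) = (fun x => (x.1 + v.1, x.2 + v.2)).
  by apply/funext => -[].
apply/measurable_fun_pair => /=.
  by apply: measurable_funD => //; exact: measurable_cst.
by apply: measurable_funD => //; exact: measurable_cst.
Qed.

(** The measure of intervals determines the Lebesgue measure. *)
Lemma lebesgue_shift (a : R) (A : set (measurableTypeR R)) : measurable A ->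
  lebesgue_measure ((fun x => x + a) @^-1` A) = lebesgue_measure A.
Proof.
move=> mA.
have mphi : @measurable_fun _ _ (measurableTypeR R) (measurableTypeR R) setT
   (fun x => x + a).
  by apply: measurable_funD => //; exact: measurable_cst.
pose phi : {mfun measurableTypeR R >-> measurableTypeR R} :=
  HB.pack (fun x : R => x + a) (isMeasurableFun.Build _ _ _ _ _ mphi).
have := @lebesgue_measure_unique R (pushforward (@lebesgue_measure R) phi) _ A mA.
rewrite /pushforward/= => -> //.
move=> X [[x y] /= _ <-].
rewrite /pushforward/=.
rewrite [X in _ = lebesgue_measure X](_ : _ = `]x - a, y - a]%classic); last first.
  by apply/seteqP; split => z /=; rewrite !in_itv/= ltrBlDr lerBrDr.
by rewrite !lebesgue_measure_itv/= !lte_fin ltrD2r -!EFinB; case: ifP => // _; congr EFin; ring.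
Qed.

(** The shifted measure has the values of the product measure on rectangles. *)
Lemma leb2_shift (v : P) (A : set MP) : measurable A ->
  mu ((fun x => x + v) @^-1` A) = mu A.
Proof.
move=> mA.
pose phi : {mfun MP >-> MP} :=
  HB.pack (fun x : P => x + v) (isMeasurableFun.Build _ _ _ _ _ (measurable_shift v)).
have := @product_measure_unique _ _ _ _ R lebesgue_measure lebesgue_measure
  (pushforward mu phi) _ A mA.
move=> h; apply/esym; apply: (h (measurable_shift v)).
move=> A' B mA' mB.
rewrite /pushforward/= -(lebesgue_shift v.1 mA') -(lebesgue_shift v.2 mB).
rewrite -product_measure1E//.
- rewrite -[X in measurable X]setTI.
  apply: (_ : @measurable_fun _ _ (measurableTypeR R) (measurableTypeR R) setT
     (fun x => x + v.1)) => //.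
  by apply: measurable_funD => //; exact: measurable_cst.
- rewrite -[X in measurable X]setTI.
  apply: (_ : @measurable_fun _ _ (measurableTypeR R) (measurableTypeR R) setT
     (fun x => x + v.2)) => //.
  by apply: measurable_funD => //; exact: measurable_cst.
Qed.

Lemma ge0_integral_shift (v : P) (f : P -> \bar R) :
  @measurable_fun _ _ MP _ setT f -> (forall x, 0 <= f x)%E ->
  (integral mu setT (fun x : P => f (x + v)%R) = \int[mu]_x f x)%E.
Proof.
move=> mf f0.
pose phi : {mfun MP >-> MP} :=
  HB.pack (fun x : P => x + v) (isMeasurableFun.Build _ _ _ _ _ (measurable_shift v)).
transitivity (\int[pushforward mu phi]_x f x)%E.
  have h := @ge0_integral_pushforward _ _ MP MP R phi (measurable_shift v) mu setT
    f measurableT mf (fun x _ => f0 x).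
  exact: (esym h).
by apply: eq_measure_integral => A mA _; exact: leb2_shift.
Qed.

Lemma intg_mfun f : intg f -> mfun2 f.
Proof. by move=> /measurable_int /measurable_EFinP. Qed.

Lemma intg_shift (v : P) f : intg f -> intg (fun x => f (x + v)).
Proof.
move=> If; apply/integrableP; split.
  apply/measurable_EFinP; apply: (mfun_comp (intg_mfun If)).
  exact: measurable_shift.
have /integrableP[mf foo] := If.
rewrite (@ge0_integral_shift v (fun x => `|(EFin \o f) x|%E))//.
exact: measurableT_comp.
Qed.

Lemma Int_shift (v : P) f : intg f -> Int (fun x => f (x + v)) = Int f.
Proof.
move=> If; congr fine.
pose phi : {mfun MP >-> MP} :=
  HB.pack (fun x : P => x + v) (isMeasurableFun.Build _ _ _ _ _ (measurable_shift v)).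
transitivity (\int[pushforward mu phi]_x (f x)%:E)%E.
  have h := @integral_pushforward _ _ MP MP R phi (measurable_shift v) mu setT
    (EFin \o f) (measurable_int _ If) (intg_shift v If) measurableT.
  exact: (esym h).
by apply: eq_measure_integral => A mA _; exact: leb2_shift.
Qed.

Lemma mfun_cst (c : R) : mfun2 (fun=> c).
Proof. exact: measurable_cst. Qed.
Lemma mfunD f g : mfun2 f -> mfun2 g -> mfun2 (fun x => f x + g x).
Proof. exact: measurable_funD. Qed.
Lemma mfunB f g : mfun2 f -> mfun2 g -> mfun2 (fun x => f x - g x).
Proof. exact: measurable_funB. Qed.
Lemma mfunM f g : mfun2 f -> mfun2 g -> mfun2 (fun x => f x * g x).
Proof. exact: measurable_funM. Qed.
Lemma mfunZ (c : R) f : mfun2 f -> mfun2 (fun x => c * f x).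
Proof. by move=> mf; apply: mfunM => //; exact: mfun_cst. Qed.
Lemma intg0 : intg (fun=> 0).
Proof. exact: integrable0. Qed.
Lemma intgD f g : intg f -> intg g -> intg (fun x => f x + g x).
Proof. by move=> If Ig; have := integrableD measurableT If Ig; exact. Qed.
Lemma intgZ (c : R) f : intg f -> intg (fun x => c * f x).
Proof. by move=> If; have := integrableZl measurableT c If; exact. Qed.
Lemma intgN f : intg f -> intg (fun x => - f x).
Proof. by move=> If; have := integrableN If; exact. Qed.
Lemma intgB f g : intg f -> intg g -> intg (fun x => f x - g x).
Proof. by move=> If Ig; have := integrableB measurableT If Ig; exact. Qed.
Lemma intg_norm f : intg f -> intg (fun x => `|f x|).
Proof. exact: integrable_norm. Qed.
Lemma intg_le f g : mfun2 f -> intg g -> (forall x, `|f x| <= g x) -> intg f.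
Proof.
move=> mf ig fg; apply: (le_integrable measurableT _ _ ig).
  exact/measurable_EFinP.
by move=> x _ /=; rewrite lee_fin (le_trans (fg x))// ler_norm.
Qed.

Lemma IntD f g : intg f -> intg g -> Int (fun x => f x + g x) = Int f + Int g.
Proof. by move=> ? ?; exact: RintegralD. Qed.
Lemma IntB f g : intg f -> intg g -> Int (fun x => f x - g x) = Int f - Int g.
Proof. by move=> ? ?; exact: RintegralB. Qed.
Lemma IntZ c f : intg f -> Int (fun x => c * f x) = c * Int f.
Proof. by move=> ?; exact: RintegralZl. Qed.
Lemma IntN f : intg f -> Int (fun x => - f x) = - Int f.
Proof.
move=> If; rewrite -mulN1r -IntZ//; congr Int; apply/funext => x.
by rewrite mulN1r.
Qed.
Lemma Int0 : Int (fun=> 0) = 0.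
Proof. by rewrite /Int /Rintegral integral0. Qed.
Lemma Int_ge0 f : (forall x, 0 <= f x) -> 0 <= Int f.
Proof. by move=> f0; apply: Rintegral_ge0. Qed.
Lemma le_Int f g : intg f -> intg g -> (forall x, f x <= g x) -> Int f <= Int g.
Proof. by move=> ? ? fg; exact: le_Rintegral. Qed.
Lemma le_norm_Int f : intg f -> `|Int f| <= Int (fun x => `|f x|).
Proof. exact: le_normr_Rintegral. Qed.

Lemma intg_sum I (s : seq I) (F : I -> P -> R) : (forall i, intg (F i)) ->
  intg (fun x => \sum_(i <- s) F i x).
Proof.
move=> iF; elim: s => [|i s IH].
  by under eq_fun do rewrite big_nil; exact: intg0.
by under eq_fun do rewrite big_cons; exact: intgD.
Qed.
Lemma Int_sum I (s : seq I) (F : I -> P -> R) : (forall i, intg (F i)) ->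
  Int (fun x => \sum_(i <- s) F i x) = \sum_(i <- s) Int (F i).
Proof.
move=> iF; elim: s => [|i s IH].
  by under eq_fun do rewrite big_nil; rewrite big_nil Int0.
under eq_fun do rewrite big_cons.
by rewrite big_cons -IH IntD//; exact: intg_sum.
Qed.

Lemma dct (F : nat -> P -> R) f g : (forall n, mfun2 (F n)) -> intg g ->
  (forall n x, `|F n x| <= g x) -> (forall x, F n x @[n --> \oo] --> f x) ->
  intg f /\ Int (F n) @[n --> \oo] --> Int f.
Proof.
move=> mF ig Fg Ff.
have mf : mfun2 f.
  by apply: (@measurable_fun_cvg _ _ _ setT (F)) => // x _; exact: Ff.
have [|||||] := @dominated_convergence _ MP R mu setT measurableT
  (fun n => EFin \o F n) (EFin \o f) (EFin \o g).
- by move=> n; apply/measurable_EFinP; exact: mF.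
- exact/measurable_EFinP.
- apply: nearW => x _; apply: cvg_EFin; first exact: nearW.
  exact: Ff.
- exact: ig.
- by apply: nearW => x n _; rewrite lee_fin.
move=> If _ h; split => //.
have Iff : (\int[mu]_x (f x)%:E)%E \is a fin_num by exact: integrable_fin_num.
apply: fine_cvg; rewrite fineK//; exact: h.
Qed.

Lemma fatouR (F : nat -> P -> R) f (C : R) : (forall n, intg (F n)) ->
  (forall n x, 0 <= F n x) -> (forall n, Int (F n) <= C) ->
  (forall x, F n x @[n --> \oo] --> f x) -> intg f /\ Int f <= C.
Proof.
move=> iF F0 FC Ff.
have f0 x : 0 <= f x by apply: (cvgr_to_ge (Ff x)); exact: nearW.
have mf : mfun2 f.
  apply: (@measurable_fun_cvg _ _ _ setT (F)) => // n.
  exact: intg_mfun.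
have key : (\int[mu]_x (f x)%:E <= C%:E)%E.
  have := @fatou _ MP R mu setT measurableT (fun n => EFin \o F n).
  have -> : (\int[mu]_x limn_einf (fun n => (EFin \o F n) x) = \int[mu]_x (f x)%:E)%E.
    apply: eq_integral => x _.
    have h : (EFin \o F n) x @[n --> \oo] --> (f x)%:E.
      by apply: cvg_EFin; [exact: nearW | exact: Ff].
    by rewrite (cvg_limn_einf_sup h).1.
  move=> /(_ _ _)/le_trans; apply.
  - by move=> n; apply: measurable_int (iF n).
  - by move=> n x _; rewrite lee_fin.
  rewrite limn_einf_lim; apply: lime_le; first exact: is_cvg_einfs.
  apply: nearW => n; apply: (@le_trans _ _ (\int[mu]_x (F n x)%:E)%E).
    by apply: ereal_inf_lbound; exists n => //=.
  rewrite -(fineK (integrable_fin_num measurableT (iF n))) lee_fin.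
  exact: FC.
have If : intg f.
  apply/integrableP; split; first exact/measurable_EFinP.
  under eq_integral do rewrite /= ger0_norm//.
  by rewrite (le_lt_trans key)// ltry.
split=> //; rewrite -lee_fin /Int /Rintegral fineK//.
exact: integrable_fin_num.
Qed.

Definition box (x : P) (r : R) : set P :=
  `[x.1 - r, x.1 + r]%classic `*` `[x.2 - r, x.2 + r]%classic.

Lemma boxE x r y : box x r y <-> `|y.1 - x.1| <= r /\ `|y.2 - x.2| <= r.
Proof. by rewrite /box /setX/= !in_itv/= !ler_distl; split => -[]. Qed.

Lemma norm_pair (x : P) r : (`|x| <= r) = (`|x.1| <= r) && (`|x.2| <= r).
Proof. by rewrite prod_normE ge_max. Qed.

Lemma boxP x r y : box x r y <-> `|y - x| <= r.
Proof.
rewrite boxE norm_pair/=; split; first by move=> [-> ->].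
by move=> /andP.
Qed.

Lemma mset_box x r : mset2 (box x r).
Proof. by apply: measurableX; exact: measurable_itv. Qed.

Lemma mu_box (x : P) (r : R) : 0 <= r -> mu (box x r) = (4 * r ^+ 2)%:E.
Proof.
move=> r0.
have -> : mu (box x r) = (@lebesgue_measure R `[(x.1 - r)%R, (x.1 + r)%R] *
    @lebesgue_measure R `[(x.2 - r)%R, (x.2 + r)%R])%E.
  by apply: product_measure1E; exact: measurable_itv.
rewrite !lebesgue_measure_itv/= !lte_fin.
have [->|r1] := eqVneq r 0.
  by rewrite !subr0 !addr0 !ltxx mule0 expr0n mulr0.
have {r1}r0 : 0 < r by rewrite lt_neqAle eq_sym r1.
rewrite !ifT ?ltrD2l ?gtrN// -!EFinB -EFinM; congr EFin; ring.
Qed.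

Lemma mu_box_lty x r : (mu (box x r) < +oo)%E.
Proof.
have [r0|r0] := leP 0 r; first by rewrite mu_box// ltry.
rewrite (_ : box x r = set0) ?measure0//.
apply/seteqP; split => // y /boxP yr.
by have := le_lt_trans yr r0; rewrite ltNge normr_ge0.
Qed.

Lemma mfun_indic A : mset2 A -> mfun2 (\1_A).
Proof. by move=> mA; exact: measurable_indic. Qed.

Lemma intg_box x r : intg (\1_(box x r)).
Proof.
have m1 := mfun_indic (mset_box x r).
apply/integrableP; split; first exact/measurable_EFinP.
have h := @integral_indic _ MP R mu setT measurableT (box x r) (mset_box x r).
rewrite setIT in h; have := mu_box_lty x r; rewrite -h.
apply: le_lt_trans; rewrite le_eqVlt; apply/orP; left; apply/eqP.
by apply: eq_integral => y _; rewrite /= ger0_norm.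
Qed.

Lemma Int_box x r : 0 <= r -> Int (\1_(box x r)) = 4 * r ^+ 2.
Proof.
move=> r0; rewrite /Int /Rintegral integral_indic//=; last exact: mset_box.
by rewrite setIT [X in fine X](_ : _ = (4 * r ^+ 2)%:E)//; exact: mu_box.
Qed.

Lemma intg_bdd f x r (C : R) : mfun2 f -> (forall y, `|f y| <= C) ->
  (forall y, ~ box x r y -> f y = 0) -> intg f.
Proof.
move=> mf fC f0; apply: (intg_le mf (intgZ C (intg_box x r))) => y.
rewrite indicE; have [/set_mem yA|/negP yA] := boolP (y \in _).
  by rewrite mulr1.
by rewrite mulr0 f0 ?normr0// => h; apply: yA; rewrite inE.
Qed.

Lemma ae_eq_Int f g : mfun2 f -> mfun2 g -> ae2 (fun x => f x = g x) -> Int f = Int g.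
Proof.
move=> mf mg fg; congr fine; apply: ae_eq_integral => //; try exact/measurable_EFinP.
by apply: ae2S fg => x /= -> .
Qed.

Lemma Int_eq0_ae f : intg f -> (forall x, 0 <= f x) -> Int f = 0 ->
  ae2 (fun x => f x = 0).
Proof.
move=> If f0 h.
have : (\int[mu]_x `|(f x)%:E| = 0)%E.
  under eq_integral do rewrite /= ger0_norm//.
  by rewrite -(fineK (integrable_fin_num measurableT If)); congr EFin.
have mf : measurable_fun setT (EFin \o f) by exact: measurable_int If.
move/(@ae_eq_integral_abs _ MP R mu setT measurableT _ mf).
by apply: ae2S => x /(_ I) [].
Qed.

Definition sqi f := mfun2 f /\ intg (fun x => f x ^+ 2).
Definition ip f g : R := Int (fun x => f x * g x).

Lemma sqi_mul f g : sqi f -> sqi g -> intg (fun x => f x * g x).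
Proof.
move=> [mf If] [mg Ig]; apply: (intg_le _ (intgD If Ig)); first exact: mfunM.
move=> x; rewrite normrM -(real_normK (num_real (f x))) -(real_normK (num_real (g x))).
by have := sqr_ge0 (`|f x| - `|g x|); nra.
Qed.

Lemma sqiD f g : sqi f -> sqi g -> sqi (fun x => f x + g x).
Proof.
move=> sf sg; have [mf If] := sf; have [mg Ig] := sg; split; first exact: mfunD.
rewrite (_ : (fun x => _) = (fun x => f x ^+ 2 + (g x ^+ 2 + 2 * (f x * g x)))).
  by apply: intgD => //; apply: intgD => //; apply: intgZ; exact: sqi_mul.
by apply/funext => x; ring.
Qed.

Lemma sqiZ c f : sqi f -> sqi (fun x => c * f x).
Proof.
move=> [mf If]; split; first exact: mfunZ.
under eq_fun do rewrite exprMn; exact: intgZ.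
Qed.

Lemma sqiN f : sqi f -> sqi (fun x => - f x).
Proof.
by move=> /(sqiZ (-1)); under eq_fun do rewrite mulN1r.
Qed.

Lemma sqiB f g : sqi f -> sqi g -> sqi (fun x => f x - g x).
Proof. by move=> sf /sqiN; exact: sqiD. Qed.

Lemma ipC f g : ip f g = ip g f.
Proof. by rewrite /ip; under eq_fun do rewrite mulrC. Qed.

Lemma ipDl f g h : sqi f -> sqi g -> sqi h ->
  ip (fun x => f x + g x) h = ip f h + ip g h.
Proof.
move=> sf sg sh; rewrite /ip; under eq_fun do rewrite mulrDl.
by apply: IntD; exact: sqi_mul.
Qed.

Lemma ipZl c f h : sqi f -> sqi h -> ip (fun x => c * f x) h = c * ip f h.
Proof.
move=> sf sh; rewrite /ip; under eq_fun do rewrite -mulrA.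
by apply: IntZ; exact: sqi_mul.
Qed.

Lemma ip_ge0 f : 0 <= ip f f.
Proof. by apply: Int_ge0 => x; rewrite -expr2 sqr_ge0. Qed.

Lemma ip_CS f g : sqi f -> sqi g -> ip f g ^+ 2 <= ip f f * ip g g.
Proof.
move=> sf sg.
have key t : 0 <= ip f f + t * (2 * ip f g) + t ^+ 2 * ip g g.
  have sh : sqi (fun x => t * g x) by exact: sqiZ.
  have := ip_ge0 (fun x => f x + t * g x).
  rewrite ipDl//; last exact: sqiD.
  rewrite ipC ipDl// (ipC (fun x => t * g x) (fun x => f x + _)) ipDl// ipZl// (ipC f).
  by rewrite !ipZl// (ipC g (fun x => t * g x)) ipZl// (ipC g f); lra.
have [g0|g0] := eqVneq (ip g g) 0.
  have [->|f0] := eqVneq (ip f g) 0; first by rewrite expr0n/= mulr_ge0 ?ip_ge0.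
  have := key (- (ip f f + 1) / (2 * ip f g)).
  rewrite g0 mulr0 addr0 divfK ?mulf_neq0//; lra.
have gg : 0 < ip g g by rewrite lt_neqAle eq_sym g0 ip_ge0.
have := key (- ip f g / ip g g).
rewrite -(ler_pM2r gg) mul0r.
have -> : (ip f f + - ip f g / ip g g * (2 * ip f g) + (- ip f g / ip g g) ^+ 2 * ip g g) * ip g g
  = ip f f * ip g g - ip f g ^+ 2 by field.
by rewrite subr_ge0.
Qed.

End PlaneMeasure.

Section PlaneMeasure2.
Context {R : realType}.
Local Notation P := (R * R)%type.
Local Notation MP := (measurableTypeR R * measurableTypeR R)%type.
Local Notation mu := (@leb2 R).
Implicit Types (f g : P -> R) (A : set P).

Definition d2 f g : R := Int (fun x => (f x - g x) ^+ 2).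

Lemma d2C f g : d2 f g = d2 g f.
Proof. by congr Int; apply/funext => x; rewrite -sqrrN opprB. Qed.

Lemma d2_tri f g h : sqi f -> sqi g -> sqi h -> d2 f h <= 2 * d2 f g + 2 * d2 g h.
Proof.
move=> sf sg sh.
have [_ Ifg] := sqiB sf sg; have [_ Igh] := sqiB sg sh; have [_ Ifh] := sqiB sf sh.
rewrite /d2 -!IntZ// -IntD//; try exact: intgZ.
apply: le_Int => //; first by apply: intgD; exact: intgZ.
by move=> x; have := sqr_ge0 ((f x - g x) - (g x - h x)); nra.
Qed.

Lemma ae_null (Q : P -> Prop) : ae2 Q ->
  exists N : set P, [/\ mset2 N, mu N = 0%E & forall x, ~ N x -> Q x].
Proof.
move=> [N [mN N0 QN]]; exists N; split => // x Nx.
by apply: contrapT => nQ; apply: Nx; apply: QN.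
Qed.

Lemma null_ae (N : set P) : mset2 N -> mu N = 0%E -> ae2 (fun x => ~ N x).
Proof. by move=> mN N0; exists N; split => // x /= /contrapT. Qed.

Lemma mfun_sqr f : mfun2 f -> mfun2 (fun x => f x ^+ 2).
Proof. by move=> mf; under eq_fun do rewrite expr2; exact: mfunM. Qed.

Lemma ae_eq_sqi f g : mfun2 g -> sqi f -> ae2 (fun x => f x = g x) -> sqi g.
Proof.
move=> mg [mf If] fg; split => //.
have mg2 : mfun2 (fun x => g x ^+ 2) by exact: mfun_sqr.
apply/integrableP; split; first exact/measurable_EFinP.
have /integrableP[mf2] := If; apply: le_lt_trans; rewrite le_eqVlt.
apply/orP; left; apply/eqP; apply: ae_eq_integral => //.
- by apply: measurableT_comp => //; exact/measurable_EFinP.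
- exact: measurableT_comp.
- by apply: ae2S fg => x /= ->.
Qed.

(** The sum of the [4^k * (v_{k+1} - v_k)^2] has finite integral, hence is finite almost everywhere. *)
Lemma series_sqi (v : nat -> P -> R) : (forall k, sqi (v k)) ->
  (forall k, d2 (v k.+1) (v k) <= 8^-1 ^+ k) ->
  ae2 (fun x => exists M, forall k, (v k.+1 x - v k x) ^+ 2 <= M * 4^-1 ^+ k).
Proof.
move=> sv hv.
pose D k (x : P) := 4 ^+ k * (v k.+1 x - v k x) ^+ 2.
have ID k : intg (D k) by apply: intgZ; have [] := sqiB (sv k.+1) (sv k).
have D0 k x : 0 <= D k x by apply: mulr_ge0; [exact: exprn_ge0 | exact: sqr_ge0].
have mD k : @measurable_fun _ _ MP _ setT (EFin \o D k) by exact: measurable_int (ID k).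
pose g := fun x : MP => (\sum_(0 <= k <oo) (D k x)%:E)%E.
have mg : measurable_fun setT g by
  apply: ge0_emeasurable_sum => [k x _ _|k _]; [rewrite lee_fin | exact: mD].
have gfin : (\int[mu]_x g x <= 2%:E)%E.
  rewrite /g integral_nneseries//; last by move=> k x _; rewrite lee_fin.
  apply: lime_le.
    apply: is_cvg_nneseries => k _ _; apply: integral_ge0 => x _; rewrite lee_fin//.
  apply: nearW => n.
  apply: (@le_trans _ _ (\sum_(0 <= k < n) (2^-1 ^+ k)%:E)%E).
    apply: lee_sum => k _.
    rewrite -(fineK (integrable_fin_num measurableT (ID k))) lee_fin.
    rewrite [X in X <= _]IntZ; last by have [] := sqiB (sv k.+1) (sv k).
    rewrite (_ : 2^-1 = 4 * 8^-1); last by field.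
    by rewrite exprMn; apply: ler_wpM2l; [exact: exprn_ge0 | exact: hv].
  rewrite sumEFin lee_fin.
  suff -> : \sum_(0 <= k < n) (2^-1 : R) ^+ k = 2 - 2 * 2^-1 ^+ n.
    by rewrite gerBl mulr_ge0// exprn_ge0.
  elim: n => [|n IH]; first by rewrite big_geq// expr0; ring.
  by rewrite big_nat_recr//= IH exprS; field.
have Ig : mu.-integrable setT g.
  apply/integrableP; split => //.
  under eq_integral => x _.
    rewrite gee0_abs; last by apply: nneseries_ge0 => k _ _; rewrite lee_fin.
    over.
  by rewrite (le_lt_trans gfin)// ltry.
have := integrable_ae measurableT Ig.
apply: ae2S => x /(_ I) gx; exists (fine (g x)) => k.
rewrite -(@ler_pM2l _ (4 ^+ k)) ?exprn_gt0// exprVn [leRHS]mulrCA mulfV ?mulr1 ?expf_neq0//.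
rewrite -lee_fin fineK//; apply: le_trans (nneseries_lim_ge k.+1 _); last first.
  by move=> n _ _; rewrite lee_fin.
rewrite big_nat_recr//= leeDr// sume_ge0// => n _.
by rewrite lee_fin.
Qed.

Lemma cvg_geom (v : nat -> R) (M : R) :
  (forall k, (v k.+1 - v k) ^+ 2 <= M * 4^-1 ^+ k) -> cvgn v.
Proof.
move=> hv.
have vb k : `|v k.+1 - v k| <= Num.sqrt M * 2^-1 ^+ k.
  have M0 : 0 <= M by have := hv 0%N; rewrite expr0 mulr1; apply: le_trans; exact: sqr_ge0.
  rewrite -(@ler_pXn2r _ 2)// ?nnegrE ?mulr_ge0 ?sqrtr_ge0 ?exprn_ge0//.
  rewrite exprMn sqr_sqrtr// real_normK ?num_real// -exprM mulnC exprM.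
  by rewrite (_ : 2^-1 ^+ 2 = 4^-1)//; field.
have -> : v = fun n => v 0%N + series (telescope v) n.
  by apply/funext => n; exact: eq_sum_telescope.
apply: is_cvgD; first exact: is_cvg_cst.
apply: normed_cvg; apply: (@series_le_cvg _ _ (geometric (Num.sqrt M) 2^-1)) => //.
- by move=> n /=.
- by move=> n; apply: mulr_ge0; rewrite ?sqrtr_ge0 ?exprn_ge0.
- apply: is_cvg_geometric_series; rewrite ger0_norm// invf_lt1//.
  by rewrite ltr1n.
Qed.

(** A subsequence with geometrically decreasing distances converges almost everywhere by
    [series_sqi]; Fatou's lemma shows that the whole sequence tends to its limit in mean square. *)
Lemma sqi_complete (u : nat -> P -> R) : (forall n, sqi (u n)) ->
  (forall e, 0 < e -> exists N, forall m n, (N <= m)%N -> (N <= n)%N ->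
     d2 (u m) (u n) < e) ->
  exists f, sqi f /\ (forall e, 0 < e -> exists N, forall n, (N <= n)%N -> d2 (u n) f < e).
Proof.
move=> su hu.
have /choice[n0 hn0] : forall k, exists N, forall m n, (N <= m)%N -> (N <= n)%N ->
    d2 (u m) (u n) < 8^-1 ^+ k.
  by move=> k; apply: hu; rewrite exprn_gt0// invr_gt0.
pose N k := \max_(j < k.+1) n0 j.
have Nn k : (n0 k <= N k)%N by apply: (leq_bigmax (ord_max : 'I_k.+1)).
have NS k : (N k <= N k.+1)%N.
  by rewrite /N [X in (_ <= X)%N]big_ord_recr/= leq_maxl.
have Nmon k l : (k <= l)%N -> (N k <= N l)%N.
  by move=> kl; apply: (homo_leq _ leq_trans) kl.
pose v k := u (N k).
have hv k l m : (k <= l)%N -> (k <= m)%N -> d2 (v l) (v m) < 8^-1 ^+ k.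
  move=> kl km; apply: hn0; exact: (leq_trans (Nn k) (Nmon _ _ _)).
have [Z [mZ Z0 hZ]] := ae_null (series_sqi (fun k => su (N k)) (fun k => ltW (hv k _ _ (leqnSn k) (leqnn k)))).
pose A := ~` Z.
have mA : mset2 A by exact: measurableC.
pose w k (x : P) := v k x * \1_A x.
have aeA : ae2 (fun x => A x) by exact: null_ae.
have vw k : ae2 (fun x => v k x = w k x).
  by apply: ae2S aeA => x Ax; rewrite /w indicE mem_set// mulr1.
have sw k : sqi (w k).
  apply: ae_eq_sqi (vw k); last exact: su.
  by rewrite /w; apply: mfunM; [have [] := su (N k) | exact: mfun_indic].
pose f x := limn (fun k => w k x).
have wf x : w k x @[k --> \oo] --> f x.
  suff : cvgn (fun k => w k x) by [].
  have [Ax|Ax] := pselect (A x).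
    have [M hM] := hZ _ Ax; apply: (@cvg_geom _ M) => k.
    by rewrite /w indicE mem_set// !mulr1; exact: hM.
  rewrite (_ : (fun k => _) = fun=> 0); first exact: is_cvg_cst.
  apply/funext => k; rewrite /w indicE memNset ?mulr0//.
have d2w k l : d2 (w k) (w l) = d2 (v k) (v l).
  apply: ae_eq_Int; try by have [] := sqiB (sw k) (sw l); exact: (fun m _ => mfun_sqr m).
    by have [] := sqiB (su (N k)) (su (N l)); exact: (fun m _ => mfun_sqr m).
  by have := ae2I (vw k) (vw l); apply: ae2S => x [-> ->].
have mf : mfun2 f.
  by apply: (@measurable_fun_cvg _ _ _ setT w) => // k; have [] := sw k.
have key k : intg (fun x => (f x - w k x) ^+ 2) /\ d2 f (w k) <= 8^-1 ^+ k.
  apply: (@fatouR R (fun l x => (w (l + k)%N x - w k x) ^+ 2)).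
  - by move=> l; have [] := sqiB (sw (l + k)%N) (sw k).
  - by move=> l x; exact: sqr_ge0.
  - by move=> l; rewrite -/(d2 _ _) d2w ltW// hv// leq_addl.
  - move=> x.
    have h : w (l + k)%N x @[l --> \oo] --> f x.
      by rewrite (cvg_shiftn k (fun l => w l x)); exact: wf.
    have h2 : w (l + k)%N x - w k x @[l --> \oo] --> f x - w k x.
      by apply: cvgB => //; exact: cvg_cst.
    by under eq_fun do rewrite expr2; rewrite expr2; exact: cvgM.
have sf : sqi f.
  split => //; have [I1 _] := key 0%N; have [_ I2] := sw 0%N.
  apply: (intg_le _ (intgD (intgZ 2 I1) (intgZ 2 I2))); first exact: mfun_sqr.
  move=> x; rewrite ger0_norm ?sqr_ge0//.
  by have := sqr_ge0 (f x - w 0%N x - w 0%N x); nra.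
exists f; split => // e e0.
have [k hk] : exists k, 8^-1 ^+ k < e / 4.
  have e40 : 0 < e / 4 by rewrite divr_gt0.
  exists (Num.truncn (e / 4)^-1); rewrite exprVn -[ltRHS]invrK ltf_pV2 ?posrE ?exprn_gt0 ?invr_gt0//.
  apply: lt_le_trans (truncnS_gt _) _.
  elim: (Num.truncn _) => [|m IH]; first by rewrite expr0.
  have h8 : 1 <= 8 ^+ m :> R by rewrite exprn_ege1// ler1n.
  by rewrite exprS -natr1; lra.
exists (N k) => n Nkn; apply: le_lt_trans (d2_tri (su n) (su (N k)) sf) _.
have h1 : d2 (u n) (u (N k)) < 8^-1 ^+ k.
  by apply: hn0; [exact: leq_trans Nkn | exact: Nn].
have h2 : d2 (u (N k)) f <= 8^-1 ^+ k.
  have [_] := key k; rewrite d2C; apply: le_trans.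
  rewrite le_eqVlt; apply/orP; left; apply/eqP; apply: ae_eq_Int.
  - by have [m _] := sqiB (su (N k)) sf; exact: mfun_sqr.
  - by have [m _] := sqiB (sw k) sf; exact: mfun_sqr.
  - by apply: ae2S (vw k) => x; rewrite /v => ->.
by lra.
Qed.

Lemma leb2_sigma_finite : sigma_finite setT mu.
Proof.
exists (fun n => box 0 n%:R); last first.
  by move=> n; split; [exact: mset_box | exact: mu_box_lty].
apply/esym; apply/seteqP; split => // x _.
exists (Num.truncn `|x|).+1 => //; apply/boxP; rewrite subr0 ltW//.
exact: truncnS_gt.
Qed.

(** Integrability on the product is replaced by a bound [G] for the integrals of [`|F|] along lines,
    so that both iterated integrals are real-valued everywhere. *)
Lemma Rfubini d (T : measurableType d) (m0 : {measure set T -> \bar R})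
    (F : T -> T -> R) (G : T -> R) : sigma_finite setT m0 ->
  measurable_fun setT (fun z : T * T => F z.1 z.2) ->
  (forall x, m0.-integrable setT (EFin \o F x)) ->
  (forall y, m0.-integrable setT (EFin \o F ^~ y)) ->
  m0.-integrable setT (EFin \o G) ->
  (forall y, \int[m0]_x `|F x y| <= G y) ->
  [/\ m0.-integrable setT (EFin \o (fun x => \int[m0]_y (F x y))),
   m0.-integrable setT (EFin \o (fun y => \int[m0]_x (F x y))) &
   \int[m0]_x (\int[m0]_y F x y) = \int[m0]_y (\int[m0]_x F x y)].
Proof.
case: m0 => ms mc; set m0 := Measure.Pack mc => sf0 mF.
pose m : {sigma_finite_measure set T -> \bar R} :=
  SigmaFiniteMeasure.pack_
    (Measure.measure_function_Content_isMeasure_mixin (Measure.class m0))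
    (isSFinite.Axioms_ _ _ _ (sfinite_measure_sigma_finite sf0))
    (isSigmaFinite.Axioms_ _ _ _ sf0).
have -> : m0 = (m : {measure set T -> \bar R}) by [].
move=> I1 I2 IG hG.
have mFE : measurable_fun setT (fun z : T * T => (F z.1 z.2)%:E) by exact/measurable_EFinP.
have IF : (m \x m)%E.-integrable setT (fun z : T * T => (F z.1 z.2)%:E).
  apply/integrable21ltyP => //.
  have mn : measurable_fun setT (fun z : T * T => `|(F z.1 z.2)%:E|%E) by exact: measurableT_comp.
  apply: (@le_lt_trans _ _ (\int[m]_y (G y)%:E)%E).
    apply: ge0_le_integral => //.
    - by move=> y _; exact: integral_ge0.
    - by have := measurable_fun_fubini_tonelli_G (m1 := m) _ mn (fun z => abse_ge0 _); exact.
    - exact: measurable_int IG.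
    move=> y _; have := hG y; rewrite -lee_fin; apply: le_trans.
    by rewrite /Rintegral fineK//; exact: integrable_fin_num (integrable_norm (I2 y)).
  have := integrable_fin_num measurableT IG.
  by rewrite fin_numE => /andP[_ h]; rewrite ltey.
have E1 x : (\int[m]_y (F x y))%:E = (\int[m]_y (F x y)%:E)%E.
  by rewrite /Rintegral fineK//; exact: integrable_fin_num (I1 x).
have E2 y : (\int[m]_x (F x y))%:E = (\int[m]_x (F x y)%:E)%E.
  by rewrite /Rintegral fineK//; exact: integrable_fin_num (I2 y).
split.
- have := integrable_fubini_F IF; apply: eq_integrable => //.
  by move=> x _; rewrite /= E1.
- apply: (le_integrable measurableT _ _ IG).
    have := measurable_fubini_G IF; apply: eq_measurable_fun => y _.
    by rewrite /= E2.
  move=> y _; rewrite /= lee_fin (le_trans (le_normr_Rintegral measurableT (I2 y)))//.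
  by rewrite (le_trans (hG y))// ler_norm.
- have h := Fubini IF; rewrite /Rintegral; congr fine.
  under eq_integral do rewrite E1; rewrite h.
  by apply: eq_integral => x _; rewrite E2.
Qed.

Lemma fubini2 (F : P -> P -> R) (G : P -> R) :
  @measurable_fun _ _ (MP * MP)%type (measurableTypeR R) setT (fun z => F z.1 z.2) ->
  (forall x, intg (F x)) -> (forall y, intg (F ^~ y)) ->
  intg G -> (forall y, Int (fun x => `|F x y|) <= G y) ->
  [/\ intg (fun x => Int (F x)), intg (fun y => Int (F ^~ y)) &
   Int (fun x => Int (F x)) = Int (fun y => Int (F ^~ y))].
Proof. by move=> mF; exact: (@Rfubini _ MP mu F G leb2_sigma_finite mF). Qed.

End PlaneMeasure2.

(** * Derivatives along a direction *)

Section Calc.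
Context {R : realType} {V : normedModType R}.
Implicit Types (f g : V -> R) (x v : V).

(** The definition of the derivative along [v] as an estimate. *)
Lemma derE f x v (df : R) : is_derive x v f df <->
  (forall e : R, 0 < e -> exists d : R, 0 < d /\
     forall h : R, `|h| < d -> `|f (h *: v + x) - f x - h * df| <= e * `|h|).
Proof.
have E : (h^-1 *: (f (h *: v + x) - f x) @[h --> (0 : R)^'] --> df) <->
  (forall e : R, 0 < e -> exists d : R, 0 < d /\
     forall h : R, `|h| < d -> `|f (h *: v + x) - f x - h * df| <= e * `|h|).
  split=> [/cvgrPdist_le h e e0|H].
    have := h e e0; rewrite near_withinE => /nbhs_ballP[d /= d0 hd].
    exists d; split => // t td.
    have [->|t0] := eqVneq t 0; first by rewrite scale0r add0r subrr mul0r subr0 normr0 mulr0.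
    have := hd t; rewrite /= /ball/= sub0r normrN => /(_ td t0).
    rewrite distrC -(ler_pM2r (_ : 0 < `|t|)) ?normr_gt0// -normrM mulrBl.
    by rewrite [_ *: _]mulrC mulrVK ?unitfE// [df * t]mulrC.
  apply/cvgrPdist_le => e e0; have [d [d0 hd]] := H e e0.
  rewrite near_withinE; apply/nbhs_ballP; exists d => //= t.
  rewrite /ball/= sub0r normrN => td t0; have := hd _ td.
  rewrite distrC -[in X in _ -> X](ler_pM2r (_ : 0 < `|t|)) ?normr_gt0// -normrM mulrBl.
  by rewrite [X in _ - X * t]mulrC mulrVK ?unitfE// [df * t]mulrC.
rewrite -E; split=> [[+ <-]|H]; first by [].
apply: DeriveDef; first by apply/cvg_ex; exists df.
exact: (cvg_lim _ H).
Qed.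

End Calc.

Section Calc0.
Context {R : realType} {V : normedModType R}.
Implicit Types (f g : V -> R) (x v : V).

Lemma dD f g x v (df dg : R) : is_derive x v f df -> is_derive x v g dg ->
  is_derive x v (fun y => f y + g y) (df + dg).
Proof. by move=> Hf Hg; have := is_deriveD Hf Hg; exact. Qed.

Lemma dB f g x v (df dg : R) : is_derive x v f df -> is_derive x v g dg ->
  is_derive x v (fun y => f y - g y) (df - dg).
Proof. by move=> Hf Hg; have := is_deriveB Hf Hg; exact. Qed.

Lemma dN f x v (df : R) : is_derive x v f df -> is_derive x v (fun y => - f y) (- df).
Proof. by move=> Hf; have := is_deriveN Hf; exact. Qed.

Lemma dM f g x v (df dg : R) : is_derive x v f df -> is_derive x v g dg ->
  is_derive x v (fun y => f y * g y) (f x * dg + g x * df).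
Proof. by move=> Hf Hg; have := is_deriveM Hf Hg; exact. Qed.

Lemma dC (c : R) x v : is_derive x v (fun=> c) 0.
Proof. exact: is_derive_cst. Qed.

Lemma dZ (c : R) f x v (df : R) : is_derive x v f df ->
  is_derive x v (fun y => c * f y) (c * df).
Proof. by move=> Hf; have := is_deriveZ c Hf; exact. Qed.

Lemma d_eq f x v (df df' : R) : is_derive x v f df -> df = df' -> is_derive x v f df'.
Proof. by move=> ? <-. Qed.

Lemma d_near f g x v (df : R) : (\near x, f x = g x) -> is_derive x v f df ->
  is_derive x v g df.
Proof. exact: near_eq_is_derive. Qed.

Lemma d_unique f x v (df df' : R) : is_derive x v f df -> is_derive x v f df' -> df = df'.
Proof. by move=> [_ <-] [_ <-]. Qed.

Lemma d_comp (F : R -> R) f x v (df dF : R) : is_derive x v f df -> is_derive (f x) 1 F dF ->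
  is_derive x v (fun y => F (f y)) (dF * df).
Proof.
move=> Hf HF; apply/derE => e e0.
pose e1 := e / (`|df| + `|dF| + 2).
have p0 : 0 < `|df| + `|dF| + 2 by have := normr_ge0 df; have := normr_ge0 dF; lra.
have e10 : 0 < e1 by rewrite divr_gt0.
pose e2 := Num.min e1 1.
have e20 : 0 < e2 by rewrite lt_min e10 ltr01.
have [d1 [d10 h1]] := (derE _ _ _ _).1 Hf _ e20.
have [d2 [d20 h2]] := (derE _ _ _ _).1 HF _ e20.
exists (Num.min d1 (d2 / (`|df| + 1))); split.
  by rewrite lt_min d10 divr_gt0// ltr_wpDl.
move=> h; rewrite lt_min => /andP[hd1 hd2].
have k1 := h1 _ hd1.
have q0 : 0 < `|df| + 1 by have := normr_ge0 df; lra.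
set D := f (h *: v + x) - f x in k1.
have e2le1 : e2 <= 1 by rewrite ge_min lexx orbT.
have e2lee : e2 <= e1 by rewrite ge_min lexx.
have Db : `|D| <= (`|df| + 1) * `|h|.
  rewrite (_ : D = (D - h * df) + h * df); last by ring.
  apply: le_trans (ler_normD _ _) _; rewrite normrM.
  by have := normr_ge0 h; nra.
have Dd : `|D| < d2.
  by rewrite (le_lt_trans Db)// mulrC -ltr_pdivlMr.
have := h2 _ Dd; rewrite [_ *: 1]mulr1 {1}/D subrK => k2.
rewrite (_ : _ - h * _ = (F (f (h *: v + x)) - F (f x) - D * dF) + dF * (D - h * df)); last by ring.
apply: le_trans (ler_normD _ _) _; rewrite normrM.
have -> : e = e1 * (`|df| + `|dF| + 2) by rewrite divfK// gt_eqF.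
have := normr_ge0 h; have := normr_ge0 dF; have := normr_ge0 df => a b c.
apply: (@le_trans _ _ (e1 * ((`|df| + 1) * `|h|) + `|dF| * (e1 * `|h|))).
  apply: lerD.
    apply: le_trans k2 _; apply: ler_pM => //; exact: ltW.
  by apply: ler_wpM2l => //; apply: le_trans k1 _; exact: ler_wpM2r.
have : 0 <= e1 * `|h| by rewrite mulr_ge0// ltW.
by nra.
Qed.

Lemma d_line f x v (t df : R) : is_derive (x + t *: v) v f df <->
  is_derive t 1 (fun s : R => f (x + s *: v)) df.
Proof.
split=> Hd; apply/derE => e /((derE _ _ _ _).1 Hd)[d [d0 hd]]; exists d; split => // h /hd.
  by rewrite [h *: 1]mulr1 scalerDl addrCA addrA.
by rewrite [h *: 1]mulr1 scalerDl addrCA addrA.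
Qed.

Lemma d_affine f (a : R) (b : V) x v (df : R) : is_derive (a *: x + b) v f df ->
  is_derive x v (fun y => f (a *: y + b)) (a * df).
Proof.
move=> Hd; have H := (derE _ _ _ _).1 Hd; apply/derE => e e0.
have p0 : 0 < `|a| + 1 by have := normr_ge0 a; lra.
have [|d [d0 hd]] := H (e / (`|a| + 1)); first exact: divr_gt0.
exists (d / (`|a| + 1)); split; first exact: divr_gt0.
move=> h hd1.
have := hd (a * h); rewrite normrM.
have -> : (a * h) *: v + (a *: x + b) = a *: (h *: v + x) + b.
  by rewrite scalerDr scalerA addrA.
have hh : `|a| * `|h| < d.
  rewrite ltr_pdivlMr// in hd1.
  by have := normr_ge0 h; nra.
move=> /(_ hh); rewrite (mulrC a h) -(mulrA h a df) => /le_trans; apply.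
rewrite mulrA ler_wpM2r// -mulrA ler_piMr ?(ltW e0)// mulrC.
by rewrite ler_pdivrMr// mul1r lerDl.
Qed.

(** Continuous derivatives up to order [n] along a family [d] of directions: for the two
    coordinate directions of the plane, and for the only direction of the line. *)
Context {I : Type} (d : I -> V).

Fixpoint Ck (n : nat) f : Prop :=
  match n with
  | 0 => continuous f
  | m.+1 => continuous f /\
      forall i, (forall x, derivable f x (d i)) /\ Ck m (fun x => 'D_(d i) f x)
  end.

Lemma Ck_cont n f : Ck n f -> continuous f.
Proof. by case: n => [|n] // []. Qed.

Lemma CkS n f : Ck n.+1 f -> Ck n f.
Proof.
elim: n f => [|n IH] f; first by case.
move=> [cf H]; split => // i; have [df Hi] := H i; split => //.
exact: IH.
Qed.

Lemma Ck_der n f : Ck n.+1 f -> forall i x, is_derive x (d i) f ('D_(d i) f x).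
Proof. by move=> [_ H] i x; have [df _] := H i; exact: derivableP. Qed.

Lemma CkI n f (df : I -> V -> R) : continuous f ->
  (forall i x, is_derive x (d i) f (df i x)) -> (forall i, Ck n (df i)) -> Ck n.+1 f.
Proof.
move=> cf Hdf Cdf; split => // i; split=> [x|]; first by have [] := Hdf i x.
by rewrite (_ : (fun x => _) = df i)//; apply/funext => x; have [_ ->] := Hdf i x.
Qed.

Lemma Ck_ext n f g : f =1 g -> Ck n f -> Ck n g.
Proof. by move=> /funext ->. Qed.

Lemma Ck_cst n c : Ck n (fun=> c).
Proof.
elim: n c => [|n IH] c; first exact: cst_continuous.
apply: (CkI (df := fun _ _ => 0) _ _ (fun _ => IH 0)); exact: cst_continuous.
Qed.

Lemma CkD n f g : Ck n f -> Ck n g -> Ck n (fun x => f x + g x).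
Proof.
elim: n f g => [|n IH] f g Hf Hg.
  by move=> x; apply: cvgD; [exact: Hf | exact: Hg].
apply: (@CkI _ _ (fun i x => 'D_(d i) f x + 'D_(d i) g x)).
- by move=> x; apply: cvgD; [apply: (Ck_cont Hf) | apply: (Ck_cont Hg)].
- by move=> i x; apply: dD; [exact: (Ck_der Hf) | exact: (Ck_der Hg)].
- by move=> i; apply: IH; [have [_ /(_ i)[]] := Hf | have [_ /(_ i)[]] := Hg].
Qed.

Lemma CkM n f g : Ck n f -> Ck n g -> Ck n (fun x => f x * g x).
Proof.
elim: n f g => [|n IH] f g Hf Hg.
  by move=> x; apply: cvgM; [exact: Hf | exact: Hg].
apply: (@CkI _ _ (fun i x => f x * 'D_(d i) g x + g x * 'D_(d i) f x)).
- by move=> x; apply: cvgM; [apply: (Ck_cont Hf) | apply: (Ck_cont Hg)].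
- by move=> i x; apply: dM; [exact: (Ck_der Hf) | exact: (Ck_der Hg)].
- move=> i; apply: CkD; apply: IH; do ?exact: CkS.
    by have [_ /(_ i)[]] := Hg.
  by have [_ /(_ i)[]] := Hf.
Qed.

Lemma CkZ n c f : Ck n f -> Ck n (fun x => c * f x).
Proof. by move=> Hf; apply: CkM => //; exact: Ck_cst. Qed.

Lemma CkN n f : Ck n f -> Ck n (fun x => - f x).
Proof. by move=> /(CkZ (-1)); apply: Ck_ext => x; rewrite mulN1r. Qed.

Lemma CkB n f g : Ck n f -> Ck n g -> Ck n (fun x => f x - g x).
Proof. by move=> Hf /CkN; exact: CkD. Qed.

Lemma Ck_affine n (a : R) (b : V) f : Ck n f -> Ck n (fun y => f (a *: y + b)).
Proof.
have cA : continuous (fun y : V => a *: y + b).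
  move=> y; apply: cvgD; last exact: cvg_cst.
  by apply: scaler_continuous.
elim: n f => [|n IH] f Hf; first by move=> x; apply: continuous_comp; [exact: cA | exact: Hf].
apply: (@CkI _ _ (fun i x => a * 'D_(d i) f (a *: x + b))).
- by move=> x; apply: continuous_comp; [exact: cA | exact: (Ck_cont Hf)].
- by move=> i x; apply: d_affine; exact: (Ck_der Hf).
- by move=> i; apply: CkZ; apply: (IH (fun x => 'D_(d i) f x)); have [_ /(_ i)[]] := Hf.
Qed.

End Calc0.

Notation Ck1 := (Ck (fun _ : unit => (1 : _))).

Section Calc1.
Context {R : realType} {V : normedModType R} {I : Type} (d : I -> V).

Lemma Ck_comp n (F : R -> R) (f : V -> R) :
  Ck (fun _ : unit => (1 : R)) n F -> Ck d n f -> Ck d n (fun x => F (f x)).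
Proof.
elim: n F f => [|n IH] F f HF Hf.
  by move=> x; apply: continuous_comp; [exact: Hf | exact: HF].
apply: (@CkI _ _ _ _ _ _ (fun i x => 'D_1 F (f x) * 'D_(d i) f x)).
- by move=> x; apply: continuous_comp; [exact: (Ck_cont Hf) | exact: (Ck_cont HF)].
- by move=> i x; apply: d_comp; [exact: (Ck_der Hf) | exact: (Ck_der HF tt)].
- move=> i; apply: CkM; last by have [_ /(_ i)[]] := Hf.
  by apply: (IH (fun x => 'D_1 F x)); [have [_ /(_ tt)[]] := HF | exact: CkS].
Qed.

(** The mean value theorem; [a] and [b] may come in either order. *)
Lemma mvt_bound (f df : R -> R) (a b k e : R) :
  (forall t, `|t - a| <= `|b - a| -> is_derive t 1 f (df t)) ->
  (forall t, `|t - a| <= `|b - a| -> `|df t - k| <= e) ->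
  `|f b - f a - k * (b - a)| <= e * `|b - a|.
Proof.
move=> Hf He.
have cont (u v : R) : (forall t : R, t \in `[u, v] -> is_derive t 1 f (df t)) ->
    {within `[u, v], continuous f}.
  move=> H; apply: derivable_within_continuous => t tuv.
  by have [] := H t tuv.
have [c [hc ->]] : exists c, `|c - a| <= `|b - a| /\ f b - f a = df c * (b - a).
  have [ab|/ltW ba] := leP a b.
    have H (t : R) : t \in `[a, b] -> is_derive t 1 f (df t).
      rewrite in_itv/= => /andP[at_ tb]; apply: Hf.
      by rewrite !ger0_norm ?subr_ge0// lerD2r.
    have Ho t : t \in `]a, b[ -> is_derive t 1 f (df t).
      by rewrite in_itv/= => /andP[a1 a2]; apply: H; rewrite in_itv/= !ltW.
    have [c cab E] := MVT_segment ab Ho (cont _ _ H).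
    exists c; split; last exact: E.
    move: cab; rewrite in_itv/= => /andP[ac cb].
    by rewrite !ger0_norm ?subr_ge0// lerD2r.
  have H (t : R) : t \in `[b, a] -> is_derive t 1 f (df t).
    rewrite in_itv/= => /andP[bt ta]; apply: Hf.
    by rewrite !ler0_norm ?subr_le0// lerN2 lerD2r.
  have Ho t : t \in `]b, a[ -> is_derive t 1 f (df t).
    by rewrite in_itv/= => /andP[a1 a2]; apply: H; rewrite in_itv/= !ltW.
  have [c cab E] := MVT_segment ba Ho (cont _ _ H).
  exists c; split; last by rewrite -[LHS]opprB E -mulrN opprB.
  move: cab; rewrite in_itv/= => /andP[ac cb].
  by rewrite !ler0_norm ?subr_le0// lerN2 lerD2r.
rewrite -mulrBl normrM ler_wpM2r//; exact: He.
Qed.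

End Calc1.

(** * Smooth step functions *)

Section Bump.
Context {R : realType}.
Implicit Types (f g : R -> R) (t : R).
Local Notation C1k := (Ck (fun _ : unit => (1 : R))).

Lemma d_cont f df : (forall t, is_derive t 1 f (df t)) -> continuous f.
Proof.
move=> H t; apply: differentiable_continuous; apply/derivable1_diffP.
by have [] := H t.
Qed.

Lemma d_near0 g t : (\near t, g t = 0) -> is_derive t 1 g 0.
Proof.
move=> g0; apply: (@d_near _ _ (fun=> 0) _ _ _ _ _ (dC 0 t 1)).
by apply: filterS g0 => s ->.
Qed.

Lemma Ck1I n f df : (forall t, is_derive t 1 f (df t)) -> C1k n df -> C1k n.+1 f.
Proof. by move=> H Hn; apply: (CkI (df := fun _ => df)) => //; exact: d_cont H. Qed.

Lemma Ck1_antider f df : (forall t, is_derive t 1 f (df t)) ->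
  (forall n, C1k n df) -> forall n, C1k n f.
Proof. by move=> H Hn [|n]; [exact: d_cont H | exact: Ck1I H (Hn n)]. Qed.

Lemma d_inv t : t != 0 -> is_derive t 1 (fun s : R => s^-1) (- t^-1 ^+ 2).
Proof.
move=> t0; apply: (d_eq (is_deriveV (f := id) (t := 1) t0 _)).
by rewrite [LHS]mulr1 exprVn.
Qed.

Lemma d_horner (p : {poly R}) t : is_derive t 1 (fun s => p.[s]) (p^`()).[t].
Proof.
have := derivableP (@derivable_horner _ p t).
by rewrite -derive1E -derivE; exact.
Qed.

(** Functions [p (1 / t) * exp (- 1 / t)], continued by [0] to [t <= 0]. Differentiation acts on the
    polynomial [p], hence they are smooth. *)
Definition expb (p : {poly R}) t := if 0 < t then p.[t^-1] * expR (- t^-1) else 0.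

Lemma expb_small (p : {poly R}) : exists C, 0 <= C /\
  forall t, `|t| <= 1 -> `|expb p t| <= C * t ^+ 2.
Proof.
pose S : R := \sum_(i < size p) `|p`_i|.
have S0 : 0 <= S by apply: sumr_ge0.
exists (S * (size p).+2`!%:R); split; first by rewrite mulr_ge0.
move=> t t1; rewrite /expb; case: ifPn => [t0|_]; last first.
  by rewrite normr0 mulr_ge0 ?sqr_ge0// mulr_ge0.
rewrite gtr0_norm// in t1; set u := t^-1.
have u1 : 1 <= u by rewrite /u invf_ge1.
have u0 : 0 < u by rewrite invr_gt0.
have pu : `|p.[u]| <= S * u ^+ size p.
  rewrite horner_coef /S mulr_suml; apply: le_trans (ler_norm_sum _ _ _) _.
  apply: ler_sum => i _; rewrite normrM ler_wpM2l// ger0_norm ?exprn_ge0 ?(ltW u0)//.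
  by rewrite ler_weXn2l// ltnW.
have eu : u ^+ (size p).+2 / (size p).+2`!%:R <= expR u.
  by apply: le_trans (expR_ge1Dxn (size p).+1 (ltW u0)); rewrite lerDr.
rewrite normrM (ger0_norm (expR_ge0 _)) expRN.
have f0 : 0 < (size p).+2`!%:R :> R by rewrite ltr0n fact_gt0.
have -> : t = u^-1 by rewrite /u invrK.
rewrite ler_pdivrMr ?expR_gt0//; apply: (le_trans pu).
rewrite -!mulrA ler_wpM2l//.
have -> : u ^+ size p = (size p).+2`!%:R * (u^-1 ^+ 2 * (u ^+ (size p).+2 / (size p).+2`!%:R)).
  rewrite -[(size p).+2]addn2 exprD; field; rewrite ?gt_eqF//.
have ui : 0 <= u^-1 by rewrite invr_ge0 ltW.
by rewrite ler_wpM2l ?(ltW f0)// expr2 -mulrA !ler_wpM2l.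
Qed.

Lemma d_expb (p : {poly R}) t : is_derive t 1 (expb p) (expb ('X^2 * (p - p^`())) t).
Proof.
have [t0|t0|->] := ltgtP t 0.
- rewrite {2}/expb ltNge (ltW t0)/=.
  apply: d_near0.
  near=> s; rewrite /expb ltNge ifN// negbK ltW//; near: s.
  by apply: open_nbhs_nbhs; split; [exact: open_lt|].
- have tn0 : t != 0 by rewrite gt_eqF.
  apply: (@d_near _ _ (fun s : R => p.[s^-1] * expR (- s^-1))).
    near=> s; rewrite /expb ifT//; near: s.
    by apply: open_nbhs_nbhs; split; [exact: open_gt|].
  have h1 := d_comp (d_inv tn0) (d_horner p t^-1).
  have h2 := d_comp (dN (d_inv tn0)) (is_derive_expR (- t^-1)).
  apply: (d_eq (dM h1 h2)); rewrite /expb t0 !hornerE/=.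
  by ring.
- rewrite {2}/expb ltxx; apply/derE => e e0.
  have [C [C0 hC]] := expb_small p.
  have C1 : 0 < C + 1 by lra.
  exists (Num.min 1 (e / (C + 1))); split; first by rewrite lt_min ltr01 divr_gt0.
  move=> h; rewrite lt_min => /andP[h1 h2].
  rewrite addr0 [h *: 1]mulr1 mulr0 subr0 {2}/expb ltxx subr0.
  apply: (le_trans (hC _ (ltW h1))); rewrite -real_normK ?num_real// expr2 mulrA.
  rewrite ler_wpM2r//; move: h2; rewrite ltr_pdivlMr// => h2.
  by have := normr_ge0 h; lra.
Unshelve. all: by end_near.
Qed.

Lemma Ck_expb n p : C1k n (expb p).
Proof.
elim: n p => [|n IH] p; first exact: (d_cont (d_expb p)).
exact: Ck1I (d_expb p) (IH _).
Qed.

Lemma expb1_gt0 t : 0 < t -> 0 < expb 1 t.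
Proof. by move=> t0; rewrite /expb t0 hornerC mul1r expR_gt0. Qed.
Lemma expb_le0 p t : t <= 0 -> expb p t = 0.
Proof. by move=> t0; rewrite /expb ltNge t0. Qed.
Lemma expb1_ge0 t : 0 <= expb 1 t.
Proof. by have [/expb1_gt0/ltW//|/expb_le0 ->] := ltP 0 t. Qed.

Lemma antiderivative f (B : R) : continuous f -> (forall t, t < B -> f t = 0) ->
  exists F, (forall t, is_derive t 1 F (f t)) /\ (forall t, t < B -> F t = 0).
Proof.
move=> cf f0; pose a := B - 1.
pose F t : R := \int[lebesgue_measure]_(s in `[a, t]) f s.
have F0 t : t < B -> F t = 0.
  move=> tB; transitivity (\int[lebesgue_measure]_(s in `[a, t]) (0 : R)); last by rewrite /Rintegral integral0.
  apply: eq_Rintegral => s; rewrite inE/= in_itv/= => /andP[_ st]; apply: f0; exact: le_lt_trans tB.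
exists F; split => // t.
have [tB|tB] := ltP t B.
  rewrite f0//; apply: d_near0.
  near=> s; rewrite F0//; near: s.
  by apply: open_nbhs_nbhs; split; [exact: open_lt|].
have atlt : a < t by rewrite /a; lra.
have tt1 : t < t + 1 by rewrite ltrDl.
have itf : lebesgue_measure.-integrable `[a, t + 1] (EFin \o f).
  apply: continuous_compact_integrable; first exact: segment_compact.
  by apply: continuous_subspaceT.
have [dF E] := continuous_FTC1_closed tt1 itf atlt (cf t).
by rewrite -E derive1E; exact: derivableP.
Unshelve. all: by end_near.
Qed.

Lemma d_nondecr f df : (forall t, is_derive t 1 f (df t)) -> (forall t, 0 <= df t) ->
  forall s t, s <= t -> f s <= f t.
Proof.
move=> H H0 s t st; have cf := d_cont H.
have [|c _ E] := MVT_segment st (fun x _ => H x).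
  by apply: continuous_subspaceT.
by rewrite -subr_ge0 E mulr_ge0// subr_ge0.
Qed.

Lemma d_const f df : (forall t, is_derive t 1 f (df t)) -> forall s t, s <= t ->
  (forall x, s <= x <= t -> df x = 0) -> f s = f t.
Proof.
move=> H s t st H0; have cf := d_cont H.
have [|c cst E] := MVT_segment st (fun x _ => H x).
  by apply: continuous_subspaceT.
by apply/esym/eqP; rewrite -subr_eq0 E H0 ?mul0r// -in_itv.
Qed.

(** A smooth step [M] from [0] to [1], and its derivative [m], which is supported between [1 / 4] and [1]. *)
Lemma smooth_step : exists m M : R -> R,
  [/\ forall n, C1k n m, forall n, C1k n M, forall t, is_derive t 1 M (m t),
      (forall t, 0 <= m t) /\ (forall t, t <= 4^-1 \/ 1 <= t -> m t = 0) &
      (forall t, t < 4^-1 -> M t = 0) /\ (forall t, 1 <= t -> M t = 1)].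
Proof.
pose m0 (t : R) := expb 1 (t - 4^-1) * expb 1 (1 - t).
have Cm0 n : C1k n m0.
  have h := CkM (Ck_affine 1 (- 4^-1 : R) (Ck_expb n 1)) (Ck_affine (-1) (1 : R) (Ck_expb n 1)).
  by apply: (Ck_ext _ h) => t; rewrite scale1r scaleN1r [- t + 1]addrC.
have m0_ge0 t : 0 <= m0 t by rewrite mulr_ge0 ?expb1_ge0.
have m0_0 t : t <= 4^-1 \/ 1 <= t -> m0 t = 0.
  rewrite /m0; case=> h; first by rewrite [X in X * _]expb_le0 ?mul0r// subr_le0.
  by rewrite [X in _ * X]expb_le0 ?mulr0// subr_le0.
have [M0 [dM0 M00]] := antiderivative (Cm0 0%N : continuous m0) (fun t (h : t < 4^-1) => m0_0 t (or_introl (ltW h))).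
have M1 : 0 < M0 1.
  have mono := d_nondecr dM0 m0_ge0.
  rewrite lt_neqAle -{2}(M00 0) ?invr_gt0// mono// andbT; apply/eqP => h.
  have z t : 0 <= t -> t <= 1 -> M0 t = 0.
    move=> t0 t1; apply/eqP; rewrite eq_le {1}h mono//= -(M00 0) ?invr_gt0// mono//.
  have : is_derive (2^-1 : R) 1 M0 0.
    apply: d_near0.
    near=> s; rewrite z//.
      near: s; apply: filterS (@open_nbhs_nbhs _ _ _ (conj (@open_gt R 0) _)) => [s /ltW//|].
      by rewrite /= invr_gt0.
    near: s; apply: filterS (@open_nbhs_nbhs _ _ _ (conj (@open_lt R 1) _)) => [s /ltW//|].
    by rewrite /= invf_lt1// ltr1n.
  move/(d_unique (dM0 _)); rewrite /m0 => /eqP; rewrite mulf_eq0.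
  by rewrite !gt_eqF//; apply: expb1_gt0; lra.
exists (fun t => (M0 1)^-1 * m0 t), (fun t => (M0 1)^-1 * M0 t); split.
- by move=> n; exact: CkZ.
- by move=> n; apply: CkZ; exact: (Ck1_antider dM0 Cm0 n).
- by move=> t; apply: dZ.
- split=> [t|t /m0_0 ->]; last by rewrite mulr0.
  by rewrite mulr_ge0// invr_ge0 ltW.
- split=> [t /M00 ->|t t1]; first by rewrite mulr0.
  rewrite -(d_const dM0 t1); first by rewrite mulVf// gt_eqF.
  by move=> x /andP[x1 _]; apply: m0_0; right.
Unshelve. all: by end_near.
Qed.

(** The singularity of the inverse powers is invisible since [k] vanishes on a half-line that
    contains the origin in its interior. *)
Lemma Ck_divX (c : R) (k : R -> R) j n : 0 < c -> (forall n, C1k n k) ->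
  (forall t, t < c -> k t = 0) -> C1k n (fun t => k t * t^-1 ^+ j).
Proof.
move=> c0; elim: n j k => [|n IH] j k Hk k0.
  have : forall t, is_derive t 1 (fun t => k t * t^-1 ^+ j) ('D_1 (fun t => k t * t^-1 ^+ j) t).
    move=> t; apply: derivableP; have [tc|tc] := ltP t c.
      have [] : is_derive t 1 (fun t => k t * t^-1 ^+ j) 0 => //.
      apply: d_near0; near=> s; rewrite k0 ?mul0r//; near: s.
      by apply: open_nbhs_nbhs; split; [exact: open_lt|].
    have tn0 : t != 0 by rewrite gt_eqF// (lt_le_trans c0).
    have h := d_comp (d_inv tn0) (derivableP (@exprn_derivable _ j t^-1 1)).
    by have [] := dM (Ck_der (Hk 1%N) tt t) h.
  by move=> H; exact: d_cont H.
have k'0 t : t < c -> 'D_1 k t = 0.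
  move=> tc; apply: (d_unique (Ck_der (Hk 1%N) tt t)); apply: d_near0.
  near=> s; rewrite k0//; near: s.
  by apply: open_nbhs_nbhs; split; [exact: open_lt|].
have H1 t : is_derive t 1 (fun t => k t * t^-1 ^+ j)
    ('D_1 k t * t^-1 ^+ j - j%:R * (k t * t^-1 ^+ j.+1)).
  have [tc|tc] := ltP t c.
    rewrite k'0// k0// !mul0r mulr0 subr0; apply: d_near0.
    near=> s; rewrite k0 ?mul0r//; near: s.
    by apply: open_nbhs_nbhs; split; [exact: open_lt|].
  have tn0 : t != 0 by rewrite gt_eqF// (lt_le_trans c0).
  have h := d_comp (d_inv tn0) (derivableP (@exprn_derivable _ j t^-1 1)).
  apply: (d_eq (dM (Ck_der (Hk 1%N) tt t) h)).
  rewrite exp_derive [_ *: 1]mulr1 {1}/GRing.scale/= [t^-1 ^+ j.+1]exprSr.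
  case: j {h} => [|j]; first by rewrite mul0r !mul0r mulr0 add0r subr0 mulrC.
  by rewrite /= [t^-1 ^+ j.+1]exprSr; ring.
have H2 : C1k n (fun t => 'D_1 k t * t^-1 ^+ j - j%:R * (k t * t^-1 ^+ j.+1)).
  apply: CkB; first by apply: IH => // m; have [_ /(_ tt)[]] := Hk m.+1.
  by apply: CkZ; exact: IH.
exact: Ck1I H1 H2.
Unshelve. all: by end_near.
Qed.

End Bump.

(** * Calculus on the plane and test functions *)

Section PlaneCalculus.
Context {R : realType}.
Local Notation P := (R * R)%type.
Local Notation mu := (@leb2 R).
Local Notation C2k := (Ck (@dir R)).
Implicit Types (g phi : P -> R) (x v : P).

Lemma dir0 : @dir R 0 = (1, 0). Proof. by []. Qed.
Lemma dir1 : @dir R 1 = (0, 1). Proof. by []. Qed.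

Lemma d_line0 g (a b t df : R) : is_derive (a + t, b) (dir 0) g df ->
  is_derive t 1 (fun s : R => g (a + s, b)) df.
Proof.
move=> H; have : is_derive ((a, b) + t *: dir 0) (dir 0) g df.
  rewrite dir0 (_ : (a, b) + _ = (a + t, b))//.
  by congr (_, _); rewrite /= ?[t *: 1]mulr1 ?[t *: 0]mulr0 ?addr0.
move/d_line; congr (is_derive _ _ _ _); apply/funext => s; congr g.
by rewrite dir0; congr (_, _); rewrite /= ?[s *: 1]mulr1 ?[s *: 0]mulr0 ?addr0.
Qed.

Lemma d_line1 g (a b t df : R) : is_derive (a, b + t) (dir 1) g df ->
  is_derive t 1 (fun s : R => g (a, b + s)) df.
Proof.
move=> H; have : is_derive ((a, b) + t *: dir 1) (dir 1) g df.
  rewrite dir1 (_ : (a, b) + _ = (a, b + t))//.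
  by congr (_, _); rewrite /= ?[t *: 1]mulr1 ?[t *: 0]mulr0 ?addr0.
move/d_line; congr (is_derive _ _ _ _); apply/funext => s; congr g.
by rewrite dir1; congr (_, _); rewrite /= ?[s *: 1]mulr1 ?[s *: 0]mulr0 ?addr0.
Qed.

Lemma d_fst x v : is_derive x v (fun y : P => y.1) v.1.
Proof.
apply/derE => e e0; exists 1; split => // h _.
have -> : (h *: v + x).1 = h * v.1 + x.1 by [].
by rewrite addrK subrr normr0 mulr_ge0// (ltW e0).
Qed.

Lemma d_snd x v : is_derive x v (fun y : P => y.2) v.2.
Proof.
apply/derE => e e0; exists 1; split => // h _.
have -> : (h *: v + x).2 = h * v.2 + x.2 by [].
by rewrite addrK subrr normr0 mulr_ge0// (ltW e0).
Qed.

Lemma fst_cont : continuous (fun y : P => y.1).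
Proof. by move=> y; exact: cvg_fst. Qed.
Lemma snd_cont : continuous (fun y : P => y.2).
Proof. by move=> y; exact: cvg_snd. Qed.

Lemma cont_near g x (e : R) : {for x, continuous g} -> 0 < e ->
  \forall y \near x, `|g y - g x| <= e.
Proof.
move=> /cvgrPdist_le h e0; have := h e e0.
by apply: filterS => y; rewrite distrC.
Qed.

Lemma ord2P (i : 'I_2) : i = 0 \/ i = 1.
Proof. by case: i => [[|[|//]] hi]; [left | right]; exact: val_inj. Qed.

Lemma Ck_fst n : C2k n (fun y : P => y.1).
Proof.
case: n => [|n]; first exact: fst_cont.
apply: (CkI (df := fun i _ => (dir i).1)) => [|i x|i].
- exact: fst_cont.
- exact: d_fst.
- exact: Ck_cst.
Qed.

Lemma Ck_snd n : C2k n (fun y : P => y.2).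
Proof.
case: n => [|n]; first exact: snd_cont.
apply: (CkI (df := fun i _ => (dir i).2)) => [|i x|i].
- exact: snd_cont.
- exact: d_snd.
- exact: Ck_cst.
Qed.

Lemma foldr_pder_rcons g s i : foldr (@pder R) g (rcons s i) = foldr (@pder R) (pder i g) s.
Proof. by rewrite foldr_rcons. Qed.

Lemma smoothP g : smooth g <-> forall n, C2k n g.
Proof.
split.
  move=> H n; elim: n g H => [|n IH] g H; first by have [] := H [::].
  split; first by have [] := H [::].
  move=> i; split; first by move=> x; have [_ ] := H [::]; exact.
  by apply: IH => s; have := H (rcons s i); rewrite foldr_pder_rcons.
move=> H s; have : forall n, C2k n (foldr (@pder R) g s).
  by elim: s => //= i s IH n; have [_ /(_ i)[]] := IH n.+1.
move=> {}H; split; first exact: (Ck_cont (H 0%N)).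
by move=> i x; have [_ /(_ i)[]] := H 1%N.
Qed.

(** A function with continuous partial derivatives is differentiable in every direction: join the two
    end points by a path parallel to the axes and apply the mean value inequality to each part. *)
Lemma d_C1 g (G : 'I_2 -> P -> R) x v :
  (\forall y \near x, forall i, is_derive y (dir i) g (G i y)) ->
  (forall i, {for x, continuous (G i)}) ->
  is_derive x v g (v.1 * G 0 x + v.2 * G 1 x).
Proof.
move=> Hd Hc; apply/derE => e e0.
pose c := `|v.1| + `|v.2| + 1.
have c0 : 0 < c by rewrite /c; have := normr_ge0 v.1; have := normr_ge0 v.2; lra.
have e10 : 0 < e / c by rewrite divr_gt0.
have near_i i := cont_near (Hc i) e10.
have [r /= r0 Hr] := (nbhs_ballP _ _).1 (filterI Hd (filterI (near_i 0) (near_i 1))).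
exists (r / c); split => [|h hr]; first by rewrite divr_gt0.
have hv (w : R) : `|w| <= c -> `|h * w| < r.
  move=> wc; rewrite normrM; move: hr; rewrite ltr_pdivlMr// => hr.
  by have := normr_ge0 h; nra.
have hv1 : `|h * v.1| < r by apply: hv; rewrite /c; have := normr_ge0 v.2; lra.
have hv2 : `|h * v.2| < r by apply: hv; rewrite /c; have := normr_ge0 v.1; lra.
have inb s t : `|s| <= `|h * v.1| -> `|t| <= `|h * v.2| -> ball x r (x.1 + s, x.2 + t).
  move=> hs ht; apply/ball2E; rewrite /= !opprD !addNKr !normrN.
  by split; [exact: le_lt_trans hv1 | exact: le_lt_trans hv2].
have A : `|g (x.1 + h * v.1, x.2 + h * v.2) - g (x.1 + 0, x.2 + h * v.2) - G 0 x * (h * v.1 - 0)|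
    <= e / c * `|h * v.1 - 0|.
  apply: (mvt_bound (f := fun s => g (x.1 + s, x.2 + h * v.2))
    (df := fun s => G 0 (x.1 + s, x.2 + h * v.2))) => t; rewrite !subr0 => ht.
    by apply: d_line0; have [] := Hr _ (inb _ _ ht (lexx _)).
  by have [_ []] := Hr _ (inb _ _ ht (lexx _)).
have B : `|g (x.1, x.2 + h * v.2) - g (x.1, x.2 + 0) - G 1 x * (h * v.2 - 0)|
    <= e / c * `|h * v.2 - 0|.
  have inb' t : `|t| <= `|h * v.2| -> ball x r (x.1, x.2 + t).
    by move=> ht; rewrite -[x.1]addr0; apply: inb; rewrite ?normr0.
  apply: (mvt_bound (f := fun s => g (x.1, x.2 + s))
    (df := fun s => G 1 (x.1, x.2 + s))) => t; rewrite !subr0 => ht.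
    by apply: d_line1; have [] := Hr _ (inb' _ ht).
  by have [_ []] := Hr _ (inb' _ ht).
rewrite !subr0 !addr0 in A B.
have -> : h *: v + x = (x.1 + h * v.1, x.2 + h * v.2) by rewrite addrC.
rewrite -surjective_pairing in B.
rewrite (_ : _ - _ - _ = (g (x.1 + h * v.1, x.2 + h * v.2) - g (x.1, x.2 + h * v.2) - G 0 x * (h * v.1))
  + (g (x.1, x.2 + h * v.2) - g x - G 1 x * (h * v.2))); last by ring.
apply: le_trans (ler_normD _ _) _; apply: le_trans (lerD A B) _.
rewrite -mulrDr !normrM -mulrDr mulrCA [leRHS]mulrC ler_wpM2l// mulrAC.
by rewrite ler_pdivrMr// ler_wpM2l ?(ltW e0)// /c; lra.
Qed.

(** The second difference of [g] over a small square is close to [h^2 * g01 x] and to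
    [h^2 * g10 x]. *)
Lemma schwarz_derive (g g0 g1 g01 g10 : P -> R) x :
  (forall y, is_derive y (dir 0) g (g0 y)) -> (forall y, is_derive y (dir 1) g (g1 y)) ->
  (forall y, is_derive y (dir 1) g0 (g01 y)) -> (forall y, is_derive y (dir 0) g1 (g10 y)) ->
  {for x, continuous g01} -> {for x, continuous g10} -> g01 x = g10 x.
Proof.
move=> D0 D1 D01 D10 cA cB; set A : R := LHS; set B : R := RHS.
apply/eqP; rewrite -subr_eq0 -normr_le0; apply/ler_addgt0Pl => e e0; rewrite addr0.
have e20 : 0 < e / 2 by rewrite divr_gt0.
have nA := cont_near cA e20.
have nB := cont_near cB e20.
have [r /= r0 Hr] := (nbhs_ballP _ _).1 (filterI nA nB).
pose h := r / 2; have h0 : 0 < h by rewrite divr_gt0.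
have hr : h < r by rewrite /h; lra.
have inb s t : `|s| <= h -> `|t| <= h -> ball x r (x.1 + s, x.2 + t).
  move=> hs ht; apply/ball2E; rewrite /= !opprD !addNKr !normrN.
  by split; apply: le_lt_trans hr.
pose f t := g (x.1 + t, x.2 + h) - g (x.1 + t, x.2 + 0).
pose f' t := g (x.1 + h, x.2 + t) - g (x.1 + 0, x.2 + t).
have hh : `|h - 0| = h by rewrite subr0 gtr0_norm.
have KA : `|f h - f 0 - (A * h) * (h - 0)| <= e / 2 * h * `|h - 0|.
  apply: (mvt_bound (df := fun t => g0 (x.1 + t, x.2 + h) - g0 (x.1 + t, x.2 + 0)));
    rewrite hh => t; rewrite subr0 => ht.
    by apply: dB; apply: (d_line0 (g := g)).
  have := @mvt_bound _ (fun s => g0 (x.1 + t, x.2 + s)) (fun s => g01 (x.1 + t, x.2 + s)) 0 h A (e / 2).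
  rewrite hh subr0; apply => s; rewrite subr0 => hs; first by apply: (d_line1 (g := g0)).
  exact: (Hr _ (inb _ _ ht hs)).1.
have KB : `|f' h - f' 0 - (B * h) * (h - 0)| <= e / 2 * h * `|h - 0|.
  apply: (mvt_bound (df := fun t => g1 (x.1 + h, x.2 + t) - g1 (x.1 + 0, x.2 + t)));
    rewrite hh => t; rewrite subr0 => ht.
    by apply: dB; apply: (d_line1 (g := g)).
  have := @mvt_bound _ (fun s => g1 (x.1 + s, x.2 + t)) (fun s => g10 (x.1 + s, x.2 + t)) 0 h B (e / 2).
  rewrite hh subr0; apply => s; rewrite subr0 => hs; first by apply: (d_line0 (g := g1)).
  exact: (Hr _ (inb _ _ hs ht)).2.
rewrite hh subr0 in KA KB.
have EF : f h - f 0 = f' h - f' 0 by rewrite /f /f'; ring.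
rewrite EF distrC in KA.
have := le_trans (ler_normD _ _) (lerD KA KB).
rewrite (_ : A * h * h - (f' h - f' 0) + (f' h - f' 0 - B * h * h) = (A - B) * (h * h)); last by ring.
rewrite (_ : e / 2 * h * h + e / 2 * h * h = e * (h * h)); last by field.
rewrite normrM [`|h * h|]gtr0_norm ?mulr_gt0//.
by rewrite ler_pM2r ?mulr_gt0.
Qed.

Lemma schwarz g x : C2k 2 g -> 'D_(dir 1) ('D_(dir 0) g) x = 'D_(dir 0) ('D_(dir 1) g) x.
Proof.
move=> Cg; have C1 i : C2k 1 ('D_(dir i) g) by have [_ /(_ i)[]] := Cg.
have C0 i j : continuous ('D_(dir j) ('D_(dir i) g)) by have [_ /(_ j)[]] := C1 i.
exact: (schwarz_derive (Ck_der Cg 0) (Ck_der Cg 1) (Ck_der (C1 0) 1) (Ck_der (C1 1) 0) (C0 _ _ x) (C0 _ _ x)).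
Qed.

Lemma Ck_bounded g M : continuous g -> exists C, 0 <= C /\ forall x, box 0 M x -> `|g x| <= C.
Proof.
move=> cg; have cK : compact (box (0 : P) M).
  by apply: compact_setX; exact: segment_compact.
have /compact_bounded [C [_ HC]] : compact (g @` box 0 M).
  by apply: continuous_compact => //; apply: continuous_subspaceT.
exists (`|C| + 1); split=> [|x bx]; first by rewrite addr_ge0.
by apply: (HC (`|C| + 1)); [rewrite ltr_pwDr// ler_norm | exists x].
Qed.

Lemma test_pder Omega phi i : test_function Omega phi -> test_function Omega (pder i phi).
Proof.
move=> [/smoothP sp [K [cK KO phi0]]]; split.
  by apply/smoothP => n; have [_ /(_ i)[]] := sp n.+1.
exists K; split => // x Kx; rewrite /pder.
have clK : closed K by apply: compact_closed => //; exact: norm_hausdorff.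
have : is_derive x (dir i) phi 0.
  apply: (@d_near _ _ (fun=> 0) _ _ _ _ _ (dC 0 x (dir i))).
  have : nbhs x (~` K) by apply: open_nbhs_nbhs; split => //; exact: closed_openC.
  by apply: filterS => y /phi0.
by move=> [_ ->].
Qed.

Lemma test_foldr Omega phi s : test_function Omega phi ->
  test_function Omega (foldr (@pder R) phi s).
Proof. by move=> H; elim: s => //= i s; exact: test_pder. Qed.

Lemma test_support Omega phi : test_function Omega phi ->
  exists M, 0 <= M /\ forall x, ~ box 0 M x -> phi x = 0.
Proof.
move=> [_ [K [/compact_bounded[M [_ HM]] _ phi0]]].
exists (`|M| + 1); split; first by rewrite addr_ge0.
move=> x nx; apply: phi0 => Kx; apply: nx; apply/boxP; rewrite subr0.
by apply: (HM (`|M| + 1)); [rewrite ltr_pwDr// ler_norm |].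
Qed.

Lemma test_bounded Omega phi : test_function Omega phi ->
  exists C, 0 <= C /\ forall x, `|phi x| <= C.
Proof.
move=> tp; have [M [M0 HM]] := test_support tp.
have [C [C0 HC]] := Ck_bounded M (Ck_cont ((smoothP _).1 tp.1 0%N)).
exists C; split => // x; have [bx|bx] := pselect (box 0 M x); first exact: HC.
by rewrite HM// normr0.
Qed.

Lemma test_cont Omega phi : test_function Omega phi -> continuous phi.
Proof. by move=> [/smoothP sp _]; exact: (Ck_cont (sp 0%N)). Qed.

Lemma test_der Omega phi i x : test_function Omega phi -> is_derive x (dir i) phi (pder i phi x).
Proof. by move=> [/smoothP sp _]; exact: (Ck_der (sp 1%N)). Qed.

Lemma intg_test Omega phi : test_function Omega phi -> intg phi.
Proof.
move=> tp; have [M [M0 HM]] := test_support tp; have [C [C0 HC]] := test_bounded tp.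
by apply: intg_bdd HC HM; apply: continuous_mfun; exact: test_cont tp.
Qed.

(** The difference quotients of [F] have integral [0], by translation invariance, and are
    dominated by [C] on a fixed square, so that dominated convergence applies. *)
Lemma Int_derive0 (F G : P -> R) v M C C' : 0 <= C ->
  (forall x, is_derive x v F (G x)) -> mfun2 F -> mfun2 G ->
  (forall x, `|G x| <= C) -> (forall x, `|F x| <= C') ->
  (forall x, ~ box 0 M x -> F x = 0) -> (forall x, ~ box 0 M x -> G x = 0) ->
  intg G /\ Int G = 0.
Proof.
move=> C0 FG mF mG GC FC F0 G0.
have IF : intg F by exact: intg_bdd FC F0.
pose h n : R := n.+1%:R^-1.
have h0 n : 0 < h n by rewrite invr_gt0.
have h1 n : h n <= 1 by rewrite invf_le1// ler1n.
pose q n x := (h n)^-1 * (F (x + h n *: v) - F x).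
have Iq n : intg (q n) by apply: intgZ; apply: intgB => //; exact: intg_shift.
have q0 n : Int (q n) = 0.
  rewrite IntZ; last by apply: intgB => //; exact: intg_shift.
  by rewrite IntB ?Int_shift ?subrr ?mulr0//; exact: intg_shift.
have [||||IG] := @dct R q G (fun x => C * \1_(box 0 (M + `|v|)) x).
- by move=> n; exact: intg_mfun.
- by apply: intgZ; exact: intg_box.
- move=> n x; rewrite indicE; case: (boolP (x \in _)) => [bx|/negP nx].
    rewrite mulr1 /q normrM (gtr0_norm (_ : 0 < (h n)^-1)) ?invr_gt0// ler_pdivrMl//.
    have := @mvt_bound _ (fun t => F (x + t *: v)) (fun t => G (x + t *: v)) 0 (h n) 0 C.
    rewrite scale0r addr0 mul0r !subr0 (gtr0_norm (h0 n)) [C * _]mulrC; apply => t _.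
      exact: (d_line _ _ _ _ _).1 (FG _).
    by rewrite subr0.
  rewrite mulr0 /q !F0 ?subrr ?mulr0 ?normr0//.
    move=> /boxP bx; apply: nx; rewrite inE; apply/boxP; rewrite !subr0 in bx *.
    by rewrite (le_trans bx)// lerDl.
  move=> /boxP bx; apply: nx; rewrite inE; apply/boxP; rewrite !subr0 in bx *.
  rewrite -[x](addrK (h n *: v)); apply: le_trans (ler_normB _ _) _.
  by rewrite lerD// normrZ (gtr0_norm (h0 n)) ler_piMl.
- move=> x; apply/cvgrPdist_le => e e0.
  have [d [d0 hd]] := (derE _ _ _ _).1 (FG x) _ e0.
  near=> n; have hn : h n < d by near: n; exact: near_infty_natSinv_lt (PosNum d0).
  have := hd (h n); rewrite (gtr0_norm (h0 n)) => /(_ hn).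
  rewrite [h n *: v + x]addrC /q => H.
  rewrite -(@ler_pM2l _ (h n))// -[X in X * _ <= _](gtr0_norm (h0 n)) -normrM mulrBr.
  by rewrite mulVKf ?gt_eqF// distrC [leRHS]mulrC.
split => //; apply: (@cvg_unique _ _ (Int (q n) @[n --> \oo])) => //.
rewrite /= (_ : (fun n => Int (q n)) = fun=> 0); first exact: cvg_cst.
by apply/funext.
Unshelve. all: by end_near.
Qed.

Lemma Int_test0 Omega phi i : test_function Omega phi -> Int (pder i phi) = 0.
Proof.
move=> tp; have [M [M0 HM]] := test_support tp; have [C [C0 HC]] := test_bounded tp.
have tp' := test_pder i tp.
have [M' [M'0 HM']] := test_support tp'; have [C' [C'0 HC']] := test_bounded tp'.
have [] // := @Int_derive0 phi (pder i phi) (dir i) (M + M') C' C.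
- by move=> x; exact: test_der tp.
- by apply: continuous_mfun; exact: test_cont tp.
- by apply: continuous_mfun; exact: test_cont tp'.
- by move=> x bx; apply: HM => /boxP h; apply: bx; apply/boxP; rewrite (le_trans h)// lerDl.
- by move=> x bx; apply: HM' => /boxP h; apply: bx; apply/boxP; rewrite (le_trans h)// lerDr.
Qed.

Lemma testM Omega phi g : test_function Omega phi -> smooth g ->
  test_function Omega (fun x => g x * phi x).
Proof.
move=> [/smoothP sp [K [cK KO p0]]] /smoothP sg; split.
  by apply/smoothP => n; exact: CkM.
by exists K; split => // x /p0 ->; rewrite mulr0.
Qed.

Lemma testD Omega phi g : test_function Omega phi -> test_function Omega g ->
  test_function Omega (fun x => phi x + g x).
Proof.
move=> [/smoothP sp [K [cK KO p0]]] [/smoothP sg [K' [cK' K'O g0]]]; split.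
  by apply/smoothP => n; exact: CkD.
exists (K `|` K'); split; first exact: compactU.
- by move=> x [/KO|/K'O].
- by move=> x /not_orP[/p0 -> /g0 ->]; rewrite addr0.
Qed.

Lemma smooth_cst (c : R) : smooth (fun=> c : R).
Proof. by apply/smoothP => n; exact: Ck_cst. Qed.

Lemma testZ Omega phi (c : R) : test_function Omega phi ->
  test_function Omega (fun x => c * phi x).
Proof. by move=> tp; apply: (testM tp); exact: smooth_cst. Qed.

Lemma pderM i phi g x : smooth phi -> smooth g ->
  pder i (fun y => phi y * g y) x = phi x * pder i g x + g x * pder i phi x.
Proof.
move=> /smoothP sp /smoothP sg.
by have [_] := dM (Ck_der (sp 1%N) i x) (Ck_der (sg 1%N) i x).
Qed.

Lemma pderD i phi g x : smooth phi -> smooth g ->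
  pder i (fun y => phi y + g y) x = pder i phi x + pder i g x.
Proof.
move=> /smoothP sp /smoothP sg.
by have [_] := dD (Ck_der (sp 1%N) i x) (Ck_der (sg 1%N) i x).
Qed.

Lemma pderZ i (c : R) phi x : smooth phi -> pder i (fun y => c * phi y) x = c * pder i phi x.
Proof. by move=> /smoothP sp; have [_] := dZ c (Ck_der (sp 1%N) i x). Qed.

Lemma pderC i j phi : smooth phi -> pder i (pder j phi) = pder j (pder i phi).
Proof.
move=> /smoothP sp.
have key : pder 1 (pder 0 phi) = pder 0 (pder 1 phi).
  by apply/funext => x; exact: schwarz.
case: (ord2P i) => ->; case: (ord2P j) => ->; [exact: erefl | exact: esym key | exact: key | exact: erefl].
Qed.

Lemma int_by_parts Omega phi g i : test_function Omega phi -> smooth g ->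
  Int (fun x => phi x * pder i g x) = - Int (fun x => pder i phi x * g x).
Proof.
move=> tp sg; have := Int_test0 i (testM tp sg).
have tp' := test_pder i tp; have sg' : smooth (pder i g).
  by apply/smoothP => n; have [_ /(_ i)[]] := ((smoothP _).1 sg) n.+1.
rewrite (_ : pder i _ = fun x => g x * pder i phi x + pder i g x * phi x).
  rewrite (IntD (intg_test (testM tp' sg)) (intg_test (testM tp sg'))).
  move/eqP; rewrite addrC addr_eq0 => /eqP h.
  rewrite (_ : (fun x => phi x * _) = fun x => pder i g x * phi x); last first.
    by apply/funext => x; exact: mulrC.
  by rewrite h; congr (- Int _); apply/funext => x; exact: mulrC.
apply/funext => x; rewrite (pderM i x sg tp.1); congr (_ + _).
exact: mulrC.
Qed.

End PlaneCalculus.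

(** * The fundamental lemma of the calculus of variations *)

Section DuBoisReymond.
Context {R : realType}.
Local Notation P := (R * R)%type.
Local Notation MP := (measurableTypeR R * measurableTypeR R)%type.
Local Notation mu := (@leb2 R).
Implicit Types (f g h : P -> R) (A B : set P).

Lemma intg_indicM f A : intg f -> mset2 A -> intg (fun x => f x * \1_A x).
Proof.
move=> If mA; apply: (intg_le _ (intg_norm If)).
  by apply: mfunM; [exact: intg_mfun | exact: mfun_indic].
move=> x; rewrite normrM indicE; case: (_ \in _); first by rewrite normr1 mulr1.
by rewrite normr0 mulr0.
Qed.

Lemma indicC A x : \1_(~` A) x = 1 - \1_A x :> R.
Proof.
rewrite !indicE in_setC; case: (x \in A); first by rewrite subrr.
by rewrite subr0.
Qed.

(** The pi-lambda theorem for the signed measure with density [f]. *)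
Lemma dynkin_Int (T : Type) (p : P -> T) (G : set (set T)) f : intg f -> Int f = 0 ->
  setI_closed G ->
  (forall A : set T, G A -> mset2 (p @^-1` A) /\ Int (fun x => f x * \1_(p @^-1` A) x) = 0) ->
  forall A : set T, <<s G >> A -> mset2 (p @^-1` A) /\ Int (fun x => f x * \1_(p @^-1` A) x) = 0.
Proof.
move=> If f0 GI HG A; rewrite -(setI_closed_g_dynkin_g_sigma_algebra GI).
apply: (@smallest_sub _ _ _ (fun A : set T => mset2 (p @^-1` A) /\ Int (fun x => f x * \1_(p @^-1` A) x) = 0)) => //.
split.
- split; first by rewrite preimage_setT; exact: measurableT.
  rewrite preimage_setT -[RHS]f0; congr Int; apply/funext => x.
  by rewrite indicE in_setT mulr1.
- move=> B [mB B0]; split; first by rewrite preimage_setC; exact: measurableC.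
  rewrite preimage_setC.
  rewrite (_ : (fun x => _) = fun x => f x - f x * \1_(p @^-1` B) x).
    by rewrite IntB// ?B0 ?f0 ?subrr//; exact: intg_indicM.
  by apply/funext => x; rewrite indicC mulrBr mulr1.
- move=> F tF HF; have mU : mset2 (p @^-1` (\bigcup_k F k)).
    by rewrite preimage_bigcup; apply: bigcupT_measurable => k; have [] := HF k.
  split => //.
  pose S n x := \sum_(k < n) f x * \1_(p @^-1` F k) x.
  have IS n : intg (S n).
    by apply: intg_sum => k; apply: intg_indicM => //; have [] := HF k.
  have S0 n : Int (S n) = 0.
    rewrite Int_sum => [|k]; last by apply: intg_indicM => //; have [] := HF k.
    by apply: big1 => k _; have [] := HF k.
  have SE n x : S n x = if `[< exists2 k, (k < n)%N & F k (p x) >] then f x else 0.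
    rewrite /S; case: asboolP => [[k kn Fk]|nF]; last first.
      apply: big1 => k _; rewrite indicE memNset ?mulr0// => Fk.
      by apply: nF; exists k.
    rewrite (bigD1 (Ordinal kn))//= indicE mem_set// mulr1 big1 ?addr0// => j jk.
    rewrite indicE memNset ?mulr0// => Fj; move/eqP: jk; apply; apply: val_inj => /=.
    by apply: (tF _ _ I I); exists (p x).
  have [||||_ lim] := @dct R S (fun x => f x * \1_(p @^-1` (\bigcup_k F k)) x) (fun x => `|f x|).
  - by move=> n; exact: intg_mfun.
  - exact: intg_norm.
  - by move=> n x; rewrite SE; case: asboolP => // _; rewrite normr0.
  - move=> x; rewrite indicE; case: (boolP (x \in _)) => [|/negP xF]; rewrite ?inE.
      move=> [k _ Fk]; rewrite mulr1; apply: cvg_near_cst; exists k.+1 => // n /= kn.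
      by rewrite SE; case: asboolP => // -[]; exists k.
    rewrite mulr0; apply: cvg_near_cst; apply: nearW => n; rewrite SE.
    by case: asboolP => // -[k _ Fk]; exfalso; apply: xF; rewrite inE; exists k.
  apply: (@cvg_unique _ _ (Int (S n) @[n --> \oo])) => //=.
  rewrite (_ : (fun n => Int (S n)) = fun=> 0); first exact: cvg_cst.
  by apply/funext.
Qed.

Definition rect (a b c d : R) : set P := `]a, b[%classic `*` `]c, d[%classic.

Lemma mset_fst (A : set R) : @measurable _ (measurableTypeR R) A -> mset2 (fst @^-1` A).
Proof.
move=> mA; rewrite (_ : _ @^-1` _ = A `*` setT); first exact: measurableX.
by apply/seteqP; split => x /=; [|case].
Qed.
Lemma mset_snd (A : set R) : @measurable _ (measurableTypeR R) A -> mset2 (snd @^-1` A).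
Proof.
move=> mA; rewrite (_ : _ @^-1` _ = setT `*` A); first exact: measurableX.
by apply/seteqP; split => x /=; [|case].
Qed.

Lemma indicI2 A B x : \1_A x * \1_B x = \1_(A `&` B) x :> R.
Proof. by rewrite !indicE in_setI; case: (_ \in A); rewrite ?mul1r ?mul0r. Qed.

Lemma itvooI (a b c d : R) : `]a, b[%classic `&` `]c, d[%classic = `]Num.max a c, Num.min b d[%classic.
Proof.
apply/seteqP; split => x /=; rewrite !in_itv/= gt_max lt_min.
  by move=> [/andP[-> ->] /andP[-> ->]].
by move=> /andP[/andP[-> ->] /andP[-> ->]].
Qed.

(** The pi-lambda theorem, applied to each coordinate in turn, carries the hypothesis from open
    intervals to Borel sets and hence to the sets where [f] is positive or negative. *)
Lemma rect_ae0 f a0 b0 c0 d0 : intg f -> (forall x, ~ rect a0 b0 c0 d0 x -> f x = 0) ->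
  (forall a b c d, Int (fun x => f x * \1_(rect a b c d) x) = 0) ->
  ae2 (fun x => f x = 0).
Proof.
move=> If fs H.
pose G := [set A : set R | exists x y, A = `]x, y[%classic].
have GI : setI_closed G.
  by move=> _ _ [a [b ->]] [c [d ->]]; rewrite itvooI; eexists; eexists.
have mG (A : set R) : G A -> @measurable _ (measurableTypeR R) A by move=> [a [b ->]]; exact: measurable_itv.
have sG : @measurable _ (measurableTypeR R) = <<s G >> by exact: (RGenOpens.measurableE R).
have f1 (C : set P) x : (rect a0 b0 c0 d0 x -> C x) -> f x * \1_C x = f x.
  move=> h; have [/h Cx|rx] := pselect (rect a0 b0 c0 d0 x); first by rewrite indicE mem_set// mulr1.
  by rewrite fs// mul0r.
have f0 : Int f = 0.
  by rewrite -(H a0 b0 c0 d0); congr Int; apply/funext => x; rewrite f1.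
have step1 c d (A : set R) : @measurable _ (measurableTypeR R) A ->
    Int (fun x => f x * \1_(A `*` `]c, d[%classic) x) = 0.
  move=> mA; have mJ : mset2 (snd @^-1` `]c, d[%classic) by apply: mset_snd; exact: measurable_itv.
  have [||||_] := @dynkin_Int _ fst G (fun x => f x * \1_(snd @^-1` `]c, d[%classic) x) _ _ GI _ A.
  - exact: intg_indicM.
  - rewrite -[RHS](H a0 b0 c d); congr Int; apply/funext => x.
    have [rx|rx] := pselect (rect a0 b0 c0 d0 x); last by rewrite fs// !mul0r.
    congr (_ * _); rewrite !indicE; congr (_%:R); congr nat_of_bool.
    apply/idP/idP; rewrite !inE; first by move=> h; split => //; case: rx.
    by case.
  - move=> _ [a [b ->]]; split; first by apply: mset_fst; exact: measurable_itv.
    rewrite -[RHS](H a b c d); congr Int; apply/funext => x.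
    by rewrite -mulrA indicI2 setIC.
  - by rewrite -sG.
  move=> h; rewrite -[RHS]h; congr Int; apply/funext => x.
  by rewrite -mulrA indicI2 setIC.
have step2 (A B : set R) : @measurable _ (measurableTypeR R) A -> @measurable _ (measurableTypeR R) B ->
    Int (fun x => f x * \1_(A `*` B) x) = 0.
  move=> mA mB; have mfA := mset_fst mA.
  have [||||_] := @dynkin_Int _ snd G (fun x => f x * \1_(fst @^-1` A) x) _ _ GI _ B.
  - exact: intg_indicM.
  - rewrite -[RHS](step1 c0 d0 A mA); congr Int; apply/funext => x.
    have [rx|rx] := pselect (rect a0 b0 c0 d0 x); last by rewrite fs// !mul0r.
    congr (_ * _); rewrite !indicE; congr (_%:R); congr nat_of_bool.
    apply/idP/idP; rewrite !inE; first by move=> h; split => //; case: rx.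
    by case.
  - move=> _ [c [d ->]]; split; first by apply: mset_snd; exact: measurable_itv.
    rewrite -[RHS](step1 c d A mA); congr Int; apply/funext => x.
    by rewrite -mulrA indicI2.
  - by rewrite -sG.
  move=> h; rewrite -[RHS]h; congr Int; apply/funext => x.
  by rewrite -mulrA indicI2.
pose G2 := [set A `*` B | A in @measurable _ (measurableTypeR R) & B in @measurable _ (measurableTypeR R)].
have step3 X : mset2 X -> Int (fun x => f x * \1_X x) = 0.
  move=> mX; have [|||_] // := @dynkin_Int _ id G2 f If f0 _ _ X.
  - move=> _ _ [A mA [B mB <-]] [A' mA' [B' mB' <-]]; exists (A `&` A'); first exact: measurableI.
    exists (B `&` B'); first exact: measurableI.
    by apply/seteqP; split => x /=; [move=> [[? ?] [? ?]] | move=> [[? ?] [? ?]]].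
  - by move=> _ [A mA [B mB <-]]; split; [exact: measurableX | exact: step2].
  - by move: mX; rewrite /mset2 measurable_prod_measurableType.
have mf := intg_mfun If.
pose A := [set x | 0 <= f x].
have mA : mset2 A.
  have := mf measurableT `[0, +oo[%classic (measurable_itv _); rewrite setTI.
  by congr mset2; apply/seteqP; split => x /=; rewrite in_itv/= andbT.
have : Int (fun x => `|f x|) = 0.
  rewrite (_ : (fun x => _) = fun x => f x * \1_A x - f x * \1_(~` A) x).
    rewrite IntB; try by apply: intg_indicM => //; exact: measurableC.
    by rewrite !step3 ?subrr//; exact: measurableC.
  apply/funext => x; rewrite indicC indicE.
  case: (boolP (x \in A)) => [|/negP]; rewrite inE /A/=; first by move=> h; rewrite ger0_norm// subrr; ring.
  by move/negP; rewrite -ltNge => h; rewrite ltr0_norm// ; ring.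
move/(Int_eq0_ae (intg_norm If) (fun x => normr_ge0 (f x))).
by apply: ae2S => x /eqP; rewrite normr_eq0 => /eqP.
Qed.

Lemma rat_cover A x : open A -> A x -> exists q : rat * rat * nat,
  let z : P := (ratr q.1.1, ratr q.1.2) in
  rect (z.1 - q.2.+1%:R^-1) (z.1 + q.2.+1%:R^-1) (z.2 - q.2.+1%:R^-1) (z.2 + q.2.+1%:R^-1) x
  /\ box z q.2.+1%:R^-1 `<=` A.
Proof.
move=> oA Ax.
have /nbhs_ballP[e /= e0 xe] : nbhs x A by apply: open_nbhs_nbhs.
have [n n1] : exists n : nat, n.+1%:R^-1 < e / 2.
  have e20 : 0 < e / 2 by rewrite divr_gt0.
  exists (Num.truncn (e / 2)^-1).
  rewrite -[ltRHS]invrK ltf_pV2 ?posrE ?invr_gt0//.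
  exact: truncnS_gt.
have n0 : (0 : R) < n.+1%:R^-1 by rewrite invr_gt0.
have rat_near (y : R) : exists q : rat, ratr q - n.+1%:R^-1 < y < ratr q + n.+1%:R^-1.
  have [|q] := @rat_in_itvoo R (y - n.+1%:R^-1) (y + n.+1%:R^-1).
    by rewrite ltrD2l gtrN.
  rewrite in_itv/= => /andP[q1 q2]; exists q.
  by rewrite ltrBlDr q2 -ltrBlDr q1.
have [q1 hq1] := rat_near x.1; have [q2 hq2] := rat_near x.2.
exists (q1, q2, n) => /=; split; first by split; rewrite /= in_itv.
move=> y /boxE[/= y1 y2]; apply: xe; apply/ball2E; move: hq1 hq2 y1 y2 n1.
set d := n.+1%:R^-1; rewrite !ler_distl => /andP[h1 h2] /andP[h3 h4] /andP[h5 h6] /andP[h7 h8] n1.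
by split; rewrite ltr_distl; apply/andP; split; lra.
Qed.

Lemma ae2_countable (T : countType) (Q : T -> P -> Prop) : (forall q, ae2 (Q q)) ->
  ae2 (fun x => forall q, Q q x).
Proof.
move=> H; have : ae2 (fun x => forall n, if unpickle n is Some q then Q q x else True).
  have /choice[N HN] : forall n, exists N : set P, [/\ mset2 N, mu N = 0%E &
      forall x, ~ N x -> if unpickle n is Some q then Q q x else True].
    move=> n; case: (unpickle n) => [q|]; first exact: ae_null.
    by exists set0; split => //; exact: measurable0.
  have mU : mset2 (\bigcup_n N n) by apply: bigcupT_measurable => n; have [] := HN n.
  have U0 : mu (\bigcup_n N n) = 0%E.
    have mN n : measurable (N n : set MP) by have [] := HN n.
    have := @measure_sigma_subadditive _ R MP mu _ N mN mU (@subset_refl _ _).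
    rewrite eseries0 ?measure_le0; first by move/eqP.
    by move=> n _ _; have [] := HN n.
  apply: ae2S (null_ae mU U0) => x Nx n; have [_ _] := HN n; apply.
  by move=> h; apply: Nx; exists n.
by apply: ae2S => x h q; have := h (pickle q); rewrite pickleK.
Qed.

Lemma step_scale (M : R -> R) : (forall t, t < 4^-1 -> M t = 0) ->
  (forall t, 1 <= t -> M t = 1) -> forall t : R,
  M (n.+1%:R * t) @[n --> \oo] --> (if (0:R) < t then (1:R) else (0:R)).
Proof.
move=> M0 M1 t; apply: cvg_near_cst; case: ifPn => [t0|]; last first.
  rewrite -leNgt => t0; apply: nearW => n; apply: M0.
  by rewrite (le_lt_trans (mulr_ge0_le0 _ _))// invr_gt0.
exists (Num.truncn t^-1) => // n /= hn; apply: M1.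
rewrite -ler_pdivrMr// mul1r ltW// (lt_le_trans (truncnS_gt _))// ler_nat ltnS; exact: hn.
Qed.

Definition crect (a b c d : R) : set P := `[a, b]%classic `*` `[c, d]%classic.

(** Products of steps of width [1 / n] near the sides of the rectangle. *)
Lemma rect_test Omega a b c d : crect a b c d `<=` Omega ->
  exists phi : nat -> P -> R,
    [/\ forall n, test_function Omega (phi n), forall n x, 0 <= phi n x <= 1,
        forall n x, ~ crect a b c d x -> phi n x = 0 &
        forall x, phi n x @[n --> \oo] --> (\1_(rect a b c d) x : R)].
Proof.
move=> cO; have [m [M [_ CM dM [m0 _] [M0 M1]]]] := @smooth_step R.
have M01 t : 0 <= M t <= 1.
  have mono := d_nondecr dM m0.
  apply/andP; split.
    have [|h] := leP 0 t; last by rewrite M0// (lt_trans h)// invr_gt0.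
    by move=> t0; rewrite -(M0 0) ?invr_gt0// mono.
  have [h|h] := leP 1 t; first by rewrite M1.
  by rewrite -(M1 1)// mono// ltW.
pose phi n (x : P) := M (n.+1%:R * (x.1 - a)) * M (n.+1%:R * (b - x.1)) *
  (M (n.+1%:R * (x.2 - c)) * M (n.+1%:R * (d - x.2))).
have Mneg n t : t <= 0 -> M (n.+1%:R * t) = 0.
  by move=> t0; apply: M0; rewrite (le_lt_trans (mulr_ge0_le0 _ _))// invr_gt0.
have phi0 n x : ~ crect a b c d x -> phi n x = 0.
  move=> nx; rewrite /phi.
  have [h1|h1] := leP x.1 a; first by rewrite Mneg ?mul0r ?subr_le0.
  have [h2|h2] := leP b x.1; first by rewrite [M (_ * (b - _))]Mneg ?mulr0 ?mul0r ?subr_le0.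
  have [h3|h3] := leP x.2 c; first by rewrite [M (_ * (x.2 - c))]Mneg ?mul0r ?mulr0 ?subr_le0.
  have [h4|h4] := leP d x.2; first by rewrite [M (_ * (d - _))]Mneg ?mulr0 ?mul0r ?subr_le0.
  by exfalso; apply: nx; split; rewrite /= in_itv/= !ltW.
exists phi; split.
- move=> n; split; last first.
    exists (crect a b c d); split => //; last exact: phi0.
    by apply: compact_setX; exact: segment_compact.
  apply/smoothP => k; apply: CkM; apply: CkM; apply: Ck_comp; try exact: CM;
    apply: CkZ; apply: CkB; try exact: Ck_cst; try exact: Ck_fst; exact: Ck_snd.
- move=> n x; rewrite /phi.
  have /andP[h1 h1'] := M01 (n.+1%:R * (x.1 - a)); have /andP[h2 h2'] := M01 (n.+1%:R * (b - x.1)).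
  have /andP[h3 h3'] := M01 (n.+1%:R * (x.2 - c)); have /andP[h4 h4'] := M01 (n.+1%:R * (d - x.2)).
  by rewrite !mulr_ge0//= mulr_ile1 ?mulr_ge0// mulr_ile1.
- exact: phi0.
- move=> x; have S t := step_scale M0 M1 t.
  have := cvgM (cvgM (S (x.1 - a)) (S (b - x.1))) (cvgM (S (x.2 - c)) (S (d - x.2))).
  rewrite (_ : _ * _ * (_ * _) = \1_(rect a b c d) x); first exact.
  rewrite indicE !subr_gt0; case: (boolP (x \in rect a b c d)); rewrite ?inE.
    by move=> [/=]; rewrite !in_itv/= => /andP[-> ->] /andP[-> ->]; rewrite !mulr1.
  move=> /negP nx; apply/eqP; rewrite -(inj_eq (@mulrI _ 1 _)) ?unitr1// !mul1r.
  have : ~~ [&& a < x.1, x.1 < b, c < x.2 & x.2 < d].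
    apply/negP => /and4P[h1 h2 h3 h4]; apply: nx; rewrite inE; split; rewrite /= in_itv/=; exact/andP.
  by case: (a < x.1); case: (x.1 < b); case: (c < x.2); case: (x.2 < d) => //= _; rewrite ?mulr0 ?mul0r ?mulr0.
Qed.

(** Functions on [Omega] are handled through their extension [_ \_ Omega] by zero, which turns
    [L2] and [dot] into integrals over the plane. *)
Variable Omega : set P.
Hypothesis oO : open Omega.

Lemma L2P g : L2 Omega g <-> sqi (g \_ Omega).
Proof.
split.
  move=> h; have := Lfun2_integrable_sqr h; move: h; rewrite /L2 inE => /andP[+ _] => h.
  by move: h; rewrite inE => h Ih; split.
move=> [mg Ig]; rewrite /L2 inE; apply/andP; split; first by rewrite inE.
rewrite inE /= /finite_norm unlock.
apply: poweR_lty.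
have /integrableP[_] := Ig; apply: le_lt_trans.
rewrite le_eqVlt; apply/orP; left; apply/eqP; apply: eq_integral => x _ /=.
by rewrite powR_mulrn// normrX.
Qed.

Lemma dotE g h : dot Omega g h = Int (fun x => (g \_ Omega) x * h x).
Proof.
rewrite /dot Rintegral_mkcond; congr Int; apply/funext => x.
by rewrite !patchE; case: ifP => // _; rewrite mul0r.
Qed.

Lemma dotC g h : dot Omega g h = dot Omega h g.
Proof. by rewrite /dot; congr fine; apply: eq_integral => x _; rewrite mulrC. Qed.

Lemma dotEip g h : dot Omega g h = ip (g \_ Omega) (h \_ Omega).
Proof.
rewrite dotE; congr Int; apply/funext => x; rewrite !patchE.
by case: ifP => // _; rewrite !mul0r.
Qed.

Lemma patchD g h : (fun x => g x + h x) \_ Omega = fun x => (g \_ Omega) x + (h \_ Omega) x.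
Proof. by apply/funext => x; rewrite !patchE; case: ifP => // _; rewrite addr0. Qed.
Lemma patchZ (c : R) g : (fun x => c * g x) \_ Omega = fun x => c * (g \_ Omega) x.
Proof. by apply/funext => x; rewrite !patchE; case: ifP => // _; rewrite mulr0. Qed.

Lemma L2D g h : L2 Omega g -> L2 Omega h -> L2 Omega (fun x => g x + h x).
Proof. by move=> /L2P sg /L2P sh; apply/L2P; rewrite patchD; exact: sqiD. Qed.
Lemma L2Z c g : L2 Omega g -> L2 Omega (fun x => c * g x).
Proof. by move=> /L2P sg; apply/L2P; rewrite patchZ; exact: sqiZ. Qed.
Lemma L2N g : L2 Omega g -> L2 Omega (fun x => - g x).
Proof. by move=> /(L2Z (-1)); under eq_fun do rewrite mulN1r. Qed.
Lemma L2B g h : L2 Omega g -> L2 Omega h -> L2 Omega (fun x => g x - h x).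
Proof. by move=> lg /L2N; exact: L2D. Qed.
Lemma dotDl g1 g2 h : L2 Omega g1 -> L2 Omega g2 -> L2 Omega h ->
  dot Omega (fun x => g1 x + g2 x) h = dot Omega g1 h + dot Omega g2 h.
Proof. by move=> /L2P s1 /L2P s2 /L2P s; rewrite !dotEip patchD ipDl. Qed.
Lemma dotZl c g h : L2 Omega g -> L2 Omega h ->
  dot Omega (fun x => c * g x) h = c * dot Omega g h.
Proof. by move=> /L2P s1 /L2P s; rewrite !dotEip patchZ ipZl. Qed.
Lemma dotNl g h : L2 Omega g -> L2 Omega h ->
  dot Omega (fun x => - g x) h = - dot Omega g h.
Proof.
move=> lg lh; rewrite (_ : (fun x => _) = fun x => -1 * g x) ?dotZl ?mulN1r//.
by apply/funext => x; rewrite mulN1r.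
Qed.
Lemma dotBl g1 g2 h : L2 Omega g1 -> L2 Omega g2 -> L2 Omega h ->
  dot Omega (fun x => g1 x - g2 x) h = dot Omega g1 h - dot Omega g2 h.
Proof. by move=> l1 l2 l; rewrite dotDl ?dotNl//; exact: L2N. Qed.
Lemma dotDr g h1 h2 : L2 Omega g -> L2 Omega h1 -> L2 Omega h2 ->
  dot Omega g (fun x => h1 x + h2 x) = dot Omega g h1 + dot Omega g h2.
Proof. by move=> ? ? ?; rewrite dotC dotDl// !(dotC g). Qed.
Lemma dotZr c g h : L2 Omega g -> L2 Omega h ->
  dot Omega g (fun x => c * h x) = c * dot Omega g h.
Proof. by move=> ? ?; rewrite dotC dotZl// dotC. Qed.
Lemma dotBr g h1 h2 : L2 Omega g -> L2 Omega h1 -> L2 Omega h2 ->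
  dot Omega g (fun x => h1 x - h2 x) = dot Omega g h1 - dot Omega g h2.
Proof. by move=> ? ? ?; rewrite dotC dotBl// !(dotC g). Qed.
Lemma dot_ge0 g : 0 <= dot Omega g g.
Proof. by rewrite dotEip ip_ge0. Qed.
Lemma dot_CS g h : L2 Omega g -> L2 Omega h ->
  dot Omega g h ^+ 2 <= dot Omega g g * dot Omega h h.
Proof. by move=> /L2P sg /L2P sh; rewrite !dotEip ip_CS. Qed.

Lemma dot_ae g h k : L2 Omega g -> L2 Omega h -> mfun2 (k \_ Omega) ->
  ae2 (fun x => Omega x -> g x = h x) -> dot Omega g k = dot Omega h k.
Proof.
move=> /L2P[mg _] /L2P[mh _] mk gh; rewrite !dotEip; apply: ae_eq_Int; try exact: mfunM.
apply: ae2S gh => x gh; rewrite !patchE; case: ifPn => //; rewrite inE => Ox.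
by rewrite gh.
Qed.

Lemma mfun_Omega f : continuous f -> mfun2 (f \_ Omega).
Proof. by move=> cf; apply: mfun_open => // x _; exact: cf. Qed.

Lemma L2_test phi : test_function Omega phi -> L2 Omega phi.
Proof.
move=> tp; apply/L2P; have [M [M0 HM]] := test_support tp; have [C [C0 HC]] := test_bounded tp.
have -> : phi \_ Omega = phi.
  apply/funext => x; rewrite patchE; case: ifPn => // nx.
  case: tp => _ [K [_ KO K0]]; rewrite [RHS]K0; first exact.
  by move=> /KO; apply: contra_not (negP nx) => ?; rewrite inE.
split; first by apply: continuous_mfun; exact: test_cont tp.
apply: (@intg_bdd _ _ 0 M (C ^+ 2)).
- by apply: mfun_sqr; apply: continuous_mfun; exact: test_cont tp.
- move=> y; rewrite normrX -ler_sqrt ?sqr_ge0// !sqrtr_sqr normr_id (ger0_norm C0)//.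
- by move=> y /HM ->; rewrite expr0n.
Qed.

(** Indicators of rectangles inside [Omega] are bounded limits of test functions, so [h] integrates
    to zero over them, and countably many rectangles with rational data cover [Omega]. *)
Lemma du_bois_reymond h : L2 Omega h ->
  (forall phi, test_function Omega phi -> dot Omega h phi = 0) ->
  ae2 (fun x => Omega x -> h x = 0).
Proof.
move=> /L2P sh H; have [mh Ih] := sh.
have key (a0 b0 c0 d0 : R) : crect a0 b0 c0 d0 `<=` Omega ->
    ae2 (fun x => rect a0 b0 c0 d0 x -> h x = 0).
  move=> crO; have mr (a b c d : R) : mset2 (rect a b c d) by apply: measurableX; exact: measurable_itv.
  have [r Hr] : exists r, crect a0 b0 c0 d0 `<=` box 0 r.
    exists (`|a0| + `|b0| + `|c0| + `|d0|) => x [/=]; rewrite !in_itv/= => /andP[h1 h2] /andP[h3 h4].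
    apply/boxE; rewrite !subr0 !ler_norml.
    have := ler_norm a0; have := ler_norm (- a0); have := ler_norm b0; have := ler_norm (- b0).
    have := ler_norm c0; have := ler_norm (- c0); have := ler_norm d0; have := ler_norm (- d0).
    by rewrite !normrN => *; split; apply/andP; split; lra.
  have sbox : sqi (\1_(box (0 : P) r)).
    split; first by apply: mfun_indic; exact: mset_box.
    rewrite (_ : (fun x => _) = \1_(box (0 : P) r)); first exact: intg_box.
    by apply/funext => x; rewrite indicE; case: (_ \in _); rewrite ?expr1n ?expr0n.
  have Ihb := sqi_mul sh sbox.
  pose f x := (h \_ Omega) x * \1_(rect a0 b0 c0 d0) x.
  have rc (a b c d : R) : rect a b c d `<=` crect a b c d.
    by move=> x [/=]; rewrite !in_itv/= => /andP[/ltW h1 /ltW h2] /andP[/ltW h3 /ltW h4]; split; rewrite /= in_itv/= ?h1 ?h2 ?h3 ?h4.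
  have If : intg f.
    rewrite (_ : f = fun x => ((h \_ Omega) x * \1_(box 0 r) x) * \1_(rect a0 b0 c0 d0) x).
      exact: intg_indicM.
    apply/funext => x; rewrite -mulrA indicI2 /f; congr (_ * \1_ _ x).
    by apply/esym/setIidPr => y /rc /Hr.
  have h0 : ae2 (fun x => f x = 0).
    apply: (@rect_ae0 _ a0 b0 c0 d0) => // [x nr|a b c d].
      by rewrite /f indicE memNset ?mulr0.
    pose a' := Num.max a0 a; pose b' := Num.min b0 b; pose c' := Num.max c0 c; pose d' := Num.min d0 d.
    have c'O : crect a' b' c' d' `<=` crect a0 b0 c0 d0.
      move=> x [/=]; rewrite !in_itv/= !ge_max !le_min.
      by move=> /andP[/andP[h1 h2] /andP[h3 h4]] /andP[/andP[h5 h6] /andP[h7 h8]]; split; rewrite /= in_itv/= ?h1 ?h3 ?h5 ?h7.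
    have [phi [tphi phi01 phi0 phil]] := rect_test (subset_trans c'O crO).
    have [||||_ lim] := @dct R (fun n x => (h \_ Omega) x * phi n x)
      (fun x => (h \_ Omega) x * \1_(rect a' b' c' d') x) (fun x => `|(h \_ Omega) x * \1_(box 0 r) x|).
    - by move=> n; apply: mfunM => //; apply: continuous_mfun; exact: test_cont (tphi n).
    - exact: intg_norm.
    - move=> n x; rewrite !normrM ler_wpM2l//; have /andP[p0 p1] := phi01 n x.
      rewrite (ger0_norm p0); have [cx|cx] := pselect (crect a' b' c' d' x).
        by rewrite indicE mem_set ?normr1//; exact/Hr/c'O.
      by rewrite phi0// normr_ge0.
    - by move=> x; apply: cvgM; [exact: cvg_cst | exact: phil].
    rewrite (_ : (fun x => f x * _) = fun x => (h \_ Omega) x * \1_(rect a' b' c' d') x).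
      apply: (@cvg_unique _ _ (Int (fun x => (h \_ Omega) x * phi n x) @[n --> \oo])) => //=.
      rewrite (_ : (fun n => _) = fun=> 0); first exact: cvg_cst.
      by apply/funext => n; rewrite -dotE H.
    apply/funext => x; rewrite /f -mulrA indicI2 /rect -setXI; congr (_ * \1_ _ x).
    by rewrite !itvooI.
  apply: ae2S h0 => x; rewrite /f => + rx; rewrite indicE mem_set// mulr1 patchE mem_set//.
  exact/crO/rc.
have H2 : forall q : rat * rat * nat, ae2 (fun x =>
    let z : P := (ratr q.1.1, ratr q.1.2) in
    rect (z.1 - q.2.+1%:R^-1) (z.1 + q.2.+1%:R^-1) (z.2 - q.2.+1%:R^-1) (z.2 + q.2.+1%:R^-1) x
    -> box z q.2.+1%:R^-1 `<=` Omega -> h x = 0).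
  move=> q; set z : P := (ratr q.1.1, ratr q.1.2).
  have [bO|bO] := pselect (box z q.2.+1%:R^-1 `<=` Omega); last by apply: ae2T => x /= _ hb; case: (bO hb).
  by apply: ae2S (key _ _ _ _ bO) => x /= hx rx _; exact: hx.
apply: ae2S (ae2_countable H2) => x Hx Ox.
by have [q [hq1 hq2]] := rat_cover oO Ox; exact: Hx hq1 hq2.
Qed.

End DuBoisReymond.

(** * Weak derivatives and the spaces H^2 and H^2_0 *)

Section WeakDerivatives.
Context {R : realType}.
Local Notation P := (R * R)%type.
Local Notation mu := (@leb2 R).
Implicit Types (f g h phi : P -> R) (A B : set P).

Lemma sum2 (V : nmodType) (F : 'I_2 -> V) : \sum_(i : 'I_2) F i = F 0 + F 1.
Proof.
by rewrite !big_ord_recl big_ord0 addr0; congr (F _ + F _); exact: val_inj.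
Qed.

Lemma sqr_le2 (a b : R) : (a + b) ^+ 2 <= 2 * a ^+ 2 + 2 * b ^+ 2.
Proof. have := sqr_ge0 (a - b); rewrite !expr2 => ?; lra. Qed.

Lemma le_eps0 (b c : R) : (forall e, 0 < e -> b ^+ 2 <= c * e) -> b = 0.
Proof.
move=> H; apply/eqP; rewrite -(sqrf_eq0 b) eq_le sqr_ge0 andbT.
apply/ler_addgt0Pl => e e0; rewrite addr0.
have d0 : 0 < `|c| + 1 by have := normr_ge0 c; lra.
apply: (le_trans (H (e / (`|c| + 1)) (divr_gt0 e0 d0))).
rewrite mulrA ler_pdivrMr// mulrC ler_wpM2l ?(ltW e0)//.
by have := ler_norm c; lra.
Qed.

Lemma lin_small (a X Y e : R) : 0 <= X -> X * (a ^+ 2 + 1) < e / 4 -> Y < e / 4 ->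
  2 * a ^+ 2 * X + 2 * Y < e.
Proof. by move=> *; lra. Qed.

Variable Omega : set P.
Hypothesis oO : open Omega.
Local Notation L2 := (L2 Omega).
Local Notation dot := (dot Omega).
Local Notation test := (test_function Omega).
Local Notation is_weak_der := (is_weak_der Omega).
Local Notation weak_der := (weak_der Omega).

Definition aeq g h := ae2 (fun x => Omega x -> g x = h x).

Lemma aeq_refl g : aeq g g. Proof. exact: ae2T. Qed.
Lemma aeq_sym g h : aeq g h -> aeq h g.
Proof. by apply: ae2S => x E Ox; rewrite E. Qed.
Lemma aeq_trans h g k : aeq g h -> aeq h k -> aeq g k.
Proof. by move=> H1 H2; apply: ae2S (ae2I H1 H2) => x [E1 E2] Ox; rewrite E1 ?E2. Qed.
Lemma aeqD g g' h h' : aeq g g' -> aeq h h' -> aeq (fun x => g x + h x) (fun x => g' x + h' x).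
Proof. by move=> H1 H2; apply: ae2S (ae2I H1 H2) => x [E1 E2] Ox; rewrite E1 ?E2. Qed.
Lemma dot_aeq g g' h h' : L2 g -> L2 g' -> L2 h -> L2 h' -> aeq g g' -> aeq h h' ->
  dot g h = dot g' h'.
Proof.
move=> lg lg' lh lh' gg hh; rewrite (dot_ae lg lg' _ gg); last by case/L2P : lh.
by rewrite dotC (dot_ae lh lh' _ hh) 1?dotC//; case/L2P : lg'.
Qed.

Lemma wd_unique i g h1 h2 : is_weak_der i g h1 -> is_weak_der i g h2 -> aeq h1 h2.
Proof.
move=> [l1 H1] [l2 H2].
have := @du_bois_reymond _ _ oO _ (L2B l1 l2).
move=> H; apply: ae2S (H _) => [x E Ox|phi tphi].
  by apply/eqP; rewrite -subr_eq0 (E Ox).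
rewrite dotBl//; last exact: L2_test.
apply/eqP; rewrite subr_eq0; apply/eqP.
by transitivity (dist_der i (dist_of Omega g) phi); [rewrite H1 | rewrite H2].
Qed.

Lemma weak_derP i g : (exists h, is_weak_der i g h) -> is_weak_der i g (weak_der i g).
Proof. by move=> [h Hh]; rewrite /Defs.weak_der; apply: (@getI _ _ h). Qed.

Lemma wd_aeq i g h : is_weak_der i g h -> aeq (weak_der i g) h.
Proof. by move=> H; apply: wd_unique (H); apply: weak_derP; exists h. Qed.

Lemma wdI i g h : L2 h -> (forall phi, test phi -> - dot g (pder i phi) = dot h phi) ->
  is_weak_der i g h.
Proof. by []. Qed.

Lemma wdE i g h phi : is_weak_der i g h -> test phi -> dot g (pder i phi) = - dot h phi.
Proof. by move=> [_ H] /H; rewrite /dist_der /dist_of => E; rewrite -[RHS]/(- \int[leb2]_(x in Omega) (h x * phi x)) -E opprK. Qed.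

Lemma wd_ext i g g' h h' : L2 g -> L2 g' -> aeq g g' -> L2 h' -> aeq h h' ->
  is_weak_der i g h -> is_weak_der i g' h'.
Proof.
move=> lg lg' gg lh' hh H; apply: wdI => // phi tphi.
have lphi := L2_test tphi; have ldphi := L2_test (test_pder i tphi).
rewrite -(dot_aeq lg lg' ldphi ldphi gg (aeq_refl _)) (wdE H tphi) opprK.
by apply: dot_aeq => //; [case: H | exact: aeq_refl].
Qed.

Lemma wdD i g1 g2 h1 h2 : L2 g1 -> L2 g2 -> is_weak_der i g1 h1 -> is_weak_der i g2 h2 ->
  is_weak_der i (fun x => g1 x + g2 x) (fun x => h1 x + h2 x).
Proof.
move=> l1 l2 H1 H2; have [k1 _] := H1; have [k2 _] := H2.
apply: wdI; first exact: L2D.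
move=> phi tphi; have lphi := L2_test tphi; have ldphi := L2_test (test_pder i tphi).
by rewrite !dotDl// (wdE H1 tphi) (wdE H2 tphi) opprD !opprK.
Qed.

Lemma wdZ i (c : R) g h : L2 g -> is_weak_der i g h ->
  is_weak_der i (fun x => c * g x) (fun x => c * h x).
Proof.
move=> l1 H1; have [k1 _] := H1; apply: wdI; first exact: L2Z.
move=> phi tphi; have lphi := L2_test tphi; have ldphi := L2_test (test_pder i tphi).
by rewrite !dotZl// (wdE H1 tphi) mulrN opprK.
Qed.

Lemma patch_test phi : test phi -> phi \_ Omega = phi.
Proof.
move=> [_ [K [_ KO K0]]]; apply/funext => x; rewrite patchE; case: ifPn => // nx.
by rewrite [RHS]K0; [exact | move=> /KO; apply: contra_not (negP nx) => ?; rewrite inE].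
Qed.

Lemma dot_testE g phi : test phi -> dot phi g = Int (fun x => phi x * g x).
Proof. by move=> tp; rewrite dotE patch_test. Qed.

Lemma wd_test i phi : test phi -> is_weak_der i phi (pder i phi).
Proof.
move=> tphi; apply: wdI; first exact/L2_test/test_pder.
move=> psi tpsi; rewrite dot_testE// (int_by_parts i tphi tpsi.1) opprK.
by rewrite dot_testE//; exact: test_pder.
Qed.

(** Weak derivatives pass to limits in mean square, since both sides of their definition do. *)
Lemma wd_closed i g h : L2 g -> L2 h ->
  (forall e, 0 < e -> exists g' h', [/\ L2 g', is_weak_der i g' h',
     dot (fun x => g' x - g x) (fun x => g' x - g x) < e &
     dot (fun x => h' x - h x) (fun x => h' x - h x) < e]) ->
  is_weak_der i g h.
Proof.
move=> lg lh H; apply: wdI => // phi tphi.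
have lphi := L2_test tphi; have ldphi := L2_test (test_pder i tphi).
apply/eqP; rewrite -subr_eq0; apply/eqP.
apply: (@le_eps0 _ (2 * dot (pder i phi) (pder i phi) + 2 * dot phi phi)) => e e0.
have [g' [h' [lg' H' he1 he2]]] := H e e0; have [lh' _] := H'.
have -> : - dot g (pder i phi) - dot h phi =
    dot (fun x => g' x - g x) (pder i phi) + dot (fun x => h' x - h x) phi.
  by rewrite !dotBl// (wdE H' tphi); ring.
apply: (le_trans (sqr_le2 _ _)).
have c1 := dot_CS (L2B lg' lg) ldphi; have c2 := dot_CS (L2B lh' lh) lphi.
have d1 := dot_ge0 Omega (pder i phi); have d2 := dot_ge0 Omega phi.
have b1 := ler_wpM2r d1 (ltW he1); have b2 := ler_wpM2r d2 (ltW he2).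
lra.
Qed.

Local Opaque Defs.L2 Defs.dot Defs.test_function Defs.is_weak_der Defs.H1.
(** A function of class [H^2] together with representatives of its derivatives; unlike [weak_der],
    they can be chosen to depend linearly on the function. *)
Definition jet v (G : 'I_2 -> P -> R) (H : 'I_2 -> 'I_2 -> P -> R) :=
  [/\ L2 v, forall i, is_weak_der i v (G i) & forall i j, is_weak_der j (G i) (H i j)].

Lemma H2_jet v : H2 Omega v ->
  jet v (fun i => weak_der i v) (fun i j => weak_der j (weak_der i v)).
Proof.
move=> [[lv ev] ew]; split => // [i|i j]; first exact: weak_derP.
by apply: weak_derP; have [_] := ew i.
Qed.

Lemma jet_L2 v G H : jet v G H -> [/\ L2 v, forall i, L2 (G i) & forall i j, L2 (H i j)].
Proof. by move=> [lv hG hH]; split => // [i|i j]; [case: (hG i) | case: (hH i j)]. Qed.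

Lemma jet_aeq v G H : jet v G H -> H2 Omega v /\ (forall i, aeq (weak_der i v) (G i)) /\
  (forall i j, aeq (weak_der j (weak_der i v)) (H i j)).
Proof.
move=> J; have [lv lG lH] := jet_L2 J; have [_ hG hH] := J.
have aG i : aeq (weak_der i v) (G i) by exact: wd_aeq.
have wG i : is_weak_der i v (weak_der i v) by apply: weak_derP; exists (G i).
have wH i j : is_weak_der j (weak_der i v) (H i j).
  apply: wd_ext (hH i j) => //; [by case: (wG i) | exact: aeq_sym | exact: aeq_refl].
split; last by split => // i j; exact: wd_aeq.
split; first by split => // i; exists (G i).
by move=> i; split => [|j]; [case: (wG i) | exists (H i j)].
Qed.

Local Opaque Defs.H2.
Definition Nsq v (G : 'I_2 -> P -> R) (H : 'I_2 -> 'I_2 -> P -> R) : R :=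
  dot v v + \sum_(i : 'I_2) dot (G i) (G i) + \sum_(i : 'I_2) \sum_(j : 'I_2) dot (H i j) (H i j).

Lemma Nsq_ge0 v G H : 0 <= Nsq v G H.
Proof.
by rewrite /Nsq !addr_ge0 ?dot_ge0// sumr_ge0// => i _; rewrite ?sumr_ge0 ?dot_ge0// => j _; exact: dot_ge0.
Qed.

Lemma H2norm_jet v G H : jet v G H -> H2norm Omega v ^+ 2 = Nsq v G H.
Proof.
move=> J; have [H2v [aG aH]] := jet_aeq J.
have [_ lG lH] := jet_L2 J; have [_ lG' lH'] := jet_L2 (H2_jet H2v).
rewrite /H2norm sqr_sqrtr; last exact: (Nsq_ge0 v (fun i => weak_der i v) (fun i j => weak_der j (weak_der i v))).
congr (_ + _ + _); first by apply: eq_bigr => i _; apply: dot_aeq.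
by apply: eq_bigr => i _; apply: eq_bigr => j _; apply: dot_aeq.
Qed.

Lemma jet_lin (a : R) v G H v' G' H' : jet v G H -> jet v' G' H' ->
  jet (fun x => a * v x + v' x) (fun i x => a * G i x + G' i x) (fun i j x => a * H i j x + H' i j x).
Proof.
move=> J J'; have [lv lG lH] := jet_L2 J; have [lv' lG' lH'] := jet_L2 J'.
have [_ hG hH] := J; have [_ hG' hH'] := J'.
split => [|i|i j]; first by apply: L2D => //; exact: L2Z.
  by apply: wdD (wdZ _ _ _) _ => //; exact: L2Z.
by apply: wdD (wdZ _ _ _) _ => //; exact: L2Z.
Qed.

Lemma jet_test phi : test phi -> jet phi (fun i => pder i phi) (fun i j => pder j (pder i phi)).
Proof.
move=> tp; split => [|i|i j]; [exact: L2_test | exact: wd_test | exact/wd_test/test_pder].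
Qed.

Lemma dotDD2 g h : L2 g -> L2 h ->
  dot (fun x => g x + h x) (fun x => g x + h x) <= 2 * dot g g + 2 * dot h h.
Proof.
move=> lg lh; have := dot_ge0 Omega (fun x => g x - h x).
have lD := L2D lg lh; have lB := L2B lg lh.
rewrite !(dotBl, dotBr, dotDl, dotDr)// (dotC Omega h g); lra.
Qed.

Lemma dot_lin2 (a : R) g h : L2 g -> L2 h ->
  dot (fun x => a * g x + h x) (fun x => a * g x + h x) <= 2 * a ^+ 2 * dot g g + 2 * dot h h.
Proof.
move=> lg lh; apply: (le_trans (dotDD2 (L2Z a lg) lh)).
rewrite dotZl ?dotZr//; last exact: L2Z.
rewrite expr2; lra.
Qed.

Lemma Nsq_lin (a : R) v G H v' G' H' : jet v G H -> jet v' G' H' ->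
  Nsq (fun x => a * v x + v' x) (fun i x => a * G i x + G' i x) (fun i j x => a * H i j x + H' i j x)
  <= 2 * a ^+ 2 * Nsq v G H + 2 * Nsq v' G' H'.
Proof.
move=> J J'; have [lv lG lH] := jet_L2 J; have [lv' lG' lH'] := jet_L2 J'.
rewrite /Nsq !sum2.
have := dot_lin2 a lv lv'.
have := dot_lin2 a (lG 0) (lG' 0); have := dot_lin2 a (lG 1) (lG' 1).
have := dot_lin2 a (lH 0 0) (lH' 0 0); have := dot_lin2 a (lH 0 1) (lH' 0 1).
have := dot_lin2 a (lH 1 0) (lH' 1 0); have := dot_lin2 a (lH 1 1) (lH' 1 1).
rewrite ?mulrDr => *.
lra.
Qed.

Lemma H2_lin (a : R) v w : H2 Omega v -> H2 Omega w -> H2 Omega (fun x => a * v x + w x).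
Proof. by move=> /H2_jet J /H2_jet J'; have [] := jet_aeq (jet_lin a J J'). Qed.

Lemma H2norm_ge0 v : 0 <= H2norm Omega v. Proof. by rewrite /H2norm sqrtr_ge0. Qed.
Local Opaque Defs.H2norm.

Lemma H2norm_lin (a : R) v w : H2 Omega v -> H2 Omega w ->
  H2norm Omega (fun x => a * v x + w x) ^+ 2 <= 2 * a ^+ 2 * H2norm Omega v ^+ 2 + 2 * H2norm Omega w ^+ 2.
Proof.
move=> Hv Hw; have J := H2_jet Hv; have J' := H2_jet Hw.
have E := H2norm_jet (jet_lin a J J').
have E1 := H2norm_jet J.
have E2 := H2norm_jet J'.
have := Nsq_lin a J J'.
by rewrite -E -E1 -E2.
Qed.

Lemma H2_test phi : test phi -> H2 Omega phi.
Proof. by move=> tp; have [] := jet_aeq (jet_test tp). Qed.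

Lemma H20P v : H20 Omega v <-> H2 Omega v /\ forall e, 0 < e ->
  exists phi, test phi /\ H2norm Omega (fun x => -1 * phi x + v x) ^+ 2 < e.
Proof.
have E phi : (fun x => -1 * phi x + v x) = (fun x => v x - phi x).
  by apply/funext => x; rewrite mulN1r addrC.
split=> -[H2v Hv]; split => // e e0.
  have s0 : 0 < Num.sqrt e by rewrite sqrtr_gt0.
  have [phi [tphi hp]] := Hv _ s0; exists phi; split => //; rewrite E.
  by rewrite -(sqr_sqrtr (ltW e0)) ltr_pXn2r// nnegrE ?sqrtr_ge0// H2norm_ge0.
have e20 : 0 < e ^+ 2 by rewrite exprn_gt0.
have [phi [tphi hp]] := Hv _ e20; exists phi; split => //; rewrite -E.
by rewrite ltr_pXn2r ?nnegrE ?H2norm_ge0 ?(ltW e0) in hp.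
Qed.

Lemma H20_lin (a : R) v w : H20 Omega v -> H20 Omega w -> H20 Omega (fun x => a * v x + w x).
Proof.
move=> /H20P[Hv av] /H20P[Hw aw]; apply/H20P; split; first exact: H2_lin.
move=> e e0; have e4 : 0 < e / 4 by lra.
have f0 : 0 < e / 4 / (a ^+ 2 + 1) by rewrite divr_gt0//; have := sqr_ge0 a; lra.
have [phi [tphi hphi]] := av _ f0; have [psi [tpsi hpsi]] := aw _ e4.
exists (fun x => a * phi x + psi x); split; first by apply: testD => //; exact: testZ.
rewrite (_ : (fun x => _) = fun x => a * (-1 * phi x + v x) + (-1 * psi x + w x)); last by apply/funext => x; ring.
have h1 : H2 Omega (fun x => -1 * phi x + v x) := H2_lin (-1) (H2_test tphi) Hv.
have h2 : H2 Omega (fun x => -1 * psi x + w x) := H2_lin (-1) (H2_test tpsi) Hw.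
apply: (le_lt_trans (H2norm_lin a h1 h2)); apply: lin_small hpsi; first exact: sqr_ge0.
move: hphi; rewrite ltr_pdivlMr//.
by have := sqr_ge0 a; lra.
Qed.

Lemma Nsq_B0 v G H : Nsq (fun x => -1 * v x + v x) (fun i x => -1 * G i x + G i x)
  (fun i j x => -1 * H i j x + H i j x) = 0.
Proof.
have Z g : dot (fun x => -1 * g x + g x) (fun x => -1 * g x + g x) = 0.
  rewrite dotE -[RHS](@Int0 R); congr Int; apply/funext => x.
  by rewrite mulN1r addNr mulr0.
by rewrite /Nsq !sum2 !Z !addr0.
Qed.

Lemma H20_test phi : test phi -> H20 Omega phi.
Proof.
move=> tp; apply/H20P; split; first exact: H2_test.
move=> e e0; exists phi; split => //.
have J := jet_test tp; have E := H2norm_jet (jet_lin (-1) J J).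
by rewrite (eq_trans E (Nsq_B0 _ _ _)).
Qed.

End WeakDerivatives.

(** * The Riesz representation theorem *)

Section Riesz.
Context {R : realType}.

Lemma quad_discr (b c d : R) : (forall t, 0 <= t ^+ 2 * b + 2 * t * c + d) -> 0 <= b ->
  c ^+ 2 <= d * b.
Proof.
move=> H; rewrite le_eqVlt => /orP[/eqP b0|b0].
  have [-> |c0] := eqVneq c 0; first by rewrite -b0 mulr0 expr0n.
  have := H (- (d + 1) / (2 * c)); rewrite -b0 mulr0 add0r => h.
  suff : 2 * (- (d + 1) / (2 * c)) * c + d = -1 by lra.
  by field.
have := H (- c / b).
rewrite (_ : _ + _ = (d * b - c ^+ 2) / b); last by field; exact: lt0r_neq0.
by rewrite pmulr_lge0 ?invr_gt0// subr_ge0.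
Qed.

Variables (T : Type) (V : (T -> R) -> Prop) (B : (T -> R) -> (T -> R) -> R).
Hypothesis V_lin : forall a u v, V u -> V v -> V (fun x => a * u x + v x).
Hypothesis B_sym : forall u v, V u -> V v -> B u v = B v u.
Hypothesis B_lin : forall a u v w, V u -> V v -> V w ->
  B (fun x => a * u x + v x) w = a * B u w + B v w.
Hypothesis B_ge0 : forall u, V u -> 0 <= B u u.

Lemma form_linr a u v w : V u -> V v -> V w ->
  B w (fun x => a * u x + v x) = a * B w u + B w v.
Proof. by move=> Vu Vv Vw; rewrite B_sym ?B_lin ?(B_sym Vw)//; exact: V_lin. Qed.

Lemma form_CS u v : V u -> V v -> B u v ^+ 2 <= B u u * B v v.
Proof.
move=> Vu Vv; apply: quad_discr; last exact: B_ge0.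
move=> t; have := B_ge0 (V_lin t Vv Vu).
rewrite B_lin ?form_linr//; last exact: V_lin.
by rewrite (B_sym Vv Vu) => h; lra.
Qed.

(** Minimization of the energy [B v v - 2 F v]: if its value at [w] is within [e] of the infimum, then
    [(B w v - F v)^2 <= e * B v v]. Hence a minimizing sequence is a Cauchy sequence, and its limit
    satisfies the equation. *)
Lemma riesz (F : (T -> R) -> R) (C : R) : (exists v, V v) ->
  (forall u : nat -> T -> R, (forall n, V (u n)) ->
     (forall e : R, 0 < e -> exists N, forall m n, (N <= m)%N -> (N <= n)%N ->
        B (fun x => -1 * u n x + u m x) (fun x => -1 * u n x + u m x) < e) ->
     exists v, V v /\ forall e : R, 0 < e -> exists N, forall n, (N <= n)%N ->
        B (fun x => -1 * u n x + v x) (fun x => -1 * u n x + v x) < e) ->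
  (forall a u v, V u -> V v -> F (fun x => a * u x + v x) = a * F u + F v) ->
  (forall v, V v -> F v ^+ 2 <= C * B v v) ->
  exists u, V u /\ forall v, V v -> B u v = F v.
Proof.
move=> [v0 Vv0] compl Flin Fbd.
pose J v := B v v - 2 * F v.
have Jbd v : V v -> - (`|C| + 1) <= J v.
  move=> Vv; have b0 := B_ge0 Vv; have h := Fbd v Vv.
  have C1 : 0 < `|C| + 1 by have := normr_ge0 C; lra.
  rewrite -subr_ge0 -(pmulr_rge0 _ C1).
  have : 0 <= (F v - (`|C| + 1)) ^+ 2 by exact: sqr_ge0.
  have : C * B v v <= `|C| * B v v by rewrite ler_wpM2r// ler_norm.
  rewrite /J; nra.
pose S := [set J v | v in V].
have hS : has_inf S.
  split; first by exists (J v0), v0.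
  by exists (- (`|C| + 1)) => _ [v Vv <-]; exact: Jbd.
have minJ v : V v -> inf S <= J v.
  by move=> Vv; apply: ge_inf; [case: hS | exists v].
have /choice[u Hu] : forall n, exists u, V u /\ J u < inf S + n.+1%:R^-1.
  move=> n; have n0 : (0 : R) < n.+1%:R^-1 by rewrite invr_gt0.
  by have [_ [v Vv <-] h] := inf_adherent n0 hS; exists v.
have key w v : V w -> V v -> (B w v - F v) ^+ 2 <= (J w - inf S) * B v v.
  move=> Vw Vv; apply: quad_discr; last exact: B_ge0.
  move=> t; have Vt := V_lin t Vv Vw; have := minJ _ Vt.
  rewrite /J Flin// B_lin// !form_linr// (B_sym Vv Vw) => h; lra.
have Jn (e : R) : 0 < e -> exists N, forall n, (N <= n)%N -> J (u n) - inf S < e.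
  move=> e0; exists (Num.truncn e^-1) => n hn.
  have [_ h] := Hu n; rewrite ltrBlDl (lt_le_trans h)// lerD2l.
  rewrite -[leRHS]invrK lef_pV2 ?posrE ?invr_gt0// ltW// (lt_le_trans (truncnS_gt _))// ler_nat.
  exact: hn.
have VU n : V (u n) := (Hu n).1.
have [|w [Vw cvw]] := compl u VU.
  move=> e e0; have e4 : 0 < e / 4 by lra.
  have [N HN] := Jn _ e4; exists N => m n Nm Nn.
  set d := fun x => -1 * u n x + u m x.
  have Vd : V d by exact: V_lin.
  have k1 := key (u m) d (VU m) Vd; have k2 := key (u n) d (VU n) Vd.
  have E : B d d = B (u m) d - B (u n) d by rewrite {1}/d B_lin// mulN1r addrC.
  have h1 := HN _ Nm; have h2 := HN _ Nn; have b0 := B_ge0 Vd.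
  move: b0; rewrite le_eqVlt => /orP[/eqP <- //|b0].
  rewrite -(ltr_pM2r b0).
  have : B d d * B d d <= 2 * (B (u m) d - F d) ^+ 2 + 2 * (B (u n) d - F d) ^+ 2.
    rewrite {1 2}E; have := sqr_ge0 (B (u m) d + B (u n) d - 2 * F d).
    rewrite !expr2 => ?; lra.
  have h1' : (J (u m) - inf S) * B d d < e / 4 * B d d by rewrite ltr_pM2r.
  have h2' : (J (u n) - inf S) * B d d < e / 4 * B d d by rewrite ltr_pM2r.
  move=> h; lra.
exists w; split => // v Vv; apply/eqP; rewrite -subr_eq0; apply/eqP.
apply: (@le_eps0 _ _ (4 * B v v)) => e e0.
have [N1 H1] := Jn _ e0; have [N2 H2] := cvw _ e0.
set n := maxn N1 N2; have {}H1 := H1 n (leq_maxl _ _); have {}H2 := H2 n (leq_maxr _ _).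
have Vd : V (fun x => -1 * u n x + w x) by exact: V_lin.
have k := key (u n) v (VU n) Vv; have cs := form_CS Vd Vv; have b0 := B_ge0 Vv.
have : B (fun x => -1 * u n x + w x) v = B w v - B (u n) v by rewrite B_lin// mulN1r addrC.
move: cs H2; move: (B (fun x => -1 * u n x + w x) (fun x => -1 * u n x + w x)) (B (fun x => -1 * u n x + w x) v) => X Y cs H2 E.
have -> : B w v - F v = Y + (B (u n) v - F v) by rewrite E; ring.
apply: (le_trans (sqr_le2 _ _)).
have h1' : (J (u n) - inf S) * B v v <= e * B v v by rewrite ler_wpM2r// ltW.
have h2' : X * B v v <= e * B v v by rewrite ler_wpM2r// ltW.
lra.
Qed.

End Riesz.

(** * Coercivity of the Laplacian on test functions *)

Section Poincare.
Context {R : realType}.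
Local Notation P := (R * R)%type.
Local Notation mu := (@leb2 R).
Implicit Types (f g h phi : P -> R) (A B : set P).
Variable Omega : set P.
Hypothesis oO : open Omega.
Hypothesis bO : bounded_set Omega.
Local Notation L2 := (L2 Omega).
Local Notation dot := (dot Omega).
Local Notation test := (test_function Omega).
Local Notation aeq := (aeq Omega).
Local Notation lap := (laplacian Omega).

Lemma bounded_box : exists M : R, 0 <= M /\ forall x, Omega x -> box 0 M x.
Proof.
have [M [_ HM]] := bO; exists (`|M| + 1); split; first by have := normr_ge0 M; lra.
move=> x Ox; apply/boxP; rewrite subr0; apply: HM => //.
by have := ler_norm M; lra.
Qed.

Lemma test_smooth phi : test phi -> smooth phi. Proof. by case. Qed.

Lemma sum22 (V : nmodType) (F : 'I_2 -> 'I_2 -> V) :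
  \sum_(i : 'I_2) \sum_(j : 'I_2) F i j = F 0 0 + F 0 1 + (F 1 0 + F 1 1).
Proof. by rewrite !sum2. Qed.

Lemma dotDD g h : L2 g -> L2 h ->
  dot (fun x => g x + h x) (fun x => g x + h x) = dot g g + 2 * dot g h + dot h h.
Proof.
by move=> lg lh; have lD := L2D lg lh; rewrite dotDl// !dotDr// (dotC Omega h g); ring.
Qed.

Lemma smooth_fst : smooth (fun x : P => x.1). Proof. by apply/smoothP => n; exact: Ck_fst. Qed.
Lemma pder_fst0 x : pder 0 (fun y : P => y.1) x = 1.
Proof. by rewrite /pder dir0; have [_ ->] := d_fst x (1, 0). Qed.

Lemma dot_by_parts phi psi i : test phi -> test psi ->
  dot phi (pder i psi) = - dot (pder i phi) psi.
Proof.
move=> tp ts; rewrite (dot_testE _ tp) (dot_testE _ (test_pder i tp)).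
exact: int_by_parts tp (test_smooth ts).
Qed.

Local Opaque Defs.pder Defs.dot Defs.L2 Defs.test_function.
(** Poincare's inequality. Integrating [d_0 (x.1 * phi^2)] gives [(phi, 2 * x.1 * d_0 phi) = - |phi|^2], and
    the square of the norm of [phi + 2 * x.1 * d_0 phi] is nonnegative. *)
Lemma poincare_test M phi : 0 <= M -> (forall x, Omega x -> box 0 M x) -> test phi ->
  dot phi phi <= 4 * M ^+ 2 * dot (pder 0 phi) (pder 0 phi).
Proof.
move=> M0 HM tp; have tD := test_pder 0 tp.
pose X x := x.1 * pder 0 phi x; pose Y x := x.1 * phi x.
have tX : test X by apply: testM tD smooth_fst.
have tY : test Y by apply: testM tp smooth_fst.
have lp := L2_test tp; have lX := L2_test tX; have lY := L2_test tY; have lD := L2_test tD.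
have eY : pder 0 Y = fun x => X x + phi x.
  apply/funext => x; rewrite /Y pderM ?pder_fst0; [|exact: smooth_fst|exact: test_smooth tp].
  by rewrite mulr1.
have := dot_by_parts 0 tp tY; rewrite eY dotDr// => E1.
have E2 : dot (pder 0 phi) Y = dot phi X.
  rewrite (dot_testE _ tD) (dot_testE _ tp); congr Int; apply/funext => x; rewrite /X /Y; ring.
have lX2 := L2Z 2 lX.
have := dot_ge0 Omega (fun x => phi x + 2 * X x).
rewrite !(dotDl, dotDr, dotZl, dotZr)//; last exact: L2D.
rewrite (dotC Omega X phi).
have : dot X X <= M ^+ 2 * dot (pder 0 phi) (pder 0 phi).
  rewrite (dot_testE _ tX) (dot_testE _ tD) -IntZ; last first.
    by rewrite -(patch_test tD); apply: sqi_mul; apply/L2P.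
  apply: le_Int.
  - by rewrite -(patch_test tX); apply: sqi_mul; apply/L2P.
  - apply: intgZ; by rewrite -(patch_test tD); apply: sqi_mul; apply/L2P.
  - move=> x; rewrite /X; have [Ox|nO] := pselect (Omega x); last first.
      have -> : pder 0 phi x = 0; last by rewrite !mulr0.
      by rewrite -(patch_test tD) patchE memNset.
    have /boxE[/= h _] := HM x Ox; rewrite subr0 in h.
    rewrite -mulrACA -!expr2 ler_wpM2r ?sqr_ge0//.
    by rewrite -(real_normK (num_real x.1)) lerXn2r// nnegrE.
rewrite E2 in E1; move=> h1 h2; lra.
Qed.

Definition lapt phi := fun x : P => pder 0 (pder 0 phi) x + pder 1 (pder 1 phi) x.

(** Integrating by parts twice moves one derivative from each factor to the other. *)
Lemma hessian_swap i j phi : test phi ->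
  dot (pder i (pder i phi)) (pder j (pder j phi)) = dot (pder j (pder i phi)) (pder j (pder i phi)).
Proof.
move=> tp; have ti := test_pder i tp; have tj := test_pder j tp.
have tij := test_pder j ti; have tii := test_pder i ti.
have E := dot_by_parts i tij tj.
have C1 := pderC j i (test_smooth ti).
have C2 := pderC j i (test_smooth tp).
have E1 := dot_by_parts j tii tj.
have E2 := congr1 (fun z => dot (pder j (pder i phi)) z) C2.
have E3 := congr1 (fun z => - dot z (pder j phi)) C1.
exact: etrans E1 (etrans E3 (etrans (esym E) (esym E2))).
Qed.

Lemma sum_aux (a d b c e : R) : e = b -> e = c -> a + b + (c + d) = a + 2 * e + d.
Proof. by move=> <- <-; ring. Qed.

(** For test functions, the mixed second derivatives in the Laplacian squared recombine into the
    sum of all squares of second derivatives, by [hessian_swap]. *)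
Lemma hessian_test phi : test phi ->
  \sum_(i : 'I_2) \sum_(j : 'I_2) dot (pder j (pder i phi)) (pder j (pder i phi)) = dot (lapt phi) (lapt phi).
Proof.
move=> tp; have l00 := L2_test (test_pder 0 (test_pder 0 tp)).
have l11 := L2_test (test_pder 1 (test_pder 1 tp)).
rewrite sum22 /lapt (dotDD l00 l11).
exact: (sum_aux _ _ (hessian_swap 0 1 tp) (etrans (dotC _ _ _) (hessian_swap 1 0 tp))).
Qed.

Lemma coercive_aux (m L a a0 a1 d00 d01 d10 d11 : R) : 0 <= m ->
  d00 + d01 + (d10 + d11) = L -> a <= 4 * m * a0 -> a0 <= 4 * m * d00 -> a1 <= 4 * m * d10 ->
  0 <= d00 -> 0 <= d01 -> 0 <= d10 -> 0 <= d11 ->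
  a + (a0 + a1) + L <= (1 + 4 * m + 16 * m * m) * L.
Proof.
move=> m0 E p p0 p1 h1 h2 h3 h4.
have e0 : a0 + a1 <= 4 * m * L by rewrite -E; nra.
have e1 : a <= 4 * m * (4 * m * L).
  apply: (le_trans p); rewrite ler_wpM2l//; first by lra.
  apply: (le_trans p0); rewrite ler_wpM2l//; lra.
lra.
Qed.

(** Poincare's inequality for the function and for its gradient, and [hessian_test]. *)
Lemma coercive_test : exists K : R, 0 <= K /\ forall phi, test phi ->
  Nsq Omega phi (fun i => pder i phi) (fun i j => pder j (pder i phi)) <= K * dot (lapt phi) (lapt phi).
Proof.
have [M [M0 HM]] := bounded_box; exists (1 + 4 * M ^+ 2 + 16 * M ^+ 2 * M ^+ 2).
have M2 := sqr_ge0 M.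
split; first by have := mulr_ge0 M2 M2; lra.
move=> phi tp; rewrite /Nsq hessian_test//.
have := hessian_test tp; rewrite sum22 sum2 => E.
have p := poincare_test M0 HM tp; have p0 := poincare_test M0 HM (test_pder 0 tp).
have p1 := poincare_test M0 HM (test_pder 1 tp).
exact: (coercive_aux M2 E p p0 p1 (dot_ge0 _ _) (dot_ge0 _ _) (dot_ge0 _ _) (dot_ge0 _ _)).
Qed.

End Poincare.

(** * The biharmonic problem *)

Section H20Riesz.
Context {R : realType}.
Local Notation P := (R * R)%type.
Local Notation mu := (@leb2 R).
Implicit Types (f g h phi : P -> R) (A B : set P).
Variable Omega : set P.
Hypothesis oO : open Omega.
Hypothesis bO : bounded_set Omega.
Local Notation L2 := (L2 Omega).
Local Notation dot := (dot Omega).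
Local Notation test := (test_function Omega).
Local Notation aeq := (aeq Omega).
Local Notation lap := (laplacian Omega).
Local Notation weak_der := (weak_der Omega).
Local Notation nsq v := (H2norm Omega v ^+ 2).
Local Notation lsq v := (dot (lap v) (lap v)).

Lemma eq_then_le (a b c : R) : a = b -> b <= c -> a <= c. Proof. by move=> ->. Qed.

Lemma lin_aux (a p q p' q' l l' : R) : l = p + q -> l' = p' + q' ->
  a * p + p' + (a * q + q') = a * l + l'.
Proof. by move=> -> ->; ring. Qed.

Lemma patch_indic f A : f \_ A = fun x => f x * \1_A x.
Proof. by apply/funext => x; rewrite patchE indicE; case: (x \in A); rewrite ?mulr1 ?mulr0. Qed.

Lemma dot_sq (u f : P -> R) : dot (fun x => -1 * u x + f x) (fun x => -1 * u x + f x)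
  = d2 (u \_ Omega) (f \_ Omega).
Proof.
rewrite dotEip; congr Int; apply/funext => x; rewrite !patchE.
case: ifP => _; rewrite ?[point](erefl (0 : R)); ring.
Qed.

Lemma L2_complete (u : nat -> P -> R) : (forall n, L2 (u n)) ->
  (forall e : R, 0 < e -> exists N, forall m n, (N <= m)%N -> (N <= n)%N ->
     dot (fun x => -1 * u n x + u m x) (fun x => -1 * u n x + u m x) < e) ->
  exists f, L2 f /\ forall e : R, 0 < e -> exists N, forall n, (N <= n)%N ->
     dot (fun x => -1 * u n x + f x) (fun x => -1 * u n x + f x) < e.
Proof.
move=> lu Hu; have su n : sqi (u n \_ Omega) by apply/L2P.
have [|f [sf cf]] := @sqi_complete _ (fun n => u n \_ Omega) su.
  move=> e e0; have [N HN] := Hu e e0; exists N => m n Nm Nn.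
  by rewrite -dot_sq; exact: HN.
have sf' : sqi (f \_ Omega).
  rewrite patch_indic; have mi : mfun2 (\1_Omega : P -> R) by apply: mfun_indic; exact: open_mset.
  split; first by apply: mfunM => //; case: sf.
  apply: (@intg_le _ _ (fun x => f x ^+ 2)).
  - by apply: mfun_sqr; apply: mfunM => //; case: sf.
  - by case: sf.
  - move=> x; rewrite indicE; case: (x \in Omega); first by rewrite mulr1 ger0_norm ?sqr_ge0.
    by rewrite mulr0 expr0n normr0 sqr_ge0.
exists f; split; first by apply/L2P.
move=> e e0; have [N HN] := cf e e0; exists N => n Nn; rewrite dot_sq.
apply: le_lt_trans (HN n Nn); apply: le_Int.
- by have [] := sqiB (su n) sf'.
- by have [] := sqiB (su n) sf.
- move=> x; rewrite !patchE; case: ifP => // _; rewrite subrr expr0n; exact: sqr_ge0.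
Qed.

Lemma lapE v : lap v = fun x => weak_der 0 (weak_der 0 v) x + weak_der 1 (weak_der 1 v) x.
Proof. by apply/funext => x; rewrite /laplacian sum2. Qed.

Lemma lapEx v x : lap v x = weak_der 0 (weak_der 0 v) x + weak_der 1 (weak_der 1 v) x.
Proof. by rewrite lapE. Qed.

Lemma lap_jet v G H : jet Omega v G H ->
  aeq (lap v) (fun x => H 0 0 x + H 1 1 x) /\ L2 (fun x => H 0 0 x + H 1 1 x).
Proof.
move=> J; have [H2v [_ aH]] := jet_aeq oO J; have [_ _ lH] := jet_L2 J.
rewrite lapE; split; last exact: L2D.
by apply: aeqD; exact: aH.
Qed.

Lemma L2_lap v : H2 Omega v -> L2 (lap v).
Proof. by move=> /H2_jet J; rewrite lapE; have [_ ] := lap_jet J. Qed.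

Lemma lap_jet_dot v G H v' G' H' : jet Omega v G H -> jet Omega v' G' H' ->
  dot (lap v) (lap v') = dot (fun x => H 0 0 x + H 1 1 x) (fun x => H' 0 0 x + H' 1 1 x).
Proof.
move=> J J'; have [a l] := lap_jet J; have [a' l'] := lap_jet J'.
have [Hv _] := jet_aeq oO J; have [Hv' _] := jet_aeq oO J'.
exact: (dot_aeq (L2_lap Hv) l (L2_lap Hv') l' a a').
Qed.

Lemma lap_lin (a : R) v w : H2 Omega v -> H2 Omega w ->
  aeq (lap (fun x => a * v x + w x)) (fun x => a * lap v x + lap w x).
Proof.
move=> /H2_jet J /H2_jet J'; have [E _] := lap_jet (jet_lin a J J').
apply: (aeq_trans E); apply: ae2T => x _.
exact: (@lin_aux a _ _ _ _ _ _ (lapEx v x) (lapEx w x)).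
Qed.

Lemma lap_dot_lin (a : R) u v w : H2 Omega u -> H2 Omega v -> H2 Omega w ->
  dot (lap (fun x => a * u x + v x)) (lap w) = a * dot (lap u) (lap w) + dot (lap v) (lap w).
Proof.
move=> Hu Hv Hw; have lu := L2_lap Hu; have lv := L2_lap Hv; have lw := L2_lap Hw.
have lau := L2Z a lu.
have E := dot_aeq (L2_lap (H2_lin oO a Hu Hv)) (L2D lau lv) lw lw (lap_lin a Hu Hv) (aeq_refl _ _).
exact: etrans E (etrans (dotDl lau lv lw) (congr1 (fun z => z + _) (dotZl _ lu lw))).
Qed.

Lemma Nsq_hess v G H : jet Omega v G H ->
  dot (fun x => H 0 0 x + H 1 1 x) (fun x => H 0 0 x + H 1 1 x) <= 2 * Nsq Omega v G H.
Proof.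
move=> J; have [_ _ lH] := jet_L2 J; apply: (le_trans (dotDD2 (lH 0 0) (lH 1 1))).
rewrite /Nsq sum22 sum2.
have := dot_ge0 Omega v; have := dot_ge0 Omega (G 0); have := dot_ge0 Omega (G 1).
have := dot_ge0 Omega (H 0 1); have := dot_ge0 Omega (H 1 0); lra.
Qed.

Lemma lsq_le v : H2 Omega v -> lsq v <= 2 * nsq v.
Proof.
move=> /H2_jet J; rewrite (H2norm_jet oO J); exact: eq_then_le (lap_jet_dot J J) (Nsq_hess J).
Qed.

Lemma lsq_lin (a : R) v w : H2 Omega v -> H2 Omega w ->
  lsq (fun x => a * v x + w x) <= 2 * a ^+ 2 * lsq v + 2 * lsq w.
Proof.
move=> Hv Hw; have lv := L2_lap Hv; have lw := L2_lap Hw.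
have l2 := L2D (L2Z a lv) lw; have l1 := L2_lap (H2_lin oO a Hv Hw).
have E := lap_lin a Hv Hw.
exact: eq_then_le (dot_aeq l1 l2 l1 l2 E E) (dot_lin2 a lv lw).
Qed.

Lemma H20_H2 v : H20 Omega v -> H2 Omega v. Proof. by case. Qed.

Lemma lt_aux (a b c e : R) : b < e / 4 -> c < e / 4 -> a <= 2 * 1 ^+ 2 * b + 2 * c -> a < e.
Proof. by rewrite expr1n => *; lra. Qed.

Lemma coer_aux (K a b c d l m e : R) : 0 <= K -> b <= e / (8 * K + 2) ->
  a <= 2 * 1 ^+ 2 * b + 2 * c -> d <= 2 * (-1) ^+ 2 * l + 2 * m -> l <= 2 * b -> c <= K * d ->
  a <= e + 4 * K * m.
Proof.
move=> K0; rewrite ler_pdivlMr; last by lra.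
rewrite sqrrN !expr1n !mulr1 => hb n1 n2 n3 n4.
have : K * d <= K * (2 * l + 2 * m) by rewrite ler_wpM2l.
have : K * l <= K * (2 * b) by rewrite ler_wpM2l.
lra.
Qed.

(** By density, from the inequality for test functions. *)
Lemma coercive_H20 : exists K : R, 0 <= K /\ forall v, H20 Omega v -> nsq v <= K * lsq v.
Proof.
have [K [K0 HK]] := coercive_test bO; exists (4 * K); split; first by lra.
move=> v /(@H20P _ Omega _)[Hv av]; apply/ler_addgt0Pl => e e0.
have e1 : 0 < e / (8 * K + 2) by rewrite divr_gt0//; lra.
have [phi [tp]] := av _ e1; set D := fun x => _ => hD.
have Hp := H2_test oO tp; have HD : H2 Omega D := H2_lin oO (-1) Hp Hv.
have Ev : v = fun x => 1 * D x + phi x by apply/funext => x; rewrite /D; ring.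
have Ep : phi = fun x => -1 * D x + v x by apply/funext => x; rewrite /D; ring.
have n1 := H2norm_lin oO 1 HD Hp; rewrite -Ev in n1.
have n2 := lsq_lin (-1) HD Hv; rewrite -Ep in n2.
have n3 := lsq_le HD.
have J := jet_test tp.
have n4 : nsq phi <= K * lsq phi.
  by rewrite (H2norm_jet oO J) (lap_jet_dot J J); exact: HK.
exact: (coer_aux K0 (ltW hD) n1 n2 n3 n4).
Qed.

Lemma Nsq_lt v (G : 'I_2 -> P -> R) (H : 'I_2 -> 'I_2 -> P -> R) (e : R) : dot v v < e -> (forall i, dot (G i) (G i) < e) ->
  (forall i j, dot (H i j) (H i j) < e) -> Nsq Omega v G H < 7 * e.
Proof.
move=> h hG hH; rewrite /Nsq sum22 sum2; have := hG 0; have := hG 1.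
have := hH 0 0; have := hH 0 1; have := hH 1 0; have := hH 1 1; lra.
Qed.

Lemma Nsq_ge v (G : 'I_2 -> P -> R) (H : 'I_2 -> 'I_2 -> P -> R) : [/\ dot v v <= Nsq Omega v G H,
  forall i, dot (G i) (G i) <= Nsq Omega v G H & forall i j, dot (H i j) (H i j) <= Nsq Omega v G H].
Proof.
rewrite /Nsq sum22 sum2.
have h := dot_ge0 Omega v; have h0 := dot_ge0 Omega (G 0); have h1 := dot_ge0 Omega (G 1).
have k0 := dot_ge0 Omega (H 0 0); have k1 := dot_ge0 Omega (H 0 1).
have k2 := dot_ge0 Omega (H 1 0); have k3 := dot_ge0 Omega (H 1 1).
split => [|i|i j]; first by lra.
  by case: (ord2P i) => ->; lra.
by case: (ord2P i) => ->; case: (ord2P j) => ->; lra.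
Qed.

(** Coercivity turns a Cauchy sequence for the energy into one in [H^2]; the limits of the function and
    of its derivatives form a jet by [wd_closed], and a diagonal choice of test functions shows that it
    lies in [H^2_0]. *)
Lemma H20_complete (u : nat -> P -> R) : (forall n, H20 Omega (u n)) ->
  (forall e : R, 0 < e -> exists N, forall m n, (N <= m)%N -> (N <= n)%N ->
     lsq (fun x => -1 * u n x + u m x) < e) ->
  exists f, H20 Omega f /\ forall e : R, 0 < e -> exists N, forall n, (N <= n)%N ->
     lsq (fun x => -1 * u n x + f x) < e.
Proof.
move=> Hu Cu; have [K [K0 HK]] := coercive_H20.
have J n := H2_jet (H20_H2 (Hu n)).
have J2 m n := jet_lin (-1) (J n) (J m).
have CN (e : R) : 0 < e -> exists N, forall m n, (N <= m)%N -> (N <= n)%N ->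
    nsq (fun x => -1 * u n x + u m x) < e.
  move=> e0; have e1 : 0 < e / (K + 1) by rewrite divr_gt0//; lra.
  have [N HN] := Cu _ e1; exists N => m n Nm Nn.
  have := HN m n Nm Nn; rewrite ltr_pdivlMr; last by lra.
  have := HK _ (H20_lin oO (-1) (Hu n) (Hu m)).
  have := dot_ge0 Omega (lap (fun x => -1 * u n x + u m x)).
  move: (nsq _) (lsq _) => a b b0 hab hb.
  by apply: (le_lt_trans hab); lra.
have comp (c : nat -> P -> R) : (forall n, L2 (c n)) ->
    (forall m n, dot (fun x => -1 * c n x + c m x) (fun x => -1 * c n x + c m x) <= nsq (fun x => -1 * u n x + u m x)) ->
    exists f, L2 f /\ forall e : R, 0 < e -> exists N, forall n, (N <= n)%N ->
     dot (fun x => -1 * c n x + f x) (fun x => -1 * c n x + f x) < e.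
  move=> lc hc; apply: L2_complete => // e e0; have [N HN] := CN e e0.
  by exists N => m n Nm Nn; apply: le_lt_trans (hc m n) (HN m n Nm Nn).
have cmp m n := Nsq_ge (fun x => -1 * u n x + u m x) (fun i x => -1 * weak_der i (u n) x + weak_der i (u m) x)
    (fun i j x => -1 * weak_der j (weak_der i (u n)) x + weak_der j (weak_der i (u m)) x).
have [f [lf cf]] : exists f, L2 f /\ forall e : R, 0 < e -> exists N, forall n, (N <= n)%N ->
     dot (fun x => -1 * u n x + f x) (fun x => -1 * u n x + f x) < e.
  apply: comp => [n|m n]; first by have [] := jet_L2 (J n).
  by rewrite (H2norm_jet oO (J2 m n)); have [] := cmp m n.
have /choice[G HG] : forall i : 'I_2, exists g, L2 g /\ forall e : R, 0 < e -> exists N, forall n, (N <= n)%N ->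
     dot (fun x => -1 * weak_der i (u n) x + g x) (fun x => -1 * weak_der i (u n) x + g x) < e.
  move=> i; apply: (comp (fun n => weak_der i (u n))) => [n|m n]; first by have [] := jet_L2 (J n).
  by rewrite (H2norm_jet oO (J2 m n)); have [_ h _] := cmp m n; exact: h.
have /choice[H HH] : forall ij : 'I_2 * 'I_2, exists g, L2 g /\ forall e : R, 0 < e -> exists N, forall n, (N <= n)%N ->
     dot (fun x => -1 * weak_der ij.2 (weak_der ij.1 (u n)) x + g x) (fun x => -1 * weak_der ij.2 (weak_der ij.1 (u n)) x + g x) < e.
  move=> [i j]; apply: (comp (fun n => weak_der j (weak_der i (u n)))) => [n|m n]; first by have [] := jet_L2 (J n).
  by rewrite (H2norm_jet oO (J2 m n)); have [_ _ h] := cmp m n; exact: h.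
have flip (a b : P -> R) : dot (fun x => a x - b x) (fun x => a x - b x) =
    dot (fun x => -1 * a x + b x) (fun x => -1 * a x + b x).
  by rewrite dot_sq dotEip; congr Int; apply/funext => x; rewrite !patchE; case: ifP => _; rewrite ?[point](erefl (0 : R)); ring.
have Jf : jet Omega f G (fun i j => H (i, j)).
  split => // [i|i j].
    have [lG cG] := HG i; apply: (wd_closed lf lG) => e e0.
    have [N1 HN1] := cf e e0; have [N2 HN2] := cG e e0.
    have [lun hG hH] := J (maxn N1 N2).
    exists (u (maxn N1 N2)), (weak_der i (u (maxn N1 N2))); split => //.
      by rewrite flip; exact/HN1/leq_maxl.
    by rewrite flip; exact/HN2/leq_maxr.
  have [lG cG] := HG i; have [lH cH] := HH (i, j); apply: (wd_closed lG lH) => e e0.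
  have [N1 HN1] := cG e e0; have [N2 HN2] := cH e e0.
  have [lun hG hH] := J (maxn N1 N2).
  exists (weak_der i (u (maxn N1 N2))), (weak_der j (weak_der i (u (maxn N1 N2)))); split => //.
  - by case: (hG i).
  - by rewrite flip; exact/HN1/leq_maxl.
  - by rewrite flip; exact/HN2/leq_maxr.
have Hf : H2 Omega f by have [] := jet_aeq oO Jf.
have cN (e : R) : 0 < e -> exists N, forall n, (N <= n)%N -> nsq (fun x => -1 * u n x + f x) < e.
  move=> e0; have e7 : 0 < e / 7 by lra.
  have [N1 HN1] := cf _ e7.
  have /choice[N2 HN2] := fun i => (HG i).2 _ e7.
  have /choice[N3 HN3] := fun ij => (HH ij).2 _ e7.
  exists (maxn N1 (maxn (\max_i N2 i) (\max_ij N3 ij))) => n.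
  rewrite !geq_max => /and3P[n1 n2 n3].
  rewrite (H2norm_jet oO (jet_lin (-1) (J n) Jf)).
  have -> : e = 7 * (e / 7) by field.
  apply: Nsq_lt => [|i|i j]; first exact: HN1.
    by apply: HN2; apply: leq_trans n2; exact: leq_bigmax.
  by apply: (HN3 (i, j)); apply: leq_trans n3; exact: leq_bigmax.
exists f; split; last first.
  move=> e e0; have e2 : 0 < e / 2 by lra.
  have [N HN] := cN _ e2; exists N => n Nn.
  have := lsq_le (H2_lin oO (-1) (H20_H2 (Hu n)) Hf); have := HN n Nn.
  by move: (nsq _) (lsq _) => a b ha hb; apply: (le_lt_trans hb); lra.
apply/(@H20P _ Omega _); split => // e e0; have e4 : 0 < e / 4 by lra.
have [n Hn] := cN _ e4; have {}Hn := Hn n (leqnn n).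
have /(@H20P _ Omega _)[Hun /(_ _ e4)[phi [tp hp]]] := Hu n.
exists phi; split => //; have Hp := H2_test oO tp.
have := H2norm_lin oO 1 (H2_lin oO (-1) Hp Hun) (H2_lin oO (-1) Hun Hf).
have -> : (fun x => 1 * (-1 * phi x + u n x) + (-1 * u n x + f x)) = fun x => -1 * phi x + f x.
  by apply/funext => x; ring.
exact: (lt_aux hp Hn).
Qed.

Lemma H20_0 : H20 Omega (fun=> 0).
Proof.
apply: H20_test => //; split; first exact: smooth_cst.
by exists set0; split => //; exact: compact0.
Qed.

(** The Riesz representation theorem for the form [(lap v, lap w)] on [H^2_0]. *)
Lemma biharmonic (F : (P -> R) -> R) (C : R) :
  (forall (a : R) v w, H20 Omega v -> H20 Omega w -> F (fun x => a * v x + w x) = a * F v + F w) ->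
  (forall v, H20 Omega v -> F v ^+ 2 <= C * nsq v) ->
  exists w, H20 Omega w /\ forall v, H20 Omega v -> dot (lap w) (lap v) = F v.
Proof.
move=> Flin Fbd; have [K [K0 HK]] := coercive_H20.
have Vl : forall (a : R) u v, H20 Omega u -> H20 Omega v -> H20 Omega (fun x => a * u x + v x).
  by move=> a u v; exact: H20_lin.
have Bs : forall u v, H20 Omega u -> H20 Omega v -> dot (lap u) (lap v) = dot (lap v) (lap u).
  by move=> u v _ _; exact: dotC.
have Bl : forall (a : R) u v w, H20 Omega u -> H20 Omega v -> H20 Omega w ->
    dot (lap (fun x => a * u x + v x)) (lap w) = a * dot (lap u) (lap w) + dot (lap v) (lap w).
  by move=> a u v w Hu Hv Hw; apply: lap_dot_lin; exact: H20_H2.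
have Bg : forall u, H20 Omega u -> 0 <= dot (lap u) (lap u) by move=> u _; exact: dot_ge0.
have ne : exists v, H20 Omega v by exists (fun=> 0); exact: H20_0.
have Fb : forall v, H20 Omega v -> F v ^+ 2 <= (`|C| * K) * dot (lap v) (lap v).
  move=> v Hv; apply: (le_trans (Fbd v Hv)).
  have n0 := sqr_ge0 (H2norm Omega v); have h := HK v Hv.
  rewrite -mulrA; apply: (@le_trans _ _ (`|C| * nsq v)).
    by rewrite ler_wpM2r// ler_norm.
  by rewrite ler_wpM2l.
exact: (@riesz _ _ (H20 Omega) (fun u v => dot (lap u) (lap v)) Vl Bs Bl Bg F _ ne H20_complete Flin Fb).
Qed.

Lemma biharmonic_Hm2 F : Hm2 Omega F ->
  exists w, H20 Omega w /\ forall v, H20 Omega v -> dot (lap w) (lap v) = F v.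
Proof.
move=> [Flin [C HC]]; apply: (biharmonic (C := C ^+ 2)) => // v Hv.
rewrite -exprMn -[leLHS]real_normK ?num_real//.
by rewrite lerXn2r ?nnegrE ?HC// (le_trans _ (HC v Hv)).
Qed.

(** Boundedness and the density of test functions in [H^2_0]. *)
Lemma Hm2_unique F F' : Hm2 Omega F -> Hm2 Omega F' -> dist_eq Omega F F' ->
  forall v, H20 Omega v -> F v = F' v.
Proof.
move=> [Fl [C HC]] [Fl' [C' HC']] E v Hv; apply/eqP; rewrite -subr_eq0; apply/eqP.
apply: (@le_eps0 _ _ (2 * C ^+ 2 + 2 * C' ^+ 2)) => e e0.
have /(@H20P _ Omega _)[_ /(_ _ e0)[phi [tp hp]]] := Hv; have Hp := H20_test oO tp.
have HD := H20_lin oO (-1) Hp Hv.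
have k (a b : R) : `|a| <= b -> a ^+ 2 <= b ^+ 2.
  by move=> h; rewrite -[leLHS]real_normK ?num_real// lerXn2r ?nnegrE// (le_trans _ h).
have k1 := k _ _ (HC _ HD); have k2 := k _ _ (HC' _ HD).
rewrite Fl// in k1; rewrite Fl'// -E// in k2; rewrite !exprMn in k1 k2.
have -> : F v - F' v = (-1 * F phi + F v) + - (-1 * F phi + F' v) by ring.
apply: (le_trans (sqr_le2 _ _)); rewrite sqrrN.
have h1 := ler_wpM2l (sqr_ge0 C) (ltW hp); have h2 := ler_wpM2l (sqr_ge0 C') (ltW hp).
lra.
Qed.

(** The pairing is computed by any bounded extension, as it is unique on [H^2_0]. *)
Lemma pairing_eq T F v : Hm2 Omega F -> dist_eq Omega T F -> H20 Omega v ->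
  pairing Omega T v = F v.
Proof.
move=> HF TF Hv; rewrite /pairing; set S := [set F | _].
have [H1 H2] : S (get S) by apply: (@getI _ _ F).
apply: Hm2_unique => // phi tp; by rewrite -H2// TF.
Qed.

End H20Riesz.

(** * Convolution *)

Section Convolution.
Context {R : realType}.
Local Notation P := (R * R)%type.
Local Notation mu := (@leb2 R).
Implicit Types (f g h k phi : P -> R) (A B : set P) (x y : P).

Lemma derive_shift g (v x : P) : (fun y => 'D_v (fun z => g (z - x)) y) = fun y => 'D_v g (y - x).
Proof.
apply/funext => y; rewrite /derive.
apply: (congr1 (fun F : R -> R => lim (F t @[t --> 0^']))).
by apply/funext => t /=; rewrite addrA.
Qed.

Lemma foldr_shift g x s :
  foldr (@pder R) (fun z => g (z - x)) s = fun y => foldr (@pder R) g s (y - x).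
Proof.
elim: s => [//|i s IH] /=; rewrite IH; apply/funext => y.
exact: (congr1 (fun f => f y) (derive_shift _ _ _)).
Qed.

Lemma pder_shift i g x : pder i (fun z => g (z - x)) = fun y => pder i g (y - x).
Proof. exact: (foldr_shift g x [:: i]). Qed.

Lemma smooth_shift g x : smooth g -> smooth (fun z => g (z - x)).
Proof.
move=> /smoothP sg; apply/smoothP => n; have := Ck_affine 1 (- x) (sg n).
by apply: Ck_ext => y; rewrite scale1r.
Qed.

Lemma smooth_reflect g y : smooth g -> smooth (fun x => g (y - x)).
Proof.
move=> /smoothP sg; apply/smoothP => n; have := Ck_affine (-1) y (sg n).
by apply: Ck_ext => x; rewrite scaleN1r addrC.
Qed.

Lemma test_shift Omega r g x : test_function (box 0 r) g -> box x r `<=` Omega ->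
  test_function Omega (fun z => g (z - x)).
Proof.
move=> [sg [K [cK Kr K0]]] xO; split; first exact: smooth_shift.
exists ((fun z => z + x) @` K); split.
- apply: continuous_compact => //; apply: continuous_subspaceT => z.
  by apply: cvgD; [exact: cvg_id | exact: cvg_cst].
- move=> _ [z Kz <-]; apply: xO; apply/boxP; rewrite addrK.
  by have /boxP := Kr z Kz; rewrite subr0.
- move=> z nz; apply: K0 => Kz; apply: nz; exists (z - x) => //; exact: subrK.
Qed.

Lemma test_mono A B g : A `<=` B -> test_function A g -> test_function B g.
Proof.
by move=> AB [sg [K [cK KA K0]]]; split => //; exists K; split => //; exact: subset_trans AB.
Qed.

Lemma norm_fst x : `|x.1| <= `|x|. Proof. by have := norm_pair x `|x|; rewrite lexx => /esym/andP[]. Qed.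
Lemma norm_snd x : `|x.2| <= `|x|. Proof. by have := norm_pair x `|x|; rewrite lexx => /esym/andP[]. Qed.

Lemma test_lip A g : test_function A g ->
  exists C : R, 0 <= C /\ forall x y, `|g x - g y| <= C * `|x - y|.
Proof.
move=> tg; have [C0 [C00 H0]] := test_bounded (test_pder 0 tg).
have [C1 [C10 H1]] := test_bounded (test_pder 1 tg).
exists (C0 + C1); split; first by rewrite addr_ge0.
move=> x y.
have h0 : `|g (x.1, x.2) - g (y.1, x.2) - 0 * (x.1 - y.1)| <= C0 * `|x.1 - y.1|.
  apply: (mvt_bound (f := fun t => g (t, x.2)) (df := fun t => pder 0 g (t, x.2))) => t _; last by rewrite subr0.
  have := @d_line0 _ g 0 x.2 t _ (test_der 0 _ tg); rewrite add0r => h.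
  by rewrite (_ : (fun t => g (t, x.2)) = fun s => g (0 + s, x.2))//; apply/funext => s; rewrite add0r.
have h1 : `|g (y.1, x.2) - g (y.1, y.2) - 0 * (x.2 - y.2)| <= C1 * `|x.2 - y.2|.
  apply: (mvt_bound (f := fun t => g (y.1, t)) (df := fun t => pder 1 g (y.1, t))) => t _; last by rewrite subr0.
  have := @d_line1 _ g y.1 0 t _ (test_der 1 _ tg); rewrite add0r => h.
  by rewrite (_ : (fun t => g (y.1, t)) = fun s => g (y.1, 0 + s))//; apply/funext => s; rewrite add0r.
rewrite !mul0r !subr0 in h0 h1.
have n1 : C0 * `|x.1 - y.1| <= C0 * `|x - y| by rewrite ler_wpM2l//; exact: (norm_fst (x - y)).
have n2 : C1 * `|x.2 - y.2| <= C1 * `|x - y| by rewrite ler_wpM2l//; exact: (norm_snd (x - y)).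
have E : g x - g y = (g (x.1, x.2) - g (y.1, x.2)) + (g (y.1, x.2) - g (y.1, y.2)).
  by rewrite addrA subrK; case: (x) (y) => ? ? [? ?].
rewrite E (le_trans (ler_normD _ _))//; lra.
Qed.

Lemma norm_dir i : `|dir i : P| <= 1.
Proof.
by rewrite norm_pair /dir; case: (i == 0); rewrite /= normr0 normr1 lexx ler01.
Qed.

Lemma test_taylor A g i : test_function A g ->
  exists C : R, 0 <= C /\ forall y (t : R), `|g (t *: dir i + y) - g y - t * pder i g y| <= C * t ^+ 2.
Proof.
move=> tg; have [C [C0 HC]] := test_lip (test_pder i tg); exists C; split => // y t.
have := @mvt_bound _ (fun s => g (y + s *: dir i)) (fun s => pder i g (y + s *: dir i)) 0 t (pder i g y) (C * `|t|).
rewrite subr0 scale0r addr0 -mulrA -expr2 real_normK ?num_real// (addrC y) (mulrC t); apply => s hs.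
  exact: (d_line g y (dir i) s _).1 (test_der i _ tg).
rewrite subr0 in hs; apply: (le_trans (HC _ _)); rewrite ler_wpM2l// addrC addKr normrZ.
by rewrite (le_trans (ler_wpM2l _ (norm_dir i)))// mulr1.
Qed.

Lemma lip_cont g (C : R) : 0 <= C -> (forall x y, `|g x - g y| <= C * `|x - y|) -> continuous g.
Proof.
move=> C0 H y; apply/cvgrPdist_le => e e0.
have d0 : 0 < e / (C + 1) by rewrite divr_gt0//; lra.
apply: filterS (nbhsx_ballx y _ d0) => z /ball2E[/ltW h1 /ltW h2].
have h : `|y - z| <= e / (C + 1) by rewrite norm_pair; apply/andP.
apply: (le_trans (H y z)); move: h; rewrite ler_pdivlMr; last by lra.
by have := normr_ge0 (y - z) => h0 h; lra.
Qed.

Definition conv phi k y : R := Int (fun x => phi x * k (y - x)).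

Lemma reflect_cont k y : continuous k -> continuous (fun x => k (y - x)).
Proof.
move=> ck x; apply: (@continuous_comp _ _ _ (fun x => y - x) k); last exact: ck.
by apply: cvgB; [exact: cvg_cst | exact: cvg_id].
Qed.

Lemma intg_mul_bdd phi k (C : R) : intg phi -> mfun2 k -> (forall x, `|k x| <= C) -> intg (fun x => phi x * k x).
Proof.
move=> ip mk kC; apply: (@intg_le _ _ (fun x => C * `|phi x|)).
- by apply: mfunM => //; exact: intg_mfun.
- by apply: intgZ; exact: intg_norm.
- by move=> x; rewrite normrM mulrC ler_wpM2r.
Qed.

Lemma intg_conv phi A k y : intg phi -> test_function A k -> intg (fun x => phi x * k (y - x)).
Proof.
move=> ip tk; have [C [_ HC]] := test_bounded tk; apply: (@intg_mul_bdd _ _ C) => //.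
by apply: continuous_mfun; apply: reflect_cont; exact: test_cont tk.
Qed.

Lemma Int_mul_bdd phi k (C : R) : intg phi -> mfun2 k -> (forall x, `|k x| <= C) ->
  `|Int (fun x => phi x * k x)| <= C * Int (fun x => `|phi x|).
Proof.
move=> ip mk kC; have I := intg_mul_bdd ip mk kC; apply: (le_trans (le_norm_Int I)).
rewrite -IntZ; last exact: intg_norm.
apply: le_Int; [exact: intg_norm | by apply: intgZ; exact: intg_norm |].
by move=> x; rewrite normrM mulrC ler_wpM2r.
Qed.

(** Differentiation under the integral sign, by a Taylor estimate uniform in the point. *)
Lemma conv_der phi A k i y : intg phi -> test_function A k ->
  is_derive y (dir i) (conv phi k) (conv phi (pder i k) y).
Proof.
move=> ip tk; apply/derE => e e0; have [C [C0 HC]] := test_taylor i tk.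
have tdk := test_pder i tk; set I := Int (fun x => `|phi x|).
have I0 : 0 <= I by apply: Int_ge0 => x.
have CI := mulr_ge0 C0 I0.
exists (e / (C * I + 1)); split => [|h hd]; first by rewrite divr_gt0//; lra.
have -> : conv phi k (h *: dir i + y) - conv phi k y - h * conv phi (pder i k) y =
    Int (fun x => phi x * (k (h *: dir i + (y - x)) - k (y - x) - h * pder i k (y - x))).
  have i1 := intg_conv (h *: dir i + y) ip tk; have i2 := intg_conv y ip tk; have i3 := intg_conv y ip tdk.
  rewrite /conv -IntB// -IntZ// -IntB; [|exact: intgB|exact: intgZ].
  by congr Int; apply/funext => x; rewrite addrA; ring.
apply: (le_trans (Int_mul_bdd (C := C * h ^+ 2) ip _ _)).
- apply: mfunB; first apply: mfunB.
  + apply: continuous_mfun; have := @reflect_cont k (h *: dir i + y) (test_cont tk).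
    by rewrite (_ : (fun x => k (_ - x)) = fun x => k (h *: dir i + (y - x)))//; apply/funext => x; rewrite addrA.
  + by apply: continuous_mfun; apply: reflect_cont; exact: test_cont tk.
  + by apply: mfunZ; apply: continuous_mfun; apply: reflect_cont; exact: test_cont tdk.
- by move=> x; exact: HC.
rewrite -/I -(real_normK (num_real h)) mulrAC expr2 mulrA ler_wpM2r//.
move: hd; rewrite ltr_pdivlMr; last by lra.
by have := normr_ge0 h => h0 h1; lra.
Qed.

Lemma conv_cont phi A k : intg phi -> test_function A k -> continuous (conv phi k).
Proof.
move=> ip tk; have [C [C0 HC]] := test_lip tk; set I := Int (fun x => `|phi x|).
have I0 : 0 <= I by apply: Int_ge0 => x.
apply: (@lip_cont _ (C * I)) => [|y z]; first exact: mulr_ge0.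
have -> : conv phi k y - conv phi k z = Int (fun x => phi x * (k (y - x) - k (z - x))).
  have i1 := intg_conv z ip tk; have i2 := intg_conv y ip tk.
  by rewrite /conv -IntB//; congr Int; apply/funext => x; ring.
rewrite mulrAC; apply: (Int_mul_bdd ip).
- apply: mfunB; apply: continuous_mfun; apply: reflect_cont; exact: test_cont tk.
- move=> x; apply: (le_trans (HC _ _)); rewrite ler_wpM2l//.
  by rewrite (_ : y - x - (z - x) = y - z)// opprB addrA subrK.
Qed.

Lemma foldr_conv phi A k s : intg phi -> test_function A k ->
  foldr (@pder R) (conv phi k) s = conv phi (foldr (@pder R) k s).
Proof.
move=> ip tk; elim: s => [//|i s IH] /=; rewrite IH; apply/funext => y.
by have [_ E] := conv_der i y ip (test_foldr s tk); exact: E.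
Qed.

Lemma smooth_conv phi A k : intg phi -> test_function A k -> smooth (conv phi k).
Proof.
move=> ip tk s; rewrite (foldr_conv s ip tk); have ts := test_foldr s tk.
split; first exact: conv_cont ip ts.
by move=> i x; have [] := conv_der i x ip ts.
Qed.

Lemma test_conv Omega phi k r (K : set P) : intg phi -> compact K -> (forall x, ~ K x -> phi x = 0) ->
  (forall x, K x -> box x r `<=` Omega) -> test_function (box 0 r) k ->
  test_function Omega (conv phi k).
Proof.
move=> ip cK K0 KO tk; split; first exact: smooth_conv ip tk.
have [_ [L [cL Lr L0]]] := tk.
exists ((fun z : P * P => z.1 + z.2) @` (K `*` L)); split.
- apply: continuous_compact; last exact: compact_setX.
  apply: continuous_subspaceT => z; apply: cvgD; [exact: cvg_fst | exact: cvg_snd].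
- move=> _ [[a b] [/= Ka Lb] <-]; apply: (KO a Ka); apply/boxP; rewrite addrAC subrr add0r.
  by have /boxP := Lr b Lb; rewrite subr0.
- move=> y ny; rewrite /conv -[RHS](@Int0 R); congr Int; apply/funext => x.
  have [Kx|/K0 ->] := pselect (K x); last by rewrite mul0r.
  rewrite L0 ?mulr0// => Ly; apply: ny; exists (x, y - x) => //=.
  by rewrite addrC subrK.
Qed.

Lemma pder_reflect i k y x : smooth k -> pder i (fun x => k (y - x)) x = - pder i k (y - x).
Proof.
move=> sk; have /smoothP/(_ 1%N)/Ck_der/(_ i) dk := sk.
have : is_derive x (dir i) (fun z => k ((-1) *: z + y)) (-1 * pder i k (y - x)).
  by apply: d_affine; rewrite scaleN1r addrC; exact: dk.
rewrite mulN1r => -[_ <-].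
apply: (congr1 (fun F : P -> R => 'D_(dir i) F x)).
by apply/funext => z; rewrite scaleN1r addrC.
Qed.

Lemma conv_swap Omega phi A k i : test_function Omega phi -> test_function A k ->
  conv phi (pder i k) = conv (pder i phi) k.
Proof.
move=> tp tk; apply/funext => y; have sk : smooth k by case: tk.
have := int_by_parts i tp (smooth_reflect y sk).
rewrite (_ : (fun x => phi x * _) = fun x => - (phi x * pder i k (y - x))); last first.
  by apply/funext => x; rewrite pder_reflect// mulrN.
rewrite IntN; last exact: intg_conv (intg_test tp) (test_pder i tk).
by move/oppr_inj.
Qed.

Lemma foldr_conv_swap Omega phi A k s : test_function Omega phi -> test_function A k ->
  foldr (@pder R) (conv phi k) s = conv (foldr (@pder R) phi s) k.
Proof.
move=> tp tk; elim: s => [//|i s IH] /=; rewrite IH.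
have ts := test_foldr s tp; rewrite -(conv_swap i ts tk).
exact: (foldr_conv [:: i] (intg_test ts) tk).
Qed.

End Convolution.

(** * Derivatives of square integrable functions as distributions *)

Section Distributions.
Context {R : realType}.
Local Notation P := (R * R)%type.
Local Notation MP := (measurableTypeR R * measurableTypeR R)%type.
Local Notation mu := (@leb2 R).
Implicit Types (f g h k phi psi : P -> R) (A B : set P) (x y : P) (D E : (P -> R) -> R).

Lemma box_ball x r (e : R) : r < e -> box x r `<=` ball x e.
Proof.
move=> re y /boxE[h1 h2]; apply/ball2E; rewrite (distrC x.1) (distrC x.2).
by split; apply: le_lt_trans re.
Qed.

Lemma compact_margin A (K : set P) : open A -> compact K -> K `<=` A ->
  exists r : R, 0 < r /\ forall x, K x -> box x r `<=` A.
Proof.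
move=> oA /compact_near_coveringP cK KA.
have := cK R (0 : R)^'+ (fun r x => box x r `<=` A) _ _.
case=> [x Kx|d /= d0 Hd].
  have /nbhs_ballP[e /= e0 xe] : nbhs x A by apply: open_nbhs_nbhs; split => //; exact: KA.
  have e20 : 0 < e / 2 by rewrite divr_gt0.
  exists (ball x (e / 2), `]-oo, e / 2[%classic) => /=.
    by split; [exact: nbhsx_ballx | exact: nbhs_right_lt].
  move=> [x' r] /= [x'x]; rewrite in_itv/= => re z /(box_ball re) zx'.
  by apply: xe; rewrite (splitr e); exact: ball_triangle zx'.
exists (d / 2); split; first by rewrite divr_gt0.
apply: (Hd (d / 2)); last by rewrite divr_gt0.
by rewrite /= sub0r normrN ger0_norm ?ltr_pdivrMr ?mulr_natr ?mulr2n ?ltrDl// divr_ge0// ltW.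
Qed.

Variable Omega : set P.
Hypothesis oO : open Omega.
Hypothesis bO : bounded_set Omega.
Local Notation L2 := (L2 Omega).
Local Notation dot := (dot Omega).
Local Notation test := (test_function Omega).

(** Finite sums of derivatives of square integrable functions. This class is closed under the
    operations that are needed, and its elements are continuous and commute with convolution. *)
Inductive dist : ((P -> R) -> R) -> Prop :=
| dist_L2 T of L2 T : dist (dist_of Omega T)
| dist_lin (a : R) D E of dist D & dist E : dist (fun phi => a * D phi + E phi)
| dist_d i D of dist D : dist (dist_der i D).

Lemma L2_intg T : L2 T -> intg (T \_ Omega).
Proof.
move=> /L2P sT; have [M [M0 HM]] := bounded_box bO.
have sbox : sqi (\1_(box (0 : P) M)).
  split; first by apply: mfun_indic; exact: mset_box.
  rewrite (_ : (fun x => _) = \1_(box (0 : P) M)); first exact: intg_box.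
  by apply/funext => x; rewrite indicE; case: (_ \in _); rewrite ?expr1n ?expr0n.
have := sqi_mul sT sbox; rewrite (_ : (fun x => _) = T \_ Omega)//.
apply/funext => x; rewrite patchE; case: ifPn => xO; last by rewrite mul0r.
by rewrite indicE mem_set ?mulr1//; apply: HM; rewrite inE in xO.
Qed.

Lemma dist_ofE T phi : dist_of Omega T phi = Int (fun x => (T \_ Omega) x * phi x).
Proof. exact: dotE. Qed.

Lemma dist_linear D : dist D -> forall (a : R) phi psi, test phi -> test psi ->
  D (fun x => a * phi x + psi x) = a * D phi + D psi.
Proof.
elim=> {D} [T lT|b D E _ HD _ HE|i D _ HD] a phi psi tp ts.
- have lp := L2_test tp; have ls := L2_test ts.
  exact: etrans (dotDr lT (L2Z a lp) ls) (congr1 (fun z => z + _) (dotZr _ lT lp)).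
- by rewrite HD// HE//; ring.
- have E : pder i (fun x => a * phi x + psi x) = fun x => a * pder i phi x + pder i psi x.
    apply/funext => x; have [st _] := testZ a tp; have [sp _] := tp; have [ss _] := ts.
    exact: etrans (pderD i x st ss) (congr1 (fun z => z + _) (pderZ i a x sp)).
  have F := HD a _ _ (test_pder i tp) (test_pder i ts); rewrite -E in F.
  by rewrite /dist_der F; ring.
Qed.

(** Distributions of the class have finite order, uniformly on [Omega]. *)
Lemma dist_bounded D : dist D -> exists (n : nat) (C : R), 0 <= C /\
  forall phi (B : R), test phi ->
    (forall s, (size s <= n)%N -> forall x, `|foldr (@pder R) phi s x| <= B) -> `|D phi| <= C * B.
Proof.
elim=> {D} [T lT|a D E _ [n [C [C0 HC]]] _ [n' [C' [C0' HC']]]|i D _ [n [C [C0 HC]]]].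
- exists 0%N, (Int (fun x => `|(T \_ Omega) x|)); split; first exact: Int_ge0.
  move=> phi B tp HB; rewrite dist_ofE mulrC; apply: Int_mul_bdd; first exact: L2_intg.
    exact: continuous_mfun (test_cont tp).
  exact: (HB [::]).
- exists (maxn n n'), (`|a| * C + C'); split; first by rewrite addr_ge0// mulr_ge0.
  move=> phi B tp HB; apply: (le_trans (ler_normD _ _)); rewrite mulrDl lerD//.
    rewrite normrM -mulrA ler_wpM2l//; apply: HC => // s hs; apply: HB.
    by rewrite (leq_trans hs)// leq_maxl.
  by apply: HC' => // s hs; apply: HB; rewrite (leq_trans hs)// leq_maxr.
- exists n.+1, C; split => // phi B tp HB; rewrite /dist_der normrN.
  apply: HC; first exact: test_pder.
  by move=> s hs; rewrite -foldr_pder_rcons; apply: HB; rewrite size_rcons.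
Qed.

Lemma mfun_prod (F : P * P -> R) phi T k :
  mfun2 phi -> mfun2 T -> mfun2 k -> (forall z, F z = phi z.1 * (T z.2 * k (z.2 - z.1))) ->
  @measurable_fun _ _ (MP * MP)%type (measurableTypeR R) setT F.
Proof.
move=> mphi mT mk HF; rewrite (_ : F = fun z => phi z.1 * (T z.2 * k (z.2 - z.1))); last exact/funext.
have m1 : @measurable_fun _ _ (MP * MP)%type MP setT (fun z => z.1) by exact: measurable_fst.
have m2 : @measurable_fun _ _ (MP * MP)%type MP setT (fun z => z.2) by exact: measurable_snd.
apply: (@measurable_funM _ (MP * MP)%type R setT); first exact: (measurableT_comp mphi m1).
apply: (@measurable_funM _ (MP * MP)%type R setT); first exact: (measurableT_comp mT m2).
have m12 : @measurable_fun _ _ (MP * MP)%type MP setT (fun z => (z.2 : P) - z.1).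
  apply/measurable_fun_pairP; split.
    apply: (@measurable_funB _ (MP * MP)%type R setT (fun z => z.2.1) (fun z => z.1.1)).
      exact: (measurableT_comp measurable_fst m2).
    exact: (measurableT_comp measurable_fst m1).
  apply: (@measurable_funB _ (MP * MP)%type R setT (fun z => z.2.2) (fun z => z.1.2)).
    exact: (measurableT_comp measurable_snd m2).
  exact: (measurableT_comp measurable_snd m1).
exact: (measurableT_comp mk m12).
Qed.

(** Convolution with [k] may be moved from the test function to the distribution: by Fubini's theorem
    for square integrable functions, and by induction for the rest of the class. *)
Lemma dist_conv D : dist D -> forall phi k r (K : set P), test phi -> compact K ->
  (forall x, ~ K x -> phi x = 0) -> (forall x, K x -> box x r `<=` Omega) ->
  test_function (box 0 r) k ->
  intg (fun x => phi x * D (fun y => k (y - x))) /\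
  D (conv phi k) = Int (fun x => phi x * D (fun y => k (y - x))).
Proof.
elim=> {D} [T lT|a D E _ HD _ HE|i D _ HD] phi k r K tp cK K0 KO tk.
- have iT := L2_intg lT; have ip := intg_test tp.
  have [C [C0 HC]] := test_bounded tk; have ck := test_cont tk; have cp := test_cont tp.
  have mk := continuous_mfun ck; have mp := continuous_mfun cp.
  have msh x : mfun2 (fun y => k (y - x)) by apply: continuous_mfun; exact: test_cont (test_mono (@subsetT _ _) (test_shift tk (@subsetT _ (box x r)))).
  have [|||||I1 I2 EI] := @fubini2 _ (fun x y => phi x * ((T \_ Omega) y * k (y - x)))
     (fun y => (C * Int (fun x => `|phi x|)) * `|(T \_ Omega) y|).
  + by apply: (@mfun_prod _ phi (T \_ Omega) k) => //; exact: intg_mfun.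
  + by move=> x; apply: intgZ; apply: (@intg_mul_bdd _ _ _ C).
  + move=> y; rewrite (_ : (fun x => _) = fun x => (T \_ Omega) y * (phi x * k (y - x))).
      by apply: intgZ; exact: intg_conv ip tk.
    by apply/funext => x; ring.
  + by apply: intgZ; exact: intg_norm.
  + move=> y; have Iy := intg_norm (intg_conv y ip tk).
    rewrite (_ : (fun x => _) = fun x => `|(T \_ Omega) y| * `|phi x * k (y - x)|); last first.
      by apply/funext => x; rewrite -normrM; congr `|_|; ring.
    rewrite IntZ// mulrC ler_wpM2r// -IntZ; last exact: intg_norm.
    apply: le_Int => //; first by apply: intgZ; exact: intg_norm.
    by move=> x; rewrite normrM mulrC ler_wpM2r.
  have Ed x : phi x * dist_of Omega T (fun y => k (y - x)) = Int (fun y => phi x * ((T \_ Omega) y * k (y - x))).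
    have I := intg_mul_bdd iT (msh x) (fun y => HC (y - x)).
    exact: etrans (congr1 (fun z => phi x * z) (dist_ofE _ _)) (esym (IntZ _ I)).
  rewrite (_ : (fun x => _) = fun x => Int (fun y => phi x * ((T \_ Omega) y * k (y - x)))); last exact/funext.
  split; first exact: I1.
  rewrite EI dist_ofE.
  apply: (congr1 (@Int R)); apply/funext => y.
  rewrite -IntZ; last exact: intg_conv ip tk.
  by congr Int; apply/funext => x; ring.
- have [I1 E1] := HD phi k r K tp cK K0 KO tk; have [I2 E2] := HE phi k r K tp cK K0 KO tk.
  rewrite (_ : (fun x => _) = fun x => a * (phi x * D (fun y => k (y - x))) + phi x * E (fun y => k (y - x))).
    by split; [apply: intgD => //; exact: intgZ | rewrite IntD ?IntZ// ?E1 ?E2//; exact: intgZ].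
  by apply/funext => x; ring.
- have [I1 E1] := HD phi (pder i k) r K tp cK K0 KO (test_pder i tk).
  have Ex x : dist_der i D (fun y => k (y - x)) = - D (fun y => pder i k (y - x)).
    by rewrite /dist_der pder_shift.
  rewrite (_ : (fun x => _) = fun x => - (phi x * D (fun y => pder i k (y - x)))); last first.
    by apply/funext => x; rewrite Ex mulrN.
  split; first exact: intgN.
  rewrite IntN// -E1 /dist_der; congr (- D _).
  exact: (foldr_conv [:: i] (intg_test tp) tk).
Qed.

End Distributions.

(** * Mean value kernels *)

Section Kernel.
Context {R : realType}.
Local Notation P := (R * R)%type.
Implicit Types (x y : P).
Local Notation C1k := (Ck (fun _ : unit => (1 : R))).
Local Notation C2k := (Ck (@dir R)).

Definition nrm2 y : R := y.1 * y.1 + y.2 * y.2.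

Lemma Ck_nrm2 n : C2k n nrm2.
Proof. by apply: CkD; apply: CkM; try exact: Ck_fst; exact: Ck_snd. Qed.

Lemma nrm2_out r y : 0 <= r -> ~ box 0 r y -> r ^+ 2 <= nrm2 y.
Proof.
move=> r0 nb; rewrite /nrm2 -!expr2 leNgt; apply/negP => h; apply: nb; apply/boxE.
rewrite !subr0 -(ler_pXn2r (n := 2))// ?nnegrE// real_normK ?num_real//.
rewrite -(ler_pXn2r (n := 2) _ (normr_ge0 y.2))// ?nnegrE// (real_normK (num_real y.2)).
by have := sqr_ge0 y.1; have := sqr_ge0 y.2; split; lra.
Qed.

Lemma compact_box (r : R) x : compact (box x r).
Proof. by apply: compact_setX; exact: segment_compact. Qed.

Lemma d_nrm2_0 y : is_derive y (dir 0) nrm2 (2 * y.1).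
Proof.
have h1 := d_fst y (dir 0); have h2 := d_snd y (dir 0); rewrite dir0/= in h1 h2.
by rewrite dir0; apply: d_eq (dD (dM h1 h1) (dM h2 h2)) _ => /=; ring.
Qed.
Lemma d_nrm2_1 y : is_derive y (dir 1) nrm2 (2 * y.2).
Proof.
have h1 := d_fst y (dir 1); have h2 := d_snd y (dir 1); rewrite dir1/= in h1 h2.
by rewrite dir1; apply: d_eq (dD (dM h1 h1) (dM h2 h2)) _ => /=; ring.
Qed.

Lemma smooth_radial (G : R -> R) : (forall n, C1k n G) -> smooth (fun y : P => G (nrm2 y)).
Proof. by move=> CG; apply/smoothP => n; apply: Ck_comp; [exact: CG | exact: Ck_nrm2]. Qed.

Lemma d_val (f : P -> R) y v (df : R) : is_derive y v f df -> 'D_v f y = df.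
Proof. by case. Qed.

Lemma lapt_radial (G g g' : R -> R) : (forall t : R, is_derive t 1 G (g t)) ->
  (forall t : R, is_derive t 1 g (g' t)) ->
  lapt (fun y : P => G (nrm2 y)) = fun y => 4 * (nrm2 y * g' (nrm2 y) + g (nrm2 y)).
Proof.
move=> dG dg.
have E0 : pder 0 (fun y : P => G (nrm2 y)) = fun y => g (nrm2 y) * (2 * y.1).
  by apply/funext => y; exact: (d_val (d_comp (d_nrm2_0 y) (dG _))).
have E1 : pder 1 (fun y : P => G (nrm2 y)) = fun y => g (nrm2 y) * (2 * y.2).
  by apply/funext => y; exact: (d_val (d_comp (d_nrm2_1 y) (dG _))).
have F0 y : pder 0 (fun y : P => g (nrm2 y) * (2 * y.1)) y = g (nrm2 y) * 2 + 2 * y.1 * (g' (nrm2 y) * (2 * y.1)).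
  have h := d_fst y (dir 0); rewrite {2}dir0/= in h.
  have := d_val (dM (d_comp (d_nrm2_0 y) (dg _)) (dZ 2 h)); rewrite mulr1; exact.
have F1 y : pder 1 (fun y : P => g (nrm2 y) * (2 * y.2)) y = g (nrm2 y) * 2 + 2 * y.2 * (g' (nrm2 y) * (2 * y.2)).
  have h := d_snd y (dir 1); rewrite {2}dir1/= in h.
  have := d_val (dM (d_comp (d_nrm2_1 y) (dg _)) (dZ 2 h)); rewrite mulr1; exact.
rewrite /lapt E0 E1; apply/funext => y; rewrite F0 F1 /nrm2; ring.
Qed.

Lemma d_scale (f : R -> R) (df a t : R) : is_derive (t * a) 1 f df ->
  is_derive t 1 (fun s : R => f (s * a)) (a * df).
Proof.
move=> h; have h1 : is_derive t (1 : R) (fun s : R => s * a) a.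
  by apply: d_eq (dM (is_derive_id _ _) (dC a _ _)) _; ring.
by rewrite mulrC; exact: d_comp h1 h.
Qed.

Lemma Ck1_scale n (f : R -> R) (a : R) : C1k n f -> C1k n (fun s : R => f (s * a)).
Proof.
move=> Cf; have := Ck_affine a (0 : R) Cf; apply: Ck_ext => s.
by rewrite addr0 /GRing.scale/= mulrC.
Qed.

(** The kernels are [m (|y|^2 / r^2) / r^2], normalized. The difference of two of them is the Laplacian
    of a radial function [G (|y|^2)] with compact support: the equation reads [4 (t g)' = k'] for [g = G'],
    where [k t = M (t / r^2) - M (t / s^2)] vanishes both near [0] and for large [t], whence [g = k / (4 t)]. *)
Lemma kernel_exists : exists rho : R -> P -> R, forall r : R, 0 < r ->
  [/\ test_function (box 0 r) (rho r), forall x y, rho r (x - y) = rho r (y - x),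
      forall y, 0 <= rho r y, Int (rho r) = 1 &
      (forall y, rho r y = r^-1 ^+ 2 * rho 1 (r^-1 *: y)) /\
      forall s : R, 0 < s -> exists W, test_function (box 0 (Num.max r s)) W /\
        forall y, lapt W y = rho r y - rho s y].
Proof.
have [m [M [Cm CM dM0 [m0 mz] [M0 M1]]]] := @smooth_step R.
pose rh (r : R) y := r^-1 ^+ 2 * m (nrm2 y * r^-1 ^+ 2).
have sm r : smooth (rh r).
  have C n : C1k n (fun t => r^-1 ^+ 2 * m (t * r^-1 ^+ 2)) by apply: CkZ; exact: Ck1_scale.
  exact: (smooth_radial C).
have out (r t : R) : 0 < r -> r ^+ 2 <= t -> 1 <= t * r^-1 ^+ 2.
  move=> r0 h; have r20 : 0 < r^-1 ^+ 2 by rewrite exprn_gt0 ?invr_gt0.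
  by rewrite -(ler_pM2r r20) -exprMn divff ?expr1n// gt_eqF in h.
have tm r : 0 < r -> test_function (box 0 r) (rh r).
  move=> r0; split; first exact: sm.
  exists (box 0 r); split => //; first exact: compact_box.
  by move=> y ny; rewrite /rh mz ?mulr0//; right; apply: out => //; apply: nrm2_out => //; exact: ltW.
have diff (r s : R) : 0 < r -> 0 < s -> exists W, test_function (box 0 (Num.max r s)) W /\
        forall y, lapt W y = rh r y - rh s y.
  move=> r0 s0; pose k t := M (t * r^-1 ^+ 2) - M (t * s^-1 ^+ 2).
  have r20 : 0 < r^-1 ^+ 2 by rewrite exprn_gt0 ?invr_gt0.
  have s20 : 0 < s^-1 ^+ 2 by rewrite exprn_gt0 ?invr_gt0.
  have Ckk n : C1k n k by apply: CkB; exact: Ck1_scale.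
  have dk (t : R) : is_derive t 1 k (r^-1 ^+ 2 * m (t * r^-1 ^+ 2) - s^-1 ^+ 2 * m (t * s^-1 ^+ 2)).
    by apply: dB; apply: d_scale.
  (* below [c], both steps vanish *)
  pose c := Num.min (4^-1 / r^-1 ^+ 2) (4^-1 / s^-1 ^+ 2).
  have c0 : 0 < c by rewrite /c lt_min !divr_gt0 ?invr_gt0.
  have k0 (t : R) : t < c -> k t = 0.
    by rewrite /c lt_min (ltr_pdivlMr _ _ r20) (ltr_pdivlMr _ _ s20) => /andP[h1 h2]; rewrite /k !M0// subrr.
  pose g (t : R) := 4^-1 * (k t * t^-1 ^+ 1).
  have Cg n : C1k n g by apply: CkZ; apply: (Ck_divX _ _ c0).
  have gk (t : R) : 4 * (t * g t) = k t.
    rewrite /g expr1; have [->|t0] := eqVneq t 0; first by rewrite k0// mul0r mulr0.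
    by field.
  have dg (t : R) : is_derive t 1 g ('D_1 g t) by exact: (Ck_der (Cg 1%N) tt t).
  have eqn (t : R) : 4 * (t * 'D_1 g t + g t) = r^-1 ^+ 2 * m (t * r^-1 ^+ 2) - s^-1 ^+ 2 * m (t * s^-1 ^+ 2).
    have idt : is_derive t (1 : R) (fun s : R => s) 1 by exact: is_derive_id.
    have h := dZ 4 (dM idt (dg t)); apply: d_unique (dk t).
    rewrite (_ : k = fun v : R => 4 * (v * g v)); last by apply/funext => u; rewrite gk.
    by apply: d_eq h _; ring.
  have g0 (t : R) : t < 0 -> g t = 0 by move=> t0; rewrite /g k0 ?mul0r ?mulr0// (lt_trans t0).
  have [F [dF F0]] := antiderivative (Ck_cont (Cg 0%N)) g0.
  (* the constant of integration makes [G] vanish beyond the larger support *)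
  pose A := (Num.max r s) ^+ 2; pose G (t : R) := F t - F A.
  have dG (t : R) : is_derive t 1 G (g t) by apply: d_eq (dB (dF t) (dC _ _ _)) _; rewrite subr0.
  have CG n : C1k n G by exact: (Ck1_antider dG).
  have mx0 : 0 < Num.max r s by rewrite lt_max r0.
  exists (fun y => G (nrm2 y)); split; last first.
    move=> y; rewrite (lapt_radial dG dg) eqn /rh; ring.
  split; first exact: smooth_radial.
  exists (box 0 (Num.max r s)); split => //; first exact: compact_box.
  move=> y /(nrm2_out (ltW mx0)) hA; rewrite /G (d_const dF hA) ?subrr// => u /andP[hu _].
  have ru : r ^+ 2 <= u by apply: le_trans hu; rewrite lerXn2r ?nnegrE ?le_max ?lexx// ltW.
  have su : s ^+ 2 <= u by apply: le_trans hu; rewrite lerXn2r ?nnegrE ?le_max ?lexx ?orbT// ltW.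
  by rewrite /g /k !M1 ?subrr ?mul0r ?mulr0//; exact: out.
have same (r s : R) : 0 < r -> 0 < s -> Int (rh r) = Int (rh s).
  move=> r0 s0; have [W [tW HW]] := diff r s r0 s0; apply/eqP; rewrite -subr_eq0; apply/eqP.
  rewrite -IntB; [|exact: intg_test (tm r r0)|exact: intg_test (tm s s0)].
  have t0 := test_pder 0 tW; have t1 := test_pder 1 tW.
  have -> : (fun x => rh r x - rh s x) = lapt W by apply/funext => y; rewrite HW.
  have i0 := intg_test (test_pder 0 t0); have i1 := intg_test (test_pder 1 t1).
  have z (a b : R) : a = 0 -> b = 0 -> a + b = 0 by move=> -> ->; rewrite addr0.
  exact: etrans (IntD i0 i1) (z _ _ (Int_test0 0 t0) (Int_test0 1 t1)).
pose c := Int (rh 1).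
have rh1 y : rh 1 y = m (nrm2 y) by rewrite /rh invr1 expr1n mul1r mulr1.
(* the normalizing constant is positive because [m] does not vanish identically *)
have c0 : 0 < c.
  have [t0 mt0] : exists t, 0 < m t.
    apply: contrapT => nm; have : M 0 = M 1.
      apply: (d_const dM0 ler01) => x _; apply/eqP; rewrite eq_le m0 andbT leNgt.
      by apply/negP => h; apply: nm; exists x.
    by rewrite M0 ?invr_gt0// M1// => /eqP; rewrite eq_sym oner_eq0.
  have t00 : 0 <= t0.
    by rewrite leNgt; apply/negP => h; move: mt0; rewrite mz ?ltxx//; left; rewrite (le_trans (ltW h))// invr_ge0.
  pose y0 : P := (Num.sqrt t0, 0).
  have my0 : rh 1 y0 = m t0 by rewrite rh1 /nrm2 /= mulr0 addr0 -expr2 sqr_sqrtr.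
  have cr : continuous (rh 1) by have [] := sm 1 [::].
  have m20 : 0 < m t0 / 2 by rewrite divr_gt0.
  have /nbhs_ballP[e /= e0 He] := cont_near (cr y0) m20.
  have e20 : 0 < e / 2 by rewrite divr_gt0.
  have e2e : e / 2 < e by rewrite ltr_pdivrMr// ltr_pMr// ltr1n.
  have Ib := @intg_box R y0 (e / 2).
  have h : Int (fun x => (m t0 / 2) * \1_(box y0 (e / 2)) x) <= c.
    apply: le_Int; [exact: intgZ | exact: intg_test (tm 1 ltr01) |].
    move=> y; rewrite indicE; case: (boolP (y \in _)) => [|_]; last first.
      by rewrite mulr0 rh1 m0.
    rewrite inE mulr1 => yb; have := He y (box_ball e2e yb).
    by rewrite /= my0 ler_distl => /andP[h _]; lra.
  apply: lt_le_trans h; rewrite IntZ// Int_box; last exact: ltW.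
  by rewrite mulr_gt0// mulr_gt0// exprn_gt0.
have ci0 : 0 <= c^-1 by rewrite invr_ge0 ltW.
exists (fun r y => c^-1 * rh r y) => r r0; split.
- exact: testZ (tm r r0).
- move=> x y; congr (_ * (_ * m (_ * _))); rewrite /nrm2 /=; ring.
- by move=> y; rewrite mulr_ge0// mulr_ge0// exprn_ge0// invr_ge0 ltW.
- by rewrite IntZ ?(same _ 1)// ?mulVf ?gt_eqF//; exact: intg_test (tm r r0).
split.
  move=> y; rewrite rh1 mulrCA /rh; congr (_ * (_ * m _)); rewrite /nrm2 /= /GRing.scale/=; ring.
move=> s s0; have [W [tW HW]] := diff r s r0 s0; exists (fun y => c^-1 * W y).
split; first exact: testZ.
move=> y; rewrite -mulrBr -HW /lapt mulrDr.
have [sW _] := tW; have [s0W _] := test_pder 0 tW; have [s1W _] := test_pder 1 tW.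
have E i : pder i (fun y => c^-1 * W y) = fun y => c^-1 * pder i W y.
  by apply/funext => z; exact: pderZ.
rewrite (E 0) (E 1); congr (_ + _); exact: pderZ.
Qed.

Definition kern : R -> P -> R := sval (cid kernel_exists).

Lemma kern_test r : 0 < r -> test_function (box 0 r) (kern r).
Proof. by move=> r0; have [] := svalP (cid kernel_exists) r r0. Qed.
Lemma kern_even r x y : 0 < r -> kern r (x - y) = kern r (y - x).
Proof. by move=> r0; have [_ h _ _ _] := svalP (cid kernel_exists) r r0; exact: h. Qed.
Lemma kern_ge0 r y : 0 < r -> 0 <= kern r y.
Proof. by move=> r0; have [_ _ h _ _] := svalP (cid kernel_exists) r r0; exact: h. Qed.
Lemma Int_kern r : 0 < r -> Int (kern r) = 1.
Proof. by move=> r0; have [] := svalP (cid kernel_exists) r r0. Qed.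
Lemma kern_scale r y : 0 < r -> kern r y = r^-1 ^+ 2 * kern 1 (r^-1 *: y).
Proof. by move=> r0; have [_ _ _ _ [h _]] := svalP (cid kernel_exists) r r0; exact: h. Qed.
Lemma kern_diff r s : 0 < r -> 0 < s -> exists W, test_function (box 0 (Num.max r s)) W /\
  forall y, lapt W y = kern r y - kern s y.
Proof. by move=> r0 s0; have [_ _ _ _ [_ h]] := svalP (cid kernel_exists) r r0; exact: h. Qed.

End Kernel.

Section Uniform.
Context {R : realType}.
Local Notation P := (R * R)%type.

(** A bound that every test function enjoys holds for all its derivatives up to a given order, with a
    common constant. *)
Lemma unif_foldr (A : set P) (Q : (P -> R) -> R -> Prop) :
  (forall k (C C' : R), C <= C' -> Q k C -> Q k C') ->
  (forall k, test_function A k -> exists C : R, 0 <= C /\ Q k C) ->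
  forall n k, test_function A k -> exists C : R, 0 <= C /\
    forall s, (size s <= n)%N -> Q (foldr (@pder R) k s) C.
Proof.
move=> mono H; elim=> [|n IH] k tk.
  have [C [C0 HC]] := H k tk; exists C; split => // s.
  by rewrite leqn0 => /nilP ->.
have [C [C0 HC]] := H k tk.
have /choice[C' HC'] : forall i : 'I_2, exists C : R, 0 <= C /\
    forall s, (size s <= n)%N -> Q (foldr (@pder R) (pder i k) s) C.
  by move=> i; apply: IH; exact: test_pder.
have C00 := (HC' 0).1; have C10 := (HC' 1).1.
exists (C + (C' 0 + C' 1)); split; first by lra.
move=> s; case/lastP: s => [_|s i]; first by apply: (mono _ C) HC; lra.
rewrite size_rcons ltnS => hs; rewrite foldr_pder_rcons.
apply: (mono _ (C' i)); last exact: (HC' i).2.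
by case: (ord2P i) => ->; lra.
Qed.

End Uniform.

(** * Weyl's lemma *)

Section Representative.
Context {R : realType}.
Local Notation P := (R * R)%type.
Implicit Types (f g h k phi psi : P -> R) (A B : set P) (x y z : P) (D E : (P -> R) -> R).
Variable Omega : set P.
Hypothesis oO : open Omega.
Hypothesis bO : bounded_set Omega.
Local Notation L2 := (L2 Omega).
Local Notation test := (test_function Omega).
Local Notation dist := (dist Omega).

Definition shifted k x := fun y : P => k (y - x).

(** A harmonic distribution takes the same value on all kernels centred at [x] (mean value
    property); that value is the value at [x] of the function which represents it. *)
Definition rep D x : R := D (shifted (kern (get [set r : R | 0 < r /\ box x r `<=` Omega])) x).

Definition harmonic D := forall phi, test phi -> D (lapt phi) = 0.

Lemma margin_pt x : Omega x -> exists r : R, 0 < r /\ box x r `<=` Omega.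
Proof.
move=> Ox; have [r [r0 Hr]] := compact_margin oO (@compact_set1 _ x) (fun y (E : [set x] y) => eq_ind_r Omega Ox E).
by exists r; split => //; exact: Hr.
Qed.

Lemma foldr_lin (a : R) A B phi psi s : test_function A phi -> test_function B psi ->
  foldr (@pder R) (fun y => a * phi y + psi y) s = fun y => a * foldr (@pder R) phi s y + foldr (@pder R) psi s y.
Proof.
move=> tp ts; elim: s => [//|i s IH] /=; rewrite IH; apply/funext => x.
have [sp _] := test_foldr s tp; have [ss _] := test_foldr s ts.
have [sp' _] := testZ a (test_foldr s tp).
have E1 := pderD i x sp' ss; have E2 := pderZ i a x sp.
exact: (eq_trans E1 (congr1 (fun z : R => z + pder i (foldr (@pder R) psi s) x) E2)).
Qed.

Lemma lapt_shift k x : lapt (shifted k x) = shifted (lapt k) x.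
Proof. by rewrite /lapt /shifted !pder_shift. Qed.

Lemma lapt_pder A i phi : test_function A phi -> lapt (pder i phi) = pder i (lapt phi).
Proof.
move=> tp; have sp := test_smooth tp.
have C j : pder j (pder j (pder i phi)) = pder i (pder j (pder j phi)).
  by rewrite (pderC j i sp) (pderC j i (test_smooth (test_pder j tp))).
have s0 := test_smooth (test_pder 0 (test_pder 0 tp)); have s1 := test_smooth (test_pder 1 (test_pder 1 tp)).
apply/funext => x; rewrite /lapt (C 0) (C 1); exact: esym (pderD i x s0 s1).
Qed.

Lemma harmonic_d D i : harmonic D -> harmonic (dist_der i D).
Proof.
move=> hD phi tp; rewrite /dist_der -(lapt_pder i tp) hD ?oppr0//.
exact: test_pder.
Qed.

(** The two kernels differ by the Laplacian of a test function. *)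
Lemma kern_indep D x r s : dist D -> harmonic D -> 0 < r -> 0 < s ->
  box x r `<=` Omega -> box x s `<=` Omega -> D (shifted (kern r) x) = D (shifted (kern s) x).
Proof.
move=> dD hD r0 s0 rO sO; have [W [tW HW]] := kern_diff r0 s0.
have mO : box x (Num.max r s) `<=` Omega by rewrite /Num.max; case: ifP.
have := hD _ (test_shift tW mO); rewrite lapt_shift.
have tr := test_shift (kern_test r0) rO; have ts := test_shift (kern_test s0) sO.
have -> : shifted (lapt W) x = fun y => -1 * kern s (y - x) + kern r (y - x).
  by apply/funext => y; rewrite /shifted HW; ring.
have L := dist_linear dD (-1) ts tr.
by rewrite L mulN1r addrC => /eqP; rewrite subr_eq0 => /eqP.
Qed.

Lemma repE D x r : dist D -> harmonic D -> 0 < r -> box x r `<=` Omega ->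
  rep D x = D (shifted (kern r) x).
Proof.
move=> dD hD r0 rO; rewrite /rep; set S := [set r | _].
have [g0 gO] : S (get S) by apply: (@getI _ _ r).
exact: kern_indep.
Qed.

Lemma rep_eq D E x : dist_eq Omega D E -> Omega x -> rep D x = rep E x.
Proof.
move=> DE Ox; have [r [r0 rO]] := margin_pt Ox; rewrite /rep; set S := [set r | _].
have [g0 gO] : S (get S) by apply: (@getI _ _ r).
by apply: DE; exact: test_shift (kern_test g0) gO.
Qed.

Lemma box_sub x z (r : R) : `|z - x| <= r -> box z r `<=` box x (2 * r).
Proof.
move=> zx y /boxP yz; apply/boxP; rewrite (_ : y - x = (y - z) + (z - x)); last by rewrite addrA subrK.
by apply: (le_trans (ler_normD _ _)); lra.
Qed.

Lemma rep_near D x : dist D -> harmonic D -> Omega x -> exists r : R,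
  [/\ 0 < r, box x (2 * r) `<=` Omega & forall z, `|z - x| <= r -> rep D z = D (shifted (kern r) z)].
Proof.
move=> dD hD Ox; have [r [r0 rO]] := margin_pt Ox; exists (r / 2).
have r20 : 0 < r / 2 by rewrite divr_gt0.
have E : 2 * (r / 2) = r by field.
rewrite E; split => // z zx; apply: repE => //.
by apply: subset_trans rO; rewrite -{2}E; exact: box_sub.
Qed.

Lemma near_norm x (r : R) (Q : P -> Prop) : 0 < r -> (forall z, `|z - x| <= r -> Q z) -> \near x, Q x.
Proof.
move=> r0 H; apply: filterS (nbhsx_ballx x _ r0) => z /ball2E[/ltW h1 /ltW h2].
by apply: H; rewrite norm_pair distrC h1/= distrC.
Qed.

(** Close to [x] the representative is [D] applied to shifts of one kernel; since [D] has finite order, the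
    difference quotients of these shifts may be replaced by the derivative of the kernel. *)
Lemma rep_der D i x : dist D -> harmonic D -> Omega x ->
  is_derive x (dir i) (rep D) (rep (dist_der i D) x).
Proof.
move=> dD hD Ox; have [r [r0 rO HD]] := rep_near dD hD Ox.
have bxr : box x r `<=` Omega.
  by apply: subset_trans rO => y /boxP h; apply/boxP; lra.
rewrite (@repE (dist_der i D) x r) => //; [|exact: dist_d|exact: harmonic_d].
have tk := kern_test r0; have tdk := test_pder i tk.
apply: (@d_near _ _ (fun z => D (shifted (kern r) z))).
  by apply: near_norm r0 _ => z /HD ->.
apply/derE => e e0.
have [n [C [C0 HC]]] := dist_bounded bO dD.
have [K [K0 HK]] := @unif_foldr _ (box 0 r) (fun k C => forall y (t : R), `|k (t *: dir i + y) - k y - t * pder i k y| <= C * t ^+ 2)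
   (fun k C C' CC' H y t => le_trans (H y t) (ler_wpM2r (sqr_ge0 t) CC')) (fun k tk => test_taylor i tk) n _ tk.
have CK := mulr_ge0 C0 K0.
have d0 : 0 < e / (C * K + 1) by rewrite divr_gt0//; lra.
exists (Num.min r (e / (C * K + 1))); split => [|h]; first by rewrite lt_min r0.
rewrite lt_min => /andP[/ltW hr hd].
have nz : `|h *: dir i + x - x| <= r.
  by rewrite addrK normrZ (le_trans (ler_wpM2l _ (norm_dir i)))// mulr1.
have bz : box (h *: dir i + x) r `<=` Omega by apply: subset_trans rO; exact: box_sub.
have t1 := test_shift tk bz; have t2 := test_shift tk bxr; have t3 := test_shift tdk bxr.
have t12 := testD (testZ (-1) t2) t1.
have E : D (shifted (kern r) (h *: dir i + x)) - D (shifted (kern r) x) - h * dist_der i D (shifted (kern r) x)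
   = D (fun y => h * shifted (pder i (kern r)) x y + (-1 * shifted (kern r) x y + shifted (kern r) (h *: dir i + x) y)).
  have L1 := dist_linear dD h t3 t12; have L2 := dist_linear dD (-1) t2 t1.
  have Ed : dist_der i D (shifted (kern r) x) = - D (shifted (pder i (kern r)) x).
    by rewrite /dist_der /shifted pder_shift.
  rewrite Ed; apply: etrans (esym L1); rewrite /shifted L2; ring.
rewrite E; apply: (@le_trans _ _ (C * (K * h ^+ 2))).
  apply: HC => [|s hs y]; first exact: testD (testZ h t3) t12.
  rewrite (foldr_lin h s t3 t12) (foldr_lin (-1) s t2 t1) !foldr_shift.
  have := HK s hs (y - x) (- h).
  rewrite sqrrN (_ : - h *: dir i + (y - x) = y - (h *: dir i + x)); last by rewrite scaleNr opprD addrCA addrA addrC.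
  rewrite (_ : pder i _ = foldr (@pder R) (pder i (kern r)) s); last first.
    by rewrite -foldr_pder_rcons; elim: (s) => [//|j s' IH] /=; rewrite -IH (pderC i j)//; exact: test_smooth (test_foldr s' tk).
  by congr (`|_| <= _); ring.
rewrite mulrA -(real_normK (num_real h)) expr2 mulrA ler_wpM2r//.
move: hd; rewrite ltr_pdivlMr; last by lra.
by have := normr_ge0 h => h0 h1; lra.
Qed.

Lemma rep_cont D x : dist D -> harmonic D -> Omega x -> {for x, continuous (rep D)}.
Proof.
move=> dD hD Ox; have [r [r0 rO HD]] := rep_near dD hD Ox.
have bxr : box x r `<=` Omega.
  by apply: subset_trans rO => y /boxP h; apply/boxP; lra.
have tk := kern_test r0.
have [n [C [C0 HC]]] := dist_bounded bO dD.
have [K [K0 HK]] := @unif_foldr _ (box 0 r) (fun k C => forall y z, `|k y - k z| <= C * `|y - z|)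
   (fun k C C' CC' H y z => le_trans (H y z) (ler_wpM2r (normr_ge0 _) CC')) (fun k tk => test_lip tk) n _ tk.
have CK := mulr_ge0 C0 K0.
apply/cvgrPdist_le => e e0.
have d0 : 0 < e / (C * K + 1) by rewrite divr_gt0//; lra.
apply: (@near_norm x (Num.min r (e / (C * K + 1)))); first by rewrite lt_min r0.
move=> z; rewrite le_min => /andP[hr hd].
have bz : box z r `<=` Omega by apply: subset_trans rO; exact: box_sub.
have t1 := test_shift tk bz; have t2 := test_shift tk bxr.
rewrite HD// ?HD ?subrr ?normr0 ?(ltW r0)// distrC.
have -> : D (shifted (kern r) z) - D (shifted (kern r) x) = D (fun y => -1 * shifted (kern r) x y + shifted (kern r) z y).
  have L2 := dist_linear dD (-1) t2 t1; apply: etrans (esym L2); rewrite /shifted; ring.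
apply: (@le_trans _ _ (C * (K * `|z - x|))).
  apply: HC => [|s hs y]; first exact: testD (testZ (-1) t2) t1.
  rewrite (foldr_lin (-1) s t2 t1) !foldr_shift.
  have := HK s hs (y - z) (y - x); rewrite (_ : y - z - (y - x) = x - z); last by rewrite opprB addrC addrA subrK.
  by rewrite (distrC x z) mulN1r addrC.
rewrite mulrA; move: hd; rewrite ler_pdivlMr; last by lra.
by have := normr_ge0 (z - x) => h0 h1; lra.
Qed.

Lemma Int_kern_reflect r y : 0 < r -> Int (fun x => kern r (y - x)) = 1.
Proof.
move=> r0; rewrite -(Int_kern r0) -[RHS](Int_shift (- y) (intg_test (kern_test r0))).
by apply: (congr1 (@Int R)); apply/funext => x; exact: kern_even.
Qed.

Lemma conv_approx A g r (C : R) y : test_function A g -> 0 < r -> 0 <= C ->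
  (forall x z, `|g x - g z| <= C * `|x - z|) -> `|-1 * g y + conv g (kern r) y| <= C * r.
Proof.
move=> tg r0 C0 HC; have tk := kern_test r0; have ig := intg_test tg.
have tr : test_function setT (fun x => kern r (y - x)).
  have := test_shift tk (@subsetT _ (box y r)); rewrite (_ : (fun z => _) = fun x => kern r (y - x))//.
  by apply/funext => x; exact: kern_even.
have ik := intg_test tr; have ic := intg_conv y ig tk.
have E : -1 * g y + conv g (kern r) y = Int (fun x => g x * kern r (y - x) - g y * kern r (y - x)).
  by rewrite IntB ?IntZ ?Int_kern_reflect//; [rewrite /conv; ring | exact: intgZ].
rewrite E; have ib : intg (fun x => g x * kern r (y - x) - g y * kern r (y - x)).
  by apply: intgB => //; exact: intgZ.
apply: (le_trans (le_norm_Int ib)).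
rewrite -[leRHS]mulr1 -(Int_kern_reflect y r0) -IntZ//.
apply: le_Int; [exact: intg_norm | exact: intgZ |] => x.
rewrite -mulrBl normrM [`|kern _ _|]ger0_norm ?kern_ge0//.
have [b|nb] := pselect (box 0 r (y - x)).
  rewrite ler_wpM2r ?kern_ge0//; apply: (le_trans (HC x y)); rewrite ler_wpM2l// distrC.
  by have /boxP := b; rewrite subr0.
have [_ [K [_ Kr K0]]] := tk; rewrite K0 ?mulr0//; by move=> /Kr.
Qed.

(** Weyl's lemma. For small [r], [D (conv phi (kern r))] is the integral of [phi * rep D], whatever
    [r]; it tends to [D phi] because the derivatives of [phi] are approximated uniformly. *)
Lemma rep_regular D phi : dist D -> harmonic D -> test phi ->
  intg (fun x => phi x * rep D x) /\ D phi = Int (fun x => phi x * rep D x).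
Proof.
move=> dD hD tp; have [sp [K [cK KO K0]]] := tp.
have [r1 [r10 HK]] := compact_margin oO cK KO.
have key r : 0 < r -> r <= r1 ->
    intg (fun x => phi x * rep D x) /\ D (conv phi (kern r)) = Int (fun x => phi x * rep D x).
  move=> r0 rr; have HKr x : K x -> box x r `<=` Omega.
    by move=> Kx; apply: subset_trans (HK x Kx) => y /boxP h; apply/boxP; exact: le_trans rr.
  have := dist_conv bO dD tp cK K0 HKr (kern_test r0).
  rewrite (_ : (fun x => phi x * D _) = fun x => phi x * rep D x)//.
  apply/funext => x; have [Kx|/K0 ->] := pselect (K x); last by rewrite !mul0r.
  by congr (_ * _); rewrite (repE dD hD r0 (HKr x Kx)).
split; first by have [] := key r1 r10 (lexx _).
have [n [C [C0 HC]]] := dist_bounded bO dD.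
have [L [L0 HL]] := @unif_foldr _ Omega (fun k C => forall y z, `|k y - k z| <= C * `|y - z|)
   (fun k C C' CC' H y z => le_trans (H y z) (ler_wpM2r (normr_ge0 _) CC')) (fun k tk => test_lip tk) n _ tp.
have CL := mulr_ge0 C0 L0.
apply/eqP; rewrite eq_sym -subr_eq0 -normr_le0; apply/ler_addgt0Pl => e e0; rewrite addr0.
have d0 : 0 < e / (C * L + 1) by rewrite divr_gt0//; lra.
set r := Num.min r1 (e / (C * L + 1)).
have r0 : 0 < r by rewrite lt_min r10.
have rr : r <= r1 by rewrite ge_min lexx.
have re : r * (C * L + 1) <= e by rewrite -ler_pdivlMr ?ge_min ?lexx ?orbT//; lra.
have [_ <-] := key r r0 rr.
have HKr x : K x -> box x r `<=` Omega.
  by move=> Kx; apply: subset_trans (HK x Kx) => y /boxP h; apply/boxP; exact: le_trans rr.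
have tc := test_conv (intg_test tp) cK K0 HKr (kern_test r0).
have -> : D (conv phi (kern r)) - D phi = D (fun y => -1 * phi y + conv phi (kern r) y).
  by rewrite (dist_linear dD (-1) tp tc); ring.
apply: (@le_trans _ _ (C * (L * r))).
  apply: HC => [|s hs y]; first exact: testD (testZ (-1) tp) tc.
  rewrite (foldr_lin (-1) s tp tc) (foldr_conv_swap s tp (kern_test r0)).
  by apply: (conv_approx _ (test_foldr s tp)) => //; exact: HL.
by rewrite mulrA; lra.
Qed.

End Representative.

(** * Potentials of closed forms on squares *)

Section LocalPotential.
Context {R : realType}.
Local Notation P := (R * R)%type.
Implicit Types (x y z p q : P).

Lemma mvt_between (f df : R -> R) (a b k e : R) :
  (forall t : R, Num.min a b <= t <= Num.max a b -> is_derive t 1 f (df t)) ->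
  (forall t : R, Num.min a b <= t <= Num.max a b -> `|df t - k| <= e) ->
  `|f b - f a - k * (b - a)| <= e * `|b - a|.
Proof.
have le_case (u v : R) : u <= v -> (forall t : R, u <= t <= v -> is_derive t 1 f (df t)) ->
    (forall t : R, u <= t <= v -> `|df t - k| <= e) -> `|f v - f u - k * (v - u)| <= e * `|v - u|.
  move=> uv Hf He.
  have H (t : R) : t \in `[u, v] -> is_derive t 1 f (df t) by rewrite in_itv/=; exact: Hf.
  have Ho (t : R) : t \in `]u, v[ -> is_derive t 1 f (df t).
    by rewrite in_itv/= => /andP[a1 a2]; apply: Hf; rewrite !ltW.
  have cont : {within `[u, v], continuous f}.
    by apply: derivable_within_continuous => t /H[].
  have [c] := MVT_segment uv Ho cont; rewrite in_itv/= => cuv ->.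
  by rewrite -mulrBl normrM ler_wpM2r//; exact: He.
have [ab|/ltW ba] := leP a b; first exact: le_case.
move=> Hf He; have := le_case b a ba Hf He.
have -> : f b - f a - k * (b - a) = - (f a - f b - k * (a - b)) by ring.
by rewrite normrN (distrC b).
Qed.

Definition clamp (lo hi t : R) : R := Num.max lo (Num.min hi t).

Lemma clamp_cont lo hi : continuous (clamp lo hi).
Proof.
move=> t; apply: (@continuous_max R R (fun=> lo) (fun t => Num.min hi t) t); first exact: cvg_cst.
by apply: (@continuous_min R R (fun=> hi) (fun t => t) t); [exact: cvg_cst | exact: cvg_id].
Qed.

Lemma clamp_in lo hi t : lo <= hi -> lo <= clamp lo hi t <= hi.
Proof. by move=> lh; rewrite /clamp le_max lexx/= ge_max lh ge_min lexx. Qed.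

Lemma clampE lo hi t : lo <= t <= hi -> clamp lo hi t = t.
Proof. by move=> /andP[h1 h2]; rewrite /clamp min_r// max_r. Qed.

Lemma antider_itv (f : R -> R) (lo hi : R) : lo <= hi ->
  (forall t : R, lo <= t <= hi -> {for t, continuous f}) ->
  exists G : R -> R, forall t : R, lo < t < hi -> is_derive t 1 G (f t).
Proof.
move=> lh cf; pose g t := f (clamp lo hi t) - f lo.
have cg : continuous g.
  move=> t; apply: cvgB; last exact: cvg_cst.
  by apply: (@continuous_comp _ _ _ (clamp lo hi) f); [exact: clamp_cont | apply: cf; exact: clamp_in].
have g0 (t : R) : t < lo -> g t = 0.
  by move=> /ltW tlo; rewrite /g /clamp (min_r (le_trans tlo lh)) max_l// subrr.
have [F [dF _]] := antiderivative cg g0; exists (fun t => F t + f lo * t) => t /andP[/ltW h1 /ltW h2].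
have h := dD (dF t) (dZ (f lo) (is_derive_id t (1 : R))); apply: d_eq h _.
by rewrite /g clampE ?h1//; ring.
Qed.

Lemma d_of_line0 (F : P -> R) y (df : R) : is_derive y.1 1 (fun t => F (t, y.2)) df ->
  is_derive y (dir 0) F df.
Proof.
move=> /derE H; apply/derE => e e0; have [d [d0 Hd]] := H e e0; exists d; split => // h hd.
have := Hd h hd; rewrite dir0 (_ : h *: (1, 0) + y = (h *: (1 : R) + y.1, y.2)); last first.
  by apply: injective_projections; rewrite /= ?scaler0 ?add0r.
by rewrite -surjective_pairing.
Qed.

Lemma d_of_line1 (F : P -> R) y (df : R) : is_derive y.2 1 (fun t => F (y.1, t)) df ->
  is_derive y (dir 1) F df.
Proof.
move=> /derE H; apply/derE => e e0; have [d [d0 Hd]] := H e e0; exists d; split => // h hd.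
have := Hd h hd; rewrite dir1 (_ : h *: (0, 1) + y = (y.1, h *: (1 : R) + y.2)); last first.
  by apply: injective_projections; rewrite /= ?scaler0 ?add0r.
by rewrite -surjective_pairing.
Qed.

Lemma d_to_line0 (F : P -> R) y (df : R) : is_derive y (dir 0) F df ->
  is_derive y.1 1 (fun t => F (t, y.2)) df.
Proof.
case: y => a b /= h; have := @d_line0 _ F 0 b a df; rewrite add0r => /(_ h).
by rewrite (_ : (fun s => F (0 + s, b)) = fun t => F (t, b))//; apply/funext => s; rewrite add0r.
Qed.

Lemma d_to_line1 (F : P -> R) y (df : R) : is_derive y (dir 1) F df ->
  is_derive y.2 1 (fun t => F (y.1, t)) df.
Proof.
case: y => a b /= h; have := @d_line1 _ F a 0 b df; rewrite add0r => /(_ h).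
by rewrite (_ : (fun s => F (a, 0 + s)) = fun t => F (a, t))//; apply/funext => s; rewrite add0r.
Qed.

Lemma between_shift (u h s : R) : Num.min u (h + u) <= s <= Num.max u (h + u) -> `|s - u| <= `|h|.
Proof.
rewrite ge_min le_max => /andP[/orP o1 /orP o2]; rewrite ler_norml.
have := ler_norm h; have := ler_norm (- h); rewrite normrN => n1 n2.
by apply/andP; split; [case: o1 => ? | case: o2 => ?]; lra.
Qed.

Lemma compact_unif (T : pseudoMetricType R) (K : set T) (c : T -> R) (e : R) : compact K ->
  (forall x : T, K x -> {for x, continuous c}) -> 0 < e ->
  exists d : R, 0 < d /\ forall x y : T, K x -> ball x d y -> `|c y - c x| <= e.
Proof.
move=> /compact_near_coveringP cK cc e0.
have := cK R (0 : R)^'+ (fun d (x : T) => forall y : T, ball x d y -> `|c y - c x| <= e) _ _.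
case=> [x Kx|d /= d0 Hd].
  have e20 : 0 < e / 2 by rewrite divr_gt0.
  have /cvgrPdist_le/(_ _ e20)/nbhs_ballP[d /= d0 xd] := cc x Kx.
  have d20 : 0 < d / 2 by rewrite divr_gt0.
  exists (ball x (d / 2), `]-oo, d / 2[%classic) => /=.
    by split; [exact: nbhsx_ballx | exact: nbhs_right_lt].
  move=> [x' r] /= [x'x]; rewrite in_itv/= => rd y x'y.
  have xx' : ball x d x' by apply: le_ball x'x; rewrite ler_pdivrMr// ler_peMr ?ler1n// ltW.
  have xy : ball x d y.
    by rewrite (splitr d); apply: ball_triangle x'x _; apply: le_ball x'y; exact: ltW.
  have h1 := xd _ xx'; have h2 := xd _ xy; rewrite /= in h1 h2.
  rewrite (_ : c y - c x' = (c x - c x') - (c x - c y)); last by ring.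
  by apply: (le_trans (ler_normB _ _)); lra.
exists (d / 2); split; first by rewrite divr_gt0.
move=> x y Kx; apply: (Hd (d / 2)) => //; last by rewrite divr_gt0.
by rewrite /= sub0r normrN ger0_norm ?ltr_pdivrMr ?mulr_natr ?mulr2n ?ltrDl// divr_ge0// ltW.
Qed.

Variable Omega : set P.
Variables (a : 'I_2 -> P -> R) (b : 'I_2 -> 'I_2 -> P -> R).
Hypothesis a_der : forall i j x, Omega x -> is_derive x (dir j) (a i) (b j i x).
Hypothesis a_cont : forall i x, Omega x -> {for x, continuous (a i)}.
Hypothesis b_cont : forall i j x, Omega x -> {for x, continuous (b i j)}.
Hypothesis b_sym : forall x, Omega x -> b 1 0 x = b 0 1 x.

Definition potential (A : set P) (F : P -> R) := forall y i, A y -> is_derive y (dir i) F (a i y).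

Lemma pair_cont1 (s : R) (c : P -> R) (t : R) : {for (s, t), continuous c} -> {for t, continuous (fun t => c (s, t))}.
Proof.
move=> h; apply: (@continuous_comp R P R (fun t => (s, t)) c) => //.
exact: cvg_pair (cvg_cst s) cvg_id.
Qed.
Lemma pair_cont0 (s : R) (c : P -> R) (t : R) : {for (t, s), continuous c} -> {for t, continuous (fun t => c (t, s))}.
Proof.
move=> h; apply: (@continuous_comp R P R (fun t => (t, s)) c) => //.
exact: cvg_pair cvg_id (cvg_cst s).
Qed.

(** Integrate [a 0] along a horizontal segment and then [a 1] along a vertical one. *)
Lemma local_potential x (r : R) : 0 < r -> box x r `<=` Omega -> exists F, potential (ball x r) F.
Proof.
move=> r0 xO.
have inb (s t : R) : `|s - x.1| <= r -> `|t - x.2| <= r -> Omega (s, t).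
  by move=> h1 h2; apply: xO; apply/boxE.
have itv (u v t : R) : u - v <= t <= u + v -> `|t - u| <= v by rewrite ler_distl.
have itvo (u v t : R) : `|t - u| < v -> u - v < t < u + v by rewrite ltr_distl.
have lh (u : R) : u - r <= u + r by rewrite lerD2l; lra.
have xx (u : R) : `|u - u| < r by rewrite subrr normr0.
have [B hB] : exists B : R -> R, forall t : R, `|t - x.1| < r -> is_derive t 1 B (a 0 (t, x.2)).
  have [t ht|G HG] := @antider_itv (fun t => a 0 (t, x.2)) _ _ (lh x.1).
    by apply: pair_cont0; apply: a_cont; apply: inb; [exact: itv | exact: ltW].
  by exists G => t /itvo; exact: HG.
have /choice[A hA] : forall s : R, exists A : R -> R, `|s - x.1| < r -> forall t : R, `|t - x.2| < r ->
    is_derive t 1 A (a 1 (s, t)).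
  move=> s; have [sr|sr] := ltP `|s - x.1| r; last by exists (fun=> 0).
  have [t ht|G HG] := @antider_itv (fun t => a 1 (s, t)) _ _ (lh x.2).
    by apply: pair_cont1; apply: a_cont; apply: inb; [exact: ltW | exact: itv].
  by exists G => _ t /itvo; exact: HG.
pose F y := B y.1 + (A y.1 y.2 - A y.1 x.2).
exists F => y i /ball2E[]; rewrite (distrC x.1) (distrC x.2) => y1 y2.
case: (ord2P i) => ->; last first.
  apply: d_of_line1; apply: d_eq (dD (dC (B y.1) _ _) (dB (hA _ y1 _ y2) (dC (A y.1 x.2) _ _))) _.
  by rewrite subr0 add0r -surjective_pairing.
apply: d_of_line0; apply/derE => e e0.
have e20 : 0 < e / 2 by rewrite divr_gt0.
have [d1 [d10 H1]] := (derE _ _ _ _).1 (hB _ y1) _ e20.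
pose e' := e / 2 / (r + 1); have r10 : 0 < r + 1 by lra.
have e'0 : 0 < e' by rewrite divr_gt0.
pose K : set P := [set (y.1, t) | t in `[Num.min x.2 y.2, Num.max x.2 y.2]%classic].
have inK (t : R) : Num.min x.2 y.2 <= t <= Num.max x.2 y.2 -> `|t - x.2| < r.
  move=> /andP[h1 h2]; rewrite ltr_distl; move: y2; rewrite ltr_distl => /andP[g1 g2].
  apply/andP; split; [apply: lt_le_trans h1 | apply: le_lt_trans h2 _].
    by rewrite lt_min g1 andbT; lra.
  by rewrite gt_max g2 andbT; lra.
have cK : compact K.
  apply: continuous_compact; last exact: segment_compact.
  by apply: continuous_subspaceT => t; exact: cvg_pair (cvg_cst y.1) cvg_id.
have [z|d2 [d20 H2]] := @compact_unif P K (b 0 1) e' cK _ e'0.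
  move=> [t /=]; rewrite in_itv/= => ht <-; apply: b_cont; apply: inb; apply: ltW => //; exact: inK.
pose d := Num.min d1 (Num.min d2 (r - `|y.1 - x.1|)).
exists d; split => [|h]; first by rewrite !lt_min d10 d20 subr_gt0.
rewrite !lt_min => /and3P[hd1 hd2 hd3].
have yh (s : R) : `|s| <= `|h| -> `|s + y.1 - x.1| < r.
  by move=> sh; rewrite -addrA (le_lt_trans (ler_normD _ _))//; lra.
have := H1 h hd1; rewrite /F/= => k1.
pose psi t := (A (h *: (1 : R) + y.1) t - A y.1 t) - h * a 0 (y.1, t).
have k2 : `|psi y.2 - psi x.2 - 0 * (y.2 - x.2)| <= (e' * `|h|) * `|y.2 - x.2|.
  apply: (@mvt_between psi (fun t => (a 1 (h *: (1 : R) + y.1, t) - a 1 (y.1, t)) - h * b 1 0 (y.1, t))) => t ht; have tr := inK t ht.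
    have hz : `|h *: (1 : R) + y.1 - x.1| < r by rewrite /GRing.scale/= mulr1; exact: yh.
    have h0 := d_to_line1 (a_der 0 1 (inb _ _ (ltW y1) (ltW tr))).
    exact: dB (dB (hA _ hz _ tr) (hA _ y1 _ tr)) (dZ h h0).
  rewrite subr0 b_sym; last exact: inb (ltW y1) (ltW tr).
  have -> : h * b 0 1 (y.1, t) = b 0 1 (y.1, t) * (h *: (1 : R) + y.1 - y.1).
    by rewrite addrK /GRing.scale/= mulr1 mulrC.
  have -> : `|h| = `|h *: (1 : R) + y.1 - y.1| by rewrite addrK /GRing.scale/= mulr1.
  have btw (s : R) : Num.min y.1 (h *: (1 : R) + y.1) <= s <= Num.max y.1 (h *: (1 : R) + y.1) -> `|s - y.1| <= `|h|.
    rewrite /GRing.scale/= mulr1; exact: between_shift.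
  apply: (@mvt_between (fun s => a 1 (s, t)) (fun s => b 0 1 (s, t))) => s hs; have sh := btw s hs.
    have := yh (s - y.1) sh; rewrite subrK => sr.
    exact: d_to_line0 (a_der 1 0 (inb _ _ (ltW sr) (ltW tr))).
  apply: H2; first by exists t => //; rewrite /= in_itv.
  by apply/ball2E => /=; rewrite subrr normr0 d20 distrC; split => //; exact: le_lt_trans hd2.
have k3 : (e' * `|h|) * `|y.2 - x.2| <= e / 2 * `|h|.
  have E : e' * (r + 1) = e / 2 by rewrite /e' divfK// lt0r_neq0.
  by rewrite mulrAC ler_wpM2r// -E ler_wpM2l ?(ltW e'0)// (le_trans (ltW y2))// lerDl ler01.
rewrite (_ : _ - _ - h * a 0 y =
   (B (h *: (1 : R) + y.1) - B y.1 - h * a 0 (y.1, x.2)) + (psi y.2 - psi x.2 - 0 * (y.2 - x.2))); last first.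
  by rewrite /F /psi /= -surjective_pairing; ring.
apply: (le_trans (ler_normD _ _)); lra.
Qed.

(** The intersection of two squares is a rectangle, in which any two points are joined by a path
    parallel to the axes. *)
Lemma potential_unique (A B : set P) F G p q (r s : R) u v : potential A F -> potential B G ->
  ball p r `<=` A -> ball q s `<=` B ->
  ball p r u -> ball p r v -> ball q s u -> ball q s v -> F u - F v = G u - G v.
Proof.
move=> HF HG pA qB pu pv qu qv.
have dFG y i : ball p r y -> ball q s y -> is_derive y (dir i) (fun z => F z - G z) 0.
  by move=> py qy; apply: d_eq (dB (HF y i (pA _ py)) (HG y i (qB _ qy))) _; rewrite subrr.
have btw c (e w1 w2 t : R) : `|c - w1| < e -> `|c - w2| < e -> Num.min w1 w2 <= t <= Num.max w1 w2 -> `|c - t| < e.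
  rewrite !ltr_distl => /andP[a1 a2] /andP[a3 a4]; rewrite ge_min le_max => /andP[/orP o1 /orP o2].
  by apply/andP; split; [case: o2 => ? | case: o1 => ?]; lra.
have in1 c e t : ball c e u -> ball c e v -> Num.min v.1 u.1 <= t <= Num.max v.1 u.1 -> ball c e (t, v.2).
  by move=> /ball2E[h1 h2] /ball2E[h3 h4] ht; apply/ball2E => /=; split => //; exact: btw ht.
have in2 c e t : ball c e u -> ball c e v -> Num.min v.2 u.2 <= t <= Num.max v.2 u.2 -> ball c e (u.1, t).
  by move=> /ball2E[h1 h2] /ball2E[h3 h4] ht; apply/ball2E => /=; split => //; exact: btw ht.
have h1 := @mvt_between (fun t => F (t, v.2) - G (t, v.2)) (fun=> 0) v.1 u.1 0 0.
have h2 := @mvt_between (fun t => F (u.1, t) - G (u.1, t)) (fun=> 0) v.2 u.2 0 0.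
have : `|(F (u.1, v.2) - G (u.1, v.2)) - (F (v.1, v.2) - G (v.1, v.2)) - 0 * (u.1 - v.1)| <= 0 * `|u.1 - v.1|.
  apply: h1 => t ht; last by rewrite subrr normr0.
  apply: (@d_to_line0 (fun z => F z - G z) (t, v.2)).
  by apply: dFG; exact: in1.
have : `|(F (u.1, u.2) - G (u.1, u.2)) - (F (u.1, v.2) - G (u.1, v.2)) - 0 * (u.2 - v.2)| <= 0 * `|u.2 - v.2|.
  apply: h2 => t ht; last by rewrite subrr normr0.
  apply: (@d_to_line1 (fun z => F z - G z) (u.1, t)).
  by apply: dFG; exact: in2.
rewrite !mul0r !subr0 !normr_le0 -!surjective_pairing !subr_eq0 => /eqP e1 /eqP e2.
by rewrite e2 in e1; apply/eqP; rewrite subr_eq addrAC -subr_eq; apply/eqP; lra.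
Qed.

End LocalPotential.

(** * Potentials on simply connected domains *)

Section Monodromy.
Context {R : realType}.
Local Notation P := (R * R)%type.
Implicit Types (x y z p q u : P).

Lemma unif_within (K : set P) (H : P -> P) (e : R) : compact K -> {within K, continuous H} -> 0 < e ->
  exists d : R, 0 < d /\ forall z z', K z -> K z' -> ball z d z' -> ball (H z) e (H z').
Proof.
move=> /compact_near_coveringP cK /subspace_continuousP cH e0.
have e20 : 0 < e / 2 by rewrite divr_gt0.
have := cK R (0 : R)^'+ (fun d z => K z -> forall z', K z' -> ball z d z' -> ball (H z) e (H z')) _ _.
case=> [z Kz|d /= d0 Hd].
  have := cH z Kz; move=> /cvg_ballP/(_ _ e20) hz.
  have /nbhs_ballP[d /= d0 zd] : nbhs z [set z' | K z' -> ball (H z) (e / 2) (H z')] by exact: hz.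
  have d20 : 0 < d / 2 by rewrite divr_gt0.
  exists (ball z (d / 2), `]-oo, d / 2[%classic) => /=.
    by split; [exact: nbhsx_ballx | exact: nbhs_right_lt].
  move=> [x' r] /= [zx']; rewrite in_itv/= => rd Kx' z' Kz' x'z'.
  have zz' : ball z d z'.
    by rewrite (splitr d); apply: ball_triangle zx' _; apply: le_ball x'z'; exact: ltW.
  have zx : ball z d x' by apply: le_ball zx'; rewrite ler_pdivrMr// ler_peMr ?ler1n// ltW.
  have h1 := zd _ zx Kx'; have h2 := zd _ zz' Kz'.
  by rewrite (splitr e); apply: ball_triangle h2; exact: ball_sym.
exists (d / 2); split; first by rewrite divr_gt0.
move=> z z' Kz; apply: (Hd (d / 2)) => //; last by rewrite divr_gt0.
by rewrite /= sub0r normrN ger0_norm ?ltr_pdivrMr ?mulr_natr ?mulr2n ?ltrDl// divr_ge0// ltW.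
Qed.

Lemma cell_aux (x1 x2 x3 x4 x5 : R) : x1 + x2 = x5 -> x3 + x4 = x5 -> x4 - x1 = x2 - x3.
Proof. by move=> <- e; lra. Qed.

Variable Omega : set P.
Hypothesis oO : open Omega.
Variable (a : 'I_2 -> P -> R).
Local Notation potential := (potential a).
Hypothesis locpot : forall x (r : R), 0 < r -> box x r `<=` Omega -> exists F, potential (ball x r) F.

Definition step p q := exists c (s : R), [/\ 0 < s, box c s `<=` Omega, ball c s p & ball c s q].

(** The integral of the closed form [a] from [p] to [q]: the increment of a potential on any square
    of [Omega] that contains both points. *)
Definition J p q : R :=
  let F := get [set F : P -> R | exists c (s : R),
     [/\ 0 < s, box c s `<=` Omega, ball c s p, ball c s q & potential (ball c s) F]] in F q - F p.

Lemma J_eq c (s : R) G p q : 0 < s -> box c s `<=` Omega -> potential (ball c s) G ->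
  ball c s p -> ball c s q -> J p q = G q - G p.
Proof.
move=> s0 cO HG cp cq; rewrite /J; set S := [set F | _].
have [c' [s' [s'0 c'O c'p c'q HF]]] : S (get S) by apply: (@getI _ _ G); exists c, s.
exact: (potential_unique HF HG (fun _ h => h) (fun _ h => h) c'q c'p cq cp).
Qed.

Lemma J_add c (s : R) p q u : 0 < s -> box c s `<=` Omega ->
  ball c s p -> ball c s q -> ball c s u -> J p q + J q u = J p u.
Proof.
move=> s0 cO cp cq cu; have [G HG] := locpot s0 cO.
by rewrite !(J_eq s0 cO HG)//; ring.
Qed.

Lemma step_sym p q : step p q -> step q p.
Proof. by move=> [c [s [s0 cO cp cq]]]; exists c, s. Qed.

Lemma J_sym p q : step p q -> J q p = - J p q.
Proof.
move=> [c [s [s0 cO cp cq]]]; have [G HG] := locpot s0 cO.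
by rewrite !(J_eq s0 cO HG)//; ring.
Qed.

Lemma J_refl p : Omega p -> J p p = 0.
Proof. by move=> Op; rewrite /J subrr. Qed.

Definition nd (N j : nat) : R := j%:R / N%:R.

Lemma nd_in N j : (j <= N)%N -> 0 <= nd N j <= 1.
Proof.
move=> jN; rewrite /nd divr_ge0//=; case: N jN => [|N jN]; first by rewrite invr0 mulr0.
by rewrite ler_pdivrMr// mul1r ler_nat.
Qed.

Lemma nd_dist N j : (0 < N)%N -> `|nd N j - nd N j.+1| = N%:R^-1.
Proof.
move=> N0; by rewrite distrC /nd -mulrBl -natrB// subSnn mul1r ger0_norm.
Qed.

Definition square : set P := `[0, 1]%classic `*` `[0, 1]%classic.

Lemma compact_square : compact square.
Proof. by apply: compact_setX; exact: segment_compact. Qed.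

(** Homotopic loops have the same integral: all cells of a fine grid are mapped into
    squares contained in [Omega], on which the form has a potential, so the integrals
    along two consecutive lines of the grid differ by a telescoping sum. *)
Lemma homotopy_sum (H : P -> P) p0 : {within square, continuous H} ->
  (forall z, square z -> Omega (H z)) ->
  (forall s : R, 0 <= s <= 1 -> H (s, 0) = p0 /\ H (s, 1) = p0) ->
  exists d : R, 0 < d /\ forall N, (0 < N)%N -> N%:R^-1 < d ->
    \sum_(0 <= j < N) J (H (0, nd N j)) (H (0, nd N j.+1)) =
    \sum_(0 <= j < N) J (H (1, nd N j)) (H (1, nd N j.+1)).
Proof.
move=> cH HO Hp0; have cK := continuous_compact cH compact_square.
have KO : H @` square `<=` Omega by move=> _ [z sz <-]; exact: HO.
have [e [e0 He]] := compact_margin oO cK KO.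
have e20 : 0 < e / 2 by rewrite divr_gt0.
have [d [d0 Hd]] := unif_within compact_square cH e20.
exists d; split => // N N0 Nd.
have sqI (s t : R) : 0 <= s <= 1 -> 0 <= t <= 1 -> square (s, t).
  by move=> hs ht; split; rewrite /= in_itv.
pose I (s : R) := \sum_(0 <= j < N) J (H (s, nd N j)) (H (s, nd N j.+1)).
(* the integral along the line [s] of the grid is the same as along the next line *)
suff line (i : nat) : (i < N)%N -> I (nd N i) = I (nd N i.+1).
  have E i : (i <= N)%N -> I (nd N 0) = I (nd N i).
    by elim: i => // i IH iN; rewrite -line//; apply: IH; exact: ltnW.
  have := E N (leqnn N); rewrite /I {1 3}/nd mul0r.
  by rewrite (_ : nd N N = 1)// /nd divff// pnatr_eq0 -lt0n.
move=> iN; set s := nd N i; set s' := nd N i.+1.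
have hs : 0 <= s <= 1 by apply: nd_in; exact: ltnW.
have hs' : 0 <= s' <= 1 by exact: nd_in.
pose E j := J (H (s, nd N j)) (H (s', nd N j)).
have bs (j : nat) : (j <= N)%N -> ball (H (s, nd N j)) (e / 2) (H (s', nd N j)).
  move=> jN; have hj := nd_in jN; apply: Hd; [exact: sqI | exact: sqI |].
  by apply/ball2E => /=; rewrite subrr normr0 nd_dist.
have bt (t : R) (j : nat) : 0 <= t <= 1 -> (j < N)%N -> ball (H (t, nd N j)) (e / 2) (H (t, nd N j.+1)).
  move=> ht jN; have hj := nd_in (ltnW jN); have hj' := nd_in jN; apply: Hd; [exact: sqI | exact: sqI |].
  by apply/ball2E => /=; rewrite subrr normr0 nd_dist.
have half c x : ball c (e / 2) x -> ball c e x.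
  by apply: le_ball; rewrite ler_pdivrMr// ler_peMr ?ler1n// ltW.
have cell j : (j < N)%N ->
    J (H (s', nd N j)) (H (s', nd N j.+1)) - J (H (s, nd N j)) (H (s, nd N j.+1)) = E j.+1 - E j.
  move=> jN; set p := H (s, nd N j); set q := H (s, nd N j.+1).
  set p' := H (s', nd N j); set q' := H (s', nd N j.+1).
  have pO : box p e `<=` Omega by apply: He; exists (s, nd N j) => //; apply: sqI => //; exact: nd_in (ltnW jN).
  have bp : ball p e p by exact: ballxx.
  have bq : ball p e q by apply: half; exact: bt.
  have bp' : ball p e p' by apply: half; apply: bs; exact: ltnW.
  have bq' : ball p e q' by rewrite (splitr e); apply: ball_triangle (bt s j hs jN) (bs j.+1 jN).
  have e1 := J_add e0 pO bp bq bq'; have e2 := J_add e0 pO bp bp' bq'.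
  exact: (cell_aux e1 e2).
apply/eqP; rewrite eq_sym -subr_eq0 /I -sumrB.
rewrite (telescope_sumr_eq E)//.
have nN : nd N N = 1 by rewrite /nd divff// pnatr_eq0 -lt0n.
have n0 : nd N 0 = 0 by rewrite /nd mul0r.
have Op0 : Omega p0.
  have h01 : 0 <= (0 : R) <= 1 by rewrite lexx ler01.
  by rewrite -(Hp0 0 h01).1; apply: HO; exact: sqI.
by rewrite /E nN n0 (Hp0 s hs).1 (Hp0 s hs).2 (Hp0 s' hs').1 (Hp0 s' hs').2 J_refl// subrr.
Qed.

Definition polygon n (p : nat -> P) (t : R) : P :=
  p 0%N + \sum_(0 <= k < n) clamp 0 1 (n%:R * t - k%:R) *: (p k.+1 - p k).

Lemma polygonE n (p : nat -> P) k (t : R) : (k < n)%N -> k%:R <= n%:R * t <= k.+1%:R ->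
  polygon n p t = p k + (n%:R * t - k%:R) *: (p k.+1 - p k).
Proof.
move=> kn /andP[h1 h2]; rewrite /polygon (big_cat_nat (n := k))//=; last exact: ltnW.
rewrite (big_ltn kn) clampE; last by rewrite subr_ge0 h1/= lerBlDl natr1.
rewrite (telescope_sumr_eq p)//; last first.
  move=> i /andP[_ ik]; rewrite /clamp min_l; last first.
    by rewrite lerBrDl natr1 (le_trans _ h1)// ler_nat.
  by rewrite max_r ?scale1r.
rewrite [X in _ + (_ + (_ + X))]big_nat big1 ?addr0 ?addrA; last first.
  move=> i /andP[ki _]; rewrite /clamp max_l ?scale0r// ge_min; apply/orP; right.
  by rewrite subr_le0 (le_trans h2)// ler_nat.
by rewrite [p 0%N + p k]addrC addrK.
Qed.

Lemma polygon_cont n (p : nat -> P) : continuous (polygon n p).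
Proof.
move=> t; apply: cvgD; first exact: cvg_cst.
elim: n {2 4}n => [n|m IH n]; first by under eq_fun do rewrite big_geq//; rewrite big_geq//; exact: cvg_cst.
under eq_fun do rewrite big_nat_recr//=; rewrite big_nat_recr//=.
apply: cvgD; first exact: IH.
apply: cvgZ; last exact: cvg_cst.
apply: (@continuous_comp R R R (fun t => n%:R * t - m%:R) (clamp 0 1)); last exact: clamp_cont.
by apply: cvgB; [apply: cvgM; [exact: cvg_cst | exact: cvg_id] | exact: cvg_cst].
Qed.

Lemma ball_seg c (s : R) p q (u : R) : 0 <= u <= 1 -> ball c s p -> ball c s q -> ball c s (p + u *: (q - p)).
Proof.
move=> /andP[u0 u1]; have seg (x y z : R) : `|x - y| < s -> `|x - z| < s -> `|x - (y + u * (z - y))| < s.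
  rewrite (_ : x - (y + u * (z - y)) = (1 - u) * (x - y) + u * (x - z)); last by ring.
  move=> h1 h2; apply: (le_lt_trans (ler_normD _ _)); rewrite !normrM (ger0_norm u0) ger0_norm ?subr_ge0//.
  move: u1; rewrite le_eqVlt => /orP[/eqP ->|u1]; first by rewrite subrr mul0r add0r mul1r.
  have : (1 - u) * `|x - y| < (1 - u) * s by rewrite ltr_pM2l// subr_gt0.
  have : u * `|x - z| <= u * s by rewrite ler_wpM2l// ltW.
  lra.
by move=> /ball2E[h1 h2] /ball2E[h3 h4]; apply/ball2E; split; exact: seg.
Qed.

Hypothesis sc : simply_connected Omega.

Lemma ball_box c (s : R) : ball c s `<=` box c s.
Proof. by move=> y /ball2E[h1 h2]; apply/boxE; rewrite !(distrC y.1) !(distrC y.2) !ltW. Qed.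

(** The closed polygon through the points of the chain is contracted by simple connectedness, and
    [homotopy_sum] says that the sum over a fine subdivision of it vanishes; on each edge, which lies in
    one square, that sum telescopes to [J]. *)
Lemma closed_chain n (p : nat -> P) : (forall k, (k < n)%N -> step (p k) (p k.+1)) -> p n = p 0%N ->
  \sum_(0 <= k < n) J (p k) (p k.+1) = 0.
Proof.
case: n => [|n']; first by rewrite big_geq.
set n := n'.+1 => st pn; have n0 : (0 : R) < n%:R by rewrite ltr0n.
have find (t : R) : 0 <= t <= 1 -> exists k, (k < n)%N /\ k%:R <= n%:R * t <= k.+1%:R.
  move=> /andP[t0 t1]; have nt0 : 0 <= n%:R * t by rewrite mulr_ge0.
  have [t1'|t1'] := ltP t 1; last first.
    exists n'; split => //; have -> : t = 1 by apply/eqP; rewrite eq_le t1.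
    by rewrite mulr1 lexx ler_nat leqnSn.
  exists (Num.truncn (n%:R * t)); have /andP[h1 h2] := truncn_itv nt0.
  split; last by rewrite h1 ltW.
  by rewrite -(ltr_nat R) (le_lt_trans h1)// gtr_pMr.
have pO k : (k < n)%N -> forall t : R, k%:R <= n%:R * t <= k.+1%:R -> forall c (s : R), ball c s (p k) -> ball c s (p k.+1) ->
    ball c s (polygon n p t).
  move=> kn t ht c s cp cq; rewrite (polygonE p kn ht); apply: ball_seg => //.
  by move: ht => /andP[h1 h2]; rewrite subr_ge0 h1/= lerBlDl natr1.
have g0 : polygon n p 0 = p 0%N.
  rewrite (@polygonE n p 0 0)//; last by rewrite mulr0 lexx ler0n.
  by rewrite mulr0 subrr scale0r addr0.
have g1 : polygon n p 1 = p 0%N.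
  rewrite (@polygonE n p n' 1)//; last by rewrite mulr1 lexx ler_nat leqnSn.
  by rewrite mulr1 -natrB// subSnn scale1r addrC subrK.
have [|||H [cH HO H0 H1 Hs]] := sc (gamma := polygon n p).
- by apply: continuous_subspaceT; exact: polygon_cont.
- move=> t; rewrite in_itv/= => /find[k [kn ht]].
  have [c [s [s0 cO cp cq]]] := st k kn; apply: cO; apply: ball_box.
  exact: pO kn t ht c s cp cq.
- by rewrite g0 g1.
have [|s hs|d [d0 Hd]] := @homotopy_sum H (p 0%N) cH.
- by move=> [s t] [/= hs ht]; exact: HO.
- have hi : s \in `[0, 1] by rewrite in_itv.
  by have [e1 e2] := Hs s hi; rewrite e1 e2 g0.
(* a multiple of [n], so that the vertices of the polygon are nodes of the subdivision *)
pose m := (Num.truncn d^-1).+1; pose N := (n * m)%N.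
have m0 : (0 : R) < m%:R by rewrite ltr0n.
have N0 : (0 < N)%N by rewrite muln_gt0.
have Nd : N%:R^-1 < d.
  rewrite -[ltRHS]invrK ltf_pV2 ?posrE ?invr_gt0 ?ltr0n//.
  rewrite (lt_le_trans (truncnS_gt _))// ler_nat -/m leq_pmull//.
have := Hd N N0 Nd; rewrite [RHS]big1_seq; last first.
  move=> j /andP[_]; rewrite mem_index_iota => /andP[_ jN].
  have hn i : (i <= N)%N -> nd N i \in `[0, 1] by move=> iN; rewrite in_itv/=; exact: nd_in.
  rewrite (H1 _ (hn _ (ltnW jN))) (H1 _ (hn _ jN)) g0; apply: J_refl.
  have [c [s [s0 cO cp cq]]] := st 0%N isT; exact/cO/ball_box.
move=> EN; rewrite -[RHS]EN; have -> : \sum_(0 <= j < N) J (H (0, nd N j)) (H (0, nd N j.+1)) =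
    \sum_(0 <= j < N) J (polygon n p (nd N j)) (polygon n p (nd N j.+1)).
  rewrite !big_nat; apply: eq_bigr => j /andP[_ jN].
  by rewrite !H0 ?in_itv/= ?nd_in// ltnW.
have ndm j : n%:R * nd N j = j%:R / m%:R.
  rewrite /nd /N natrM; field; by rewrite !gt_eqF.
have main k : (k <= n)%N -> \sum_(0 <= i < k) J (p i) (p i.+1) =
    \sum_(0 <= j < (k * m)%N) J (polygon n p (nd N j)) (polygon n p (nd N j.+1)).
  elim: k => [_|k IH kn]; first by rewrite mul0n !big_geq.
  rewrite big_nat_recr//= (IH (ltnW kn)) [RHS](big_cat_nat (n := (k * m)%N))//=; last by rewrite leq_pmul2r.
  congr (_ + _); have [c [s [s0 cO cp cq]]] := st k kn.
  have [G HG] := locpot s0 cO.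
  have inb j : (k * m <= j <= k.+1 * m)%N -> k%:R <= n%:R * nd N j <= k.+1%:R.
    by move=> /andP[h1 h2]; rewrite ndm ler_pdivlMr// ler_pdivrMr// -!natrM !ler_nat h1.
  have km : (k * m <= k.+1 * m)%N by rewrite leq_mul2r leqnSn orbT.
  have mm : (m%:R : R) != 0 by rewrite gt_eqF.
  have pk : polygon n p (nd N (k * m)) = p k.
    rewrite (polygonE p kn); last by apply: inb; rewrite leqnn km.
    by rewrite ndm natrM mulfK// subrr scale0r addr0.
  have pk1 : polygon n p (nd N (k.+1 * m)) = p k.+1.
    rewrite (polygonE p kn); last by apply: inb; rewrite leqnn km.
    by rewrite ndm natrM mulfK// -natrB// subSnn scale1r addrC subrK.
  rewrite (@telescope_sumr_eq _ _ _ (fun j => G (polygon n p (nd N j))))//.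
    by rewrite (J_eq s0 cO HG cp cq) pk pk1.
  move=> j /andP[h1 h2]; apply: (J_eq s0 cO HG); apply: (pO k kn) => //; apply: inb.
    by rewrite h1 ltnW.
  by rewrite (leq_trans h1)// h2.
by rewrite (main n (leqnn n)).
Qed.

(** [reach x0 x v]: some chain of squares from [x0] to [x] gives the integral [v]. *)
Inductive reach x0 : P -> R -> Prop :=
| reach0 : reach x0 x0 0
| reachS x v y of reach x0 x v & step x y : reach x0 y (v + J x y).

Lemma reach_trans x y z (v w : R) : reach x y v -> reach y z w -> reach x z (v + w).
Proof.
move=> rxy; elim=> [|u w' t _ IH st]; first by rewrite addr0.
by rewrite addrA; exact: reachS.
Qed.

Lemma reach_sym x y (v : R) : reach x y v -> reach y x (- v).
Proof.
elim=> [|u w t _ IH st]; first by rewrite oppr0; exact: reach0.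
rewrite opprD addrC -(J_sym st).
apply: reach_trans IH; rewrite -[J t u]add0r.
by apply: reachS; [exact: reach0 | exact: step_sym].
Qed.

Lemma reach_fun x y (v : R) : reach x y v -> exists n (p : nat -> P),
  [/\ p 0%N = x, p n = y, forall k, (k < n)%N -> step (p k) (p k.+1) &
      v = \sum_(0 <= k < n) J (p k) (p k.+1)].
Proof.
elim=> [|u w t _ [n [p [p0 pn st E]]] su]; first by exists 0%N, (fun=> x); rewrite big_geq.
exists n.+1, (fun k => if (k <= n)%N then p k else t); rewrite ltnn /=; split => //.
  move=> k; rewrite ltnS => kn; rewrite kn; case: ltnP => h; first exact: st.
  have -> : k = n by apply/eqP; rewrite eqn_leq kn.
  by rewrite pn.
rewrite big_nat_recr//= leqnn ltnn pn E; congr (_ + _).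
by rewrite !big_nat; apply: eq_bigr => k /andP[_ kn]; rewrite kn (ltnW kn).
Qed.

Lemma reach_closed x (v : R) : reach x x v -> v = 0.
Proof. by move=> /reach_fun[n [p [p0 pn st ->]]]; apply: closed_chain => //; rewrite pn. Qed.

Lemma reach_unique x y (v w : R) : reach x y v -> reach x y w -> v = w.
Proof.
move=> h1 h2; have := reach_closed (reach_trans h1 (reach_sym h2)).
by move=> /eqP; rewrite subr_eq0 => /eqP.
Qed.

Hypothesis cO : connected Omega.

(** The set of reachable points is open and closed in [Omega]. *)
Lemma reach_all x0 x : Omega x0 -> Omega x -> exists v, reach x0 x v.
Proof.
move=> O0 Ox; pose S := [set y | Omega y /\ exists v, reach x0 y v].
have near_step y : Omega y -> exists r : R, 0 < r /\ forall z, ball y r z -> Omega z /\ step y z.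
  move=> Oy; have [r [r0 yO]] := margin_pt oO Oy; exists r; split => // z yz.
  by split; [exact/yO/ball_box | exists y, r; split => //; exact: ballxx].
have oS : open S.
  rewrite openE => y [Oy [v rv]]; have [r [r0 Hr]] := near_step y Oy.
  apply/nbhs_ballP; exists r => //= z /Hr[Oz st]; split => //.
  by exists (v + J y z); exact: reachS.
have oT : open (Omega `\` S).
  rewrite openE => y [Oy nS]; have [r [r0 Hr]] := near_step y Oy.
  apply/nbhs_ballP; exists r => //= z /Hr[Oz st]; split => // -[_ [v rv]].
  by apply: nS; split => //; exists (v + J z y); apply: reachS => //; exact: step_sym.
have SO : S = Omega.
  apply: cO.
  - by exists x0; split => //; exists 0; exact: reach0.
  - by exists S => //; apply/seteqP; split => [y [Oy Sy]|y []//].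
  - exists (~` (Omega `\` S)); first exact: open_closedC.
    apply/seteqP; split => [y [Oy Sy]|y [Oy nS]]; first by split => // -[_]; apply.
    by apply: contrapT => h; apply: nS.
by have [] : S x by rewrite SO.
Qed.

(** Sums along chains of squares depend on the end point only, as they vanish on closed chains. *)
Lemma global_potential : exists h, potential Omega h.
Proof.
have [[x0 O0]|ne] := pselect (exists x0, Omega x0); last by exists (fun=> 0) => y i Oy; case: ne; exists y.
pose h x := get [set v | reach x0 x v].
have hP x : Omega x -> reach x0 x (h x).
  by move=> Ox; have [v rv] := reach_all O0 Ox; exact: (@getI _ [set v | reach x0 x v] v).
exists h => y i Oy; have [r [r0 yO]] := margin_pt oO Oy; have [G HG] := locpot r0 yO.
have yy : ball y r y by exact: ballxx.
apply: (@d_near _ _ (fun z => (h y - G y) + G z)); last first.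
  by apply: d_eq (dD (dC (h y - G y) _ _) (HG y i yy)) _; rewrite add0r.
apply: filterS (nbhsx_ballx y _ r0) => z yz.
have st : step y z by exists y, r; split.
rewrite (reach_unique (hP z (yO _ (ball_box yz))) (reachS (hP y Oy) st)).
by rewrite (J_eq r0 yO HG yy yz); ring.
Qed.

End Monodromy.

(** * Growth of harmonic functions at the boundary *)

Section RepresentativeBound.
Context {R : realType}.
Local Notation P := (R * R)%type.
Implicit Types (f g h k phi psi S T : P -> R) (x y z : P) (D E : (P -> R) -> R).

Lemma sqr_le (a b : R) : `|a| <= b -> a ^+ 2 <= b ^+ 2.
Proof.
by move=> h; rewrite -[leLHS]real_normK ?num_real// lerXn2r ?nnegrE// (le_trans _ h).
Qed.

Lemma foldr_scale (a : R) g s : smooth g ->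
  foldr (@pder R) (fun y => g (a *: y)) s = fun y => a ^+ size s * foldr (@pder R) g s (a *: y).
Proof.
move=> sg; elim: s => [|i s IH] /=; first by apply/funext => y; rewrite expr0 mul1r.
rewrite IH; apply/funext => y; have /smoothP/(_ 1%N)/Ck_der/(_ i) dk : smooth (foldr (@pder R) g s).
  by move=> s'; rewrite -foldr_cat; exact: sg.
have h : is_derive (a *: y + 0) (dir i) (foldr (@pder R) g s) (pder i (foldr (@pder R) g s) (a *: y)).
  by rewrite addr0; exact: dk.
have := d_val (dZ (a ^+ size s) (d_affine h)).
rewrite (_ : (fun z => _ * _) = fun y => a ^+ size s * foldr (@pder R) g s (a *: y)); last first.
  by apply/funext => z; rewrite addr0.
by move=> E; rewrite [LHS]E exprSr mulrA.
Qed.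

(** The bound for [r = 1], scaled. *)
Lemma kern_foldr s : exists B : R, 0 <= B /\ forall r y, 0 < r ->
  `|foldr (@pder R) (kern r) s y| <= B * r^-1 ^+ (2 + size s).
Proof.
have tk := @kern_test R 1 ltr01; have [B [B0 HB]] := test_bounded (test_foldr s tk).
exists B; split => // r y r0.
have E : kern r = fun y => r^-1 ^+ 2 * kern 1 (r^-1 *: y) + 0.
  by apply/funext => z; rewrite addr0; exact: kern_scale.
have tz : test_function setT (fun _ : P => 0 : R).
  by split; [exact: smooth_cst | exists set0; split => //; exact: compact0].
have ts : test_function setT (fun y : P => kern 1 (r^-1 *: y)).
  have := testZ (r ^+ 2) (test_mono (@subsetT _ _) (kern_test r0)).
  rewrite (_ : (fun x => _) = fun y : P => kern 1 (r^-1 *: y))//.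
  by apply/funext => z; rewrite (kern_scale z r0) mulrA -exprMn divff ?expr1n ?mul1r// gt_eqF.
have F1 := congr1 (fun F => F y) (foldr_lin (r^-1 ^+ 2) s ts tz); rewrite -E in F1.
have F2 := congr1 (fun F => F y) (foldr_scale r^-1 s (test_smooth tk)).
have Z : foldr (@pder R) (fun _ : P => 0 : R) s y = 0.
  have := congr1 (fun F => F y) (foldr_lin (-1) s tz tz); rewrite /= (_ : (fun _ : P => -1 * 0 + 0) = fun=> 0).
    by move=> ->; ring.
  by apply/funext => z; rewrite mulr0 addr0.
rewrite /= Z addr0 in F1; rewrite /= in F2; rewrite F1 F2 mulrA -exprD normrM ger0_norm; last first.
  by rewrite exprn_ge0// invr_ge0 ltW.
by rewrite mulrC ler_wpM2r ?exprn_ge0 ?invr_ge0// ltW.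
Qed.

Variable Omega : set P.
Hypothesis oO : open Omega.
Hypothesis bO : bounded_set Omega.
Local Notation L2 := (L2 Omega).
Local Notation test := (test_function Omega).
Local Notation dist := (dist Omega).

(** What remains of being a sum of derivatives of order at most two of square integrable functions
    when tested against kernels. For [D = d_i d_j T], the bound holds with [S = T^2] by the
    Cauchy-Schwarz inequality: [|d_i d_j (kern r)| <= B r^-4] on a square of area [4 r^2], and
    [(r^-4)^2 * r^2 = r^-6]. *)
Definition order2 D := exists S (C : R), [/\ intg S, forall x, 0 <= S x, 0 <= C &
  forall x (r : R), 0 < r -> box x r `<=` Omega ->
    D (shifted (kern r) x) ^+ 2 <= C * r^-1 ^+ 6 * Int (fun y => S y * \1_(box x r) y)].

Lemma order2_eq D E : dist_eq Omega D E -> order2 E -> order2 D.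
Proof.
move=> DE [S [C [iS S0 C0 H]]]; exists S, C; split => // x r r0 rO.
by rewrite DE; [exact: H | exact: test_shift (kern_test r0) rO].
Qed.

Lemma order2_lin (a : R) D E : order2 D -> order2 E -> order2 (fun phi => a * D phi + E phi).
Proof.
move=> [S [C [iS S0 C0 H]]] [S' [C' [iS' S0' C0' H']]].
exists (fun y => S y + S' y), (2 * a ^+ 2 * C + 2 * C').
have a2 := sqr_ge0 a; have aC := mulr_ge0 a2 C0.
split; [exact: intgD | by move=> x; exact: addr_ge0 | by lra |] => x r r0 rO.
have h := H x r r0 rO; have h' := H' x r r0 rO.
apply: (le_trans (sqr_le2 _ _)); rewrite exprMn.
have ib := intg_indicM iS (mset_box x r); have ib' := intg_indicM iS' (mset_box x r).
have -> : Int (fun y => (S y + S' y) * \1_(box x r) y) = Int (fun y => S y * \1_(box x r) y) + Int (fun y => S' y * \1_(box x r) y).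
  by rewrite -IntD//; congr Int; apply/funext => y; rewrite mulrDl.
have I0 : 0 <= Int (fun y => S y * \1_(box x r) y) by apply: Int_ge0 => y; rewrite mulr_ge0// indicE.
have I0' : 0 <= Int (fun y => S' y * \1_(box x r) y) by apply: Int_ge0 => y; rewrite mulr_ge0// indicE.
have w0 : 0 <= r^-1 ^+ 6 by rewrite exprn_ge0// invr_ge0 ltW.
move: h h' I0 I0' w0; set I := Int _; set I' := Int _; set w := r^-1 ^+ 6.
move: (D _) (E _) => d e h h' I0 I0' w0.
have k1 : a ^+ 2 * d ^+ 2 <= a ^+ 2 * (C * w * I) by rewrite ler_wpM2l.
have k2 : 0 <= a ^+ 2 * C * w * I' := mulr_ge0 (mulr_ge0 aC w0) I0'.
have k3 : 0 <= C' * w * I := mulr_ge0 (mulr_ge0 C0' w0) I0.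
lra.
Qed.

Lemma margin_le x (r : R) : exists2 M : R, 0 <= M & forall x (r : R), 0 < r -> box x r `<=` Omega -> r <= M.
Proof.
have [M [M0 HM]] := bounded_box bO; exists M => // {}x {}r r0 rO.
have h (e : R) : `|e| <= r -> `|x.1 + e| <= M.
  move=> er; have /HM/boxE[/=] : Omega (x.1 + e, x.2).
    apply: rO; apply/boxE; split => /=; first by rewrite addrAC subrr add0r.
    by rewrite subrr normr0 ltW.
  by rewrite subr0.
have rr : `|r| <= r by rewrite ger0_norm// ltW.
have rr' : `|- r| <= r by rewrite normrN.
have := h _ rr; have := h _ rr'; rewrite !ler_norml => /andP[? ?] /andP[? ?]; lra.
Qed.

Lemma order2_foldr s T : (size s <= 2)%N -> L2 T -> order2 (fun phi => dot Omega T (foldr (@pder R) phi s)).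
Proof.
move=> s2 lT; have sT : sqi (T \_ Omega) by apply/L2P.
have [B [B0 HB]] := kern_foldr s; have [M M0 HM] := margin_le 0 0.
have B2 := sqr_ge0 B; have w1 : 0 <= M ^+ (2 * (2 - size s)) by exact: exprn_ge0.
exists (fun y => (T \_ Omega) y ^+ 2), (4 * B ^+ 2 * M ^+ (2 * (2 - size s))); split.
- by case: sT.
- by move=> x; exact: sqr_ge0.
- by rewrite mulr_ge0// mulr_ge0.
move=> x r r0 rO; have tk := test_shift (kern_test r0) rO.
have rM := HM x r r0 rO; have tk2 := test_foldr s tk.
set K := foldr (@pder R) (shifted (kern r) x) s.
have KE y : K y = foldr (@pder R) (kern r) s (y - x).
  have F := foldr_shift (kern r) x s.
  exact: (congr1 (fun G : R * R -> R => G y) F).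
have Kout y : ~ box x r y -> K y = 0.
  move=> ny; have [_ [L [_ Lr L0]]] := test_foldr s (kern_test r0).
  by rewrite KE; apply: L0 => /Lr /boxP; rewrite subr0 => h; apply: ny; apply/boxP.
have E : dot Omega T K = ip (fun y => (T \_ Omega) y * \1_(box x r) y) K.
  rewrite dotE; apply: (congr1 (@Int R)); apply/funext => y.
  rewrite indicE; case: (boolP (y \in box x r)); first by rewrite mulr1.
  by rewrite notin_setE => /Kout ->; rewrite !mulr0.
have sb : sqi (fun y => (T \_ Omega) y * \1_(box x r) y).
  have mb := mfun_indic (mset_box x r).
  split; first by apply: mfunM => //; case: sT.
  rewrite (_ : (fun y => _ ^+ 2) = fun y => (T \_ Omega) y ^+ 2 * \1_(box x r) y).
    by apply: intg_indicM; [case: sT | exact: mset_box].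
  by apply/funext => y; rewrite indicE; case: (_ \in _); rewrite ?mulr1 ?mulr0// expr0n.
have sk : sqi K by have /L2P := L2_test tk2; rewrite (patch_test tk2).
rewrite E; apply: (le_trans (ip_CS sb sk)).
have -> : ip (fun y => (T \_ Omega) y * \1_(box x r) y) (fun y => (T \_ Omega) y * \1_(box x r) y) =
    Int (fun y => (T \_ Omega) y ^+ 2 * \1_(box x r) y).
  apply: (congr1 (@Int R)); apply/funext => y; rewrite indicE.
  by case: (_ \in _); rewrite ?mulr1 ?mulr0 ?expr2.
have I0 : 0 <= Int (fun y => (T \_ Omega) y ^+ 2 * \1_(box x r) y).
  by apply: Int_ge0 => y; rewrite mulr_ge0 ?sqr_ge0// indicE.
rewrite mulrC ler_wpM2r//.
have w0 : 0 <= r^-1 by rewrite invr_ge0 ltW.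
have le1 : ip K K <= Int (fun y => (B * r^-1 ^+ (2 + size s)) ^+ 2 * \1_(box x r) y).
  apply: le_Int.
  - exact: (sqi_mul sk sk).
  - by apply: intgZ; exact: intg_box.
  move=> y; rewrite -expr2 indicE; case: (boolP (y \in box x r)) => [_|].
    by rewrite mulr1 KE; exact: sqr_le (HB r (y - x) r0).
  by rewrite notin_setE => /Kout ->; rewrite mulr0 expr0n.
apply: (le_trans le1); rewrite IntZ ?Int_box ?(ltW r0)//; last exact: intg_box.
rewrite (_ : _ * _ = 4 * B ^+ 2 * r ^+ (2 * (2 - size s)) * r^-1 ^+ 6).
  rewrite ler_wpM2r ?exprn_ge0// ler_wpM2l ?mulr_ge0// lerXn2r ?nnegrE// ltW//.
have rn0 : r != 0 by exact: lt0r_neq0.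
by move: s2; case: (size s) => [|[|[|n]]]//= _; field.
Qed.

Lemma order2_dd i j T : L2 T -> order2 (dist_der i (dist_der j (dist_of Omega T))).
Proof.
move=> lT; apply: order2_eq (@order2_foldr [:: j; i] T isT lT) => phi tp.
by rewrite /dist_der opprK.
Qed.

Lemma order2_d i T : L2 T -> order2 (dist_der i (dist_of Omega T)).
Proof.
move=> lT; have lT' := L2N lT; apply: order2_eq (@order2_foldr [:: i] (fun x => - T x) isT lT') => phi tp.
exact: esym (dotNl lT (L2_test (test_pder i tp))).
Qed.

(** Interior estimate for the harmonic function that represents [D]. *)
Lemma rep_bound D : dist D -> harmonic Omega D -> order2 D ->
  exists S (C : R), [/\ intg S, forall x, 0 <= S x, 0 <= C &
  forall x (r : R), 0 < r -> box x r `<=` Omega ->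
    rep Omega D x ^+ 2 <= C * r^-1 ^+ 6 * Int (fun y => S y * \1_(box x r) y)].
Proof.
move=> dD hD [S [C [iS S0 C0 H]]]; exists S, C; split => // x r r0 rO.
by rewrite (repE dD hD r0 rO); exact: H.
Qed.

End RepresentativeBound.

(** * Hardy's inequality above a graph *)

Section HardyCore.
Context {R : realType}.
Local Notation P := (R * R)%type.
Implicit Types (x y z : P).

Lemma compact_bdd (K : set P) (f : P -> R) : compact K -> (forall x, K x -> {for x, continuous f}) ->
  exists C : R, 0 <= C /\ forall x, K x -> `|f x| <= C.
Proof.
move=> cK cf; have [d [d0 Hd]] := compact_unif cK cf ltr01.
move: cK => /compact_near_coveringP cK.
have := cK R (pinfty_nbhs R) (fun C x => `|f x| <= C) _ _.
case=> [x Kx|B [_ HB]].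
  exists (ball x d, [set C | `|f x| + 1 <= C]) => /=.
    by split; [exact: nbhsx_ballx | exact: nbhs_pinfty_ge (num_real _)].
  move=> [y C] /= [xy hC]; have := Hd x y Kx xy => h.
  by have := ler_normD (f y - f x) (f x); rewrite subrK => h'; lra.
exists (`|B| + 1); split; first by have := normr_ge0 B; lra.
move=> x Kx; apply: (HB (`|B| + 1)) => //.
by have := ler_norm B; lra.
Qed.

Lemma cont_comp1 (F : R -> R) (f : P -> R) x : continuous F -> {for x, continuous f} ->
  {for x, continuous (fun y => F (f y))}.
Proof. by move=> cF cf; apply: (@continuous_comp _ _ _ f F) => //; exact: cF. Qed.

Variables (M m : R -> R).
Hypothesis m_cont : continuous m.
Hypothesis M_cont : continuous M.
Hypothesis M_der : forall t : R, is_derive t 1 M (m t).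
Hypothesis m_ge0 : forall t, 0 <= m t.
Hypothesis m_out : forall t, t <= 4^-1 \/ 1 <= t -> m t = 0.
Hypothesis M_out : forall t, t < 4^-1 -> M t = 0.
Hypothesis M_in : forall t, 1 <= t -> M t = 1.

Lemma M_itv t : 0 <= M t <= 1.
Proof.
have mono := d_nondecr M_der m_ge0; apply/andP; split.
  have [|h] := leP 0 t; last by rewrite M_out// (lt_trans h)// invr_gt0.
  by move=> t0; rewrite -(M_out (t := 0)) ?invr_gt0// mono.
have [h|h] := leP 1 t; first by rewrite M_in.
by rewrite -(M_in (t := 1))// mono// ltW.
Qed.

Lemma m_bdd : exists C : R, 0 <= C /\ forall t, m t <= C.
Proof.
have [//|x _|C [C0 HC]] := @compact_bdd (box 0 1) (fun x => m x.1).
- exact: compact_box.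
- by apply: (@continuous_comp _ _ _ fst m); [exact: fst_cont | exact: m_cont].
exists C; split => // t; have [t1|t1] := leP `|t| 1; last first.
  rewrite m_out//; move: t1; rewrite ltr_normr => /orP[] h; [right; exact: ltW|left].
  by rewrite (@le_trans _ _ 0) ?invr_ge0//; lra.
have := HC (t, 0); rewrite ger0_norm//; apply.
by apply/boxE => /=; rewrite !subr0 t1 normr0 ler01.
Qed.

Variables (c s : R) (g : R -> R) (p1 p2 rho H : R).
Hypothesis cs1 : c ^+ 2 + s ^+ 2 = 1.
Hypothesis g_cont : continuous g.
Hypothesis rho0 : 0 < rho.
Hypothesis H0 : 0 < H.
Hypothesis g_near : forall u, `|u - p1| <= rho -> `|g u - p2| <= H / 4.

(** Rotated coordinates, the direction [nrm] of the second one and the height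
    [del] above the graph of [g]. *)
Definition y1 x : R := c * x.1 + s * x.2.
Definition y2 x : R := - s * x.1 + c * x.2.
Definition del x : R := y2 x - g (y1 x).
Definition nrm : P := (- s, c).

Lemma y1_cont : continuous y1.
Proof.
move=> x; apply: cvgD; apply: cvgM; try exact: cvg_cst; [exact: fst_cont | exact: snd_cont].
Qed.
Lemma y2_cont : continuous y2.
Proof.
move=> x; apply: cvgD; apply: cvgM; try exact: cvg_cst; [exact: fst_cont | exact: snd_cont].
Qed.
Lemma del_cont : continuous del.
Proof.
move=> x; apply: cvgB; first exact: y2_cont.
by apply: (@continuous_comp _ _ _ y1 g); [exact: y1_cont | exact: g_cont].
Qed.

Lemma d_y1 (f : R -> R) x : is_derive x nrm (fun x => f (y1 x)) 0.
Proof.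
apply/derE => e e0; exists 1; split => // t _.
rewrite (_ : y1 (t *: nrm + x) = y1 x); first by rewrite subrr mulr0 subr0 normr0 mulr_ge0// ltW.
by rewrite /y1 /nrm /= /GRing.scale/=; ring.
Qed.

Lemma d_y2 x : is_derive x nrm y2 1.
Proof.
have h1 := d_fst x nrm; have h2 := d_snd x nrm; rewrite /= in h1 h2.
by apply: d_eq (dD (dZ (- s) h1) (dZ c h2)) _; rewrite -cs1 !expr2; ring.
Qed.

Lemma d_del x : is_derive x nrm del 1.
Proof. by apply: d_eq (dB (d_y2 x) (d_y1 g x)) _; rewrite subr0. Qed.

Definition slab : set P := [set x | `|y1 x - p1| <= rho /\ y2 x <= p2 + H].

Lemma slab_closed : closed slab.
Proof.
rewrite (_ : slab = (fun x => `|y1 x - p1|) @^-1` [set t | t <= rho] `&` y2 @^-1` [set t | t <= p2 + H])//.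
apply: closedI; apply: closed_comp.
- move=> x _; apply: cvg_norm; apply: cvgB; [exact: y1_cont | exact: cvg_cst].
- exact: closed_le.
- by move=> x _; exact: y2_cont.
- exact: closed_le.
Qed.

Lemma slab_box : exists B : R, 0 <= B /\ forall x, slab x -> 0 <= del x -> box 0 B x.
Proof.
exists (`|p1| + rho + `|p2| + H); split.
  by rewrite !addr_ge0 ?normr_ge0// ltW.
move=> x [h1 h2] d0; have h3 := g_near h1.
have cs : `|c| <= 1 /\ `|s| <= 1.
  split; rewrite -(ler_pXn2r (n := 2))// ?nnegrE// real_normK ?num_real// expr1n -cs1;
  by have := sqr_ge0 c; have := sqr_ge0 s; lra.
have n1 : `|y1 x| <= `|p1| + rho.
  by have := ler_normD (y1 x - p1) p1; rewrite subrK; lra.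
have n2 : `|y2 x| <= `|p2| + H.
  move: h3 d0 h2; rewrite /del ler_norml => /andP[h3 h4] d0 h2; rewrite ler_norml.
  by have := ler_norm p2; have := ler_norm (- p2); rewrite normrN; have := H0 => *; apply/andP; split; lra.
have E1 : x.1 = c * y1 x - s * y2 x.
  by rewrite -[LHS]mul1r -cs1 /y1 /y2; ring.
have E2 : x.2 = s * y1 x + c * y2 x.
  by rewrite -[LHS]mul1r -cs1 /y1 /y2; ring.
have le1 (a b : R) : `|a| <= 1 -> `|a * b| <= `|b| by move=> a1; rewrite normrM ler_piMl.
have [c1 s1] := cs; apply/boxE; rewrite !subr0; split.
  by rewrite E1 (le_trans (ler_normB _ _))//; have := le1 _ (y1 x) c1; have := le1 _ (y2 x) s1; lra.
by rewrite E2 (le_trans (ler_normD _ _))//; have := le1 _ (y1 x) s1; have := le1 _ (y2 x) c1; lra.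
Qed.

Lemma slab_compact (e : R) : 0 <= e -> compact (slab `&` [set x | e <= del x]).
Proof.
move=> e0; have [B [B0 HB]] := slab_box.
apply: (@subclosed_compact _ _ (box 0 B)).
- apply: closedI; first exact: slab_closed.
  rewrite (_ : [set x | _] = del @^-1` [set t | e <= t])//; apply: closed_comp; last exact: closed_ge.
  by move=> x _; exact: del_cont.
- exact: compact_box.
- by move=> x [sx /= ex]; apply: HB => //; exact: le_trans ex.
Qed.

Variable Omega : set P.
Hypothesis oO : open Omega.
Hypothesis slabO : forall x, slab x -> 0 < del x -> Omega x.
Variables h k l : P -> R.
Hypothesis h_der : forall x, Omega x -> is_derive x nrm h (k x).
Hypothesis k_der : forall x, Omega x -> is_derive x nrm k (l x).
Hypothesis h_cont : forall x, Omega x -> {for x, continuous h}.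
Hypothesis k_cont : forall x, Omega x -> {for x, continuous k}.
Hypothesis l_cont : forall x, Omega x -> {for x, continuous l}.
Hypothesis l_intg : intg (fun x => if `[< slab x /\ 0 < del x >] then del x ^+ 4 * l x ^+ 2 else 0).

Let A1 x := M (2 - 2 * ((y1 x - p1) / rho) ^+ 2).
Let A2 x := M ((p2 + H - y2 x) * (2 / H)).
Let A3 (e : R) x := M (e * del x).
Let Phi x := del x * h x ^+ 2 + del x ^+ 3 * k x ^+ 2.
Let Phi' x := h x ^+ 2 + 2 * del x * h x * k x + 3 * del x ^+ 2 * k x ^+ 2 + 2 * del x ^+ 3 * k x * l x.
Let m2 x := m ((p2 + H - y2 x) * (2 / H)).
Let m3 (e : R) x := m (e * del x).
Let F (e : R) x := A1 x * (A2 x * A3 e x * Phi x).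
Let G (e : R) x := A1 x * (A2 x * A3 e x * Phi' x + A2 x * (e * m3 e x) * Phi x - (2 / H) * m2 x * A3 e x * Phi x).

Let A1_cont : continuous A1.
Proof.
move=> x; apply: (@continuous_comp _ _ _ (fun x => 2 - 2 * ((y1 x - p1) / rho) ^+ 2) M); last exact: M_cont.
apply: cvgB; first exact: cvg_cst.
apply: cvgM; first exact: cvg_cst.
apply: (@continuous_comp _ _ _ (fun x => (y1 x - p1) / rho) (fun t => t ^+ 2)); last exact: exprn_continuous.
by apply: cvgM; [apply: cvgB; [exact: y1_cont | exact: cvg_cst] | exact: cvg_cst].
Qed.

Let y2s_cont : continuous (fun x => (p2 + H - y2 x) * (2 / H)).
Proof.
by move=> x; apply: cvgM; [apply: cvgB; [exact: cvg_cst | exact: y2_cont] | exact: cvg_cst].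
Qed.

Let dels_cont (e : R) : continuous (fun x => e * del x).
Proof. by move=> x; apply: cvgM; [exact: cvg_cst | exact: del_cont]. Qed.

Let A2_cont : continuous A2.
Proof. by move=> x; exact: cont_comp1 M_cont (@y2s_cont x). Qed.
Let m2_cont : continuous m2.
Proof. by move=> x; exact: cont_comp1 m_cont (@y2s_cont x). Qed.
Let A3_cont e : continuous (A3 e).
Proof. by move=> x; exact: cont_comp1 M_cont (@dels_cont e x). Qed.
Let m3_cont e : continuous (m3 e).
Proof. by move=> x; exact: cont_comp1 m_cont (@dels_cont e x). Qed.

Lemma pow_cont n (f : P -> R) x : {for x, continuous f} -> {for x, continuous (fun y => f y ^+ n)}.
Proof. by move=> cf; apply: (@continuous_comp _ _ _ f (fun t => t ^+ n)) => //; exact: exprn_continuous. Qed.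

Let Phi_cont x : Omega x -> {for x, continuous Phi}.
Proof.
move=> Ox; have ch := h_cont Ox; have ck := k_cont Ox; have cd := @del_cont x.
apply: cvgD; apply: cvgM; [exact: cd | exact: pow_cont ch | exact: pow_cont cd | exact: pow_cont ck].
Qed.

Let Phi'_cont x : Omega x -> {for x, continuous Phi'}.
Proof.
move=> Ox; have ch := h_cont Ox; have ck := k_cont Ox; have cl := l_cont Ox; have cd := @del_cont x.
have c2 (a : R) : {for x, continuous (fun _ : P => a)} by exact: cvg_cst.
apply: cvgD; first apply: cvgD; first apply: cvgD.
- exact: pow_cont ch.
- by apply: cvgM; [apply: cvgM; [apply: cvgM; [exact: (c2 2) | exact: cd] | exact: ch] | exact: ck].
- by apply: cvgM; [apply: cvgM; [exact: (c2 3) | exact: pow_cont cd] | exact: pow_cont ck].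
- by apply: cvgM; [apply: cvgM; [apply: cvgM; [exact: (c2 2) | exact: pow_cont cd] | exact: ck] | exact: cl].
Qed.

Let F_cont e x : Omega x -> {for x, continuous (F e)}.
Proof.
move=> Ox; apply: cvgM; first exact: A1_cont.
apply: cvgM; last exact: Phi_cont.
by apply: cvgM; [exact: A2_cont | exact: A3_cont].
Qed.

Let G_cont e x : Omega x -> {for x, continuous (G e)}.
Proof.
move=> Ox; have cP := Phi_cont Ox; have cP' := Phi'_cont Ox.
have c1 := @A1_cont x; have c2 := @A2_cont x; have c3 := @A3_cont e x; have d2 := @m2_cont x; have d3 := @m3_cont e x.
apply: cvgM; first exact: c1.
apply: cvgB; first apply: cvgD.
- apply: cvgM; [apply: cvgM; [exact: c2 | exact: c3] | exact: cP'].
- apply: cvgM; [apply: cvgM; [exact: c2 | apply: cvgM; [exact: cvg_cst | exact: d3]] | exact: cP].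
- apply: cvgM; [apply: cvgM; [apply: cvgM; [exact: cvg_cst | exact: d2] | exact: c3] | exact: cP].
Qed.

Let F_der e x : Omega x -> is_derive x nrm (F e) (G e x).
Proof.
move=> Ox; have dh := h_der Ox; have dk := k_der Ox; have dd := d_del x.
have dA1 : is_derive x nrm A1 0 by exact: (d_y1 (fun t => M (2 - 2 * ((t - p1) / rho) ^+ 2))).
have dA2 : is_derive x nrm A2 (- (2 / H) * m2 x).
  have d2 : is_derive x nrm (fun x => (p2 + H - y2 x) * (2 / H)) (- (2 / H)).
    by apply: d_eq (dM (dB (dC (p2 + H) x nrm) (d_y2 x)) (dC (2 / H) x nrm)) _; ring.
  by rewrite mulrC; exact: (d_comp d2 (M_der _)).
have dA3 : is_derive x nrm (A3 e) (m3 e x * e).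
  have d3 : is_derive x nrm (fun x => e * del x) e by apply: d_eq (dZ e dd) _; ring.
  exact: (d_comp d3 (M_der _)).
have dP : is_derive x nrm Phi (Phi' x).
  have h2 := dM dh dh; have k2 := dM dk dk; have d3 := dM dd (dM dd dd).
  rewrite (_ : Phi = fun x => del x * (h x * h x) + del x * (del x * del x) * (k x * k x)); last first.
    by apply/funext => z; rewrite /Phi !exprS !expr0; ring.
  by apply: d_eq (dD (dM dd h2) (dM d3 k2)) _; rewrite /Phi' !exprS !expr0; ring.
by apply: d_eq (dM dA1 (dM (dM dA2 dA3) dP)) _; rewrite /G; ring.
Qed.

Let A1_out x : A1 x != 0 -> `|y1 x - p1| <= rho.
Proof.
apply: contraNT; rewrite -ltNge => hy; apply/eqP; apply: M_out.
have : 1 < ((y1 x - p1) / rho) ^+ 2.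
  rewrite -(real_normK (num_real (_ / _))) normrM normfV (gtr0_norm rho0).
  by rewrite exprn_egt1// ltr_pdivlMr// mul1r.
by move=> ?; lra.
Qed.

Let A2_out x : y2 x > p2 + H -> A2 x = 0 /\ m2 x = 0.
Proof.
move=> hy; have : (p2 + H - y2 x) * (2 / H) <= 0.
  by rewrite mulr_le0_ge0 ?divr_ge0// ?(ltW H0)//; lra.
move=> h0; split; [apply: M_out | apply: m_out; left].
  by apply: le_lt_trans h0 _; rewrite invr_gt0.
by apply: le_trans h0 _; rewrite invr_ge0.
Qed.

Let A3_out (e : R) x : 0 < e -> del x < (4 * e)^-1 -> A3 e x = 0 /\ m3 e x = 0.
Proof.
move=> e0 hy; have : e * del x < 4^-1.
  have -> : 4^-1 = e * (4 * e)^-1 by field; exact: lt0r_neq0.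
  by rewrite ltr_pM2l.
by move=> h'; split; [exact: M_out | apply: m_out; left; exact: ltW].
Qed.

Let Ke (e : R) := slab `&` [set x | (4 * e)^-1 <= del x].

Let FG_out (e : R) x : 0 < e -> ~ Ke e x -> F e x = 0 /\ G e x = 0.
Proof.
move=> e0 nK; rewrite /F /G.
have [->|/A1_out h1] := eqVneq (A1 x) 0; first by rewrite !mul0r.
have [h2|/A2_out[-> ->]] := leP (y2 x) (p2 + H); last by split; rewrite !(mul0r, mulr0, addr0, subr0, oppr0).
have [h3|/(A3_out e0)[-> ->]] := leP (4 * e)^-1 (del x).
  by exfalso; apply: nK.
by split; rewrite !(mul0r, mulr0, addr0, subr0, oppr0).
Qed.

Let Ke_O (e : R) : 0 < e -> Ke e `<=` Omega.
Proof.
by move=> e0 x [sx /= dx]; apply: slabO => //; apply: lt_le_trans dx; rewrite invr_gt0 mulr_gt0.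
Qed.

Let Ke_compact (e : R) : 0 < e -> compact (Ke e).
Proof. by move=> e0; apply: slab_compact; rewrite invr_ge0 mulr_ge0// ltW. Qed.

Let Ke_box : exists B : R, 0 <= B /\ forall e : R, 0 < e -> Ke e `<=` box 0 B.
Proof.
have [B [B0 HB]] := slab_box; exists B; split => // e e0 x [sx /= dx]; apply: HB => //.
by apply: le_trans dx; rewrite invr_ge0 mulr_ge0// ltW.
Qed.

Let patch_bdd (e : R) (f : P -> R) : 0 < e -> (forall x, Omega x -> {for x, continuous f}) ->
  (forall x, ~ Ke e x -> f x = 0) -> exists C : R, 0 <= C /\ forall x, `|(f \_ Omega) x| <= C.
Proof.
move=> e0 cf f0; have [|C [C0 HC]] := compact_bdd (Ke_compact e0) (f := f).
  by move=> x Kx; apply: cf; exact: Ke_O Kx.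
exists C; split => // x; rewrite patchE; case: ifP => _; last by rewrite normr0.
have [Kx|/f0 ->] := pselect (Ke e x); first exact: HC.
by rewrite normr0.
Qed.

Let IntG (e : R) : 0 < e -> intg (G e \_ Omega) /\ Int (G e \_ Omega) = 0.
Proof.
move=> e0; have [B [B0 HB]] := Ke_box.
have [CF [CF0 HCF]] := patch_bdd e0 (@F_cont e) (fun x nK => (FG_out e0 nK).1).
have [CG [CG0 HCG]] := patch_bdd e0 (@G_cont e) (fun x nK => (FG_out e0 nK).2).
have out (f : P -> R) x : (forall x, ~ Ke e x -> f x = 0) -> ~ box 0 B x -> (f \_ Omega) x = 0.
  by move=> f0 nb; rewrite patchE; case: ifP => // _; apply: f0 => /(HB e e0).
apply: (@Int_derive0 _ (F e \_ Omega) (G e \_ Omega) nrm B CG CF) => //.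
- move=> x; have [Ox|nO] := pselect (Omega x).
    have -> : (G e \_ Omega) x = G e x by rewrite patchE mem_set.
    apply: d_near (F_der e Ox).
    have : nbhs x Omega by apply: open_nbhs_nbhs.
    by apply: filterS => z Oz; rewrite patchE mem_set.
  have -> : (G e \_ Omega) x = 0 by rewrite patchE memNset.
  apply: d_near (dC (0 : R) x nrm).
  have nK : ~ Ke e x by move=> /(Ke_O e0).
  have cK : closed (Ke e) by apply: compact_closed; [exact: norm_hausdorff | exact: Ke_compact].
  have : nbhs x (~` Ke e) by apply: open_nbhs_nbhs; split => //; exact: closed_openC.
  apply: filterS => z nz; rewrite patchE; case: ifP => // _.
  by rewrite (FG_out e0 nz).1.
- by apply: mfun_open => // x; exact: F_cont.
- by apply: mfun_open => // x; exact: G_cont.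
- by move=> x; apply: out => y /(FG_out e0)[].
- by move=> x; apply: out => y /(FG_out e0)[].
Qed.

Let chi (e : R) x := A1 x * (A2 x * A3 e x).

Let A1i x : 0 <= A1 x <= 1. Proof. exact: M_itv. Qed.
Let A2i x : 0 <= A2 x <= 1. Proof. exact: M_itv. Qed.
Let A3i e x : 0 <= A3 e x <= 1. Proof. exact: M_itv. Qed.

(** Twice completing the square. *)
Let hardy_algebra (d u v w : R) : 0 <= d ->
  u ^+ 2 / 2 <= (u ^+ 2 + 2 * d * u * v + 3 * d ^+ 2 * v ^+ 2 + 2 * d ^+ 3 * v * w) + d ^+ 4 * w ^+ 2.
Proof.
move=> d0; rewrite -subr_ge0.
have -> : u ^+ 2 + 2 * d * u * v + 3 * d ^+ 2 * v ^+ 2 + 2 * d ^+ 3 * v * w + d ^+ 4 * w ^+ 2 - u ^+ 2 / 2 =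
  (u + 2 * d * v) ^+ 2 / 2 + (d * v + d ^+ 2 * w) ^+ 2 by field.
by rewrite addr_ge0 ?sqr_ge0// divr_ge0 ?sqr_ge0.
Qed.

(** Of the two cut-off factors that depend on the second coordinate, the one near the graph, with
    parameter [e], is increasing, so its derivative has the good sign; the other one varies at height
    at least [H / 4] only, where [Phi] is bounded by a constant independent of [e]. *)
Let lower : exists B : R, 0 <= B /\ forall e : R, 0 < e -> forall x, Omega x ->
  chi e x * (h x ^+ 2 / 2) <= G e x + (if `[< slab x /\ 0 < del x >] then del x ^+ 4 * l x ^+ 2 else 0)
    + (if `[< slab x /\ 0 < del x >] then B else 0).
Proof.
have [Cm [Cm0 HCm]] := m_bdd.
have e40 : 0 < H^-1 by rewrite invr_gt0.
have [|CP [CP0 HCP]] := compact_bdd (Ke_compact e40) (f := Phi).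
  by move=> x Kx; apply: Phi_cont; exact: Ke_O Kx.
have H20 : 0 <= 2 / H by rewrite divr_ge0// ltW.
have BC0 : 0 <= 2 / H * Cm * CP := mulr_ge0 (mulr_ge0 H20 Cm0) CP0.
exists (2 / H * Cm * CP); split; first exact: BC0.
move=> e e0 x Ox; case: asboolP => [[sx dx]|nV]; last first.
  have nK : ~ Ke e x.
    move=> [sx /= dx]; apply: nV; split => //; apply: lt_le_trans dx.
    by rewrite invr_gt0 mulr_gt0.
  have [_ ->] := FG_out e0 nK; rewrite !addr0 /chi.
  have [->|/A1_out h1] := eqVneq (A1 x) 0; first by rewrite !mul0r.
  have [h2|/A2_out[-> _]] := leP (y2 x) (p2 + H); last by rewrite mul0r mulr0 mul0r.
  have [h3|/(A3_out e0)[-> _]] := leP (4 * e)^-1 (del x); last by rewrite !mulr0 mul0r.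
  by exfalso; apply: nK.
have /andP[a0 a1] := A1i x; have /andP[b0 b1] := A2i x; have /andP[c0 c1] := A3i e x.
have P0 : 0 <= Phi x by rewrite addr_ge0// mulr_ge0 ?sqr_ge0 ?exprn_ge0// ltW.
have t1 : 2 / H * m2 x * A3 e x * Phi x <= 2 / H * Cm * CP.
  have [mz|mz] := eqVneq (m2 x) 0; first by rewrite mz mulr0 !mul0r.
  have [sx1 sx2] := sx.
  have dH : H / 4 <= del x.
    have : (p2 + H - y2 x) * (2 / H) < 1.
      by rewrite ltNge; apply: contraNN mz => hh; rewrite /m2 m_out//; right.
    rewrite mulrA ltr_pdivrMr// => hh; have := g_near sx1; rewrite ler_norml => /andP[_ hg].
    by rewrite /del; lra.
  have PC : Phi x <= CP.
    rewrite (le_trans (ler_norm _))// HCP//; split => //=.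
    by rewrite invfM invrK mulrC.
  have q1 : 0 <= 2 / H * m2 x := mulr_ge0 H20 (m_ge0 _).
  apply: (ler_pM (mulr_ge0 q1 c0) P0 _ PC).
  rewrite -[leRHS]mulr1; apply: (ler_pM q1 c0 _ c1).
  by rewrite ler_wpM2l//; exact: HCm.
have t2 : 0 <= A2 x * (e * m3 e x) * Phi x.
  by rewrite mulr_ge0// mulr_ge0// mulr_ge0 ?m_ge0// ltW.
have t3 := hardy_algebra (h x) (k x) (l x) (ltW dx); rewrite -/(Phi' x) in t3.
have W0 : 0 <= del x ^+ 4 * l x ^+ 2 by rewrite mulr_ge0 ?sqr_ge0// exprn_ge0// ltW.
have X0 : 0 <= chi e x := mulr_ge0 a0 (mulr_ge0 b0 c0).
have X1 : chi e x <= 1 by rewrite /chi mulr_ile1 ?(mulr_ge0 b0 c0)// mulr_ile1.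
have s1 : chi e x * (h x ^+ 2 / 2) <= chi e x * Phi' x + del x ^+ 4 * l x ^+ 2.
  apply: (le_trans (ler_wpM2l X0 t3)); rewrite mulrDr lerD2l.
  by rewrite ler_piMl.
have s2 : A1 x * (2 / H * m2 x * A3 e x * Phi x) <= 2 / H * Cm * CP.
  by apply: le_trans t1; rewrite ler_piMl// (mulr_ge0 (mulr_ge0 (mulr_ge0 H20 (m_ge0 _)) c0) P0).
have s3 : 0 <= A1 x * (A2 x * (e * m3 e x) * Phi x) by rewrite mulr_ge0.
have E : G e x = chi e x * Phi' x + A1 x * (A2 x * (e * m3 e x) * Phi x) - A1 x * (2 / H * m2 x * A3 e x * Phi x).
  by rewrite /G /chi; ring.
rewrite E; move: s1 s2 s3; move: (chi e x * (h x ^+ 2 / 2)) (chi e x * Phi' x) (A1 x * (2 / H * m2 x * A3 e x * Phi x)) (A1 x * (A2 x * (e * m3 e x) * Phi x)) (del x ^+ 4 * l x ^+ 2) (2 / H * Cm * CP) => ? ? ? ? ? ? *; lra.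
Qed.

Lemma slab_mset : mset2 (slab `&` [set x | 0 < del x]).
Proof.
apply: measurableI.
  have mC := open_mset (closed_openC slab_closed).
  by rewrite -(setCK slab); exact: measurableC.
apply: open_mset; rewrite (_ : [set x | _] = del @^-1` [set t | 0 < t])//.
by apply: open_comp => [x _|]; [exact: del_cont | exact: open_gt].
Qed.

(** Hardy's inequality above a Lipschitz graph, iterated: if [l] is the second derivative of [h] in the
    direction [nrm], transversal to the graph, then [del^4 * l^2] controls [h^2] up to bounded terms.
    Let [Phi = del * h^2 + del^3 * k^2]. Then [d_nrm Phi + del^4 * l^2 >= h^2 / 2], the difference being
    a sum of squares, and the integral of [d_nrm (chi * Phi)] vanishes for every cut-off [chi]. The
    cut-offs converge to a function which is [1] on the region, and Fatou's lemma concludes. *)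
Lemma hardy_core : intg (fun x => if `[< [/\ (y1 x - p1) ^+ 2 <= rho ^+ 2 / 2, y2 x <= p2 + H / 2 & 0 < del x] >]
  then h x ^+ 2 else 0).
Proof.
have [B [B0 HB]] := lower; have [b [b0 Hb]] := slab_box.
pose V := slab `&` [set x | 0 < del x].
have mV : mset2 V := slab_mset.
have Vb x : V x -> box 0 b x by move=> [sx /= dx]; apply: Hb => //; exact: ltW.
have iB : intg (fun x => if `[< slab x /\ 0 < del x >] then B else 0).
  rewrite (_ : (fun x => _) = fun x => B * \1_V x); last first.
    apply/funext => x; rewrite indicE; case: asboolP => hx; first by rewrite mem_set// mulr1.
    by rewrite memNset// mulr0.
  apply: intgZ; apply: (@intg_bdd _ _ 0 b 1).
  - exact: mfun_indic.
  - by move=> x; rewrite indicE; case: (_ \in _); rewrite ?normr1 ?normr0.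
  - by move=> x nb; rewrite indicE memNset// => /Vb.
pose W x := if `[< slab x /\ 0 < del x >] then del x ^+ 4 * l x ^+ 2 else 0.
have iW : intg W := l_intg.
pose BB x := if `[< slab x /\ 0 < del x >] then B else 0.
have {}iB : intg BB := iB.
have {}HB (e : R) : 0 < e -> forall x, Omega x -> chi e x * (h x ^+ 2 / 2) <= G e x + W x + BB x := HB e.
pose Fn (n : nat) := (fun x => chi n.+1%:R x * (h x ^+ 2 / 2)) \_ Omega.
pose f := (fun x => A1 x * (A2 x * (if 0 < del x then 1 else 0)) * (h x ^+ 2 / 2)) \_ Omega.
have n0 (n : nat) : (0 : R) < n.+1%:R by rewrite ltr0n.
have cFn n x : Omega x -> {for x, continuous (fun x => chi n.+1%:R x * (h x ^+ 2 / 2))}.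
  move=> Ox; apply: cvgM.
    apply: cvgM; first exact: A1_cont.
    by apply: cvgM; [exact: A2_cont | exact: A3_cont].
  by apply: cvgM; [exact: (pow_cont (h_cont Ox)) | exact: cvg_cst].
have Fout n x : ~ Ke n.+1%:R x -> chi n.+1%:R x * (h x ^+ 2 / 2) = 0.
  move=> nK; rewrite /chi.
  have [->|/A1_out h1] := eqVneq (A1 x) 0; first by rewrite !mul0r.
  have [h2|/A2_out[-> _]] := leP (y2 x) (p2 + H); last by rewrite mul0r mulr0 mul0r.
  have [h3|/(A3_out (n0 n))[-> _]] := leP (4 * n.+1%:R)^-1 (del x); last by rewrite !mulr0 mul0r.
  by exfalso; apply: nK.
have iFn n : intg (Fn n).
  have [C [C0 HC]] := patch_bdd (n0 n) (cFn n) (Fout n).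
  apply: (@intg_bdd _ _ 0 b C) => //; first by apply: mfun_open => // x; exact: cFn.
  move=> x nb; rewrite /Fn patchE; case: ifP => // _; apply: Fout => -[sx /= dx].
  by apply: nb; apply: Hb => //; apply: le_trans dx; rewrite invr_ge0 mulr_ge0.
have chi0 n x : 0 <= chi n.+1%:R x.
  by rewrite /chi !mulr_ge0//; [case/andP: (A1i x) | case/andP: (A2i x) | case/andP: (A3i n.+1%:R x)].
have [|n x|n|x|iff _] := @fatouR _ Fn f (Int W + Int BB).
- exact: iFn.
- rewrite /Fn patchE; case: ifP => // _.
  by rewrite mulr_ge0// divr_ge0 ?sqr_ge0.
- have [iG G0] := IntG (n0 n).
  rewrite -[leRHS]add0r -{1}G0 -IntD// -IntD//; last exact: intgD.
  apply: le_Int => //; first by apply: intgD => //; exact: intgD.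
  move=> x; rewrite /Fn addrA !patchE; case: ifPn => [|_].
    by rewrite inE => Ox; exact: HB.
  rewrite add0r addr_ge0// /W /BB; case: asboolP => // -[_ dx].
  by rewrite mulr_ge0 ?sqr_ge0// exprn_ge0// ltW.
- rewrite /Fn /f; case: (boolP (x \in Omega)) => xO.
    rewrite patchE xO; rewrite (_ : (fun n => _) = fun n => chi n.+1%:R x * (h x ^+ 2 / 2)); last first.
      by apply/funext => n; rewrite patchE xO.
    apply: cvgM; last exact: cvg_cst.
    apply: cvgM; first exact: cvg_cst.
    by apply: cvgM; [exact: cvg_cst | exact: step_scale].
  rewrite patchE (negbTE xO) (_ : (fun n => _) = fun n => 0); first exact: cvg_cst.
  by apply/funext => n; rewrite patchE (negbTE xO).
have inO x : [/\ (y1 x - p1) ^+ 2 <= rho ^+ 2 / 2, y2 x <= p2 + H / 2 & 0 < del x] -> V x /\ (A1 x = 1 /\ A2 x = 1).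
  move=> [h1 h2 h3]; have r2 : 0 < rho ^+ 2 by rewrite exprn_gt0.
  split; last first.
    split; apply: M_in.
      rewrite expr_div_n; have : (y1 x - p1) ^+ 2 / rho ^+ 2 <= 2^-1 by rewrite ler_pdivrMr// mulrC.
      by move=> q; lra.
    by rewrite mulrA ler_pdivlMr// mul1r; lra.
  split => //; split; last by have := H0; lra.
  rewrite -(ler_pXn2r (n := 2))// ?nnegrE// ?(ltW rho0)// real_normK ?num_real//.
  by apply: (le_trans h1); lra.
apply: (intg_le _ (intgZ 2 iff)).
  rewrite (_ : (fun x => _) = fun x => ((fun x => h x ^+ 2) \_ Omega) x *
      \1_([set x | (y1 x - p1) ^+ 2 <= rho ^+ 2 / 2] `&` ([set x | y2 x <= p2 + H / 2] `&` [set x | 0 < del x])) x).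
    apply: mfunM.
      by apply: mfun_open => // x Ox; exact: (pow_cont (h_cont Ox)).
    apply: mfun_indic; apply: measurableI; [|apply: measurableI].
    - rewrite -[X in measurable X]setCK; apply: measurableC; apply: open_mset; apply: closed_openC.
      rewrite (_ : [set x | _] = (fun x => (y1 x - p1) ^+ 2) @^-1` [set t | t <= rho ^+ 2 / 2])//.
      apply: closed_comp; last exact: closed_le.
      by move=> x _; apply: (pow_cont (f := fun x => y1 x - p1)); apply: cvgB; [exact: y1_cont | exact: cvg_cst].
    - rewrite -[X in measurable X]setCK; apply: measurableC; apply: open_mset; apply: closed_openC.
      rewrite (_ : [set x | _] = y2 @^-1` [set t | t <= p2 + H / 2])//.
      by apply: closed_comp; [move=> x _; exact: y2_cont | exact: closed_le].
    - apply: open_mset; rewrite (_ : [set x | _] = del @^-1` [set t | 0 < t])//.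
      by apply: open_comp => [x _|]; [exact: del_cont | exact: open_gt].
  apply/funext => x; rewrite indicE; case: asboolP => hx.
    have [[sx dx] _] := inO x hx; rewrite patchE mem_set; last exact: slabO.
    by rewrite mem_set ?mulr1//; case: hx.
  by rewrite memNset ?mulr0// => -[g1 [g2 g3]]; apply: hx.
move=> x; rewrite /f; case: asboolP => hx.
  have [[sx dx] [e1 e2]] := inO x hx; rewrite patchE mem_set; last exact: slabO.
  rewrite e1 e2; have -> : 0 < del x = true by exact: dx.
  by rewrite ger0_norm ?sqr_ge0// !mul1r mulrC divfK.
rewrite normr0 mulr_ge0// patchE; case: ifP => // _.
have /andP[a0 _] := A1i x; have /andP[b00 _] := A2i x.
by rewrite mulr_ge0 ?divr_ge0 ?sqr_ge0// mulr_ge0// mulr_ge0//; case: ifP.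
Qed.

End HardyCore.

(** * Square integrability up to a Lipschitz boundary *)

Section HardyDomain.
Context {R : realType}.
Local Notation P := (R * R)%type.
Local Notation MP := (measurableTypeR R * measurableTypeR R)%type.
Implicit Types (x y z : P).

Lemma norm_pair2 (v : P) (r : R) : (`|v| < r) = (`|v.1| < r) && (`|v.2| < r).
Proof. by rewrite /Num.norm/= gt_max. Qed.

(** Growth of a function at the boundary of [Omega] which is typical of second
    derivatives of harmonic functions whose second antiderivative is square integrable. *)
Definition growth6 (Omega : set P) (l : P -> R) := exists S (C : R),
  [/\ intg S, forall x, 0 <= S x, 0 <= C & forall x (r : R), 0 < r -> box x r `<=` Omega ->
    l x ^+ 2 <= C * r^-1 ^+ 6 * Int (fun y => S y * \1_(box x r) y)].

Lemma compact_finite_cover (K : set P) (e : P -> R) : compact K -> (forall x, K x -> 0 < e x) ->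
  exists s : seq P, forall x, K x -> exists i, [/\ i \in s, K i & ball i (e i) x].
Proof.
move=> /compact_near_coveringP cK e0.
pose F : set_system (seq P) := [set A | exists s0 : seq P, forall s : seq P, {subset s0 <= s} -> A s].
have FF : Filter F.
  split; first by exists [::].
  - move=> A B [s HA] [t HB]; exists (s ++ t) => u su; split.
      by apply: HA => x xs; apply: su; rewrite mem_cat xs.
    by apply: HB => x xt; apply: su; rewrite mem_cat xt orbT.
  - by move=> A B AB [s HA]; exists s => u /HA /AB.
have := cK (seq P) F (fun s x => K x -> exists i, [/\ i \in s, K i & ball i (e i) x]) FF.
case=> [x Kx|s0 Hs].
  exists (ball x (e x), [set s : seq P | x \in s]) => /=.
    split; first exact: nbhsx_ballx (e0 x Kx).
    by exists [:: x] => s; apply; rewrite mem_head.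
  by move=> [y s] /= [xy xs] _; exists x.
by exists s0 => x Kx; apply: (Hs s0).
Qed.

Lemma mfun_inv (f : P -> R) (A : set P) : open A -> (forall x, A x -> {for x, continuous f}) ->
  (forall x, A x -> f x != 0) -> mfun2 ((fun x => (f x)^-1) \_ A).
Proof. by move=> oA cf f0; apply: mfun_open => // x Ax; apply: cvgV; [exact: f0 | exact: cf]. Qed.

Section Weighted.
Variable Omega : set P.
Hypothesis oO : open Omega.
Variables (V : set P) (d : P -> R) (kap : R).
Hypothesis mV : mset2 V.
Hypothesis d_cont : continuous d.
Hypothesis V_pos : forall x, V x -> 0 < d x.
Hypothesis kap0 : 0 < kap.
Hypothesis V_box : forall x, V x -> box x (kap * d x) `<=` Omega.
Hypothesis V_cmp : forall x y, V x -> `|y - x| <= kap * d x -> d x / 2 <= d y <= 2 * d x.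

(** By Tonelli's theorem: [int d(x)^-2 (int_(|y - x| <= kap d(x)) S(y) dy) dx] is at most
    a multiple of [int S], as [d(x)] and [d(y)] are comparable. *)
Lemma growth_intg (l : P -> R) : (forall x, Omega x -> {for x, continuous l}) -> growth6 Omega l ->
  intg (fun x => if `[< V x >] then d x ^+ 4 * l x ^+ 2 else 0).
Proof.
move=> cl [S [C [iS S0 C0 HS]]].
pose w x := ((fun x => (d x)^-1) \_ [set x | 0 < d x]) x ^+ 2 * \1_V x.
have oD : open [set x | 0 < d x].
  by rewrite (_ : [set x | _] = d @^-1` [set t | 0 < t])//; apply: open_comp => [x _|]; [exact: d_cont | exact: open_gt].
have wE x : w x = if `[< V x >] then (d x)^-1 ^+ 2 else 0.
  rewrite /w indicE; case: asboolP => Vx; last by rewrite memNset// mulr0.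
  by rewrite patchE !mem_set ?mulr1//; exact: V_pos.
have mw : mfun2 w.
  apply: mfunM; last exact: mfun_indic.
  apply: mfun_sqr; apply: mfun_inv => // x /= dx; [exact: d_cont | exact: lt0r_neq0].
have w0 x : 0 <= w x by rewrite /w mulr_ge0 ?sqr_ge0// indicE.
(* the pairs [(x, y)] with [y] in the square around [x] of size [kap * d x] *)
pose A := [set z : P * P | `|z.2.1 - z.1.1| <= kap * d z.1 /\ `|z.2.2 - z.1.2| <= kap * d z.1].
pose F x y := w x * (S y * \1_A (x, y)).
have AE x y : A (x, y) <-> box x (kap * d x) y by rewrite boxE.
have m1 : @measurable_fun _ _ (MP * MP)%type MP setT (fun q : P * P => q.1) by exact: measurable_fst.
have m2 : @measurable_fun _ _ (MP * MP)%type MP setT (fun q : P * P => q.2) by exact: measurable_snd.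
have mA : @measurable _ (MP * MP)%type A.
  have mcoord (pr : P -> R) : mfun2 pr ->
      @measurable _ (MP * MP)%type [set z : P * P | `|pr z.2 - pr z.1| <= kap * d z.1].
    move=> mpr.
    have mf : @measurable_fun _ _ (MP * MP)%type (measurableTypeR R) setT
        (fun q : P * P => kap * d q.1 - `|pr q.2 - pr q.1|).
      apply: (@measurable_funB _ (MP * MP)%type R setT).
        exact: (measurableT_comp (mfunZ kap (continuous_mfun d_cont)) m1).
      apply: (measurableT_comp (@normr_measurable R setT)).
      apply: (@measurable_funB _ (MP * MP)%type R setT); exact: (measurableT_comp mpr _).
    have := mf measurableT `[0, +oo[%classic (measurable_itv _); rewrite setTI.
    by congr measurable; apply/seteqP; split => z /=; rewrite in_itv/= andbT subr_ge0.
  rewrite (_ : A = [set z : P * P | `|z.2.1 - z.1.1| <= kap * d z.1] `&` [set z : P * P | `|z.2.2 - z.1.2| <= kap * d z.1])//.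
  apply: measurableI; [apply: (mcoord (fun x => x.1)) | apply: (mcoord (fun x => x.2))]; apply: continuous_mfun; [exact: fst_cont | exact: snd_cont].
have mS := intg_mfun iS.
have mF : @measurable_fun _ _ (MP * MP)%type (measurableTypeR R) setT (fun q : P * P => F q.1 q.2).
  apply: (@measurable_funM _ (MP * MP)%type R setT); first exact: (measurableT_comp mw m1).
  apply: (@measurable_funM _ (MP * MP)%type R setT); first exact: (measurableT_comp mS m2).
  rewrite (_ : (fun q : P * P => _) = \1_A); last by apply/funext => -[].
  exact: measurable_indic.
have FE x : F x = fun y => w x * (S y * \1_(box x (kap * d x)) y).
  apply/funext => y; rewrite /F !indicE; congr (_ * (_ * (nat_of_bool _)%:R)).
  by apply/idP/idP; rewrite !inE => /AE.
have iFx x : intg (F x).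
  by rewrite FE; apply: intgZ; apply: intg_indicM => //; exact: mset_box.
(* seen from [y], the point [x] lies in a square of size [2 * kap * d y], as [d x <= 2 * d y] *)
have Fb x y : F x y <= (4 * (d y)^-1 ^+ 2 * S y) * \1_(box y (2 * kap * d y)) x.
  have r0 : 0 <= (4 * (d y)^-1 ^+ 2 * S y) * \1_(box y (2 * kap * d y)) x.
    by rewrite mulr_ge0 ?indicE// mulr_ge0// mulr_ge0 ?sqr_ge0.
  rewrite /F wE; case: asboolP => Vx; last by rewrite mul0r.
  rewrite indicE; case: (boolP ((x, y) \in A)) => [|_]; last by rewrite !mulr0.
  rewrite inE => /AE /boxP xy; have /andP[d1 d2] := V_cmp Vx xy; have dx := V_pos Vx.
  have dy : 0 < d y by apply: lt_le_trans d1; rewrite divr_gt0.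
  rewrite mulr1 indicE mem_set ?mulr1; last first.
    apply/boxP; rewrite distrC (le_trans xy)// -mulrA mulrCA ler_wpM2l ?(ltW kap0)//.
    by lra.
  rewrite ler_wpM2r// (_ : 4 * (d y)^-1 ^+ 2 = (2 / d y) ^+ 2); last by rewrite expr_div_n exprVn -natrX.
  rewrite lerXn2r ?nnegrE ?invr_ge0 ?divr_ge0 ?(ltW dx) ?(ltW dy)//.
  by rewrite -[leLHS]mul1r ler_pdivrMr// mulrAC ler_pdivlMr//; lra.
have F0 x y : 0 <= F x y by rewrite /F mulr_ge0// mulr_ge0// indicE.
have iFy y : intg (F ^~ y).
  apply: (intg_le _ (intgZ (4 * (d y)^-1 ^+ 2 * S y) (intg_box y (2 * kap * d y)))); last first.
    by move=> x; rewrite ger0_norm.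
  apply: mfunM => //; apply: mfunM; first exact: mfun_cst.
  have mAy : mset2 [set x | A (x, y)].
    have := @measurable_ysection _ _ MP MP A y mA.
    by congr measurable; apply/seteqP; split => x; rewrite /ysection/= inE.
  rewrite (_ : (fun x => _) = \1_[set x | A (x, y)]); first exact: mfun_indic.
  apply/funext => x; rewrite !indicE; congr (nat_of_bool _)%:R.
have [|||||I1 _ _] := @fubini2 _ F (fun y => (64 * kap ^+ 2) * S y).
- exact: mF.
- exact: iFx.
- exact: iFy.
- exact: intgZ.
- move=> y; have [dy|dy] := ltP 0 (d y); last first.
    rewrite (_ : (fun x => _) = fun=> 0).
      by rewrite Int0 mulr_ge0// mulr_ge0// sqr_ge0.
    apply/funext => x; rewrite /F wE; case: asboolP => Vx; last by rewrite mul0r normr0.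
    rewrite indicE; case: (boolP ((x, y) \in A)) => [|_]; last by rewrite !mulr0 normr0.
    rewrite inE => /AE /boxP xy; have /andP[d1 _] := V_cmp Vx xy; have dx := V_pos Vx.
    by exfalso; lra.
  apply: (@le_trans _ _ (Int (fun x => (4 * (d y)^-1 ^+ 2 * S y) * \1_(box y (2 * kap * d y)) x))).
    apply: le_Int; [exact: intg_norm | by apply: intgZ; exact: intg_box |].
    by move=> x; rewrite ger0_norm.
  rewrite IntZ ?Int_box; [|by rewrite !mulr_ge0// ltW|exact: intg_box].
  rewrite le_eqVlt; apply/orP; left; apply/eqP; field; exact: lt0r_neq0.
have kinv : 0 <= C * kap^-1 ^+ 6 by rewrite mulr_ge0// exprn_ge0// invr_ge0 ltW.
apply: (intg_le _ (intgZ (C * kap^-1 ^+ 6) I1)).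
  rewrite (_ : (fun x => _) = fun x => ((fun x => d x ^+ 4 * l x ^+ 2) \_ Omega) x * \1_V x); last first.
    apply/funext => x; rewrite indicE; case: asboolP => Vx; last by rewrite memNset// mulr0.
    rewrite patchE !mem_set ?mulr1//; apply: (V_box Vx); apply/boxP.
    by rewrite subrr normr0 mulr_ge0 ?ltW// V_pos.
  apply: mfunM; last exact: mfun_indic.
  apply: mfun_open => // x Ox; apply: cvgM.
    exact: (pow_cont (n := 4) (@d_cont x)).
  exact: (pow_cont (n := 2) (cl x Ox)).
move=> x; rewrite FE IntZ; last by apply: intg_indicM => //; exact: mset_box.
have I0 : 0 <= Int (fun y => S y * \1_(box x (kap * d x)) y).
  by apply: Int_ge0 => y; rewrite mulr_ge0// indicE.
case: asboolP => Vx; last by rewrite normr0 mulr_ge0// mulr_ge0.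
have dx := V_pos Vx; have k0 : 0 < kap * d x by rewrite mulr_gt0.
have h := HS x _ k0 (V_box Vx); rewrite ger0_norm; last by rewrite mulr_ge0 ?sqr_ge0// exprn_ge0// ltW.
have d40 : 0 <= d x ^+ 4 by rewrite exprn_ge0// ltW.
apply: (le_trans (ler_wpM2l d40 h)); rewrite le_eqVlt; apply/orP; left; apply/eqP.
rewrite wE asboolT//; field; by rewrite !lt0r_neq0.
Qed.

End Weighted.

Variable Omega : set P.
Hypothesis oO : open Omega.
Hypothesis bO : bounded_set Omega.
Hypothesis lipO : lipschitz_boundary Omega.
Variables (h : P -> R) (h1 : 'I_2 -> P -> R) (h2 : 'I_2 -> 'I_2 -> P -> R).
Hypothesis h_der : forall i x, Omega x -> is_derive x (dir i) h (h1 i x).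
Hypothesis h1_der : forall i j x, Omega x -> is_derive x (dir j) (h1 i) (h2 i j x).
Hypothesis h_cont : forall x, Omega x -> {for x, continuous h}.
Hypothesis h1_cont : forall i x, Omega x -> {for x, continuous (h1 i)}.
Hypothesis h2_cont : forall i j x, Omega x -> {for x, continuous (h2 i j)}.
Hypothesis h2_growth : forall i j, growth6 Omega (h2 i j).

Lemma growth6_lin (a : R) l l' : growth6 Omega l -> growth6 Omega l' -> growth6 Omega (fun x => a * l x + l' x).
Proof.
move=> [S [C [iS S0 C0 HS]]] [S' [C' [iS' S0' C0' HS']]].
exists (fun y => S y + S' y), (2 * a ^+ 2 * C + 2 * C').
have a2 := sqr_ge0 a; have aC := mulr_ge0 a2 C0.
split; [exact: intgD | by move=> x; exact: addr_ge0 | by lra |] => x r r0 rO.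
have k := HS x r r0 rO; have k' := HS' x r r0 rO.
apply: (le_trans (sqr_le2 _ _)); rewrite exprMn.
have ib := intg_indicM iS (mset_box x r); have ib' := intg_indicM iS' (mset_box x r).
have -> : Int (fun y => (S y + S' y) * \1_(box x r) y) = Int (fun y => S y * \1_(box x r) y) + Int (fun y => S' y * \1_(box x r) y).
  by rewrite -IntD//; congr Int; apply/funext => y; rewrite mulrDl.
have I0 : 0 <= Int (fun y => S y * \1_(box x r) y) by apply: Int_ge0 => y; rewrite mulr_ge0// indicE.
have I0' : 0 <= Int (fun y => S' y * \1_(box x r) y) by apply: Int_ge0 => y; rewrite mulr_ge0// indicE.
have w0 : 0 <= r^-1 ^+ 6 by rewrite exprn_ge0// invr_ge0 ltW.
move: k k' I0 I0' w0; move: (Int _) (Int _) (r^-1 ^+ 6) (l x) (l' x) => I' I w u v k k' I0 I0' w0.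
have k1 : a ^+ 2 * u ^+ 2 <= a ^+ 2 * (C * w * I) by rewrite ler_wpM2l.
have k2 : 0 <= a ^+ 2 * C * w * I' := mulr_ge0 (mulr_ge0 aC w0) I0'.
have k3 : 0 <= C' * w * I := mulr_ge0 (mulr_ge0 C0' w0) I0.
lra.
Qed.

Lemma growth6_0 : growth6 Omega (fun=> 0).
Proof.
exists (fun=> 0), 0; split => //; first exact: intg0.
by move=> x r _ _; rewrite expr0n !mul0r.
Qed.

Lemma growth6_ext l l' : l =1 l' -> growth6 Omega l -> growth6 Omega l'.
Proof. by move=> /funext ->. Qed.

Local Notation sq A := (intg (fun x => ((fun x => h x ^+ 2) \_ Omega) x * \1_A x)).

Lemma mfun_h2 : mfun2 ((fun x => h x ^+ 2) \_ Omega).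
Proof. by apply: mfun_open => // x Ox; exact: (pow_cont (n := 2) (h_cont Ox)). Qed.

Lemma sq_interior x : Omega x -> exists e : R, 0 < e /\ sq (ball x e).
Proof.
move=> Ox; have [r [r0 xO]] := margin_pt oO Ox; exists r; split => //.
have [|C [C0 HC]] := @compact_bdd _ (box x r) (fun x => h x ^+ 2) (@compact_box _ r x).
  by move=> y /xO Oy; exact: (pow_cont (n := 2) (h_cont Oy)).
have mb : mset2 (ball x r) by apply: open_mset; exact: ball_open.
apply: (@intg_bdd _ _ x r C).
- by apply: mfunM; [exact: mfun_h2 | exact: mfun_indic].
- move=> y; rewrite indicE; case: (boolP (y \in _)); last by rewrite mulr0 normr0.
  rewrite inE => yb; have yb' : box x r y.
    by move/ball2E: yb => [b1 b2]; apply/boxE; rewrite (distrC y.1) (distrC y.2) !ltW.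
  by rewrite mulr1 patchE mem_set; [exact: HC | exact: xO].
- move=> y nb; rewrite indicE memNset ?mulr0// => /ball2E[b1 b2]; apply: nb.
  by apply/boxE; rewrite (distrC y.1) (distrC y.2) !ltW.
Qed.

(** Near [p], in the rotated coordinates of its chart, the height above the graph is comparable to the
    distance to the boundary up to the Lipschitz constant. Thus squares of size proportional to the height
    stay in [Omega], [growth_intg] makes [del^4 * l^2] integrable, and [hardy_core] applies. *)
Lemma sq_boundary p : boundary Omega p -> exists e : R, 0 < e /\ sq (ball p e).
Proof.
move=> bp; have [c [s [g [r [cs1 lg r0 Hp]]]]] := lipO bp.
have [L [L0 HL]] : exists L : R, 0 <= L /\ forall u v : R, `|g u - g v| <= L * `|u - v|.
  have [L [_ HL]] := lg; exists (`|L| + 1); split; first by have := normr_ge0 L; lra.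
  have LL : L < `|L| + 1 by have := ler_norm L; lra.
  by move=> u v; exact: (HL _ LL (u, v)).
have g_cont : continuous g.
  move=> u; apply/cvgrPdist_le => e e0; have e1 : 0 < e / (L + 1) by rewrite divr_gt0//; lra.
  apply: filterS (nbhsx_ballx u _ e1) => v /=; rewrite /ball/= ltr_pdivlMr; last by lra.
  by move=> hv; apply: (le_trans (HL u v)); have := normr_ge0 (u - v); lra.
have cs : `|c| <= 1 /\ `|s| <= 1.
  split; rewrite -(ler_pXn2r (n := 2))// ?nnegrE// real_normK ?num_real// expr1n -cs1;
  by have := sqr_ge0 c; have := sqr_ge0 s; lra.
have [c1 s1] := cs.
pose Y1 := y1 c s; pose Y2 := y2 c s; pose D := del c s g.
have le1 (a b : R) : `|a| <= 1 -> `|a * b| <= `|b| by move=> a1; rewrite normrM ler_piMl.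
have dY1 x y : `|Y1 x - Y1 y| <= 2 * `|x - y|.
  have -> : Y1 x - Y1 y = c * (x - y).1 + s * (x - y).2 by rewrite /Y1 /y1 /=; ring.
  have := norm_fst (x - y); have := norm_snd (x - y) => n2 n1.
  by apply: (le_trans (ler_normD _ _)); have := le1 _ (x - y).1 c1; have := le1 _ (x - y).2 s1; lra.
have dY2 x y : `|Y2 x - Y2 y| <= 2 * `|x - y|.
  have -> : Y2 x - Y2 y = c * (x - y).2 - s * (x - y).1 by rewrite /Y2 /y2 /=; ring.
  have := norm_fst (x - y); have := norm_snd (x - y) => n2 n1.
  by apply: (le_trans (ler_normB _ _)); have := le1 _ (x - y).2 c1; have := le1 _ (x - y).1 s1; lra.
pose La := 2 + 2 * L.
have lipD x y : `|D x - D y| <= La * `|x - y|.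
  have -> : D x - D y = (Y2 x - Y2 y) - (g (Y1 x) - g (Y1 y)) by rewrite /D /del /Y1 /Y2; ring.
  apply: (le_trans (ler_normB _ _)); have := HL (Y1 x) (Y1 y); have := dY2 x y.
  have := ler_wpM2l L0 (dY1 x y); rewrite /La => *; lra.
have HpD x : ball p r x -> Omega x <-> 0 < D x.
  by move=> /Hp ->; rewrite subr_gt0.
have nOp : ~ Omega p.
  by case: bp => _; rewrite (interior_id _).1.
have Dp : D p = 0.
  apply/eqP; rewrite eq_le; apply/andP; split.
    by rewrite leNgt; apply/negP => Dp; apply: nOp; apply/HpD => //; exact: ballxx.
  rewrite leNgt; apply/negP => Dp.
  have La0 : 0 < La by rewrite /La; lra.
  have e0 : 0 < Num.min r (- D p / La) by rewrite lt_min r0 divr_gt0// oppr_gt0.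
  have [cp _] := bp; have [x [Ox px]] := cp _ (nbhsx_ballx p _ e0).
  have pr : ball p r x by apply: le_ball px; rewrite ge_min lexx.
  have pD : `|p - x| < - D p / La.
    have px' : ball p (- D p / La) x by apply: le_ball px; rewrite ge_min lexx orbT.
    by move/ball2E: px' => [a b]; rewrite norm_pair2; apply/andP.
  have := (HpD x pr).1 Ox; move: pD; rewrite ltr_pdivlMr// => pD.
  by have := ler_norm (D x - D p); have := lipD x p; rewrite (distrC x p) => *; lra.
pose H := r / 4; have H0 : 0 < H by rewrite divr_gt0.
have L10 : 0 < 4 * (L + 1) by lra.
pose rho := Num.min H (H / (4 * (L + 1))).
have rho0 : 0 < rho by rewrite lt_min H0 divr_gt0.
have rhoH : rho <= H by rewrite ge_min lexx.
have rhoL : L * rho <= H / 4.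
  have : rho <= H / (4 * (L + 1)) by rewrite ge_min lexx orbT.
  by rewrite ler_pdivlMr//; have := ltW rho0; nra.
have g_near u : `|u - Y1 p| <= rho -> `|g u - Y2 p| <= H / 4.
  move=> hu; have -> : Y2 p = g (Y1 p) by move: Dp; rewrite /D /del => /eqP; rewrite subr_eq0 => /eqP.
  by apply: (le_trans (HL _ _)); apply: le_trans rhoL; rewrite ler_wpM2l.
pose sl := slab c s (Y1 p) (Y2 p) rho H.
pose V := sl `&` [set x | 0 < D x].
have Vp x : V x -> `|x - p| <= 2 * H /\ D x <= 2 * H.
  move=> [[sx1 sx2] /= dx]; have gx := g_near _ sx1; move: gx; rewrite ler_norml => /andP[g1 g2].
  have n2 : `|Y2 x - Y2 p| <= H.
    by rewrite ler_norml; apply/andP; split; move: dx sx2; rewrite /D /del -/(Y1 x) -/(Y2 x) -/(Y2 p); lra.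
  split; last by move: sx2; rewrite /D /del -/(Y1 x) -/(Y2 x) -/(Y2 p); lra.
  have E1 : (x - p).1 = c * (Y1 x - Y1 p) - s * (Y2 x - Y2 p).
    by rewrite -[LHS]mul1r -cs1 /Y1 /Y2 /y1 /y2 /=; ring.
  have E2 : (x - p).2 = s * (Y1 x - Y1 p) + c * (Y2 x - Y2 p).
    by rewrite -[LHS]mul1r -cs1 /Y1 /Y2 /y1 /y2 /=; ring.
  have sx1' : `|Y1 x - Y1 p| <= rho by [].
  rewrite norm_pair E1 E2; apply/andP; split.
    by rewrite (le_trans (ler_normB _ _))//; have := le1 _ (Y1 x - Y1 p) c1; have := le1 _ (Y2 x - Y2 p) s1; lra.
  by rewrite (le_trans (ler_normD _ _))//; have := le1 _ (Y1 x - Y1 p) s1; have := le1 _ (Y2 x - Y2 p) c1; lra.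
have inball x : `|x - p| < r -> ball p r x.
  by rewrite distrC norm_pair2 => /andP[i1 i2]; apply/ball2E.
(* [La] is a Lipschitz constant of [D]; over a square of size [kap * D x], [D] varies by at most [D x / 2] *)
pose kap := (2 * La)^-1.
have La2 : 2 <= La by rewrite /La; lra.
have kap0 : 0 < kap by rewrite invr_gt0; lra.
have kapL : La * kap = 2^-1 by rewrite /kap; field; rewrite lt0r_neq0//; lra.
have kap1 : kap <= 4^-1.
  by rewrite /kap lef_pV2 ?posrE//; lra.
have V_cmp x y : V x -> `|y - x| <= kap * D x -> D x / 2 <= D y <= 2 * D x.
  move=> [_ /= dx] yx; have := lipD y x; rewrite ler_norml => /andP[q1 q2].
  have : La * `|y - x| <= D x / 2.
    rewrite -[X in _ <= X]mulrC -kapL -mulrA ler_wpM2l//; lra.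
  by move=> q3; apply/andP; split; lra.
have V_box x : V x -> box x (kap * D x) `<=` Omega.
  move=> Vx y /boxP yx; have [px Dx] := Vp x Vx; have /andP[q1 _] := V_cmp x y Vx yx.
  have dx : 0 < D x by case: Vx.
  have py : ball p r y.
    apply: inball; have := ler_normD (y - x) (x - p); rewrite addrA subrK.
    have : kap * D x <= 4^-1 * D x by rewrite ler_wpM2r// ltW.
    by rewrite /H in H0 Dx px *; lra.
  by apply/(HpD y py); lra.
have mV : mset2 V by exact: slab_mset.
have D_cont : continuous D by exact: del_cont.
have V_pos x : V x -> 0 < D x by case.
have slabO x : sl x -> 0 < D x -> Omega x.
  move=> sx dx; have Vx : V x by [].
  by apply: (V_box x Vx); apply/boxP; rewrite subrr normr0 mulr_ge0// ltW.
pose k x := - s * h1 0 x + c * h1 1 x.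
pose l x := - s * (- s * h2 0 0 x + c * h2 0 1 x) + c * (- s * h2 1 0 x + c * h2 1 1 x).
have inO_near x : Omega x -> \near x, Omega x by move=> Ox; apply: open_nbhs_nbhs.
have kd x : Omega x -> is_derive x (nrm c s) h (k x).
  move=> Ox; have := @d_C1 _ h h1 x (nrm c s); apply; last by move=> i; exact: h1_cont.
  by apply: filterS (inO_near x Ox) => y Oy i; exact: h_der.
have h1d i x : Omega x -> is_derive x (nrm c s) (h1 i) (- s * h2 i 0 x + c * h2 i 1 x).
  move=> Ox; have := @d_C1 _ (h1 i) (h2 i) x (nrm c s); apply; last by move=> j; exact: h2_cont.
  by apply: filterS (inO_near x Ox) => y Oy j; exact: h1_der.
have ld x : Omega x -> is_derive x (nrm c s) k (l x).
  by move=> Ox; exact: dD (dZ (- s) (h1d 0 x Ox)) (dZ c (h1d 1 x Ox)).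
have cC (f f' : P -> R) x : {for x, continuous f} -> {for x, continuous f'} ->
    {for x, continuous (fun x => - s * f x + c * f' x)}.
  by move=> cf cf'; apply: cvgD; apply: cvgM; [exact: cvg_cst | exact: cf | exact: cvg_cst | exact: cf'].
have k_cont x : Omega x -> {for x, continuous k}.
  by move=> Ox; apply: cC; exact: h1_cont.
have l_cont x : Omega x -> {for x, continuous l}.
  by move=> Ox; apply: (cC); apply: (cC); exact: h2_cont.
have gl : growth6 Omega l.
  have gc f f' : growth6 Omega f -> growth6 Omega f' -> growth6 Omega (fun x => - s * f x + c * f' x).
    move=> gf gf'; have := growth6_lin (- s) gf (growth6_lin c gf' growth6_0).
    by apply: growth6_ext => x; rewrite addr0.
  by apply: (gc); apply: (gc); exact: h2_growth.
have l_int : intg (fun x => if `[< sl x /\ 0 < D x >] then D x ^+ 4 * l x ^+ 2 else 0).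
  exact: (@growth_intg _ oO V D kap mV D_cont V_pos kap0 V_box V_cmp l l_cont gl).
have [m [M [Cm CM dM0 [m0 mz] [M0 M1]]]] := @smooth_step R.
have core := @hardy_core _ M m (Ck_cont (Cm 0%N)) (Ck_cont (CM 0%N)) dM0 m0 mz M0 M1 c s g (Y1 p) (Y2 p) rho H
   cs1 g_cont rho0 H0 g_near Omega oO slabO h k l kd ld h_cont k_cont l_cont l_int.
pose e := Num.min r (Num.min (rho / 4) (H / 4)).
have e0 : 0 < e by rewrite !lt_min r0 !divr_gt0.
exists e; split => //.
have mb : mset2 (ball p e) by apply: open_mset; exact: ball_open.
apply: (intg_le _ core); first by apply: mfunM; [exact: mfun_h2 | exact: mfun_indic].
move=> x; have c0 : 0 <= if `[< [/\ (y1 c s x - Y1 p) ^+ 2 <= rho ^+ 2 / 2, y2 c s x <= Y2 p + H / 2 & 0 < del c s g x] >]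
    then h x ^+ 2 else 0 by case: ifP => // _; exact: sqr_ge0.
rewrite indicE patchE; case: (boolP (x \in Omega)) => xO; last by rewrite mul0r normr0.
case: (boolP (x \in (ball p e : set P))) => xb; last by rewrite mulr0 normr0.
rewrite mulr1 ger0_norm ?sqr_ge0//; rewrite !inE in xO xb.
have pe : `|x - p| < e by rewrite distrC norm_pair2; apply/andP; case/ball2E: xb.
move: pe; rewrite !lt_min => /and3P[pe1 pe2 pe3].
rewrite asboolT//; split.
- have q := dY1 x p; rewrite -(real_normK (num_real (_ - _))).
  have q1 : `|Y1 x - Y1 p| <= rho / 2 by lra.
  apply: (@le_trans _ _ ((rho / 2) ^+ 2)).
    by rewrite lerXn2r ?nnegrE// divr_ge0// ltW.
  by have := sqr_ge0 rho; rewrite expr_div_n => *; lra.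
- have := dY2 x p; have := ler_norm (Y2 x - Y2 p); rewrite /Y2; lra.
- by apply/(HpD x) => //; exact: inball.
Qed.

Lemma closed_compact : compact (closure Omega).
Proof.
have [B [B0 HB]] := bounded_box bO.
have cB : closed (box (0 : P) B) by apply: compact_closed; [exact: norm_hausdorff | exact: compact_box].
apply: (@subclosed_compact _ _ (box 0 B)); [exact: closed_closure | exact: compact_box |].
move=> x cx; have : closure (box 0 B) x by exact: closure_subset cx.
  by rewrite -((closure_id (box 0 B)).1 cB).
Qed.

(** [h^2] is integrable near each point of the closure of [Omega], which is compact. *)
Theorem hardy_L2 : L2 Omega h.
Proof.
have /choice[e He] : forall x, exists e : R, 0 < e /\ (closure Omega x -> sq (ball x e)).
  move=> x; have [cx|ncx] := pselect (closure Omega x); last by exists 1.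
  have [Ox|nO] := pselect (Omega x).
    by have [e [e0 H]] := sq_interior Ox; exists e.
  have [|e [e0 H]] := @sq_boundary x; last by exists e.
  by split => //; rewrite (interior_id _).1.
have [D' cov] := compact_finite_cover closed_compact (fun x _ => (He x).1).
apply/L2P; split; first by apply: mfun_open => // x; exact: h_cont.
pose F i x := if `[< closure Omega i >] then ((fun x => h x ^+ 2) \_ Omega) x * \1_(ball i (e i)) x else 0.
have iF i : intg (F i).
  by rewrite /F; case: asboolP => [/(He i).2 //|_]; exact: intg0.
have F0 i x : 0 <= F i x.
  rewrite /F; case: ifP => // _; rewrite mulr_ge0 ?indicE// patchE.
  by case: ifP => // _; exact: sqr_ge0.
apply: (intg_le _ (intg_sum D' iF)).
  by apply: mfun_sqr; apply: mfun_open => // x; exact: h_cont.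
move=> x; have [Ox|nO] := pselect (Omega x); last first.
  by rewrite patchE memNset// expr0n normr0 sumr_ge0.
have [i [iD ci xi]] := cov x (subset_closure Ox).
rewrite (big_rem i)//= -[leLHS]addr0 lerD ?sumr_ge0//.
rewrite /F asboolT// !patchE mem_set// indicE mem_set// mulr1.
by rewrite ger0_norm ?sqr_ge0.
Qed.

End HardyDomain.

(** * Calculus on an open set *)

Section OpenCalculus.
Context {R : realType}.
Local Notation P := (R * R)%type.
Implicit Types (f g h phi psi : P -> R) (A B : set P) (x y : P).

(** The mean value inequality along the axes. *)
Lemma C1_cont g (G : 'I_2 -> P -> R) A : open A ->
  (forall i x, A x -> is_derive x (dir i) g (G i x)) ->
  (forall i x, A x -> {for x, continuous (G i)}) ->
  forall x, A x -> {for x, continuous g}.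
Proof.
move=> oA dg cG x Ax.
have [r [r0 rA]] := margin_pt oA Ax.
have cK : compact (box x r) by exact: compact_box.
have [C0 [_ H0]] := compact_bdd cK (fun z zK => cG 0 z (rA z zK)).
have [C1 [_ H1]] := compact_bdd cK (fun z zK => cG 1 z (rA z zK)).
pose C := `|C0| + `|C1|.
have key y : `|y - x| <= r -> `|g y - g x| <= C * `|y - x|.
  move=> yr; have := yr; rewrite norm_pair => /andP[/= y1 y2].
  have btw (u v s : R) : `|u - v| <= r -> Num.min v u <= s <= Num.max v u -> `|s - v| <= r.
    rewrite ge_min le_max !ler_norml => ? /andP[/orP[?|?] /orP[?|?]]; apply/andP; split; lra.
  have a0 : `|g (y.1, y.2) - g (x.1, y.2) - 0 * (y.1 - x.1)| <= `|C0| * `|y.1 - x.1|.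
    apply: (@mvt_between R (fun t => g (t, y.2)) (fun t => G 0 (t, y.2)) x.1 y.1) => t /btw tr.
      apply: (@d_to_line0 R g (t, y.2)); apply: dg; apply: rA; apply/boxP; rewrite norm_pair /=.
      by rewrite tr.
    rewrite subr0; apply: (le_trans (H0 _ _)); last exact: ler_norm.
    by apply/boxP; rewrite norm_pair /= tr.
  have a1 : `|g (x.1, y.2) - g (x.1, x.2) - 0 * (y.2 - x.2)| <= `|C1| * `|y.2 - x.2|.
    apply: (@mvt_between R (fun t => g (x.1, t)) (fun t => G 1 (x.1, t)) x.2 y.2) => t /btw tr.
      apply: (@d_to_line1 R g (x.1, t)); apply: dg; apply: rA; apply/boxP; rewrite norm_pair /=.
      by rewrite subrr normr0 (ltW r0) tr.
    rewrite subr0; apply: (le_trans (H1 _ _)); last exact: ler_norm.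
    by apply/boxP; rewrite norm_pair /= subrr normr0 (ltW r0) tr.
  rewrite !mul0r !subr0 -!surjective_pairing in a0 a1.
  have b0 : `|C0| * `|y.1 - x.1| <= `|C0| * `|y - x| by rewrite ler_wpM2l// (norm_fst (y - x)).
  have b1 : `|C1| * `|y.2 - x.2| <= `|C1| * `|y - x| by rewrite ler_wpM2l// (norm_snd (y - x)).
  rewrite (_ : g y - g x = (g y - g (x.1, y.2)) + (g (x.1, y.2) - g x)); last by ring.
  apply: (le_trans (ler_normD _ _)); rewrite mulrDl.
  by apply: lerD; [exact: le_trans a0 b0 | exact: le_trans a1 b1].
have C_ge0 : 0 <= C by rewrite addr_ge0.
apply/cvgrPdist_le => e e0; have m0 : 0 < Num.min r (e / (C + 1)).
  by rewrite lt_min r0 divr_gt0// ltr_wpDl.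
apply: near_norm m0 _ => z; rewrite le_min => /andP[zr ze].
rewrite distrC; apply: (le_trans (key z zr)).
have C1p : 0 < C + 1 by rewrite ltr_wpDl.
rewrite ler_pdivlMr// in ze; have := normr_ge0 (z - x); lra.
Qed.

Lemma test_zero A phi : test_function A phi -> exists K : set P, [/\ compact K, K `<=` A,
  open (~` K) & forall i x, ~ K x -> phi x = 0 /\ pder i phi x = 0].
Proof.
move=> tp; have [_ [K [cK KA K0]]] := tp.
have oK : open (~` K).
  by apply: closed_openC; apply: compact_closed cK; exact: norm_hausdorff.
exists K; split => // i x nK; split; first exact: K0.
apply: d_unique (test_der i x tp) _; apply: d_near (dC (0 : R) x (dir i)).
by apply: filterS (open_nbhs_nbhs (conj oK nK)) => y /K0 ->.
Qed.

(** The product [phi * f], extended by zero, has a continuous derivative on the whole plane, whose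
    integral vanishes. *)
Lemma ibp_Omega A phi f g i : open A -> test_function A phi ->
  (forall x, A x -> is_derive x (dir i) f (g x)) ->
  (forall x, A x -> {for x, continuous f}) -> (forall x, A x -> {for x, continuous g}) ->
  [/\ intg (fun x => phi x * f x), intg (fun x => phi x * g x) &
  Int (fun x => pder i phi x * f x) = - Int (fun x => phi x * g x)].
Proof.
move=> oA tp df cf cg; have [K [cK KA oK K0]] := test_zero tp.
have [M [M0 HM]] := test_support tp.
have cp : continuous phi := test_cont tp.
have tq := test_pder i tp; have cq : continuous (pder i phi) := test_cont tq.
have [M' [M0' HM']] := test_support tq.
have near0 (q w : P -> R) x : ~ K x -> (forall x, ~ K x -> q x = 0) -> \near x, 0 = q x * w x.
  by move=> nK q0; apply: filterS (open_nbhs_nbhs (conj oK nK)) => y /q0 ->; rewrite mul0r.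
have p0 x : ~ K x -> phi x = 0 by move=> /(K0 i)[].
have q0 x : ~ K x -> pder i phi x = 0 by move=> /(K0 i)[].
have cts (q w : P -> R) : continuous q -> (forall x, ~ K x -> q x = 0) -> (forall x, A x -> {for x, continuous w}) ->
    continuous (fun x => q x * w x).
  move=> cq' q0' cw x; have [/KA Ax|nK] := pselect (K x); first by apply: cvgM; [exact: cq' | exact: cw].
  rewrite /continuous_at (q0' x nK) mul0r.
  exact: cvg_trans (near_eq_cvg (near0 q w x nK q0')) (cvg_cst (0 : R)).
have bdd (q w : P -> R) : continuous q -> (forall x, ~ K x -> q x = 0) -> (forall x, A x -> {for x, continuous w}) ->
    exists C : R, 0 <= C /\ forall x, `|q x * w x| <= C.
  move=> cq' q0' cw; have cqw := cts q w cq' q0' cw.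
  have [C [C0 HC]] := compact_bdd cK (fun z _ => cqw z); exists C; split => // x.
  by have [/HC//|nK] := pselect (K x); rewrite (q0' x nK) mul0r normr0.
have igr (q w : P -> R) (N : R) : 0 <= N -> (forall x, ~ box 0 N x -> q x = 0) -> continuous q -> (forall x, ~ K x -> q x = 0) ->
    (forall x, A x -> {for x, continuous w}) -> intg (fun x => q x * w x).
  move=> N0 HN cq' q0' cw; have [C [C0 HC]] := bdd q w cq' q0' cw.
  apply: (@intg_bdd _ _ 0 N C) => //; first by apply: continuous_mfun; exact: cts.
  by move=> y /HN ->; rewrite mul0r.
have i1 := igr phi f M M0 HM cp p0 cf; have i2 := igr phi g M M0 HM cp p0 cg.
have i3 := igr (pder i phi) f M' M0' HM' cq q0 cf.
split => //.
pose F x := phi x * f x; pose G x := phi x * g x + pder i phi x * f x.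
have dF x : is_derive x (dir i) F (G x).
  have [/KA Ax|nK] := pselect (K x).
    by apply: d_eq (dM (test_der i x tp) (df x Ax)) _; rewrite /G [f x * _]mulrC.
  apply: d_eq (d_near (near0 phi f x nK p0) (dC (0 : R) x (dir i))) _.
  by rewrite /G (p0 x nK) (q0 x nK) !mul0r addr0.
have cF : continuous F by exact: cts.
have cG : continuous G by move=> x; apply: cvgD; [exact: cts | exact: (cts (pder i phi))].
have [C1 [C10 H1]] := bdd phi g cp p0 cg; have [C2 [C20 H2]] := bdd (pder i phi) f cq q0 cf.
have [C3 [C30 H3]] := bdd phi f cp p0 cf.
have C12 : 0 <= C1 + C2 by exact: addr_ge0.
have bG x : `|G x| <= C1 + C2 by apply: (le_trans (ler_normD _ _)); exact: lerD.
have F0 x : ~ box 0 (Num.max M M') x -> F x = 0.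
  move=> nb; rewrite /F HM ?mul0r// => /boxP b; apply: nb; apply/boxP.
  by rewrite le_max b.
have G0 x : ~ box 0 (Num.max M M') x -> G x = 0.
  move=> nb; rewrite /G HM ?HM' ?mul0r ?addr0// => /boxP b; apply: nb; apply/boxP;
  by rewrite le_max b ?orbT.
have [_] := Int_derive0 C12 dF (continuous_mfun cF) (continuous_mfun cG) bG H3 F0 G0.
rewrite /G (IntD i2 i3) => /eqP; rewrite addrC addr_eq0 => /eqP.
exact.
Qed.

(** The level sets of [g] are open, as [g] is constant on squares. *)
Lemma connected_const A g : open A -> connected A ->
  (forall i x, A x -> is_derive x (dir i) g 0) -> exists c : R, forall x, A x -> g x = c.
Proof.
move=> oA cA dg; have [->|/set0P[x0 Ax0]] := eqVneq A set0; first by exists 0.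
exists (g x0) => x Ax.
pose B : set P := A `&` [set y | g y = g x0].
have oloc (Q : set R) : open (A `&` [set y | Q (g y)]).
  rewrite openE => y [Ay Qy]; have [r [r0 rA]] := margin_pt oA Ay.
  apply: near_norm (r0) _ => z zr; have zb : box y r z by apply/boxP.
  split; first exact: rA.
  suff -> : [set y | Q (g y)] z = Q (g y) by [].
  rewrite /=; congr Q.
  move: zr; rewrite norm_pair => /andP[/= z1 z2].
  have btw (u v s : R) : `|u - v| <= r -> Num.min v u <= s <= Num.max v u -> `|s - v| <= r.
    rewrite ge_min le_max !ler_norml => ? /andP[/orP[?|?] /orP[?|?]]; apply/andP; split; lra.
  have z0 (u v : R) : `|u - v| <= 0 -> u = v by rewrite normr_le0 subr_eq0 => /eqP.
  have a0 : `|g (z.1, z.2) - g (y.1, z.2) - 0 * (z.1 - y.1)| <= 0 * `|z.1 - y.1|.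
    apply: (@mvt_between R (fun t => g (t, z.2)) (fun t => 0) y.1 z.1) => t /btw tr.
      apply: (@d_to_line0 R g (t, z.2)); apply: dg; apply: rA; apply/boxP; rewrite norm_pair /=.
      by rewrite tr.
    by rewrite subr0 normr0.
  have a1 : `|g (y.1, z.2) - g (y.1, y.2) - 0 * (z.2 - y.2)| <= 0 * `|z.2 - y.2|.
    apply: (@mvt_between R (fun t => g (y.1, t)) (fun t => 0) y.2 z.2) => t /btw tr.
      apply: (@d_to_line1 R g (y.1, t)); apply: dg; apply: rA; apply/boxP; rewrite norm_pair /=.
      by rewrite subrr normr0 (ltW r0) tr.
    by rewrite subr0 normr0.
  rewrite !mul0r !subr0 -!surjective_pairing in a0 a1.
  by rewrite (z0 _ _ a0) (z0 _ _ a1).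
suff BA : B = A by have [] : B x by rewrite BA.
apply: cA; first by exists x0.
  by exists B; [exact: (oloc [set t | t = g x0]) | rewrite /B setIA setIid].
exists (~` (A `&` [set y | g y <> g x0])).
  by apply: open_closedC; exact: (oloc [set t | t <> g x0]).
apply/seteqP; split => [y [Ay gy]|y [Ay ny]]; first by split => // -[].
split => //=; apply: contrapT => ne; exact: ny.
Qed.

End OpenCalculus.

(** * Functions with a prescribed Hessian *)

Section HessianEquation.
Context {R : realType}.
Local Notation P := (R * R)%type.
Implicit Types (f g h phi psi T : P -> R) (x y : P) (D E : (P -> R) -> R).
Variable Omega : set P.
Hypothesis oO : open Omega.
Hypothesis bO : bounded_set Omega.
Local Notation L2 := (L2 Omega).
Local Notation dot := (dot Omega).
Local Notation test := (test_function Omega).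
Local Notation dist := (dist Omega).
Local Notation weak_der := (weak_der Omega).
Local Notation lap := (laplacian Omega).
Local Notation nsq v := (H2norm Omega v ^+ 2).

Lemma L2_continuous f : continuous f -> L2 f.
Proof.
move=> cf; apply/(L2P); have [M [M0 HM]] := bounded_box bO.
have cK : compact (box (0 : P) M) by exact: compact_box.
have [C [C0 HC]] := compact_bdd cK (fun z _ => cf z).
have mf := mfun_Omega oO cf; split => //.
apply: (@intg_bdd _ _ 0 M (C ^+ 2)); first exact: mfun_sqr.
  move=> y; rewrite normrX; apply: sqr_le; rewrite normr_id patch_indic indicE.
  case: (boolP (y \in Omega)) => [/set_mem /HM /HC|_]; first by rewrite mulr1.
  by rewrite mulr0 normr0.
move=> y nb; rewrite patch_indic indicE; case: (boolP (y \in Omega)) => [/set_mem /HM//|_].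
by rewrite mulr0 expr0n.
Qed.

Lemma wd_smooth i g : smooth g -> is_weak_der Omega i g (pder i g).
Proof.
move=> sg; have [cg _] := sg [::]; have [cg' _] := sg [:: i].
apply: (wdI (L2_continuous cg')) => phi tp.
have e1 := etrans (dotC Omega g _) (dot_testE g (test_pder i tp)).
have e2 := etrans (dotC Omega (pder i g) _) (dot_testE (pder i g) tp).
exact: etrans (congr1 -%R e1) (etrans (esym (int_by_parts i tp sg)) (esym e2)).
Qed.

Lemma dist_lapt D phi : dist D -> test phi ->
  D (lapt phi) = D (pder 0 (pder 0 phi)) + D (pder 1 (pder 1 phi)).
Proof.
move=> dD tp; have t00 := test_pder 0 (test_pder 0 tp); have t11 := test_pder 1 (test_pder 1 tp).
have E : lapt phi = fun x => 1 * pder 0 (pder 0 phi) x + pder 1 (pder 1 phi) x.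
  by apply/funext => x; rewrite mul1r.
exact: etrans (congr1 D E) (etrans (dist_linear dD 1 t00 t11) (congr1 (fun z : R => z + _) (mul1r _))).
Qed.

(** A distribution with vanishing gradient is harmonic; its representative has vanishing gradient too. *)
Lemma dist_const D : connected Omega -> dist D ->
  (forall i phi, test phi -> D (pder i phi) = 0) ->
  exists c : R, forall phi, test phi -> D phi = dot (fun=> c) phi.
Proof.
move=> cO dD D0.
have hD : harmonic Omega D.
  move=> phi tp; have t0 := test_pder 0 tp; have t1 := test_pder 1 tp.
  exact: etrans (dist_lapt dD tp) (etrans (congr2 +%R (D0 0 _ t0) (D0 1 _ t1)) (addr0 0)).
have r0 i x : Omega x -> is_derive x (dir i) (rep Omega D) 0.
  move=> Ox; apply: d_eq (@rep_der R Omega oO bO D i x dD hD Ox) _.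
  have z : dist_eq Omega (dist_der i D) (fun=> 0).
    by move=> phi tp; rewrite /dist_der D0// oppr0.
  exact: (rep_eq oO z Ox).
have [c Hc] := connected_const oO cO r0; exists c => phi tp.
have [_ ->] := rep_regular oO bO dD hD tp.
apply: esym; apply: etrans (dotC Omega _ _) (etrans (dot_testE _ tp) _); apply: (congr1 (@Int R)); apply/funext => x.
have [Ox|nO] := pselect (Omega x); first by rewrite Hc.
have -> : phi x = 0; last by rewrite !mul0r.
by rewrite -(patch_test tp) patchE memNset.
Qed.

Lemma Hm2I (F : (P -> R) -> R) (C : R) :
  (forall (a : R) v w, H20 Omega v -> H20 Omega w -> F (fun x => a * v x + w x) = a * F v + F w) ->
  (forall v, H20 Omega v -> F v ^+ 2 <= C ^+ 2 * nsq v) -> Hm2 Omega F.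
Proof.
move=> lF bF; split => //; exists `|C| => v hv.
have h0 := H2norm_ge0 Omega v.
rewrite -(@ler_pXn2r _ 2)// ?nnegrE ?normr_ge0 ?mulr_ge0//.
by rewrite exprMn !real_normK ?num_real//; exact: bF.
Qed.

Lemma Hm2_lin (a : R) F G : Hm2 Omega F -> Hm2 Omega G -> Hm2 Omega (fun v => a * F v + G v).
Proof.
move=> [lF [C HC]] [lG [C' HC']]; split.
  move=> b v w hv hw; rewrite (lF b v w hv hw) (lG b v w hv hw); ring.
exists (`|a| * C + C') => v hv; apply: (le_trans (ler_normD _ _)).
rewrite normrM mulrDl -mulrA; apply: lerD (HC' v hv).
by apply: ler_wpM2l => //; exact: HC.
Qed.

Lemma in_Hm2_lin (a : R) D E : in_Hm2 Omega D -> in_Hm2 Omega E ->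
  in_Hm2 Omega (fun phi => a * D phi + E phi).
Proof.
move=> [F [hF eF]] [G [hG eG]]; exists (fun v => a * F v + G v); split; first exact: Hm2_lin.
by move=> phi tp; rewrite (eF phi tp) (eG phi tp).
Qed.

Lemma CS_le (t a N c : R) : 0 <= t -> c ^+ 2 <= t * a -> a <= N -> c ^+ 2 <= Num.sqrt t ^+ 2 * N.
Proof. by move=> t0 h aN; rewrite sqr_sqrtr//; apply: le_trans h _; rewrite ler_wpM2l. Qed.

Lemma Hm2_hess i j T : L2 T -> Hm2 Omega (fun v => dot T (weak_der j (weak_der i v))).
Proof.
move=> lT; apply: (@Hm2I _ (Num.sqrt (dot T T))) => [a v w hv hw|v hv].
  have jv := H2_jet (H20_H2 hv); have jw := H2_jet (H20_H2 hw).
  have jl := jet_lin a jv jw; have [_ [_ e]] := jet_aeq oO jl.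
  have [_ _ lv] := jet_L2 jv; have [_ _ lw] := jet_L2 jw; have [_ _ ll] := jet_L2 jl.
  have [_ _ ll'] := jet_L2 (H2_jet (proj1 (jet_aeq oO jl))).
  have lZ := L2Z a (lv i j).
  apply: etrans (dot_aeq lT lT (ll' i j) (ll i j) (aeq_refl Omega T) (e i j)) _.
  apply: etrans (dotDr lT lZ (lw i j)) _.
  exact: (congr1 (fun z : R => z + _) (dotZr a lT (lv i j))).
have jv := H2_jet (H20_H2 hv); have [_ _ lv] := jet_L2 jv.
have [_ _ hN] := Nsq_ge Omega v (fun i => weak_der i v) (fun i j => weak_der j (weak_der i v)).
have hNij := hN i j; rewrite -(H2norm_jet oO jv) in hNij.
exact: CS_le (dot_ge0 Omega T) (dot_CS lT (lv i j)) hNij.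
Qed.

Lemma Hm2_grad i T : L2 T -> Hm2 Omega (fun v => dot T (weak_der i v)).
Proof.
move=> lT; apply: (@Hm2I _ (Num.sqrt (dot T T))) => [a v w hv hw|v hv].
  have jv := H2_jet (H20_H2 hv); have jw := H2_jet (H20_H2 hw).
  have jl := jet_lin a jv jw; have [_ [e _]] := jet_aeq oO jl.
  have [_ lv _] := jet_L2 jv; have [_ lw _] := jet_L2 jw; have [_ ll _] := jet_L2 jl.
  have [_ ll' _] := jet_L2 (H2_jet (proj1 (jet_aeq oO jl))).
  have lZ := L2Z a (lv i).
  apply: etrans (dot_aeq lT lT (ll' i) (ll i) (aeq_refl Omega T) (e i)) _.
  apply: etrans (dotDr lT lZ (lw i)) _.
  exact: (congr1 (fun z : R => z + _) (dotZr a lT (lv i))).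
have jv := H2_jet (H20_H2 hv); have [_ lv _] := jet_L2 jv.
have [_ hN _] := Nsq_ge Omega v (fun i => weak_der i v) (fun i j => weak_der j (weak_der i v)).
have hNij := hN i; rewrite -(H2norm_jet oO jv) in hNij.
exact: CS_le (dot_ge0 Omega T) (dot_CS lT (lv i)) hNij.
Qed.

Lemma in_Hm2_dd i j T : L2 T -> in_Hm2 Omega (dist_der i (dist_der j (dist_of Omega T))).
Proof.
move=> lT; exists (fun v => dot T (weak_der j (weak_der i v))); split; first exact: Hm2_hess.
move=> phi tp; have jp := jet_test tp; have [hp [_ e]] := jet_aeq oO jp.
have [_ _ l1] := jet_L2 jp; have [_ _ l2] := jet_L2 (H2_jet hp).
exact: etrans (opprK _) (esym (dot_aeq lT lT (l2 i j) (l1 i j) (aeq_refl Omega T) (e i j))).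
Qed.

Lemma in_Hm2_d i T : L2 T -> in_Hm2 Omega (dist_der i (dist_of Omega T)).
Proof.
move=> lT; have lN := L2N lT; exists (fun v => dot (fun x => - T x) (weak_der i v)); split; first exact: Hm2_grad.
move=> phi tp; have jp := jet_test tp; have [hp [e _]] := jet_aeq oO jp.
have [_ l1 _] := jet_L2 jp; have [_ l2 _] := jet_L2 (H2_jet hp).
exact: esym (etrans (dot_aeq lN lN (l2 i) (l1 i) (aeq_refl Omega _) (e i)) (dotNl lT (l1 i))).
Qed.

Lemma trace_aux (a b c d f g s : R) :
  1 * a + b = f -> s = f -> s = g -> g = c + d -> a - c + (b - d) = 0.
Proof. lra. Qed.

(** Three properties shared by the sums of derivatives of order one or two of square integrable functions:
    regularity when they are harmonic, control of the growth at the boundary, and membership in [H^-2]. *)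
Definition second_order D := [/\ dist D, order2 Omega D & in_Hm2 Omega D].

Lemma second_order_lin (a : R) D E : second_order D -> second_order E ->
  second_order (fun phi => a * D phi + E phi).
Proof.
move=> [d1 o1 i1] [d2 o2 i2].
by split; [exact: dist_lin | exact: order2_lin | exact: in_Hm2_lin].
Qed.

Lemma second_order_dd i j T : L2 T -> second_order (dist_der i (dist_der j (dist_of Omega T))).
Proof.
move=> lT; split; [|exact: order2_dd|exact: in_Hm2_dd].
by apply: dist_d; apply: dist_d; exact: dist_L2.
Qed.

Lemma second_order_d i T : L2 T -> second_order (dist_der i (dist_of Omega T)).
Proof.
move=> lT; split; [|exact: order2_d|exact: in_Hm2_d].
by apply: dist_d; exact: dist_L2.
Qed.

Hypothesis lipO : lipschitz_boundary Omega.
Hypothesis sc : simply_connected Omega.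
Hypothesis cO : connected Omega.

Section Harmonic.
Variable Q : 'I_2 -> 'I_2 -> (P -> R) -> R.
Hypothesis dQ : forall i j, dist (Q i j).
Hypothesis oQ : forall i j, order2 Omega (Q i j).
Hypothesis Q_sym : forall i j phi, test phi -> Q i j phi = Q j i phi.
Hypothesis Q_closed : forall i j k phi, test phi -> Q i j (pder k phi) = Q k j (pder i phi).
Hypothesis Q_tr : forall phi, test phi -> Q 0 0 phi + Q 1 1 phi = 0.

(** By the closedness relations, [lap (Q i j) = d_i d_j (Q 0 0 + Q 1 1)]. *)
Lemma hess_harmonic i j : harmonic Omega (Q i j).
Proof.
move=> phi tp.
have kk k : Q i j (pder k (pder k phi)) = Q k k (pder j (pder i phi)).
  have tk := test_pder k tp; have ti := test_pder i tp.
  rewrite (Q_closed i j k tk) (pderC i k (test_smooth tp)).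
  by rewrite (Q_sym k j (test_pder k ti)) (Q_closed j k k ti).
have tr := Q_tr (test_pder j (test_pder i tp)).
exact: etrans (dist_lapt (dQ i j) tp) (etrans (congr2 +%R (kk 0) (kk 1)) tr).
Qed.

Let q i j := rep Omega (Q i j).
Let q' k i j := rep Omega (dist_der k (Q i j)).

Lemma q_der k i j x : Omega x -> is_derive x (dir k) (q i j) (q' k i j x).
Proof. move=> Ox; exact: (@rep_der R Omega oO bO _ k x (dQ i j) (hess_harmonic i j) Ox). Qed.

Lemma q_cont i j x : Omega x -> {for x, continuous (q i j)}.
Proof. move=> Ox; exact: (rep_cont oO bO (dQ i j) (hess_harmonic i j) Ox). Qed.

Lemma q'_cont k i j x : Omega x -> {for x, continuous (q' k i j)}.
Proof. by apply: (rep_cont oO bO _ (harmonic_d k (hess_harmonic i j))); exact: dist_d. Qed.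

Lemma q'_closed i k j x : Omega x -> q' k i j x = q' i k j x.
Proof.
apply: (rep_eq oO) => phi tp.
exact: (congr1 -%R (Q_closed i j k tp)).
Qed.

Lemma q_sym i j x : Omega x -> q i j x = q j i x.
Proof. by apply: (rep_eq oO) => phi tp; exact: Q_sym. Qed.

(** Each column of the matrix of smooth representatives is a closed form, with a potential; the potentials
    form a closed form again, by symmetry. The potential [h] of the latter is square integrable by [hardy_L2]. *)
Lemma harmonic_hessian : exists h, L2 h /\
  forall i j phi, test phi -> Q i j phi = dot h (pder i (pder j phi)).
Proof.
have pot j : exists hj, potential (fun i => q i j) Omega hj.
  apply: (global_potential oO _ sc cO) => x r r0 rO.
  apply: (local_potential (Omega := Omega) (b := fun k i => q' k i j)) r0 rO => [i k y|i y|i k y|y].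
  - exact: q_der.
  - exact: q_cont.
  - exact: q'_cont.
  - exact: q'_closed.
have [h1 Hh1] := choice pot.
have h1c j x : Omega x -> {for x, continuous (h1 j)}.
  exact: (C1_cont oO (fun i y Oy => Hh1 j y i Oy) (fun i y Oy => @q_cont i j y Oy)).
have [h Hh] : exists h, potential h1 Omega h.
  apply: (global_potential oO _ sc cO) => x r r0 rO.
  apply: (local_potential (Omega := Omega) (b := q)) r0 rO => [i k y|i y|i k y|y].
  - exact: Hh1.
  - exact: h1c.
  - exact: q_cont.
  - exact: q_sym.
have hc x : Omega x -> {for x, continuous h}.
  exact: (C1_cont oO (fun i y Oy => Hh y i Oy) (fun i y Oy => @h1c i y Oy)).
exists h; split.
  apply: (@hardy_L2 _ _ oO bO lipO h h1 (fun i j => q j i)).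
  - by move=> i x; exact: Hh.
  - by move=> i j x; exact: Hh1.
  - exact: hc.
  - exact: h1c.
  - by move=> i j x; exact: q_cont.
  - by move=> i j; exact: rep_bound (dQ j i) (hess_harmonic j i) (oQ j i).
move=> i j phi tp; have tj := test_pder j tp.
have [_ _ e1] := ibp_Omega oO tj (fun x => Hh x i) hc (h1c i).
have [_ _ e2] := ibp_Omega oO tp (fun x => Hh1 i x j) (h1c i) (@q_cont j i).
have [_ e3] := rep_regular oO bO (dQ j i) (hess_harmonic j i) tp.
have e4 := etrans (dotC Omega h _) (dot_testE h (test_pder i tj)).
have e5 := etrans e1 (etrans (congr1 -%R e2) (opprK _)).
exact: etrans (Q_sym i j tp) (etrans e3 (esym (etrans e4 e5))).
Qed.

End Harmonic.

(** Saint-Venant's theorem in negative norm. Choose [z] in [H^2_0] with [lap (lap z)] equal to the trace of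
    [A]. Then [A] minus the Hessian of [lap z] is compatible and has trace zero, so [harmonic_hessian] gives
    it as the Hessian of some [h], and [lap z + h] is a solution. *)
Theorem hessian_solvable (A : 'I_2 -> 'I_2 -> (P -> R) -> R) :
  (forall i j, second_order (A i j)) ->
  (forall i j phi, test phi -> A i j phi = A j i phi) ->
  (forall i j k phi, test phi -> A i j (pder k phi) = A k j (pder i phi)) ->
  exists p, L2 p /\ forall i j phi, test phi -> A i j phi = dot p (pder i (pder j phi)).
Proof.
move=> sA A_sym A_closed.
have [F [hF eF]] : in_Hm2 Omega (fun phi => 1 * A 0 0 phi + A 1 1 phi).
  by have [_ _ ?] := sA 0 0; have [_ _ ?] := sA 1 1; exact: in_Hm2_lin.
have [z [hz Hz]] := biharmonic_Hm2 oO bO hF.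
pose q := lap z; have lq : L2 q := L2_lap oO (H20_H2 hz).
pose Q i j := fun phi => -1 * dist_der i (dist_der j (dist_of Omega q)) phi + A i j phi.
have QE i j phi : Q i j phi = A i j phi - dot q (pder j (pder i phi)).
  by rewrite /Q /dist_der opprK mulN1r addrC.
have sQ i j : second_order (Q i j).
  by apply: second_order_lin; [exact: second_order_dd | exact: sA].
have tr phi : test phi -> Q 0 0 phi + Q 1 1 phi = 0.
  move=> tp; have e1 := eF phi tp; have e2 := Hz phi (H20_test oO tp).
  have jz := H2_jet (H20_H2 hz); have jp := jet_test tp.
  have [_ _ lp] := jet_L2 jp.
  have [ae_lap lp2] := lap_jet oO jp.
  have lp3 := L2_lap oO (proj1 (jet_aeq oO jp)).
  have e3 := dot_aeq lq lq lp3 lp2 (aeq_refl Omega q) ae_lap.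
  have e4 := dotDr lq (lp 0 0) (lp 1 1).
  exact: etrans (congr2 +%R (QE 0 0 phi) (QE 1 1 phi)) (trace_aux e1 e2 e3 e4).
have Qsym i j phi : test phi -> Q i j phi = Q j i phi.
  by move=> tp; rewrite !QE (A_sym i j phi tp) (pderC i j (test_smooth tp)).
have Qcl i j k phi : test phi -> Q i j (pder k phi) = Q k j (pder i phi).
  by move=> tp; rewrite !QE (A_closed i j k phi tp) (pderC i k (test_smooth tp)).
have [h [lh Hh]] := harmonic_hessian (fun i j => let: And3 d _ _ := sQ i j in d)
  (fun i j => let: And3 _ o _ := sQ i j in o) Qsym Qcl tr.
exists (fun x => q x + h x); split; first exact: L2D.
move=> i j phi tp; have tij := test_pder i (test_pder j tp).
have e1 := congr2 (fun a b : R => a + b) (congr1 (dot q) (pderC i j (test_smooth tp))) (esym (Hh i j phi tp)).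
apply: esym; apply: etrans (dotDl lq lh (L2_test tij)) (etrans e1 _).
by rewrite QE addrC subrK.
Qed.

End HessianEquation.

(** * Potentials of a tensor field with vanishing divdivdiv *)

Section Exactness.
Context {R : realType}.
Local Notation P := (R * R)%type.
Implicit Types (f g h phi psi T : P -> R) (x y : P) (D E : (P -> R) -> R).
Variable Omega : set P.
Hypothesis oO : open Omega.
Hypothesis bO : bounded_set Omega.
Hypothesis lipO : lipschitz_boundary Omega.
Hypothesis sc : simply_connected Omega.
Hypothesis cO : connected Omega.
Local Notation L2 := (L2 Omega).
Local Notation dot := (dot Omega).
Local Notation test := (test_function Omega).
Local Notation dist := (dist Omega).
Local Notation second_order := (second_order Omega).
Local Notation is_weak_der := (is_weak_der Omega).

Definition affine (c0 c1 : R) : P -> R := fun x => c0 * x.1 + c1 * x.2.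

Lemma smooth_affine c0 c1 : smooth (affine c0 c1).
Proof.
by apply/smoothP => n; apply: CkD; apply: CkZ; [exact: Ck_fst | exact: Ck_snd].
Qed.

Lemma affine_der c0 c1 v x : is_derive x v (affine c0 c1) (c0 * v.1 + c1 * v.2).
Proof. by apply: dD; apply: dZ; [exact: d_fst | exact: d_snd]. Qed.

Lemma L2_affine c0 c1 : L2 (affine c0 c1).
Proof. by apply: (L2_continuous oO bO); have [] := smooth_affine c0 c1 [::]. Qed.

Lemma affine_test c0 c1 i phi : test phi ->
  dot (affine c0 c1) (pder i phi) = - dot (fun=> c0 * (dir i).1 + c1 * (dir i).2) phi.
Proof.
move=> tp; have w := wd_smooth oO bO i (smooth_affine c0 c1).
apply: etrans (wdE w tp) _; apply: (congr1 -%R).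
have e : pder i (affine c0 c1) = fun=> c0 * (dir i).1 + c1 * (dir i).2.
  by apply/funext => x; have h := affine_der c0 c1 (dir i) x; exact: (@derive_val _ _ _ _ _ _ _ h).
exact: (congr1 (fun g => dot g phi) e).
Qed.

Lemma affine_test_dir c0 c1 phi : test phi ->
  dot (affine c0 c1) (pder 0 phi) = - dot (fun=> c0) phi /\
  dot (affine c0 c1) (pder 1 phi) = - dot (fun=> c1) phi.
Proof.
move=> tp; have e0 := affine_test c0 c1 0 tp; have e1 := affine_test c0 c1 1 tp.
rewrite dir0 dir1 /= !mulr1 !mulr0 addr0 add0r in e0 e1; split => //.
Qed.

(** The same with the three independent entries of a symmetric matrix. *)
Lemma hessian3 (A00 A01 A11 : (P -> R) -> R) :
  second_order A00 -> second_order A01 -> second_order A11 ->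
  (forall phi, test phi -> A00 (pder 1 phi) = A01 (pder 0 phi)) ->
  (forall phi, test phi -> A01 (pder 1 phi) = A11 (pder 0 phi)) ->
  exists p, L2 p /\ forall phi, test phi -> [/\ A00 phi = dot p (pder 0 (pder 0 phi)),
    A01 phi = dot p (pder 0 (pder 1 phi)) & A11 phi = dot p (pder 1 (pder 1 phi))].
Proof.
move=> s00 s01 s11 c0 c1.
pose A (i j : 'I_2) : (P -> R) -> R := match (i + j)%N with 0%N => A00 | 1%N => A01 | _ => A11 end.
have sA i j : second_order (A i j).
  by case: (ord2P i) => ->; case: (ord2P j) => ->.
have A_sym i j phi : test phi -> A i j phi = A j i phi by move=> _; rewrite /A addnC.
have cl j phi : test phi -> A 0 j (pder 1 phi) = A 1 j (pder 0 phi).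
  by move=> tp; case: (ord2P j) => ->; [exact: c0 | exact: c1].
have A_cl i j k phi : test phi -> A i j (pder k phi) = A k j (pder i phi).
  move=> tp; case: (ord2P i) => ->; case: (ord2P k) => ->.
  - by [].
  - exact: cl.
  - exact: esym (cl j phi tp).
  - by [].
have [p [lp Hp]] := hessian_solvable oO bO lipO sc cO sA A_sym A_cl.
exists p; split => // phi tp; split.
- exact: (Hp 0 0).
- exact: (Hp 0 1).
- exact: (Hp 1 1).
Qed.

(** A closed form with square integrable coefficients has a square integrable potential. Its derivatives of
    first order form a compatible matrix, so some [p] has the right Hessian; the gradient of [p] is then right
    up to constants, which an affine function corrects. *)
Lemma weak_potential F0 F1 : L2 F0 -> L2 F1 ->
  (forall phi, test phi -> dot F0 (pder 1 phi) = dot F1 (pder 0 phi)) ->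
  exists a, [/\ L2 a, is_weak_der 0 a F0 & is_weak_der 1 a F1].
Proof.
move=> l0 l1 cl.
have [p [lp Hp]] : exists p, L2 p /\ forall phi, test phi ->
    [/\ dist_der 0 (dist_of Omega F0) phi = dot p (pder 0 (pder 0 phi)),
    dist_der 0 (dist_of Omega F1) phi = dot p (pder 0 (pder 1 phi)) &
    dist_der 1 (dist_of Omega F1) phi = dot p (pder 1 (pder 1 phi))].
  apply: hessian3; [exact: second_order_d|exact: second_order_d|exact: second_order_d| |] => phi tp.
    have e := cl _ (test_pder 0 tp).
    have e' := congr1 (dot F0) (pderC 0 1 (test_smooth tp)).
    exact: (congr1 (fun z : R => - z) (etrans e' e)).
  exact: (congr1 (fun z : R => - z) (congr1 (dot F1) (pderC 0 1 (test_smooth tp)))).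
pose D0 := fun phi => -1 * dist_der 0 (dist_of Omega p) phi + dist_of Omega F0 phi.
pose D1 := fun phi => -1 * dist_der 1 (dist_of Omega p) phi + dist_of Omega F1 phi.
have dd i F : L2 F -> dist (fun phi => -1 * dist_der i (dist_of Omega p) phi + dist_of Omega F phi).
  by move=> lF; apply: dist_lin; [apply: dist_d|]; exact: dist_L2.
have aux (b c d : R) : c = d -> - b = d -> -1 * - c + b = 0 by move=> -> <-; ring.
have z0 i phi : test phi -> D0 (pder i phi) = 0.
  move=> tp; have [e00 e01 e11] := Hp phi tp.
  have C := congr1 (dot p) (pderC 0 1 (test_smooth tp)).
  case: (ord2P i) => ->; first exact: aux (erefl _) e00.
  exact: aux (erefl _) (etrans (congr1 -%R (cl _ tp)) e01).
have z1 i phi : test phi -> D1 (pder i phi) = 0.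
  move=> tp; have [e00 e01 e11] := Hp phi tp.
  have C := congr1 (dot p) (pderC 0 1 (test_smooth tp)).
  case: (ord2P i) => ->; last exact: aux (erefl _) e11.
  exact: aux (esym C) e01.
have [c0 H0] := dist_const oO bO cO (dd 0 F0 l0) z0.
have [c1 H1] := dist_const oO bO cO (dd 1 F1 l1) z1.
have la := L2_affine c0 c1.
have aux2 (q f c l s : R) : -1 * - q + f = c -> l = - c -> s = q + l -> - s = f.
  by move=> h1 h2 h3; rewrite h3 h2 -h1; ring.
exists (fun x => p x + affine c0 c1 x); split; first exact: L2D.
- apply: (wdI l0) => phi tp; have [e _] := affine_test_dir c0 c1 tp.
  exact: aux2 (H0 phi tp) e (dotDl lp la (L2_test (test_pder 0 tp))).
- apply: (wdI l1) => phi tp; have [_ e] := affine_test_dir c0 c1 tp.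
  exact: aux2 (H1 phi tp) e (dotDl lp la (L2_test (test_pder 1 tp))).
Qed.

Lemma second_orderZ (a : R) D : second_order D -> second_order (fun phi => a * D phi).
Proof.
move=> sD; have := second_order_lin (a - 1) sD sD; congr second_order.
by apply/funext => phi; rewrite mulrBl mul1r subrK.
Qed.

Lemma second_orderD D E : second_order D -> second_order E -> second_order (fun phi => D phi + E phi).
Proof.
move=> sD sE; have := second_order_lin 1 sD sE; congr second_order.
by apply/funext => phi; rewrite mul1r.
Qed.

Section Potentials.
Variables t1 t2 t3 t4 : P -> R.
Hypotheses (l1 : L2 t1) (l2 : L2 t2) (l3 : L2 t3) (l4 : L2 t4).
Hypothesis div0 : forall phi, test phi ->
  dot t1 (pder 0 (pder 0 (pder 0 phi))) + 3 * dot t2 (pder 0 (pder 0 (pder 1 phi)))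
  + 3 * dot t3 (pder 0 (pder 1 (pder 1 phi))) + dot t4 (pder 1 (pder 1 (pder 1 phi))) = 0.

Let e i j T := dist_der i (dist_der j (dist_of Omega T)).

Lemma swap3 phi : test phi -> pder 0 (pder 1 (pder 0 phi)) = pder 0 (pder 0 (pder 1 phi)).
Proof. by move=> tp; exact: (congr1 (@pder R 0) (pderC 1 0 (test_smooth tp))). Qed.

Lemma swap3' phi : test phi -> pder 1 (pder 1 (pder 0 phi)) = pder 0 (pder 1 (pder 1 phi)).
Proof.
move=> tp; apply: etrans (congr1 (@pder R 1) (pderC 1 0 (test_smooth tp))) _.
exact: pderC (test_smooth (test_pder 1 tp)).
Qed.

(** The field [p] stands for [d_0 a], whose Hessian is forced by [d_1 a = t1] and by the solvability condition
    [d_0 (d_0 a + 3 t2) = d_1 (d_1 b - 3 t3)] for [c]. *)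
Lemma potential_p : exists p, L2 p /\ forall phi, test phi ->
  [/\ dot p (pder 0 (pder 0 phi)) = -3 * dot t2 (pder 0 (pder 0 phi))
        + (-3 * dot t3 (pder 0 (pder 1 phi)) + -1 * dot t4 (pder 1 (pder 1 phi))),
      dot p (pder 0 (pder 1 phi)) = dot t1 (pder 0 (pder 0 phi)) &
      dot p (pder 1 (pder 1 phi)) = dot t1 (pder 0 (pder 1 phi))].
Proof.
pose A00 := fun phi => -3 * e 0 0 t2 phi + (-3 * e 1 0 t3 phi + -1 * e 1 1 t4 phi).
have s00 : second_order A00.
  by apply: second_orderD; [|apply: second_orderD]; apply: second_orderZ; exact: second_order_dd.
have aux (z1 z2 z3 z4 w1 w2 w3 w4 : R) : z1 + 3 * z2 + 3 * z3 + z4 = 0 -> w1 = z1 -> w2 = z2 -> w3 = z3 ->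
    w4 = z4 -> -3 * w2 + (-3 * w3 + -1 * w4) = w1.
  move=> h -> -> -> ->; lra.
have [||phi tp|phi tp|p [lp Hp]] := @hessian3 A00 (e 0 0 t1) (e 1 0 t1) s00.
- exact: second_order_dd.
- exact: second_order_dd.
- exact: (aux _ _ _ _ _ _ _ _ (div0 tp) (opprK _) (opprK _) (opprK _) (opprK _)).
- exact: etrans (opprK _) (esym (etrans (opprK _) (congr1 (dot t1) (swap3 tp)))).
exists p; split; [exact: lp|move=> phi tp]; have [h1 h2 h3] := Hp phi tp.
have aux2 (q w2 w3 w4 z2 z3 z4 : R) : -3 * w2 + (-3 * w3 + -1 * w4) = q -> w2 = z2 -> w3 = z3 -> w4 = z4 ->
    q = -3 * z2 + (-3 * z3 + -1 * z4).
  by move=> h <- <- <-.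
split.
- exact: (aux2 _ _ _ _ _ _ _ h1 (opprK _) (opprK _) (opprK _)).
- exact: etrans (esym h2) (opprK _).
- exact: etrans (esym h3) (opprK _).
Qed.

(** Similarly [q] stands for [d_1 b]. *)
Lemma potential_q : exists q, L2 q /\ forall phi, test phi ->
  [/\ dot q (pder 0 (pder 0 phi)) = - dot t4 (pder 0 (pder 1 phi)),
      dot q (pder 0 (pder 1 phi)) = - dot t4 (pder 1 (pder 1 phi)) &
      dot q (pder 1 (pder 1 phi)) = dot t1 (pder 0 (pder 0 phi))
        + (3 * dot t2 (pder 0 (pder 1 phi)) + 3 * dot t3 (pder 1 (pder 1 phi)))].
Proof.
pose A11 := fun phi => e 0 0 t1 phi + (3 * e 1 0 t2 phi + 3 * e 1 1 t3 phi).
have s11 : second_order A11.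
  apply: second_orderD; first exact: second_order_dd.
  by apply: second_orderD; apply: second_orderZ; exact: second_order_dd.
pose A00 := fun phi => -1 * e 1 0 t4 phi; pose A01 := fun phi => -1 * e 1 1 t4 phi.
have s00 : second_order A00 by apply: second_orderZ; exact: second_order_dd.
have s01 : second_order A01 by apply: second_orderZ; exact: second_order_dd.
have aux0 (x y z : R) : x = z -> y = z -> -1 * x = -1 * y by move=> -> ->.
have aux (z1 z2 z3 z4 w1 w2 w3 w4 : R) : z1 + 3 * z2 + 3 * z3 + z4 = 0 -> w1 = z1 -> w2 = z2 -> w3 = z3 ->
    w4 = z4 -> -1 * w4 = w1 + (3 * w2 + 3 * w3).
  move=> h -> -> -> ->; lra.
have [phi tp|phi tp|q [lq Hq]] := @hessian3 A00 A01 A11 s00 s01 s11.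
- exact: (aux0 _ _ _ (opprK _) (etrans (opprK _) (congr1 (dot t4) (swap3' tp)))).
- exact: (aux _ _ _ _ _ _ _ _ (div0 tp) (opprK _) (etrans (opprK _) (congr1 (dot t2) (swap3 tp)))
    (etrans (opprK _) (congr1 (dot t3) (swap3' tp))) (opprK _)).
exists q; split; [exact: lq|move=> phi tp]; have [h1 h2 h3] := Hq phi tp.
have aux1 (x y z : R) : -1 * x = y -> x = z -> y = - z by move=> <- ->; rewrite mulN1r.
have aux2 (q0 w1 w2 w3 z1 z2 z3 : R) : w1 + (3 * w2 + 3 * w3) = q0 -> w1 = z1 -> w2 = z2 -> w3 = z3 ->
    q0 = z1 + (3 * z2 + 3 * z3).
  by move=> h <- <- <-.
split.
- exact: (aux1 _ _ _ h1 (opprK _)).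
- exact: (aux1 _ _ _ h2 (opprK _)).
- exact: (aux2 _ _ _ _ _ _ _ h3 (opprK _) (opprK _) (opprK _)).
Qed.

(** The fields of [potential_p] and [potential_q] satisfy the first order equations up to constants, as the
    Hessians are right and [Omega] is connected; affine corrections remove the constants. *)
Lemma compatible_pq : exists p q, [/\ L2 p, L2 q & forall phi, test phi ->
  [/\ dot p (pder 1 phi) = dot t1 (pder 0 phi), dot q (pder 0 phi) = - dot t4 (pder 1 phi) &
      dot p (pder 0 phi) + 3 * dot t2 (pder 0 phi) = dot q (pder 1 phi) - 3 * dot t3 (pder 1 phi)]].
Proof.
have [p [lp Hp]] := potential_p; have [q [lq Hq]] := potential_q.
pose d i T := dist_der i (dist_of Omega T).
have dd i T : L2 T -> dist (d i T) by move=> lT; apply: dist_d; exact: dist_L2.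
pose D1 := fun phi => -1 * d 0 t1 phi + d 1 p phi.
pose D2 := fun phi => 1 * d 1 t4 phi + d 0 q phi.
pose D3 := fun phi => 3 * d 0 t2 phi + (3 * d 1 t3 phi + (-1 * d 1 q phi + d 0 p phi)).
have dD1 : dist D1 by apply: dist_lin; exact: dd.
have dD2 : dist D2 by apply: dist_lin; exact: dd.
have dD3 : dist D3.
  by apply: dist_lin; [exact: dd|apply: dist_lin; [exact: dd|apply: dist_lin; exact: dd]].
have C i phi (T : P -> R) : test phi -> dot T (pder 1 (pder i phi)) = dot T (pder i (pder 1 phi)).
  by move=> tp; exact: (congr1 (dot T) (pderC 1 i (test_smooth tp))).
have z1 i phi : test phi -> D1 (pder i phi) = 0.
  have aux (x y z w : R) : x = y -> x = z -> w = y -> -1 * - w + - z = 0 by lra.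
  move=> tp; have [_ h2 h3] := Hp phi tp.
  case: (ord2P i) => ->; first exact: aux h2 (esym (C 0 phi p tp)) (erefl _).
  exact: aux h3 (erefl _) (erefl _).
have z2 i phi : test phi -> D2 (pder i phi) = 0.
  have aux (x y z : R) : x = - y -> z = y -> 1 * - z + - x = 0 by lra.
  move=> tp; have [h1 h2 _] := Hq phi tp.
  case: (ord2P i) => ->; first exact: aux h1 (C 0 phi t4 tp).
  exact: aux h2 (erefl _).
have z3 i phi : test phi -> D3 (pder i phi) = 0.
  have aux (x2 x3 x4 y2 y3 yq yp : R) : yp = -3 * x2 + (-3 * x3 + -1 * x4) -> yq = - x4 -> y2 = x2 -> y3 = x3 ->
    3 * - y2 + (3 * - y3 + (-1 * - yq + - yp)) = 0 by lra.
  have aux' (x1 x2 x3 y2 y3 yq yp : R) : yp = x1 -> yq = x1 + (3 * x2 + 3 * x3) -> y2 = x2 -> y3 = x3 ->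
    3 * - y2 + (3 * - y3 + (-1 * - yq + - yp)) = 0 by lra.
  move=> tp; have [h1 h2 h3] := Hp phi tp; have [k1 k2 k3] := Hq phi tp.
  case: (ord2P i) => ->.
    exact: (aux _ _ _ _ _ _ _ h1 (etrans (C 0 phi q tp) k2) (erefl _) (C 0 phi t3 tp)).
  exact: (aux' _ _ _ _ _ _ _ h2 k3 (erefl _) (erefl _)).
have [c1 H1] := dist_const oO bO cO dD1 z1.
have [c2 H2] := dist_const oO bO cO dD2 z2.
have [c3 H3] := dist_const oO bO cO dD3 z3.
pose ap := affine (- c3) (- c1); pose aq := affine (- c2) 0.
have lap : L2 ap := L2_affine _ _; have laq : L2 aq := L2_affine _ _.
have aux1 (r s t u m k : R) : r = s + t -> t = - (- k * m) -> -1 * - u + - s = k * m -> r = u by lra.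
have aux2 (r s t u m k : R) : r = s + t -> t = - (- k * m) -> 1 * - u + - s = k * m -> r = - u by lra.
have aux3 (r s t r' s' t' u2 u3 m k : R) : r = s + t -> t = - (- k * m) -> r' = s' + t' -> t' = - (0 * m) ->
  3 * - u2 + (3 * - u3 + (-1 * - s' + - s)) = k * m -> r + 3 * u2 = r' - 3 * u3 by lra.
exists (fun x => p x + ap x), (fun x => q x + aq x); split; [exact: L2D|exact: L2D|] => phi tp.
have lt := L2_test tp; have ld i := L2_test (test_pder i tp).
have K (c : R) : dot (fun=> c) phi = c * dot (fun=> 1) phi.
  have lc : L2 (fun=> 1) by apply: (L2_continuous oO bO) => x; exact: cvg_cst.
  by rewrite -(dotZl c lc lt); congr dot; apply/funext => x; rewrite mulr1.
have [p0 p1] := affine_test_dir (- c3) (- c1) tp.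
have [q0 q1] := affine_test_dir (- c2) 0 tp.
have P1 := dotDl lp lap (ld 1); have P0 := dotDl lp lap (ld 0).
have Q1 := dotDl lq laq (ld 1); have Q0 := dotDl lq laq (ld 0).
have h1 := H1 phi tp; have h2 := H2 phi tp; have h3 := H3 phi tp.
rewrite K in h1; rewrite K in h2; rewrite K in h3; rewrite K in p0; rewrite K in p1; rewrite K in q0; rewrite K in q1.
split.
- exact: (aux1 _ _ _ _ _ _ P1 p1 h1).
- exact: (aux2 _ _ _ _ _ _ Q0 q0 h2).
- exact: (aux3 _ _ _ _ _ _ _ _ _ _ P0 p0 Q1 q1 h3).
Qed.

(** The three pairs of prescribed derivatives of [a], [b] and [c] are closed forms by [compatible_pq]. *)
Theorem tensor_potentials : exists a b c a0 b1, [/\ L2 a, L2 b & L2 c] /\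
  [/\ is_weak_der 0 a a0, is_weak_der 1 a t1, is_weak_der 0 b (fun x => - t4 x) & is_weak_der 1 b b1] /\
  [/\ is_weak_der 0 c (fun x => 2^-1 * b1 x - 2^-1 * 3 * t3 x) &
      is_weak_der 1 c (fun x => 2^-1 * a0 x + 2^-1 * 3 * t2 x)].
Proof.
have [p [q [lp lq H]]] := compatible_pq.
have l4' := L2N l4.
have aux (l r x y z w : R) : l = 2^-1 * x - 2^-1 * 3 * y -> r = 2^-1 * z + 2^-1 * 3 * w ->
  z + 3 * w = x - 3 * y -> l = r by lra.
have [|a [la a0 a1]] := @weak_potential p t1 lp l1; first by move=> phi /H[].
have [phi tp|b [lb b0 b1]] := @weak_potential (fun x => - t4 x) q l4' lq.
- have [_ h _] := H phi tp; exact: etrans (dotNl l4 (L2_test (test_pder 1 tp))) (esym h).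
have lq2 := L2Z 2^-1 lq; have lp2 := L2Z 2^-1 lp.
have l3' := L2Z (2^-1 * 3) l3; have l2' := L2Z (2^-1 * 3) l2.
have l6 := L2B lq2 l3'; have l7 := L2D lp2 l2'.
have [phi tp|c [lc c0 c1]] := @weak_potential _ _ l6 l7.
  have [_ _ h] := H phi tp; have t0 := L2_test (test_pder 0 tp); have s1 := L2_test (test_pder 1 tp).
  have e1 := etrans (dotBl lq2 l3' s1) (congr2 (fun a b : R => a - b) (dotZl 2^-1 lq s1) (dotZl (2^-1 * 3) l3 s1)).
  have e2 := etrans (dotDl lp2 l2' t0) (congr2 (fun a b : R => a + b) (dotZl 2^-1 lp t0) (dotZl (2^-1 * 3) l2 t0)).
  exact: aux e1 e2 h.
by exists a, b, c, p, q.
Qed.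

End Potentials.
End Exactness.

(** * Symmetric tensor fields *)

Section SymmetricTensors.
Context {R : realType}.
Local Notation P := (R * R)%type.
Implicit Types (f g h phi : P -> R) (x y : P) (sigma tau : tens_field R) (s t : nat -> P -> R).
Implicit Types (psi : mat_field R).
Variable Omega : set P.
Hypothesis oO : open Omega.
Local Notation L2 := (L2 Omega).
Local Notation dot := (dot Omega).
Local Notation test := (test_function Omega).
Local Notation aeq := (aeq Omega).
Local Notation weak_der := (weak_der Omega).

Lemma sum_perm3 (F : 'I_3 -> 'I_3 -> 'I_3 -> R) :
  \sum_(s : 'S_3) F (s 0) (s 1) (s 2%:R) =
  F 0 1 2%:R + (F 0 2%:R 1 + (F 1 0 2%:R + (F 1 2%:R 0 + (F 2%:R 0 1 + F 2%:R 1 0)))).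
Proof.
pose a : {perm 'I_3} := tperm 0 1; pose b : {perm 'I_3} := tperm 0 2%:R.
pose c : {perm 'I_3} := tperm 1 2%:R; pose e : {perm 'I_3} := 1%g.
pose L : seq {perm 'I_3} := [:: e; c; a; (a * b)%g; (b * a)%g; b].
have uL : uniq L.
  apply: (@map_uniq _ _ (fun s : 'S_3 => (s 0, s 1))).
  by rewrite /= /e /a /b /c !permM !permE /=.
have pL : perm_eq (index_enum {perm 'I_3}) L.
  apply: uniq_perm => //; first exact: index_enum_uniq.
  have sub : {subset L <= index_enum {perm 'I_3}} by move=> s _; exact: mem_index_enum.
  have [|_ eL] := uniq_min_size uL sub; last by move=> s; rewrite eL.
  by rewrite [index_enum _]unlock -enumT -cardT card_Sn.
rewrite (perm_big _ pL) !big_cons big_nil /= addr0 /e /a /b /c !permM !permE /=.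
by [].
Qed.

Lemma ae_aeq g h : g = h %[ae leb2 in Omega] <-> aeq g h.
Proof. by []. Qed.

(** The tensor whose entry at three indices is determined by their sum, which is the number
    of those equal to the second coordinate. *)
Definition symt t : tens_field R := fun i j k => t (i + j + k)%N.

Lemma permute_symt (s : 'S_3) t : permute_indices s (symt t) = symt t.
Proof.
apply/funext => i; apply/funext => j; apply/funext => k; rewrite /permute_indices /symt.
congr t; pose F (m : 'I_3) : nat := tnth [tuple i; j; k] m.
have e (G : 'I_3 -> nat) : (G (0 : 'I_3)%R + G (1 : 'I_3)%R + G (2%:R : 'I_3)%R)%N = (\sum_m G m)%N.
  rewrite !big_ord_recl big_ord0 addn0 addnA.
  by congr (G _ + G _ + G _)%N; apply: val_inj.
apply: etrans (e (fun m => F (s m))) (etrans _ (esym (e F))).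
exact: esym (reindex_inj (@perm_inj _ s)).
Qed.

Lemma symE tau : sym tau = symt (fun n x => match n with
  | 0 => tau 0 0 0 x
  | 1 => 3^-1 * (tau 0 0 1 x + tau 0 1 0 x + tau 1 0 0 x)
  | 2 => 3^-1 * (tau 0 1 1 x + tau 1 0 1 x + tau 1 1 0 x)
  | _ => tau 1 1 1 x end).
Proof.
apply/funext => i; apply/funext => j; apply/funext => k; apply/funext => x.
have e : \sum_(s : 'S_3) permute_indices s tau i j k x = tau i j k x + (tau i k j x +
    (tau j i k x + (tau j k i x + (tau k i j x + tau k j i x)))).
  exact: (sum_perm3 (fun a b c : 'I_3 =>
    tau (tnth [tuple i; j; k] a) (tnth [tuple i; j; k] b) (tnth [tuple i; j; k] c) x)).
apply: etrans (congr1 (fun z : R => 6^-1 * z) e) _.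
case: (ord2P i) => ->; case: (ord2P j) => ->; case: (ord2P k) => ->; rewrite /symt /=; by field.
Qed.

(** A symmetric tensor field has four independent entries, numbered by the sum of their indices; [t] lists
    them. All products and divergences below are computed from these four functions. *)
Definition reduces sigma t := [/\ forall i j k, L2 (sigma i j k), forall n, L2 (t n) &
  forall i j k, aeq (sigma i j k) (t (i + j + k)%N)].

Lemma reduces_L2S3 sigma t : reduces sigma t -> L2S3 Omega sigma.
Proof.
move=> [ls lt ae]; split => // s i j k; apply/ae_aeq.
have h : aeq (permute_indices s sigma i j k) (permute_indices s (symt t) i j k) by exact: ae.
rewrite permute_symt in h; exact: aeq_trans h (aeq_sym (ae i j k)).
Qed.

Definition entries sigma : nat -> P -> R := fun n => match n with
  | 0 => sigma 0 0 0 | 1 => sigma 0 0 1 | 2 => sigma 0 1 1 | _ => sigma 1 1 1 end.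

Lemma L2S3_reduces sigma : L2S3 Omega sigma -> reduces sigma (entries sigma).
Proof.
move=> [ls sy].
have s1 i j k : aeq (sigma i j k) (sigma j i k).
  have := sy (tperm 0 1) j i k; rewrite ae_aeq /permute_indices !permE /=.
  exact.
have s2 i j k : aeq (sigma i j k) (sigma i k j).
  have := sy (tperm 1 2%:R) i k j; rewrite ae_aeq /permute_indices !permE /=.
  exact.
split => //; first by move=> [|[|[|n]]]; exact: ls.
move=> i j k; case: (ord2P i) => ->; case: (ord2P j) => ->; case: (ord2P k) => ->.
- exact: aeq_refl.
- exact: aeq_refl.
- exact: (s2 0 1 0).
- exact: aeq_refl.
- exact: aeq_trans (s1 1 0 0) (s2 0 1 0).
- exact: (s1 1 0 1).
- exact: aeq_trans (s2 1 1 0) (s1 1 0 1).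
- exact: aeq_refl.
Qed.

Lemma reduces_symt t : (forall n, L2 (t n)) -> reduces (symt t) t.
Proof. by move=> lt; split => // i j k; [exact: lt | exact: aeq_refl]. Qed.

Lemma reduces_ae sigma tau t : (forall i j k, L2 (sigma i j k)) -> tens_ae_eq Omega sigma tau ->
  reduces tau t -> reduces sigma t.
Proof. by move=> ls e [lt l ae]; split => // i j k; exact: aeq_trans (e i j k) (ae i j k). Qed.

Lemma reduces_add sigma tau s t : reduces sigma s -> reduces tau t ->
  reduces (tens_add sigma tau) (fun n x => s n x + t n x).
Proof.
move=> [l1 l2 e] [l1' l2' e']; split => [i j k|n|i j k]; [exact: L2D|exact: L2D|exact: aeqD].
Qed.

(** The product of symmetric tensors, where the middle entries occur three times each. *)
Definition dot4 s t : R :=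
  dot (s 0%N) (t 0%N) + 3 * dot (s 1%N) (t 1%N) + 3 * dot (s 2%N) (t 2%N) + dot (s 3%N) (t 3%N).

Lemma sum8 (G : nat -> R) : \sum_(i : 'I_2) \sum_(j : 'I_2) \sum_(k : 'I_2) G (i + j + k)%N =
  G 0%N + 3 * G 1%N + 3 * G 2%N + G 3%N.
Proof.
rewrite !sum2 /=; ring.
Qed.

Lemma sum8_eq (F : 'I_2 -> 'I_2 -> 'I_2 -> R) (G : nat -> R) :
  (forall i j k, F i j k = G (i + j + k)%N) ->
  \sum_i \sum_j \sum_k F i j k = G 0%N + 3 * G 1%N + 3 * G 2%N + G 3%N.
Proof.
move=> e; rewrite -sum8; apply: eq_bigr => i _; apply: eq_bigr => j _; apply: eq_bigr => k _.
exact: e.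
Qed.

Lemma reduces_dot3 sigma tau s t : reduces sigma s -> reduces tau t ->
  dot3 Omega sigma tau = dot4 s t.
Proof.
move=> [l1 l2 e] [l1' l2' e']; apply: (sum8_eq (G := fun n => dot (s n) (t n))) => i j k.
exact: dot_aeq.
Qed.

(** The third derivative that pairs with the entries of index sum [n]. *)
Definition third (n : nat) phi : P -> R := match n with
  | 0 => pder 0 (pder 0 (pder 0 phi)) | 1 => pder 0 (pder 0 (pder 1 phi))
  | 2 => pder 0 (pder 1 (pder 1 phi)) | _ => pder 1 (pder 1 (pder 1 phi)) end.

Lemma third_eq (n m : nat) g phi : n = m -> g = third m phi -> g = third n phi.
Proof. by move=> ->. Qed.

Lemma thirdE i j k phi : test phi -> pder k (pder j (pder i phi)) = third (i + j + k)%N phi.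
Proof.
move=> tp; have c01 := pderC 1 0 (test_smooth tp).
have c1 := pderC 1 0 (test_smooth (test_pder 1 tp)).
have c0 := pderC 1 0 (test_smooth (test_pder 0 tp)).
have d0 := congr1 (@pder R 0) c01; have d1 := congr1 (@pder R 1) c01.
have e001 : pder 1 (pder 0 (pder 0 phi)) = third 1 phi := etrans c0 d0.
have e110 : pder 1 (pder 1 (pder 0 phi)) = third 2 phi := etrans d1 c1.
case: (ord2P i) => ->; case: (ord2P j) => ->; case: (ord2P k) => ->.
- exact: (@third_eq _ 0%N _ _ erefl erefl).
- exact: (@third_eq _ 1%N _ _ erefl e001).
- exact: (@third_eq _ 1%N _ _ erefl d0).
- exact: (@third_eq _ 2%N _ _ erefl e110).
- exact: (@third_eq _ 1%N _ _ erefl erefl).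
- exact: (@third_eq _ 2%N _ _ erefl c1).
- exact: (@third_eq _ 2%N _ _ erefl erefl).
- exact: (@third_eq _ 3%N _ _ erefl erefl).
Qed.

Lemma test_third n phi : test phi -> test (third n phi).
Proof. by move=> tp; case: n => [|[|[|n]]]; do 3 apply: test_pder. Qed.

(** The weak form of [divdivdiv], up to sign. *)
Definition div4 t phi : R := dot4 t (third ^~ phi).

Lemma reduces_div sigma t phi : reduces sigma t -> test phi ->
  divdivdiv Omega sigma phi = - div4 t phi.
Proof.
move=> [ls lt ae] tp.
have aux (a b c d : R) : - a + 3 * - b + 3 * - c + - d = - (a + 3 * b + 3 * c + d) by ring.
apply: etrans (aux _ _ _ _).
apply: (sum8_eq (G := fun n => - dot (t n) (third n phi))) => i j k.
have e := congr1 (dot (sigma i j k)) (thirdE i j k tp).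
have l3 := L2_test (test_third (i + j + k)%N tp).
have e' := dot_aeq (ls i j k) (lt (i + j + k)%N) l3 l3 (ae i j k) (aeq_refl Omega _).
exact: etrans (congr1 (fun z : R => - z) (opprK _)) (congr1 (fun z : R => - z) (etrans e e')).
Qed.

Lemma dot4D s s' t : (forall n, L2 (s n)) -> (forall n, L2 (s' n)) -> (forall n, L2 (t n)) ->
  dot4 (fun n x => s n x + s' n x) t = dot4 s t + dot4 s' t.
Proof.
move=> l l' lt; have D n := dotDl (l n) (l' n) (lt n).
have aux (a b c d a' b' c' d' x y z w : R) : x = a + a' -> y = b + b' -> z = c + c' -> w = d + d' ->
  x + 3 * y + 3 * z + w = (a + 3 * b + 3 * c + d) + (a' + 3 * b' + 3 * c' + d').
  by move=> -> -> -> ->; ring.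
exact: aux (D 0%N) (D 1%N) (D 2%N) (D 3%N).
Qed.

Lemma dot4C s t : dot4 s t = dot4 t s.
Proof.
have D n := dotC Omega (s n) (t n).
have aux (a b c d x y z w : R) : x = a -> y = b -> z = c -> w = d ->
  x + 3 * y + 3 * z + w = a + 3 * b + 3 * c + d by move=> -> -> -> ->.
exact: aux (D 0%N) (D 1%N) (D 2%N) (D 3%N).
Qed.

End SymmetricTensors.

(** * The fields sym curl psi and Xi grad w *)

Section CurlAndXi.
Context {R : realType}.
Local Notation P := (R * R)%type.
Implicit Types (f g h phi v w : P -> R) (x y : P) (sigma tau : tens_field R) (s t : nat -> P -> R).
Implicit Types (psi : mat_field R).
Variable Omega : set P.
Hypothesis oO : open Omega.
Local Notation L2 := (L2 Omega).
Local Notation dot := (dot Omega).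
Local Notation test := (test_function Omega).
Local Notation aeq := (aeq Omega).
Local Notation weak_der := (weak_der Omega).
Local Notation lap := (laplacian Omega).

(** The four entries of [sym curl psi]. *)
Definition scurl psi : nat -> P -> R := fun n x => match n with
  | 0 => weak_der 1 (psi 0 0) x
  | 1 => 3^-1 * (- weak_der 0 (psi 0 0) x + weak_der 1 (psi 0 1) x + weak_der 1 (psi 1 0) x)
  | 2 => 3^-1 * (- weak_der 0 (psi 0 1) x + - weak_der 0 (psi 1 0) x + weak_der 1 (psi 1 1) x)
  | _ => - weak_der 0 (psi 1 1) x end.

(** The four entries of [Xi (grad w)]. *)
Definition xgrad w : nat -> P -> R := fun n x => match n with
  | 0 => weak_der 0 w x | 1 => 3^-1 * weak_der 1 w x
  | 2 => 3^-1 * weak_der 0 w x | _ => weak_der 1 w x end.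

Lemma symCurlE psi : symCurl Omega psi = symt (scurl psi).
Proof. exact: symE. Qed.

Lemma XiE w : Xi (grad Omega w) = symt (xgrad w).
Proof. exact: erefl. Qed.

Lemma H1_wd g k : H1 Omega g -> is_weak_der Omega k g (weak_der k g).
Proof. by move=> [_ H]; exact: weak_derP (H k). Qed.

Lemma L2_third f g h : L2 f -> L2 g -> L2 h -> L2 (fun x => 3^-1 * (f x + g x + h x)).
Proof. by move=> lf lg lh; apply: L2Z; apply: L2D => //; exact: L2D. Qed.

Lemma dot_third f g h phi : L2 f -> L2 g -> L2 h -> L2 phi ->
  dot (fun x => 3^-1 * (f x + g x + h x)) phi = 3^-1 * (dot f phi + dot g phi + dot h phi).
Proof.
move=> lf lg lh lp; have lfg := L2D lf lg.
have e1 := dotZl 3^-1 (L2D lfg lh) lp; have e2 := dotDl lfg lh lp; have e3 := dotDl lf lg lp.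
exact: etrans e1 (congr1 (fun z : R => 3^-1 * z) (etrans e2 (congr1 (fun z : R => z + _) e3))).
Qed.

Lemma scurl_L2 psi n : H1S Omega psi -> L2 (scurl psi n).
Proof.
move=> [H _]; have l k i j : L2 (weak_der k (psi i j)) by have [] := H1_wd k (H i j).
case: n => [|[|[|n]]].
- exact: l.
- by apply: L2_third => //; exact: L2N.
- by apply: L2_third => //; exact: L2N.
- exact: L2N.
Qed.

Lemma curl_reduces psi : H1S Omega psi -> reduces Omega (symCurl Omega psi) (scurl psi).
Proof.
by move=> hp; rewrite symCurlE; apply: reduces_symt => n; exact: scurl_L2.
Qed.

Lemma third1E phi : test phi -> pder 1 (pder 0 (pder 0 phi)) = third 1 phi.
Proof. by move=> tp; exact: (third_eq (n := 1%N) erefl (thirdE 0 0 1 tp)). Qed.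

Lemma third2E phi : test phi -> pder 1 (pder 0 (pder 1 phi)) = third 2 phi.
Proof. by move=> tp; exact: (third_eq (n := 2%N) erefl (thirdE 1 0 1 tp)). Qed.

Lemma third_swap n phi : (n < 3)%N -> test phi -> pder 1 (third n phi) = pder 0 (third n.+1 phi).
Proof.
move=> n3 tp.
have sw g : test g -> pder 1 (pder 0 g) = pder 0 (pder 1 g) by move=> tg; exact: pderC (test_smooth tg).
have t0 := test_pder 0 tp; have t1 := test_pder 1 tp.
have h1 := congr1 (@pder R 0) (third1E tp); have h2 := congr1 (@pder R 0) (third2E tp).
have s1 := sw _ (test_pder 0 t0); have s2 := sw _ (test_pder 0 t1); have s3 := sw _ (test_pder 1 t1).
have z0 : third 0 phi = pder 0 (pder 0 (pder 0 phi)) := erefl.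
have z1 : third 1 phi = pder 0 (pder 0 (pder 1 phi)) := erefl.
have z2 : third 2 phi = pder 0 (pder 1 (pder 1 phi)) := erefl.
have z3 : third 3 phi = pder 1 (pder 1 (pder 1 phi)) := erefl.
case: n n3 => [|[|[|n n3]]]; [move=> _|move=> _|move=> _|exfalso; by move: n3; rewrite !ltnS ltn0].
- rewrite z0; refine (etrans s1 h1).
- rewrite z1; refine (etrans s2 h2).
- rewrite z2 z3; refine s3.
Qed.

(** Integrating by parts once, each component of [psi] meets the same fourth derivative twice, with opposite
    signs. *)
Lemma div_curl psi phi : H1S Omega psi -> test phi -> div4 Omega (scurl psi) phi = 0.
Proof.
have aux (a b c d b0 b1 b2 c0 c1 c2 p00 p01 p10 p11 q00 q01 q10 q11 : R) :
  a = - p00 -> b = 3^-1 * (b0 + b1 + b2) -> c = 3^-1 * (c0 + c1 + c2) ->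
  b0 = q00 -> b1 = - p01 -> b2 = - p10 -> c0 = q01 -> c1 = q10 -> c2 = - p11 -> d = q11 ->
  p00 = q00 -> p01 = q01 -> p10 = q10 -> p11 = q11 -> a + 3 * b + 3 * c + d = 0.
  by move=> -> -> -> -> -> -> -> -> -> -> -> -> -> ->; field.
move=> [H _] tp.
have W k i j := H1_wd k (H i j).
have l k i j : L2 (weak_der k (psi i j)) by have [] := W k i j.
have T n : test (third n phi) := test_third n tp.
have lT n : L2 (third n phi) := L2_test (T n).
have D k i j n : dot (weak_der k (psi i j)) (third n phi) = - dot (psi i j) (pder k (third n phi)).
  by rewrite (wdE (W k i j) (T n)) opprK.
have N k i j n : dot (fun x => - weak_der k (psi i j) x) (third n phi) = dot (psi i j) (pder k (third n phi)).
  exact: etrans (dotNl (l k i j) (lT n)) (etrans (congr1 (fun z : R => - z) (D k i j n)) (opprK _)).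
have S i j n (n3 : (n < 3)%N) : dot (psi i j) (pder 1 (third n phi)) = dot (psi i j) (pder 0 (third n.+1 phi)).
  have h := third_swap n3 tp; exact (congr1 (dot (psi i j)) h).
have ln k i j := L2N (l k i j).
exact: (aux _ _ _ _ _ _ _ _ _ _ _ _ _ _ _ _ _ _ (D 1 0 0 0%N)
  (dot_third (ln 0 0 0) (l 1 0 1) (l 1 1 0) (lT 1%N))
  (dot_third (ln 0 0 1) (ln 0 1 0) (l 1 1 1) (lT 2%N))
  (N 0 0 0 1%N) (D 1 0 1 1%N) (D 1 1 0 1%N) (N 0 0 1 2%N) (N 0 1 0 2%N) (D 1 1 1 2%N)
  (N 0 1 1 3%N) (S 0 0 0%N isT) (S 0 1 1%N isT) (S 1 0 1%N isT) (S 1 1 2%N isT)).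
Qed.

Lemma xgrad_L2 w n : H2 Omega w -> L2 (xgrad w n).
Proof.
move=> hw; have [_ l _] := jet_L2 (H2_jet hw).
by case: n => [|[|[|n]]]; [exact: l|exact: L2Z|exact: L2Z|exact: l].
Qed.

Lemma Xi_reduces w : H2 Omega w -> reduces Omega (Xi (grad Omega w)) (xgrad w).
Proof. by move=> hw; rewrite XiE; apply: reduces_symt => n; exact: xgrad_L2. Qed.

(** The factors [1 / 3] of [Xi] cancel the multiplicities of the middle entries, so that [d_0 w] and [d_1 w]
    meet the components of [grad (lap phi)]; one integration by parts remains. *)
Lemma div_Xi w phi : H2 Omega w -> test phi -> div4 Omega (xgrad w) phi = - dot (lap w) (lap phi).
Proof.
have aux (a b c d b' c' x y z u l m n : R) : b = 3^-1 * b' -> c = 3^-1 * c' -> a = - x -> b' = - y -> c' = - z ->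
  d = - u -> l = m + n -> m = x + z -> n = y + u -> a + 3 * b + 3 * c + d = - l.
  by move=> -> -> -> -> -> -> -> -> ->; field.
move=> hw tp; have jw := H2_jet hw; have jp := jet_test tp.
have [_ l1 l2] := jet_L2 jw; have [_ W1 W2] := jw; have [_ _ lp] := jet_L2 jp.
have lT n : L2 (third n phi) := L2_test (test_third n tp).
have t0 := test_pder 0 tp; have t1 := test_pder 1 tp.
have t00 := test_pder 0 t0; have t11 := test_pder 1 t1.
have e := lap_jet_dot oO jw jp.
have e1 := dotDl (l2 0 0) (l2 1 1) (L2D (lp 0 0) (lp 1 1)).
have e2 := dotDr (l2 0 0) (lp 0 0) (lp 1 1); have e3 := dotDr (l2 1 1) (lp 0 0) (lp 1 1).
have s001 : third 1 phi = pder 1 (pder 0 (pder 0 phi)) := esym (third1E tp).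
have a1 := etrans (congr1 (dot (weak_der 1 w)) s001) (wdE (W2 1 1) t00).
exact: (aux _ _ _ _ _ _ _ _ _ _ _ _ _ (dotZl 3^-1 (l1 1) (lT 1%N)) (dotZl 3^-1 (l1 0) (lT 2%N))
  (wdE (W2 0 0) t00) a1 (wdE (W2 0 0) t11) (wdE (W2 1 1) t11) (etrans e e1) e2 e3).
Qed.

Lemma divdivdiv_Xi w phi : H2 Omega w -> test phi ->
  divdivdiv Omega (Xi (grad Omega w)) phi = dot (lap w) (lap phi).
Proof.
move=> hw tp; rewrite (reduces_div (Xi_reduces hw) tp).
exact: etrans (congr1 (fun z : R => - z) (div_Xi hw tp)) (opprK _).
Qed.

Lemma divdivdiv_curl psi phi : H1S Omega psi -> test phi -> divdivdiv Omega (symCurl Omega psi) phi = 0.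
Proof.
move=> hp tp; rewrite (reduces_div (curl_reduces hp) tp).
exact: etrans (congr1 (fun z : R => - z) (div_curl hp tp)) (oppr0 _).
Qed.

Lemma Hm2_0 : Hm2 Omega (fun=> 0).
Proof.
split => [a v w _ _|]; first by rewrite mulr0 addr0.
by exists 0 => v _; rewrite normr0 mul0r.
Qed.

Lemma bound_aux (A c l n : R) : 0 <= A -> c <= A * l -> l <= 2 * n -> c <= 2 * A * n.
Proof.
move=> A0 h1 h2; apply: (le_trans h1); rewrite -mulrA mulrCA.
exact: ler_wpM2l.
Qed.

Lemma Hm2_lap w : H20 Omega w -> Hm2 Omega (fun v => dot (lap w) (lap v)).
Proof.
move=> hw; have hw2 := H20_H2 hw; have lw := L2_lap oO hw2.
apply: (@Hm2I _ _ _ (Num.sqrt (2 * dot (lap w) (lap w)))) => [a v v' hv hv'|v hv].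
  have hv2 := H20_H2 hv; have hv2' := H20_H2 hv'.
  have e := lap_dot_lin oO a hv2 hv2' hw2.
  have C u := dotC Omega (lap w) (lap u).
  have aux (x y z x' y' z' : R) : x = a * y + z -> x' = x -> y' = y -> z' = z -> x' = a * y' + z'.
    by move=> -> -> -> ->.
  exact: aux e (C _) (C v) (C v').
have g0 := dot_ge0 Omega (lap w).
rewrite sqr_sqrtr ?mulr_ge0//.
have cs := dot_CS lw (L2_lap oO (H20_H2 hv)); have le := lsq_le oO (H20_H2 hv).
exact: bound_aux g0 cs le.
Qed.

Lemma Hdiv3_curl psi : H1S Omega psi -> Hdiv3 Omega (symCurl Omega psi).
Proof.
move=> hp; split; first exact: reduces_L2S3 (curl_reduces hp).
by exists (fun=> 0); split; [exact: Hm2_0 | move=> phi tp; exact: divdivdiv_curl].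
Qed.

Lemma Hdiv3_Xi w : H20 Omega w -> Hdiv3 Omega (Xi (grad Omega w)).
Proof.
move=> hw; split; first exact: reduces_L2S3 (Xi_reduces (H20_H2 hw)).
exists (fun v => dot (lap w) (lap v)); split; first exact: Hm2_lap.
by move=> phi tp; exact: divdivdiv_Xi (H20_H2 hw) tp.
Qed.

End CurlAndXi.

(** * Decomposition and equivalence *)

Section Decoupling.
Context {R : realType}.
Local Notation P := (R * R)%type.
Implicit Types (f g h phi u v w : P -> R) (x y : P) (sigma tau : tens_field R) (s t : nat -> P -> R).
Implicit Types (psi : mat_field R).
Variable Omega : set P.
Hypothesis oO : open Omega.
Local Notation L2 := (L2 Omega).
Local Notation dot := (dot Omega).
Local Notation test := (test_function Omega).
Local Notation aeq := (aeq Omega).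
Local Notation weak_der := (weak_der Omega).
Local Notation lap := (laplacian Omega).

Lemma dot3_split sigma tau w psi : L2S3 Omega sigma -> L2S3 Omega tau -> H20 Omega w -> H1S Omega psi ->
  tens_ae_eq Omega sigma (sigma_of Omega w psi) ->
  dot3 Omega sigma tau = dot3 Omega (symCurl Omega psi) tau + dot3 Omega (Xi (grad Omega w)) tau.
Proof.
move=> hs ht hw hp e; have [ls _] := hs; have rt := L2S3_reduces ht.
have rx := Xi_reduces (H20_H2 hw); have rc := curl_reduces hp.
have rs := reduces_ae ls e (reduces_add rc rx).
have [_ lt _] := rt; have [_ lx _] := rx; have [_ lc _] := rc.
rewrite (reduces_dot3 rs rt) (reduces_dot3 rc rt) (reduces_dot3 rx rt).
exact: dot4D.
Qed.

Lemma dot3C sigma tau : L2S3 Omega sigma -> L2S3 Omega tau ->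
  dot3 Omega sigma tau = dot3 Omega tau sigma.
Proof.
move=> /L2S3_reduces rs /L2S3_reduces rt.
by rewrite (reduces_dot3 rs rt) (reduces_dot3 rt rs) dot4C.
Qed.

Lemma dot3_ae sigma sigma' tau : L2S3 Omega sigma -> L2S3 Omega sigma' -> L2S3 Omega tau ->
  tens_ae_eq Omega sigma sigma' -> dot3 Omega sigma tau = dot3 Omega sigma' tau.
Proof.
move=> [ls _] hs' /L2S3_reduces rt e; have rs' := L2S3_reduces hs'.
by rewrite (reduces_dot3 (reduces_ae ls e rs') rt) (reduces_dot3 rs' rt).
Qed.

Lemma sigma_of_L2S3 w psi : H20 Omega w -> H1S Omega psi -> L2S3 Omega (sigma_of Omega w psi).
Proof.
move=> hw hp; exact: reduces_L2S3 (reduces_add (curl_reduces hp) (Xi_reduces (H20_H2 hw))).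
Qed.

Lemma div_sigma sigma w psi phi : L2S3 Omega sigma -> H20 Omega w -> H1S Omega psi ->
  tens_ae_eq Omega sigma (sigma_of Omega w psi) -> test phi ->
  divdivdiv Omega sigma phi = dot (lap w) (lap phi).
Proof.
move=> [ls _] hw hp e tp; have hw2 := H20_H2 hw.
have rx := Xi_reduces hw2; have rc := curl_reduces hp.
have [_ lx _] := rx; have [_ lc _] := rc.
rewrite (reduces_div (reduces_ae ls e (reduces_add rc rx)) tp).
have l3 n : L2 (third n phi) := L2_test (test_third n tp).
have aux (a b c d : R) : a = b + c -> b = 0 -> c = - d -> - a = d by move=> -> -> ->; rewrite add0r opprK.
exact: aux (dot4D lc lx l3) (div_curl hp tp) (div_Xi oO hw2 tp).
Qed.

Lemma pairing_lap tau w v : H20 Omega w -> H20 Omega v ->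
  (forall phi, test phi -> divdivdiv Omega tau phi = dot (lap w) (lap phi)) ->
  pairing Omega (divdivdiv Omega tau) v = dot (lap w) (lap v).
Proof. by move=> hw hv e; exact: (pairing_eq oO (Hm2_lap oO hw) e hv). Qed.

Hypothesis bO : bounded_set Omega.
Hypothesis lipO : lipschitz_boundary Omega.
Hypothesis sc : simply_connected Omega.
Hypothesis cO : connected Omega.

(** Exactness. With [psi = [[a, c], [c, b]]], the entries of [sym curl psi] are [d_1 a],
    [(2 d_1 c - d_0 a) / 3], [(d_1 b - 2 d_0 c) / 3] and [- d_0 b]. *)
Lemma tensor_exact tau t : reduces Omega tau t -> (forall phi, test phi -> div4 Omega t phi = 0) ->
  exists psi, H1S Omega psi /\ reduces Omega tau (scurl Omega psi).
Proof.
move=> rt div0; have [lt l t_ae] := rt.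
have [a [b [c [a0 [b1 [[la lb lc] [[wa0 wa1 wb0 wb1] [wc0 wc1]]]]]]]] :=
  tensor_potentials oO bO lipO sc cO (l 0%N) (l 1%N) (l 2%N) (l 3%N) div0.
pose psi : mat_field R := fun i j => match (i + j)%N with 0%N => a | 1%N => c | _ => b end.
have hp : H1S Omega psi.
  have H1I g g0 g1 : L2 g -> is_weak_der Omega 0 g g0 -> is_weak_der Omega 1 g g1 -> H1 Omega g.
    by move=> lg w0 w1; split => // i; case: (ord2P i) => ->; [exists g0 | exists g1].
  split => i j; last first.
    have -> : psi i j = psi j i by rewrite /psi addnC.
    exact: aeq_refl.
  rewrite /psi; case: (i + j)%N => [|[|n]].
  - exact: H1I la wa0 wa1.
  - exact: H1I lc wc0 wc1.
  - exact: H1I lb wb0 wb1.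
have A0 := wd_aeq oO wa0; have A1 := wd_aeq oO wa1.
have B0 := wd_aeq oO wb0; have B1 := wd_aeq oO wb1.
have C0 := wd_aeq oO wc0; have C1 := wd_aeq oO wc1.
have aux1 (d e p q : R) : d = p -> e = 2^-1 * p + 2^-1 * 3 * q -> 3^-1 * (- d + e + e) = q.
  by move=> -> ->; field.
have aux2 (d e p q : R) : d = p -> e = 2^-1 * p - 2^-1 * 3 * q -> 3^-1 * (- e + - e + d) = q.
  by move=> -> ->; field.
have aux3 (d q : R) : d = - q -> - d = q by move=> ->; rewrite opprK.
have ae n : (n < 4)%N -> aeq (scurl Omega psi n) (t n).
  case: n => [|[|[|[|n]]]] n4.
  - exact A1.
  - by apply: ae2S (ae2I A0 C1) => x [h1 h2] Ox; exact: aux1 (h1 Ox) (h2 Ox).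
  - by apply: ae2S (ae2I B1 C0) => x [h1 h2] Ox; exact: aux2 (h1 Ox) (h2 Ox).
  - by apply: ae2S B0 => x h1 Ox; exact: aux3 (h1 Ox).
  - by exfalso; move: n4; rewrite !ltnS ltn0.
exists psi; split => //; split => [||i j k]; [exact: lt|by move=> n; exact: scurl_L2|].
apply: aeq_trans (t_ae i j k) (aeq_sym (ae _ _)).
by case: (ord2P i) => ->; case: (ord2P j) => ->; case: (ord2P k) => ->.
Qed.

(** The field [tau - Xi (grad w)] has vanishing divdivdiv, because that of [Xi (grad w)] is the
    bilaplacian of [w]; exactness applies to it. *)
Lemma tensor_decomposition tau w : L2S3 Omega tau -> H20 Omega w ->
  (forall phi, test phi -> divdivdiv Omega tau phi = dot (lap w) (lap phi)) ->
  exists psi, H1S Omega psi /\ tens_ae_eq Omega tau (sigma_of Omega w psi).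
Proof.
move=> ht hw e; have rt := L2S3_reduces ht; have hw2 := H20_H2 hw.
have [_ lt _] := rt; have lx n := xgrad_L2 n hw2.
have lN n : L2 (fun x => - xgrad Omega w n x) by exact: L2N.
have rN := reduces_symt lN.
have [|psi [hp rp]] := tensor_exact (reduces_add rt rN).
  move=> phi tp; have l3 n : L2 (third n phi) := L2_test (test_third n tp).
  have e1 := dot4D lt lN l3.
  have e2 := etrans (esym (reduces_div rt tp)) (e phi tp).
  have e3 := div_Xi oO hw2 tp.
  have D n := dotNl (lx n) (l3 n).
  have aux (a b c d a' b' c' d' : R) : a' = - a -> b' = - b -> c' = - c -> d' = - d ->
    a' + 3 * b' + 3 * c' + d' = - (a + 3 * b + 3 * c + d) by move=> -> -> -> ->; ring.
  have e4 := aux _ _ _ _ _ _ _ _ (D 0%N) (D 1%N) (D 2%N) (D 3%N).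
  have aux2 (r s s' x l : R) : r = s + s' -> - s = l -> s' = - x -> x = - l -> r = 0.
    by move=> -> <- -> ->; ring.
  exact: aux2 e1 e2 e4 e3.
exists psi; split => // i j k.
have [_ _ ae] := rp; have aeijk := ae i j k.
have [_ _ aec] := curl_reduces hp; have aecijk := aec i j k.
apply: ae2S (ae2I aeijk aecijk) => x [h1 h2] Ox.
have aux (a b c d : R) : a + - b = c -> d = c -> a = d + b by move=> <- ->; rewrite subrK.
exact: aux (h1 Ox) (h2 Ox).
Qed.

(** The second mixed equation says that [divdivdiv sigma] is [f], that is, the bilaplacian of [w]; this yields
    [psi]. The first one, tested with [sym curl chi] and with [Xi (grad chi)], gives the other two equations. *)
Lemma mixed_decoupled (f0 : (P -> R) -> R) sigma u : Hm2 Omega f0 -> L2S3 Omega sigma -> mixed_solution Omega f0 sigma u ->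
  exists w psi, decoupled_solution Omega f0 w psi u /\ tens_ae_eq Omega sigma (sigma_of Omega w psi).
Proof.
have auxC (a b c d : R) : a + b = 0 -> b = 0 -> a = c + d -> c = - d by lra.
have auxX (a b c d g : R) : a + b = 0 -> b = c -> a = d -> c = g -> g = - d by lra.
move=> hf hs [[_ [F [hF eF]]] hu eq1 eq2].
have [w [hw Hw]] := biharmonic_Hm2 oO bO hf.
have [phi tp|psi [hp e]] := tensor_decomposition hs hw.
  have h20 := H20_test oO tp.
  have e1 := eq2 _ h20; have e2 := pairing_eq oO hF eF h20.
  exact: etrans (eF phi tp) (etrans (esym e2) (etrans e1 (esym (Hw phi h20)))).
exists w, psi; split=> //; split=> // [chi hc|chi hc].
  have [hd _] := Hdiv3_curl hc; have z := eq1 _ (Hdiv3_curl hc).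
  have z2 := pairing_eq oO (Hm2_0 Omega) (fun phi tp => divdivdiv_curl hc tp) hu.
  have z3 := dot3_split hs hd hw hp e.
  exact: auxC z z2 z3.
have [hd _] := Hdiv3_Xi oO hc; have z := eq1 _ (Hdiv3_Xi oO hc).
have z2 := pairing_lap hc hu (fun phi tp => divdivdiv_Xi oO (H20_H2 hc) tp).
have z3 := dot3_ae hs (sigma_of_L2S3 hw hp) hd e.
have z4 := dotC Omega (lap chi) (lap u).
exact: auxX z z2 z3 z4.
Qed.

(** Every test field [tau] is [sym curl eta + Xi (grad chi)] by [tensor_decomposition], and on the two kinds
    of fields the first mixed equation is one of the decoupled equations. *)
Lemma decoupled_mixed (f0 : (P -> R) -> R) sigma u w psi : Hm2 Omega f0 -> L2S3 Omega sigma ->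
  decoupled_solution Omega f0 w psi u -> tens_ae_eq Omega sigma (sigma_of Omega w psi) ->
  mixed_solution Omega f0 sigma u.
Proof.
have aux (p l l' X S c x C Y T : R) : p = l -> l = l' -> l' = - X -> S = X -> C = c + x -> c = - x ->
  T = C + S -> T = Y -> Y + p = 0 by lra.
move=> hf hs [[hw [hp hu]] eq1 eq2 eq3] e.
have D phi (tp : test phi) := div_sigma hs hw hp e tp.
split => //.
- split => //; exists (fun v => dot (lap w) (lap v)); split; first exact: Hm2_lap.
  exact: D.
- move=> tau [ht [F [hF eF]]].
  have [chi [hc Hc]] := biharmonic_Hm2 oO bO hF.
  have eD phi : test phi -> divdivdiv Omega tau phi = dot (lap chi) (lap phi).
    by move=> tp; exact: etrans (eF phi tp) (esym (Hc phi (H20_test oO tp))).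
  have [eta [he ee]] := tensor_decomposition ht hc eD.
  have [hdc _] := Hdiv3_curl he; have [hdx _] := Hdiv3_Xi oO hc.
  have z1 := pairing_lap hc hu eD.
  have z2 := dotC Omega (lap chi) (lap u); have z3 := eq3 _ hc.
  have z4 := dot3_ae hs (sigma_of_L2S3 hw hp) hdx e.
  have z5 := dot3_split hs hdc hw hp e; have z6 := eq2 _ he.
  have z7 := dot3_split ht hs hc he ee.
  have z8 := dot3C ht hs; have z9 := dot3C hdc hs; have z10 := dot3C hdx hs.
  have aux7 (a b c b' c' : R) : a = b + c -> b = b' -> c = c' -> a = b' + c' by move=> -> -> ->.
  exact: aux z1 z2 z3 z4 z5 z6 (aux7 _ _ _ _ _ z7 z9 z10) z8.
move=> v hv; exact: etrans (pairing_lap hw hv D) (eq1 v hv).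
Qed.

End Decoupling.

Theorem mainTheorem12 (R : realType) (Omega : set (R * R))
  (f : (R * R -> R) -> R) :
  bounded_lipschitz_domain Omega ->
  simply_connected Omega ->
  connected (boundary Omega) ->
  Hm2 Omega f ->
  forall (sigma : tens_field R) (u : R * R -> R),
    L2S3 Omega sigma ->
    mixed_solution Omega f sigma u <->
    exists (w : R * R -> R) (phi : mat_field R),
      decoupled_solution Omega f w phi u /\
      tens_ae_eq Omega sigma (sigma_of Omega w phi).
Proof.
move=> [_ oO cO bO lipO] sc _ hf sigma u hs; split.
  exact: mixed_decoupled.
by move=> [w [phi [hd e]]]; exact: decoupled_mixed hd e.
Qed.
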